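(* Let $T$ be a tree whose edges have positive lengths (points of $T$ may lie in the interior of edges, and $d(p,q)$ is the length of the simple path between points $p,q$ of $T$). Let $\mathcal{P}=\{P_1,\dots,P_n\}$ be a set of $n$ uncertain points, where each $P_i$ has a weight $w_i\ge 0$ and $m$ locations $p_{i1},\dots,p_{im}$ (points of $T$) with probabilities $f_{i1},\dots,f_{im}\ge 0$. For a point $x$ of $T$ let $\mathsf{E}\mathrm{d}(P_i,x)=\sum_{j=1}^m f_{ij}\, d(p_{ij},x)$, and for points $x_1,x_2$ of $T$ let $\phi(x_1,x_2)=\max_{1\le i\le n} w_i\cdot\min\big(\mathsf{E}\mathrm{d}(P_i,x_1),\mathsf{E}\mathrm{d}(P_i,x_2)\big)$. Then two points $q_1^*,q_2^*$ of $T$ minimizing $\phi(x_1,x_2)$ over all pairs of points of $T$ can be computed in $O(|T|+mn\log(mn))$ time.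
   Context: $|T|$ denotes the number of vertices of $T$. The pair $(q_1^*,q_2^* )$ is called a pair of (two-)centers of $\mathcal{P}$ on $T$; this is the weighted two-center problem of uncertain points on a tree. *)

(* Defs.v *)
From mathcomp Require Import all_boot all_order all_algebra.
From mathcomp Require Import classical_sets reals exp.

Set Implicit Arguments.
Unset Strict Implicit.
Unset Printing Implicit Defensive.

Import Order.TTheory GRing.Theory Num.Theory.
Local Open Scope ring_scope.

Record wgraph (R : realType) := WGraph {
  nv : nat;
  ne : nat;
  src : 'I_ne -> 'I_nv;
  dst : 'I_ne -> 'I_nv;
  len : 'I_ne -> R }.

Section Trees.
Variables (R : realType) (T : wgraph R).

Definition joins (k : 'I_(ne T)) (u v : 'I_(nv T)) : bool :=
  ((src k == u) && (dst k == v)) || ((src k == v) && (dst k == u)).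

Definition adj : rel 'I_(nv T) := fun u v => [exists k, joins k u v].

Definition simple_graph : Prop :=
  (forall k, src (w := T) k != dst k) /\
  (forall k k' u v, joins k u v -> joins k' u v -> k = k').

(* A closed walk u, v, u along one edge is a [cycle] of size 2 for [path.cycle]. *)
Definition acyclic : Prop :=
  forall c : seq 'I_(nv T), cycle adj c -> uniq c -> (size c <= 2)%N.

Definition is_tree : Prop :=
  [/\ (0 < nv T)%N, simple_graph, forall u v, connect adj u v & acyclic].

(* [OnEdge k t] is the point of edge k at distance t from [src k]; an endpoint
   of k may be given in this form as well as by [Vertex]. *)
Inductive tpoint :=
| Vertex of 'I_(nv T)
| OnEdge of 'I_(ne T) & R.

Definition on_tree (p : tpoint) : Prop :=
  if p is OnEdge k t then 0 <= t <= len k else True.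

Definition steps (u : 'I_(nv T)) (s : seq 'I_(nv T)) := zip (u :: s) s.

Definition walk_len (u : 'I_(nv T)) (s : seq 'I_(nv T)) : R :=
  \sum_(uv <- steps u s) \sum_(k | joins k uv.1 uv.2) len k.

(* The vertices at which a path from p can leave the edge holding p, with the
   length travelled to get there. *)
Definition exits (p : tpoint) : seq ('I_(nv T) * R) :=
  match p with
  | Vertex v => [:: (v, 0)]
  | OnEdge k t => [:: (src k, t); (dst k, len k - t)]
  end.

Definition avoids (p : tpoint) (u : 'I_(nv T)) (s : seq 'I_(nv T)) : bool :=
  if p is OnEdge k _ then all (fun uv => ~~ joins k uv.1 uv.2) (steps u s)
  else true.

Definition same_edge (p q : tpoint) : bool :=
  match p, q with
  | OnEdge k _, OnEdge k' _ => k == k'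
  | _, _ => false
  end.

(* Two points given on one edge are joined by a segment of it. Any other simple
   path leaves the edge of p at an endpoint a, follows a simple vertex path
   a :: s that does not return through the edge of p and does not yet cross the
   edge of q, and enters the edge of q at the last vertex of that path. *)
Definition simple_path_length (p q : tpoint) (l : R) : Prop :=
  if same_edge p q then
    match p, q with
    | OnEdge _ t, OnEdge _ t' => l = `|t - t'|
    | _, _ => False
    end
  else
    exists ax by_ s,
      [/\ ax \in exits p /\ by_ \in exits q,
          path adj ax.1 s /\ last ax.1 s = by_.1,
          uniq (ax.1 :: s),
          avoids p ax.1 s && avoids q ax.1 s
        & l = ax.2 + walk_len ax.1 s + by_.2].

(* In a tree exactly one length qualifies, so the choice and the default value
   are immaterial. *)
Definition dist (p q : tpoint) : R :=
  xget 0 [set l | simple_path_length p q l]%classic.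

End Trees.

Record uncertain (R : realType) (T : wgraph R) (n m : nat) := Uncertain {
  weight : 'I_n -> R;
  loc : 'I_n -> 'I_m -> tpoint T;
  prob : 'I_n -> 'I_m -> R }.

Section Centers.
Variables (R : realType) (T : wgraph R) (n m : nat) (P : uncertain T n m).

Definition Edist (i : 'I_n) (x : tpoint T) : R :=
  \sum_(j < m) prob P i j * dist (loc P i j) x.

(* All the terms are nonnegative, so the seed 0 does not affect the maximum
   when n > 0. *)
Definition phi (x1 x2 : tpoint T) : R :=
  \big[Num.max/0]_(i < n)
    (weight P i * Num.min (Edist i x1) (Edist i x2)).

Definition two_centers (q1 q2 : tpoint T) : Prop :=
  [/\ on_tree q1, on_tree q2 &
      forall x1 x2, on_tree x1 -> on_tree x2 -> phi q1 q2 <= phi x1 x2].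

End Centers.

(* Storage consists of integer arrays and real arrays, named by naturals and
   unbounded. A program names finitely many arrays; interleaving them gives the
   usual pair of linear memories. Scalar variables are cells of such arrays.
   Integers are machine words; reals are exact, and the only flow from reals to
   integers is through comparisons (there is no floor). *)
Inductive iexp :=
| IConst of nat
| ILoad of nat & iexp
| IAdd of iexp & iexp
| ISub of iexp & iexp
| IMul of iexp & iexp
| IDiv of iexp & iexp.

Inductive rexp :=
| RConst of int
| RLoad of nat & iexp
| RAdd of rexp & rexp
| RSub of rexp & rexp
| RMul of rexp & rexp
| RDiv of rexp & rexp.

Inductive bexp :=
| ILe of iexp & iexp
| RLe of rexp & rexp
| BNot of bexp
| BAnd of bexp & bexp.

Inductive cmd :=
| Skip
| IStore of nat & iexp & iexp
| RStore of nat & iexp & rexp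
| Seq of cmd & cmd
| If of bexp & cmd & cmd
| While of bexp & cmd.

Record state (R : realType) := State {
  ints : nat -> nat -> nat;
  reals : nat -> nat -> R }.

Definition upd (A : Type) (f : nat -> nat -> A) (a i : nat) (x : A) :=
  fun b j => if (b == a) && (j == i) then x else f b j.

Definition lift2 (A B C : Type) (f : A -> B -> option C)
    (x : option A) (y : option B) : option C :=
  obind (fun a => obind (f a) y) x.

Section Semantics.
(* W is the largest machine word; a program that computes a larger integer is
   stuck. *)
Variables (R : realType) (W : nat).

Definition word (x : nat) : option nat := if (x <= W)%N then Some x else None.

(* Subtraction is truncated, and division is Euclidean with x / 0 = 0. *)
Fixpoint ieval (s : state R) (e : iexp) : option nat :=
  match e with
  | IConst k => word k
  | ILoad a e => omap (ints s a) (ieval s e)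
  | IAdd e1 e2 => lift2 (fun x y => word (x + y)%N) (ieval s e1) (ieval s e2)
  | ISub e1 e2 => lift2 (fun x y => word (x - y)%N) (ieval s e1) (ieval s e2)
  | IMul e1 e2 => lift2 (fun x y => word (x * y)%N) (ieval s e1) (ieval s e2)
  | IDiv e1 e2 => lift2 (fun x y => word (x %/ y)%N) (ieval s e1) (ieval s e2)
  end.

Fixpoint reval (s : state R) (e : rexp) : option R :=
  match e with
  | RConst z => Some z%:~R
  | RLoad a e => omap (reals s a) (ieval s e)
  | RAdd e1 e2 => lift2 (fun x y => Some (x + y)) (reval s e1) (reval s e2)
  | RSub e1 e2 => lift2 (fun x y => Some (x - y)) (reval s e1) (reval s e2)
  | RMul e1 e2 => lift2 (fun x y => Some (x * y)) (reval s e1) (reval s e2)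
  | RDiv e1 e2 => lift2 (fun x y => Some (x / y)) (reval s e1) (reval s e2)
  end.

Fixpoint beval (s : state R) (b : bexp) : option bool :=
  match b with
  | ILe e1 e2 => lift2 (fun x y => Some (x <= y)%N) (ieval s e1) (ieval s e2)
  | RLe e1 e2 => lift2 (fun x y => Some (x <= y)) (reval s e1) (reval s e2)
  | BNot b => omap negb (beval s b)
  | BAnd b1 b2 => lift2 (fun x y => Some (x && y)) (beval s b1) (beval s b2)
  end.

Fixpoint icost (e : iexp) : nat :=
  match e with
  | IConst _ => 1
  | ILoad _ e => (icost e).+1
  | IAdd e1 e2 | ISub e1 e2 | IMul e1 e2 | IDiv e1 e2 =>
      (icost e1 + icost e2).+1
  end.

Fixpoint rcost (e : rexp) : nat :=
  match e with
  | RConst _ => 1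
  | RLoad _ e => (icost e).+1
  | RAdd e1 e2 | RSub e1 e2 | RMul e1 e2 | RDiv e1 e2 =>
      (rcost e1 + rcost e2).+1
  end.

Fixpoint bcost (b : bexp) : nat :=
  match b with
  | ILe e1 e2 => (icost e1 + icost e2).+1
  | RLe e1 e2 => (rcost e1 + rcost e2).+1
  | BNot b => (bcost b).+1
  | BAnd b1 b2 => (bcost b1 + bcost b2).+1
  end.

(* [exec c s t s']: started in s, c halts in s' after t unit-cost operations. *)
Inductive exec : cmd -> state R -> nat -> state R -> Prop :=
| ESkip s : exec Skip s 1 s
| EIStore s a e1 e2 i x :
    ieval s e1 = Some i -> ieval s e2 = Some x ->
    exec (IStore a e1 e2) s (icost e1 + icost e2).+1
      (State (upd (ints s) a i x) (reals s))
| ERStore s a e1 e2 i x :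
    ieval s e1 = Some i -> reval s e2 = Some x ->
    exec (RStore a e1 e2) s (icost e1 + rcost e2).+1
      (State (ints s) (upd (reals s) a i x))
| ESeq c1 c2 s1 s2 s3 t1 t2 :
    exec c1 s1 t1 s2 -> exec c2 s2 t2 s3 ->
    exec (Seq c1 c2) s1 (t1 + t2)%N s3
| EIfTrue b c1 c2 s s' t :
    beval s b = Some true -> exec c1 s t s' ->
    exec (If b c1 c2) s (bcost b + t).+1 s'
| EIfFalse b c1 c2 s s' t :
    beval s b = Some false -> exec c2 s t s' ->
    exec (If b c1 c2) s (bcost b + t).+1 s'
| EWhileTrue b c s1 s2 s3 t1 t2 :
    beval s1 b = Some true -> exec c s1 t1 s2 -> exec (While b c) s2 t2 s3 ->
    exec (While b c) s1 (bcost b + t1 + t2).+1 s3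
| EWhileFalse b c s :
    beval s b = Some false -> exec (While b c) s (bcost b).+1 s.

End Semantics.

(* A point is stored in one integer cell and one real cell: vertex v as (v, 0),
   the point at offset t on edge k as (nv T + k, t). *)
Definition stores_point (R : realType) (T : wgraph R) (s : state R)
    (a i : nat) (p : tpoint T) : Prop :=
  match p with
  | Vertex v => ints s a i = v /\ reals s a i = 0
  | OnEdge k t => ints s a i = (nv T + k)%N /\ reals s a i = t
  end.

(* The tree is given as an unordered list of edges. Cells not mentioned here
   have arbitrary contents. *)
Definition stores_input (R : realType) (T : wgraph R) (n m : nat)
    (P : uncertain T n m) (s : state R) : Prop :=
  [/\ [/\ ints s 0 0 = nv T, ints s 0 1 = ne T, ints s 0 2 = n
        & ints s 0 3 = m],
      forall k : 'I_(ne T),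
        [/\ ints s 1 k = src k, ints s 2 k = dst k & reals s 1 k = len k],
      forall i : 'I_n, reals s 2 i = weight P i,
      forall (i : 'I_n) (j : 'I_m), reals s 3 (i * m + j)%N = prob P i j
    & forall (i : 'I_n) (j : 'I_m), stores_point s 4 (i * m + j)%N (loc P i j)].

Definition stores_output (R : realType) (T : wgraph R) (s : state R)
    (q1 q2 : tpoint T) : Prop :=
  stores_point s 5 0 q1 /\ stores_point s 5 1 q2.

(* Words have O(log N) bits, where c is a constant of the program. *)
Definition max_word (c N : nat) : nat := ((N + 2) ^ c)%N.

(* Main.v *)
(* The tree is rooted by peeling off its leaves and subdivided at the locations.
   An uncertain point is drawn from a vertex v in the direction that holds more
   than half of its probability mass; moving from v in any other direction does
   not decrease its expected distance. For a costliest point at v, a center that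
   does better than v therefore lies in the direction d in which that point is
   drawn. Cutting the tree at centroids v in these directions d, one arrives at
   an edge such that one center may be sought on each side, up to that edge.

   The two resulting regions are then cut down together. Let lam v be the
   largest cost at the centroid v of a point not drawn back towards the other
   region, let u be the centroid of the other region, and let lam u <= lam v. If
   every point costs at most lam v at v or at u, then so does the optimum, and
   the region of v shrinks in its direction d; otherwise some point costs more
   at v and at u and is drawn back from both; were a center needed beyond u, this
   point would be served by neither center, so the region of u shrinks backwards.
   Locations outside a region are collapsed to the vertex through which they
   enter it, so that each of the O(log (mn)) rounds takes O(mn) time.

   On the two final edges costs are linear. A point whose line descends towards
   the far end of one of them costs at least its value there; every other point
   contributes the smaller of the crossings of its two lines with the upper
   envelopes of the descending lines. These envelopes are built from the sorted
   slopes. *)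

(* The logarithm may fall on mn but not on |T|. A round that cuts a region of K edges takes O(K +
   mn) steps and halves K: the terms K form a geometric series bounded by the size of the tree,
   while the terms mn are paid once per round. There are O(log(|T| + mn)) rounds, and ln x < x turns
   mn log(|T| + mn) into O(|T| + mn log(mn)). All cuts are justified in decision form: for every
   bound lam, a pair of centers of cost at most lam in the tree gives such a pair in the current
   regions. Each argument compares lam with the cost at a centroid: below that cost the costliest
   point forces the direction, from it on the centroid itself can serve as a center. Subdividing at
   the locations makes all costs linear along an edge, so a center is an edge together with a
   fraction. *)
From mathcomp Require Import all_boot all_order all_algebra.
From mathcomp Require Import boolp classical_sets reals exp.
From mathcomp Require Import zify ring lra.
Require Import Defs.

Set Implicit Arguments.
Unset Strict Implicit.
Unset Printing Implicit Defensive.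

Import Order.TTheory GRing.Theory Num.Theory.

(** * Rooted trees given by a parent array *)

(* Vertices are naturals, 0 is the root and parents precede their children. *)
Definition parent_array (par : nat -> nat) : Prop :=
  par 0 = 0 /\ forall x, 0 < x -> par x < x.

(** The fuel n bounds the number of parent steps. Parents strictly decrease, so x steps always
    suffice from x, and [anc] takes x as its fuel. *)
Fixpoint anc_upto (par : nat -> nat) n c x : bool :=
  (c == x) || if n is n'.+1 then anc_upto par n' c (par x) else false.

Definition anc par c x := anc_upto par x c x.

(* The neighbour of v through which x is seen from v; [dir v v] is the parent
   of v, and the direction of v itself therefore stands for the edge above v. *)
Definition dir par v x : nat :=
  if anc par v x && (x != v)
  then head 0 [seq c <- iota 0 x.+1 | [&& 0 < c, par c == v & anc par c x]]
  else par v.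

Section Combinatorics.
Variable par : nat -> nat.
Hypothesis parP : parent_array par.
Local Notation anc := (anc par).
Local Notation dir := (dir par).

Let par0 : par 0 = 0. Proof. by case: parP. Qed.
Let par_lt x : 0 < x -> par x < x. Proof. by case: parP => _; apply. Qed.

Lemma par_le x : par x <= x.
Proof. by case: x => [|x]; [rewrite par0|apply/ltnW/par_lt]. Qed.

Lemma anc_upto_root n c : anc_upto par n c 0 = (c == 0).
Proof. by elim: n => [|n IH] /=; rewrite ?orbF // par0 IH orbb. Qed.

Lemma anc_uptoE n m c x : x <= n -> x <= m -> anc_upto par n c x = anc_upto par m c x.
Proof.
elim: n m x => [|n IH] [|m] x hn hm.
- by [].
- by move: hn; rewrite leqn0 => /eqP ->; rewrite !anc_upto_root.
- by move: hm; rewrite leqn0 => /eqP ->; rewrite !anc_upto_root.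
- rewrite /=; case: x hn hm => [|x] hn hm; first by rewrite par0 !anc_upto_root.
  by have h := @par_lt x.+1 isT; congr orb; apply: IH; lia.
Qed.

Lemma ancE c x : anc c x = (c == x) || ((0 < x) && anc c (par x)).
Proof.
case: x => [|x]; first by rewrite /anc /= orbF.
rewrite {1}/anc /=; congr orb.
by have h := @par_lt x.+1 isT; apply: anc_uptoE; lia.
Qed.

Lemma ancxx x : anc x x. Proof. by rewrite ancE eqxx. Qed.


Lemma anc_par c x : c != x -> anc c x = anc c (par x).
Proof.
move=> h; rewrite ancE (negbTE h) /=; case: x h => //= h.
by rewrite par0 ancE (negbTE h).
Qed.

Lemma anc_up c x : anc c (par x) -> anc c x.
Proof. by case: (eqVneq c x) => [->|/anc_par -> //]; rewrite ancxx. Qed.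

Lemma anc0 x : anc 0 x.
Proof.
elim/ltn_ind: x => x IH; rewrite ancE; case: x IH => //= x IH.
by apply: IH; apply: par_lt.
Qed.

Lemma anc_le c x : anc c x -> c <= x.
Proof.
elim/ltn_ind: x => x IH; rewrite ancE => /orP[/eqP -> //|/andP[hx h]].
by apply: leq_trans (IH _ (par_lt hx) h) (par_le x).
Qed.

Lemma anc_trans a b c : anc a b -> anc b c -> anc a c.
Proof.
move=> hab; elim/ltn_ind: c => c IH; rewrite ancE => /orP[/eqP <- //|/andP[hx h]].
exact/anc_up/IH/h/par_lt.
Qed.

(** The ancestors of x form a chain along which numbers increase away from the root, so comparing
    numbers decides which of two is above. *)
Lemma anc_laminar a b x : anc a x -> anc b x -> a <= b -> anc a b.
Proof.
elim/ltn_ind: x => x IH; rewrite (ancE b) => ha /orP[/eqP -> //|/andP[hx hb]] hab.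
apply: (IH (par x)) => //; first exact: par_lt.
move: ha; rewrite ancE hx => /orP[/eqP ax|//].
by have := anc_le hb; have := par_lt hx; lia.
Qed.

Lemma anc_anti a b : anc a b -> anc b a -> a = b.
Proof. by move=> /anc_le h1 /anc_le h2; lia. Qed.

Lemma anc_parF x : 0 < x -> anc x (par x) = false.
Proof. by move=> hx; apply/negP => /anc_le; have := par_lt hx; lia. Qed.

Lemma child_uniq c c' x : 0 < c -> 0 < c' -> par c = par c' -> anc c x -> anc c' x -> c = c'.
Proof.
wlog: c c' / c <= c' => [hw|hle hc hc' e h h'].
  by case: (leqP c c') => h *; [exact: hw|apply/esym/hw => //; exact: ltnW].
have := anc_laminar h h' hle; rewrite ancE => /orP[/eqP //|].
by rewrite hc' -e anc_parF.
Qed.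

Lemma child_ex v x : anc v x -> x != v -> exists c, [/\ 0 < c, par c = v & anc c x].
Proof.
elim/ltn_ind: x => x IH; rewrite ancE eq_sym => /orP[-> //|/andP[hx h]] hn.
case: (eqVneq (par x) v) => [e|e]; first by exists x; rewrite ancxx.
have [c [h1 h2 h3]] := IH _ (par_lt hx) h e.
by exists c; split=> //; apply: anc_up.
Qed.

Lemma dir_down v c x : 0 < c -> par c = v -> anc c x -> dir v x = c.
Proof.
move=> hc e h.
have hv : anc v x by apply: anc_trans h; apply: anc_up; rewrite e ancxx.
have hxv : x != v by apply/eqP => xv; have := anc_le h; have := par_lt hc; lia.
rewrite /dir hv hxv.
set s := filter _ _.
have : c \in s.
  by rewrite mem_filter hc e eqxx h mem_iota /=; have := anc_le h; lia.
case es : s => [//|a s'] _ /=.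
have : a \in s by rewrite es mem_head.
rewrite mem_filter => /andP[/and3P[ha /eqP ea hax] _].
by apply: (child_uniq ha hc _ hax h); rewrite ea.
Qed.

Lemma dir_up v x : ~~ anc v x || (x == v) -> dir v x = par v.
Proof. by rewrite /dir => /orP[/negbTE ->|->] //; rewrite andbF. Qed.

Variant dir_spec v x : nat -> Prop :=
| DirDown c of 0 < c & par c = v & anc c x & anc v x & x != v : dir_spec v x c
| DirUp of ~~ anc v x || (x == v) : dir_spec v x (par v).

Lemma dirP v x : dir_spec v x (dir v x).
Proof.
case: (boolP (anc v x && (x != v))) => [/andP[h1 h2]|].
  have [c [h3 h4 h5]] := child_ex h1 h2.
  by rewrite (dir_down h3 h4 h5); apply: DirDown h4 h5 h1 h2.
by rewrite negb_and negbK => h; rewrite dir_up //; apply: DirUp.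
Qed.

(** This is the recurrence that the machine uses: the direction of a vertex that is not above v is
    read off its parent, except that a child of v is a direction of its own. *)
Lemma dir_rec v x : dir v x =
  if anc x v then par v else if par x == v then x else dir v (par x).
Proof.
case: ifP => hxv.
  apply: dir_up; case: eqP => [|/eqP ne]; rewrite ?orbT ?orbF //.
  by apply: contra ne => /(anc_anti hxv) ->.
have hx : 0 < x by case: x hxv => //; rewrite anc0.
have hne : x != v by apply: contraFneq hxv => ->; rewrite ancxx.
case: eqP => [e|/eqP e]; first by apply: dir_down e (ancxx _).
case: (dirP v (par x)) => [c h1 h2 h3 h4 h5|h].
  by apply: dir_down h2 (anc_up h3).
apply: dir_up; rewrite (negbTE hne) orbF.
by move: h; rewrite (negbTE e) orbF; apply: contra; rewrite (@anc_par v x) 1?eq_sym.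
Qed.

Lemma dir_self v : dir v v = par v.
Proof. by rewrite dir_up // eqxx orbT. Qed.

Lemma dir_child c : 0 < c -> dir (par c) c = c.
Proof. by move=> h; rewrite (dir_down h) // ancxx. Qed.

(** An edge is seen from v in one direction, unless it hangs from v. The convention
    [dir v v = par v] makes this true for the edge above v as well. *)
Lemma dir_par_edge v c : 0 < c -> par c != v -> dir v (par c) = dir v c.
Proof.
move=> hc hn; case: (eqVneq c v) => [e|cv].
  by rewrite -e dir_self dir_up // anc_parF.
rewrite [RHS]dir_rec; case: ifP => [h|h]; last by rewrite (negbTE hn).
rewrite dir_up //; apply/orP; left; apply/negP => h2.
have := anc_anti (anc_trans h2 (anc_up (ancxx (par c)))) h.
by move=> e; rewrite e eqxx in cv.
Qed.

(* A vertex separating a from b is seen from a in the direction of b. *)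
Lemma dir_through v a b : dir v a != dir v b -> a != v -> dir a b = dir a v.
Proof.
move=> hne hav; case: (dirP v a) hne => [d h1 h2 h3 h4 h5|].
  move=> hb'; have hdb : ~~ anc d b by apply: contra hb' => h; rewrite (dir_down h1 h2 h).
  rewrite dir_up ?dir_up //; first last.
    by apply/orP; left; apply: contra hdb => h; apply: anc_trans h.
  apply/orP; left; apply/negP => h; have := anc_le (anc_trans h3 h).
  by have := par_lt h1; rewrite h2; lia.
rewrite (negbTE hav) orbF => hva; case: (dirP v b) => [d h1 h2 h3 h4 h5|]; last by rewrite eqxx.
move=> _; case: (boolP (anc a v)) => hav'.
  have [c [k1 k2 k3]] := child_ex hav' ltac:(by rewrite eq_sym).
  by rewrite (dir_down k1 k2 k3) (dir_down k1 k2 (anc_trans k3 h4)).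
rewrite [RHS]dir_up ?hav' //; rewrite dir_up //.
apply/orP; left; apply/negP => hab.
case: (leqP a v) => [h|/ltnW h].
  by move: hav'; rewrite (anc_laminar hab h4 h).
by move: hva; rewrite (anc_laminar h4 hab h).
Qed.

End Combinatorics.

(** * Tree distances *)

Section Distance.
Variables (R : realFieldType) (N : nat) (par : nat -> nat) (pl : nat -> R).
Hypothesis parP : parent_array par.
Hypothesis pl_ge0 : forall c, c < N -> (0 <= pl c)%R.
Local Notation anc := (anc par).
Local Notation dir := (dir par).
Local Open Scope ring_scope.

(** The edge c lies on the path from x to y exactly when it is above one of them and not above the
    other. *)
Definition tdist x y : R := \sum_(c < N) pl c * (anc c x (+) anc c y)%:R.
Definition depth x : R := \sum_(c < N) pl c * (anc c x)%:R.
(* The depth of the lowest common ancestor. *)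
Definition meet_depth v x : R := \sum_(c < N) pl c * (anc c v && anc c x)%:R.

Lemma tdistC x y : tdist x y = tdist y x.
Proof. by apply: eq_bigr => c _; rewrite addbC. Qed.

Lemma tdistxx x : tdist x x = 0.
Proof. by apply: big1 => c _; rewrite addbb mulr0. Qed.

Lemma tdist_ge0 x y : 0 <= tdist x y.
Proof. by apply: sumr_ge0 => c _; rewrite mulr_ge0 // pl_ge0. Qed.

Lemma tdistE v x : tdist v x = depth v + depth x - 2 * meet_depth v x.
Proof.
rewrite /tdist /depth /meet_depth mulr_sumr -big_split -sumrB.
by apply: eq_bigr => c _ /=; case: (anc c v); case: (anc c x) => /=; ring.
Qed.

Lemma depth_par x : (0 < x)%N -> (x < N)%N -> depth x = depth (par x) + pl x.
Proof.
move=> h0 hN; rewrite /depth (bigD1 (Ordinal hN)) //= [in RHS](bigD1 (Ordinal hN)) //=.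
rewrite ancxx // anc_parF // mulr0 add0r mulr1 addrC; congr (_ + _).
apply: eq_bigr => c hc; rewrite anc_par //.
Qed.

(** Only the edge above x is lost when passing from x to its parent, and it is common to v and x
    only if x is above v. *)
Lemma meet_depth_rec v x :
  meet_depth v x = if anc x v then depth x else meet_depth v (par x).
Proof.
rewrite /meet_depth /depth; case: ifP => h; apply: eq_bigr => c _.
  by case: (boolP (anc c x)) => h2; rewrite ?andbF // (anc_trans parP h2 h).
case: (eqVneq (c : nat) x) => [->|hc]; first by rewrite h.
by rewrite (anc_par parP hc).
Qed.

Lemma tdist_tri x v y : tdist x y <= tdist x v + tdist v y.
Proof.
rewrite /tdist -big_split; apply: ler_sum => c _ /=.
rewrite -mulrDr; apply: ler_wpM2l; first exact: pl_ge0.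
by case: (anc c x); case: (anc c v); case: (anc c y) => /=; rewrite ?addr0 ?add0r //; lra.
Qed.

(** Checked edge by edge: an edge that has x and y on one side and v on the other would show both x
    and y in the same direction from v. *)
Lemma tdist_sep x v y : [|| x == v, y == v | dir v x != dir v y] ->
  tdist x y = tdist x v + tdist v y.
Proof.
case/or3P => [/eqP ->|/eqP ->|h]; rewrite ?tdistxx ?add0r ?addr0 //.
rewrite /tdist -big_split; apply: eq_bigr => c _ /=.
rewrite -mulrDr; congr (_ * _).
suff : (anc c x == anc c y) ==> (anc c x == anc c v).
  by case: (anc c x); case: (anc c y); case: (anc c v) => //= _; rewrite ?addr0 ?add0r.
apply/implyP => /eqP e; apply/eqP; case: (boolP (anc c v)) => hv.
  case: (boolP (anc c x)) => // hx; exfalso; move: h; rewrite !dir_up ?eqxx //.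
  - by apply/orP; left; apply: contra hx => h; rewrite e; apply: anc_trans h.
  - by apply/orP; left; apply: contra hx => h; apply: anc_trans h.
apply/negbTE/negP => hx; have hy : anc c y by rewrite -e.
have hcv : c != v :> nat by apply: contraNneq hv => ->; rewrite ancxx.
(* Now c is above x and y but not above v. If c is below v, both are seen through the child of v
   above c; otherwise both are seen upwards. *)
have [b hb1 hb2] : exists2 b : nat, anc b c & dir v x = b /\ dir v y = b \/ ~~ anc v c.
  case: (boolP (anc v c)) => hvc; last by exists (c : nat); [rewrite ancxx|right].
  have [b [k1 k2 k3]] := child_ex parP hvc hcv.
  by exists b => //; left; split; apply: dir_down => //; apply: anc_trans k3 _.
case: hb2 => [[e1 e2]|hvc]; first by move: h; rewrite e1 e2 eqxx.
suff hu z : anc c z -> dir v z = par v by move: h; rewrite !hu ?eqxx.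
move=> hz; apply: dir_up; apply/orP; left; apply/negP => hvz.
case: (leqP c v) => [hl|/ltnW hl].
  by move: hv; rewrite (anc_laminar parP hz hvz hl).
by move: hvc; rewrite (anc_laminar parP hvz hz hl).
Qed.

End Distance.

(** * Regions of a rooted tree *)

(* A region is a connected set E of edges, an edge being named by its lower
   end; its vertices are rho :: E, and rho is a leaf of the region. *)
Record region (N : nat) (par : nat -> nat) (rho : nat) (E : seq nat) : Prop := Region {
  region_gt : forall c, c \in E -> rho < c < N;
  region_sorted : sorted ltn E;
  region_par : forall c, c \in E -> par c \in rho :: E;
  region_leaf : exists d, forall c, c \in E -> dir par rho c = d;
  region_ne : E != [::] }.

Definition cut par v d (E : seq nat) := [seq c <- E | dir par v c == d].
Definition cut_root (par : nat -> nat) v d (rho : nat) := if d == par v then rho else v.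
(** Edges in at least two directions: v is not a leaf of the region, so cutting at v in any
    direction loses edges. *)
Definition interior par v (E : seq nat) := forall d, exists2 c, c \in E & dir par v c != d.
(* The vertex y enters the region E at its vertex e. *)
Definition enters par (E : seq nat) (y e : nat) :=
  e = y \/ exists2 d, (forall c, c \in E -> dir par e c = d) & dir par e y != d.

Section Regions.
Variables (N : nat) (par : nat -> nat).
Hypothesis parP : parent_array par.
Local Notation anc := (anc par).
Local Notation dir := (dir par).
Local Notation cut := (cut par).
Local Notation cut_root := (cut_root par).
Local Notation region := (region N par).
Local Notation interior := (interior par).
Local Notation enters := (enters par).

Let par_lt x : 0 < x -> par x < x. Proof. by case: parP => _; apply. Qed.

Lemma region_anc rho E c : region rho E -> c \in rho :: E -> anc rho c.
Proof.
move=> rg; elim/ltn_ind: c => c IH; rewrite inE => /orP[/eqP ->|hc]; first exact: ancxx.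
have /andP[h1 h2] := region_gt rg hc.
by apply/anc_up/IH/(region_par rg)/hc => //; apply: par_lt; lia.
Qed.

Lemma region_anc_mem rho E c d : region rho E -> c \in E -> anc d c -> ~~ anc d rho -> d \in E.
Proof.
move=> rg; elim/ltn_ind: c => c IH hc hdc hd; have /andP[h1 _] := region_gt rg hc.
case: (eqVneq d c) => [-> //|hne]; move: hdc; rewrite anc_par // => hdc.
have := region_par rg hc; rewrite inE => /orP[/eqP e|h].
  by move: hd; rewrite -e hdc.
by apply: IH h hdc hd; apply: par_lt; lia.
Qed.

Lemma dir_root rho E v : region rho E -> v \in E -> dir v rho = par v.
Proof.
move=> rg hv; apply: dir_up => //; apply/orP; left; apply/negP => /(anc_le parP).
by have := region_gt rg hv; lia.
Qed.

Lemma dir_root_edge rho E c : region rho E -> c \in E -> par rho != dir rho c.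
Proof.
move=> rg hc; have h := region_anc rg (mem_behead (s := rho :: E) hc).
have hn := region_gt rg hc; case: (dirP parP rho c) => [d h1 h2 _ _ _|].
  have := par_lt h1; have := par_le parP rho; rewrite h2; lia.
by rewrite h /= => /eqP e; move: hn; rewrite e ltnn.
Qed.

Lemma interior_mem rho E v : region rho E -> interior v E -> v \in rho :: E -> v \in E.
Proof.
move=> rg hi; rewrite inE => /orP[/eqP ev|//].
by have [d hd] := region_leaf rg; have [c /hd] := hi d; rewrite ev => ->; rewrite eqxx.
Qed.

(** A downward piece is rooted at v, which is a leaf of it because all its edges are seen from v in
    direction d; an upward piece keeps the old root, which was a leaf already. *)
Lemma region_cut rho E v d : region rho E -> v \in rho :: E ->
  (exists2 c, c \in E & dir v c = d) -> region (cut_root v d rho) (cut v d E).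
Proof.
move=> rg hv [c0 hc0 hd0]; have rgt := region_gt rg; split.
- move=> c; rewrite mem_filter => /andP[/eqP hd hc]; rewrite /cut_root; case: eqP => [_|e].
    exact: rgt.
  move: hd e; case: (dirP parP v c) => [b h1 h2 h3 h4 h5|]; last by move=> _ ->.
  move=> _ _; have := anc_le parP h4; have := rgt _ hc; move: h5; lia.
- by apply: sorted_filter (region_sorted rg) => ? ? ?; apply: ltn_trans.
- move=> c; rewrite mem_filter => /andP[/eqP hd hc]; have hcr := rgt _ hc.
  have hc1 : 0 < c by lia.
  rewrite inE mem_filter /cut_root; case: (eqVneq (par c) v) => [e|hne].
    have hdc : d = c by rewrite -hd -e dir_child.
    rewrite hdc; case: (eqVneq c (par v)) => [e2|_]; last by rewrite e eqxx.
    by have := par_le parP v; have := par_lt hc1; lia.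
  rewrite dir_par_edge // hd eqxx /=.
  have := region_par rg hc; rewrite inE => /orP[/eqP e|->]; last by rewrite orbT.
  move: hv hne; rewrite e inE => /orP[/eqP ->|hv]; first by rewrite eqxx.
  by move=> _; rewrite -hd -dir_par_edge // ?e ?(dir_root rg hv) ?eqxx //; apply: contraTneq hv => <-;
    apply/negP => /rgt; lia.
- rewrite /cut_root; case: eqP => [_|_]; last by exists d => c; rewrite mem_filter => /andP[/eqP].
  by have [d' hd'] := region_leaf rg; exists d' => c; rewrite mem_filter => /andP[_ /hd'].
- apply/eqP => e; have : c0 \in cut v d E by rewrite mem_filter hd0 eqxx.
  by rewrite e.
Qed.

Lemma cut_vertex rho E v d x : region rho E -> v \in rho :: E ->
  (exists2 c, c \in E & dir v c = d) -> x \in rho :: E -> dir v x = d ->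
  x \in cut_root v d rho :: cut v d E.
Proof.
move=> rg hv [c0 hc0 hd0] hx hd; rewrite inE mem_filter hd eqxx /=.
move: hx; rewrite inE => /orP[/eqP ex|->]; last by rewrite orbT.
rewrite /cut_root -hd ex; move: hv; rewrite inE => /orP[/eqP ->|hv].
  by case: ifP; rewrite eqxx.
by rewrite (dir_root rg hv) !eqxx.
Qed.

Lemma cut_self rho E v d : region rho E -> v \in rho :: E ->
  (exists2 c, c \in E & dir v c = d) -> v \in cut_root v d rho :: cut v d E.
Proof.
move=> rg hv [c0 hc0 hd0]; rewrite inE mem_filter /cut_root.
case: (eqVneq d (par v)) => [e|]; last by rewrite eqxx.
move: hv; rewrite inE => /orP[/eqP ev|->]; last by rewrite dir_self // -e eqxx orbT.
by have := dir_root_edge rg hc0; rewrite -ev hd0 e eqxx.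
Qed.

Lemma cut_vertexW rho E v d x : region rho E -> v \in rho :: E ->
  x \in cut_root v d rho :: cut v d E -> x \in rho :: E.
Proof.
move=> rg hv; rewrite [x \in _ :: cut _ _ _]inE mem_filter /cut_root => /orP[/eqP ->|/andP[_]].
  by case: ifP; rewrite ?mem_head.
by rewrite inE => ->; rewrite orbT.
Qed.

Lemma cut_vertex_dir rho E v d x : region rho E -> v \in rho :: E ->
  (exists2 c, c \in E & dir v c = d) ->
  x \in cut_root v d rho :: cut v d E -> x != v -> dir v x = d.
Proof.
move=> rg hv [c0 hc0 hd0]; rewrite inE mem_filter /cut_root => /orP[|/andP[/eqP //]].
case: ifP => [/eqP e /eqP ->|_ /eqP ->]; last by rewrite eqxx.
move: hv; rewrite inE => /orP[/eqP ->|hv]; first by rewrite eqxx.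
by rewrite (dir_root rg hv).
Qed.

Lemma enters_dir rho E y e x : region rho E -> enters E y e -> e \in rho :: E ->
  x \in rho :: E -> x != e -> (y == e) || (dir e y != dir e x).
Proof.
move=> rg [->|[d hd hy]] he hx hne; rewrite ?eqxx //; apply/orP; right.
suff -> : dir e x = d by [].
move: hx; rewrite inE => /orP[/eqP ex|]; last exact: hd.
move: he; rewrite inE => /orP[/eqP ee|he]; first by rewrite ex ee eqxx in hne.
by rewrite ex (dir_root rg he) -(hd _ he) dir_self.
Qed.

Lemma enters_tdist (R : realFieldType) (pl : nat -> R) rho E y e x :
  region rho E -> enters E y e -> e \in rho :: E -> x \in rho :: E ->
  tdist N par pl y x = (tdist N par pl y e + tdist N par pl e x)%R.
Proof.
move=> rg hy he hx; apply: tdist_sep => //; case: (eqVneq x e) => [_|hne]; first by rewrite orbT.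
by case/orP: (enters_dir rg hy he hx hne) => ->; rewrite ?orbT.
Qed.

Lemma enters_dirE rho E y e v : region rho E -> enters E y e -> e \in rho :: E ->
  v \in E -> interior v E -> dir v y = dir v e.
Proof.
move=> rg hy he hv hi; case: (eqVneq v e) => [ev|hne].
  case: hy => [->//|[d hd _]]; have [c /hd] := hi d.
  by rewrite ev => ->; rewrite eqxx.
have := enters_dir rg hy he (mem_behead (s := rho :: E) hv) hne.
case/orP => [/eqP -> //|h]; apply: dir_through => //; by rewrite eq_sym.
Qed.

(** The alternative [e = y] serves the cut that creates a half of the tree: it is made before any
    location is collapsed, at an end of an edge, which may be a leaf. All other cuts are made at
    interior vertices. *)
Lemma enters_cut rho E y e v d : region rho E -> enters E y e -> e \in rho :: E ->
  v \in rho :: E -> (e = y \/ interior v E) -> (exists2 c, c \in E & dir v c = d) ->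
  let e' := if dir v e == d then e else v in
  enters (cut v d E) y e' /\ e' \in cut_root v d rho :: cut v d E.
Proof.
move=> rg hy he hv hi hd /=; case: (eqVneq (dir v e) d) => hde; split.
- case: hy => [->|[d' h1 h2]]; first by left.
  by right; exists d' => // c; rewrite mem_filter => /andP[_ /h1].
- exact: cut_vertex.
- case: (eqVneq v y) => [->|hne]; first by left.
  right; exists d; first by move=> c; rewrite mem_filter => /andP[/eqP].
  case: hi => [<- //|hi].
  by rewrite (enters_dirE rg hy he (interior_mem rg hi hv)).
- exact: cut_self.
Qed.

End Regions.

(** * The two-center search on a rooted tree *)

(* Location j of uncertain point i is the vertex [node (i * m + j)], and a
   point of the tree is an edge c with the fraction of it lying above. *)
Record instance (R : realFieldType) := Instance {
  size_t : nat;
  par : nat -> nat;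
  pl : nat -> R;
  npt : nat;
  nloc : nat;
  node : nat -> nat;
  prb : nat -> R;
  wgt : nat -> R }.

(** [root_leaf] says that vertex 1 is the only child of the root; this makes the root a leaf, so
    that the set of all edges is a region. *)
Record instance_ok (R : realFieldType) (I : instance R) : Prop := InstanceOk {
  par_ok : parent_array (par I);
  pl_ok : forall c, c < size_t I -> (0 <= pl I c)%R;
  node_ok : forall k, k < npt I * nloc I -> node I k < size_t I;
  prb_ok : forall k, k < npt I * nloc I -> (0 <= prb I k)%R;
  wgt_ok : forall i, i < npt I -> (0 <= wgt I i)%R;
  npt_gt0 : 0 < npt I;
  size_gt1 : 1 < size_t I;
  root_leaf : forall x, 1 < x < size_t I -> 0 < par I x }.

Section Search.
Variables (R : realFieldType) (I : instance R).
Hypothesis I_ok : instance_ok I.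
Local Notation N := (size_t I).
Local Notation n := (npt I).
Local Notation m := (nloc I).
Local Notation dir := (dir (par I)).
Local Notation tdist := (tdist N (par I) (pl I)).
Local Notation region := (region N (par I)).
Local Notation interior := (interior (par I)).
Local Notation cut := (cut (par I)).
Local Notation cut_root := (cut_root (par I)).
Local Open Scope ring_scope.
Let parP := par_ok I_ok.

(** Mass located at v itself is counted in the direction of the parent, as [dir v v = par v]. The
    masses of different directions stay disjoint, and counting too much only makes the test for a
    minority stricter. *)
Definition mass v d i : R :=
  \sum_(j < m) prb I (i * m + j) * (dir v (node I (i * m + j)) == d)%:R.
Definition total_mass i : R := \sum_(j < m) prb I (i * m + j).
Definition fvert i v : R :=
  wgt I i * \sum_(j < m) prb I (i * m + j) * tdist (node I (i * m + j)) v.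
(** Locations being vertices, the expected distance is linear along every edge, so the cost at an
    inner point interpolates the costs at its ends. *)
Definition fpt i (x : nat * R) : R :=
  (1 - x.2) * fvert i (par I x.1) + x.2 * fvert i x.1.
Definition on (E : seq nat) (x : nat * R) : Prop := x.1 \in E /\ 0 <= x.2 <= 1.
Definition covers lam x y : Prop :=
  forall i, (i < n)%N -> fpt i x <= lam \/ fpt i y <= lam.
(* Restricting the two centers to E1 and E2 loses nothing. *)
Definition suffice E1 E2 : Prop := forall E lam x y, (forall c, c \in E -> (0 < c < N)%N) ->
  on E x -> on E y -> covers lam x y -> exists x' y', [/\ on E1 x', on E2 y' & covers lam x' y'].

Let idx_lt i (j : 'I_m) : (i < n)%N -> (i * m + j < n * m)%N.
Proof. by case: j => j /= hj hi; nia. Qed.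

Lemma fvert_ge0 i v : (i < n)%N -> 0 <= fvert i v.
Proof.
move=> hi; rewrite mulr_ge0 ?(wgt_ok I_ok) // sumr_ge0 // => j _.
by rewrite mulr_ge0 ?(tdist_ge0 _ (pl_ok I_ok)) // (prb_ok I_ok) // idx_lt.
Qed.

Lemma fpt_ge0 i x : (i < n)%N -> 0 <= x.2 <= 1 -> 0 <= fpt i x.
Proof. by move=> hi /andP[h0 h1]; rewrite addr_ge0 // mulr_ge0 ?fvert_ge0 // subr_ge0. Qed.

Lemma covers_ge0 E E' lam x y : on E x -> on E' y -> covers lam x y -> 0 <= lam.
Proof.
move=> [_ hx] [_ hy] /(_ _ (npt_gt0 I_ok)) [] h; apply: le_trans h;
  by apply: fpt_ge0 => //; apply: npt_gt0.
Qed.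

(* Moving from v in a direction in which no majority of the probability mass of
   point i lies does not bring the point closer. *)
Lemma fvert_minority i v z : (i < n)%N -> (z == v) || (2 * mass v (dir v z) i <= total_mass i) ->
  fvert i v <= fvert i z.
Proof.
move=> hi; case: eqP => [-> //|/eqP hne] /= hm.
apply: ler_wpM2l; first exact: (wgt_ok I_ok).
rewrite -subr_ge0 -sumrB; set D := tdist v z; have hz : 0 <= D by rewrite (tdist_ge0 _ (pl_ok I_ok)).
(* Moving from v to z, a location in the direction of z gains at most D and every other location
   loses exactly D. *)
apply: (@le_trans _ _ (D * (total_mass i - 2 * mass v (dir v z) i))).
  by rewrite mulr_ge0 // subr_ge0.
rewrite /total_mass /mass mulr_sumr -sumrB mulr_sumr; apply: ler_sum => j _.
have hp : 0 <= prb I (i * m + j) by apply: (prb_ok I_ok); apply: idx_lt.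
set y := node I _; set p := prb I _ in hp *.
case: eqP => [e|/eqP hd] /=.
  have := tdist_tri (par I) (pl_ok I_ok) y z v; rewrite (tdistC _ _ _ z) -/D; nra.
have -> : tdist y z = tdist y v + D by apply: tdist_sep => //; rewrite hd !orbT.
by lra.
Qed.

Lemma fpt_minority i v c s : (i < n)%N -> (0 < c)%N -> 0 <= s <= 1 ->
  2 * mass v (dir v c) i <= total_mass i -> fvert i v <= fpt i (c, s).
Proof.
move=> hi hc /andP[h0 h1] hm; rewrite /fpt /=.
have hc1 : fvert i v <= fvert i c by apply: fvert_minority; rewrite ?hm ?orbT.
suff hp1 : fvert i v <= fvert i (par I c) by nra.
apply: fvert_minority => //; case: (eqVneq (par I c) v) => //= hne.
by rewrite dir_par_edge.
Qed.

Lemma mass_disjoint v d d' i : (i < n)%N -> d != d' -> mass v d i + mass v d' i <= total_mass i.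
Proof.
move=> hi hd; rewrite -big_split; apply: ler_sum => j _ /=.
have hp : 0 <= prb I (i * m + j) by apply: (prb_ok I_ok); apply: idx_lt.
case: eqP => [->|_]; first by rewrite (negbTE hd) /=; lra.
by case: eqP => _ /=; lra.
Qed.

(** A majority in one direction leaves at most half of the mass for any other. *)
Lemma fpt_majority i v d c s : (i < n)%N -> (0 < c)%N -> 0 <= s <= 1 ->
  total_mass i < 2 * mass v d i -> dir v c != d -> fvert i v <= fpt i (c, s).
Proof.
move=> hi hc hs hm hd; apply: fpt_minority => //.
by have := mass_disjoint v hi hd; lra.
Qed.

Lemma region_edges rho E c : region rho E -> c \in E -> (0 < c < N)%N.
Proof. by move=> rg /(region_gt rg); lia. Qed.

(** A vertex has to be named by an edge of the region. For the root this is the smallest edge: its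
    upper end is smaller still and hence not in the sorted list E. *)
Lemma vertex_on rho E u : region rho E -> u \in rho :: E ->
  exists2 x, on E x & forall i, fpt i x = fvert i u.
Proof.
move=> rg; rewrite inE => /orP[/eqP ->|hu]; last first.
  by exists (u, 1); [split=> //=; rewrite ler01 lexx|move=> i; rewrite /fpt /=; ring].
have := region_ne rg; case eE : E => [//|c E'] _.
have hc : c \in E by rewrite eE mem_head.
exists (c, 0); first by split; rewrite /= ?mem_head // ler01 lexx.
suff -> : rho = par I c by move=> i; rewrite /fpt /=; ring.
have := region_par rg hc; rewrite inE => /orP[/eqP -> //|h].
have := region_sorted rg; rewrite eE /= => /(order_path_min ltn_trans) /allP hmin.
have hlt : (par I c < c)%N by apply: (proj2 parP); have := region_edges rg hc; lia.
move: h; rewrite eE inE => /orP[/eqP e|/hmin /=]; move: hlt; rewrite ?e ?ltnn //; lia.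
Qed.

(* [lam] is the largest cost at v of a point not drawn up towards the anchor,
   and d the direction in which a point attaining it is drawn. *)
Record votes (E : seq nat) up v lam d : Prop := Votes {
  votes_dir : exists2 c, c \in E & dir v c = d;
  votes_ge0 : 0 <= lam;
  votes_max : forall i, (i < n)%N -> 2 * mass v up i <= total_mass i -> fvert i v <= lam;
  votes_arg : lam = 0 \/ exists i, [/\ (i < n)%N, fvert i v = lam,
    2 * mass v up i <= total_mass i & forall e, e != d -> 2 * mass v e i <= total_mass i] }.

(* The region E seen from E': every interior vertex of E sees E' in the
   direction of the anchor r, which is the vertex of E closest to E'. *)
Record faces (rho : nat) (E : seq nat) (r : nat) (E' : seq nat) : Prop := Faces {
  faces_mem : r \in rho :: E;
  faces_leaf : exists d, forall c, c \in E -> dir r c = d;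
  faces_dir : forall v c, v \in rho :: E -> v != r -> c \in E' -> dir v c = dir v r;
  faces_sep : forall c e, c \in E' -> c \notin E -> e \in E -> dir r c != dir r e }.

Lemma interior_anchor rho E r E' v : faces rho E r E' -> interior v E -> v != r.
Proof.
move=> hf hi; apply/eqP => e; have [d hd] := faces_leaf hf; have [c /hd] := hi d.
by rewrite e => ->; rewrite eqxx.
Qed.

Lemma faces_sub rho E r (E' E'' : seq nat) : {subset E'' <= E'} -> faces rho E r E' -> faces rho E r E''.
Proof.
move=> hs [h1 h2 h3 h4]; split=> // [v c hv hr /hs|c e /hs]; [exact: h3|exact: h4].
Qed.

Lemma cut_subset v d E : {subset cut v d E <= E}.
Proof. by move=> c; rewrite mem_filter => /andP[]. Qed.

(** A piece towards the anchor keeps it. In any other piece v becomes the anchor, since the other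
    region is seen from v in the direction of the old anchor. *)
Lemma faces_cut rho E r E' v d : region rho E -> faces rho E r E' ->
  v \in rho :: E -> interior v E -> (exists2 c, c \in E & dir v c = d) ->
  faces (cut_root v d rho) (cut v d E) (if d == dir v r then r else v) E'.
Proof.
move=> rg hf hv hi hd; have hvr := interior_anchor hf hi.
have hE' c : c \in E' -> dir v c = dir v r by apply: (faces_dir hf).
case: (eqVneq d (dir v r)) => [e|hne]; split.
- exact: (cut_vertex parP rg hv hd (faces_mem hf)).
- by have [d' h] := faces_leaf hf; exists d' => c /cut_subset /h.
- by move=> v' c /(cut_vertexW rg hv) hv' hr hc; apply: (faces_dir hf).
- move=> c b hc; rewrite mem_filter hE' // -e eqxx /= => hcE /cut_subset.
  exact: (faces_sep hf).
- exact: (cut_self parP rg hv hd).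
- by exists d => c; rewrite mem_filter => /andP[/eqP].
- move=> v' c hv' hvv' /hE' hc; apply: dir_through => //; rewrite hc.
  by rewrite (cut_vertex_dir parP rg hv hd hv').
- move=> c b /hE' -> _; rewrite mem_filter => /andP[/eqP -> _].
  by rewrite eq_sym.
Qed.

Lemma fpt_edge E x : on E x -> x = (x.1, x.2). Proof. by case: x. Qed.

(** * One cut while both regions still have interior vertices *)

Section Step.
Variables (rho1 : nat) (E1 : seq nat) (r1 rho2 : nat) (E2 : seq nat) (r2 : nat).
Hypotheses (rg1 : region rho1 E1) (rg2 : region rho2 E2).
Hypotheses (F1 : faces rho1 E1 r1 E2) (F2 : faces rho2 E2 r2 E1).
Variables (lamv lamu : R) (v u d d' : nat).
Hypotheses (hv : v \in rho1 :: E1) (hu : u \in rho2 :: E2).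
Hypotheses (iv : interior v E1) (iu : interior u E2).
Hypotheses (V1 : votes E1 (dir v r1) v lamv d) (V2 : votes E2 (dir u r2) u lamu d').
Hypothesis suff12 : suffice E1 E2.

Lemma on_pos rho E x : region rho E -> on E x -> (0 < x.1)%N.
Proof. by move=> rg [/(region_edges rg) /andP[]]. Qed.

(** The point attaining [lamv] is not drawn from v towards the anchor, behind which y lies, so it
    costs at least [lamv] at y. Hence x serves it, and x is in the direction d in which the point is
    drawn. *)
Lemma votes_serve lam x y : on E1 x -> on E2 y -> covers lam x y -> 0 <= lam -> lam < lamv ->
  dir v x.1 = d /\ d != dir v r1.
Proof.
move=> hx hy hc h0 hlt; have hvr := interior_anchor F1 iv.
have [e|[i [hi hf hup hd]]] := votes_arg V1; first by exfalso; lra.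
have hy' : fvert i v <= fpt i y.
  rewrite (fpt_edge hy); apply: fpt_minority => //; [exact: on_pos rg2 hy|by case: hy|].
  by rewrite (faces_dir F1 hv hvr (proj1 hy)).
have hx' : fpt i x <= lam by case: (hc _ hi) => // h; lra.
have hdx : dir v x.1 = d.
  apply/eqP/negPn/negP => hne; suff : fvert i v <= fpt i x by lra.
  by rewrite (fpt_edge hx); apply: fpt_minority (hd _ hne) => //; [exact: on_pos rg1 hx|case: hx].
split=> //; apply/eqP => e; suff : fvert i v <= fpt i x by lra.
rewrite (fpt_edge hx); apply: fpt_minority => //; [exact: on_pos rg1 hx|by case: hx|].
by rewrite hdx e.
Qed.

(** Below [lamv] the first center is in direction d already, by [votes_serve]; from [lamv] on, v
    together with y0 serves every point. *)
Lemma suffice_down y0 : on E2 y0 ->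
  (forall i, (i < n)%N -> fvert i v <= lamv \/ fpt i y0 <= lamv) ->
  suffice (cut v d E1) E2.
Proof.
move=> hy0 hphi E lam x y hE hx hy hc; have h0 := covers_ge0 hx hy hc.
have [x1 [y1 [hx1 hy1 hc1]]] := suff12 hE hx hy hc.
case: (ltP lam lamv) => hlt.
  have [h _] := votes_serve hx1 hy1 hc1 h0 hlt.
  by exists x1, y1; split=> //; split; [rewrite mem_filter h eqxx (proj1 hx1)|case: hx1].
have rg' := region_cut parP rg1 hv (votes_dir V1).
have [x' hx' ex'] := vertex_on rg' (cut_self parP rg1 hv (votes_dir V1)).
exists x', y0; split=> // i hi; rewrite ex'.
by case: (hphi i hi) => h; [left|right]; apply: le_trans h hlt.
Qed.

(* If the second center could be strictly below u with cost below [lamu], the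
   point i would be served by neither center. *)
Lemma suffice_up i : lamu <= lamv -> (i < n)%N -> lamv < fvert i v -> lamv < fvert i u ->
  suffice E1 (cut u (dir u r2) E2).
Proof.
move=> hle hi hiv hiu E lam x y hE hx hy hc; have h0 := covers_ge0 hx hy hc.
have [x1 [y1 [hx1 hy1 hc1]]] := suff12 hE hx hy hc.
have dirs : exists2 c, c \in E2 & dir u c = dir u r2.
  have := region_ne rg1; case eE : E1 => [//|c0 ?] _; have hc0 : c0 \in E1 by rewrite eE mem_head.
  have hur := interior_anchor F2 iu; have e0 := faces_dir F2 hu hur hc0.
  have := faces_mem F2; rewrite inE => /orP[/eqP er|hr]; last by exists r2.
  have hu' := interior_mem rg2 iu hu.
  by exists u => //; rewrite dir_self er (dir_root parP rg2).
case: (eqVneq (dir u y1.1) (dir u r2)) => hdir.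
  by exists x1, y1; split=> //; split; [rewrite mem_filter hdir eqxx (proj1 hy1)|case: hy1].
have yp := on_pos rg2 hy1; have xp := on_pos rg1 hx1.
have bad k : (k < n)%N -> total_mass k < 2 * mass u (dir u r2) k -> fvert k u <= fpt k y1.
  by move=> hk hm; rewrite (fpt_edge hy1); apply: fpt_majority hm hdir => //; case: hy1.
(* The second center, found beyond u, is pulled back to u: points not drawn up cost at most [lamu]
   there, and points drawn up only come closer. *)
case: (lerP lamu lam) => hlt.
  have rg' := region_cut parP rg2 hu dirs.
  have [y' hy' ey'] := vertex_on rg' (cut_self parP rg2 hu dirs).
  exists x1, y'; split=> // k hk; rewrite ey'; case: (hc1 k hk) => h; first by left.
  right; case: (lerP (2 * mass u (dir u r2) k) (total_mass k)) => hm.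
    exact: le_trans (votes_max V2 hk hm) hlt.
  exact: le_trans (bad _ hk hm) h.
have [hd hne] := votes_serve hx1 hy1 hc1 h0 (lt_le_trans hlt hle).
have hx' : fvert i v <= fpt i x1.
  rewrite (fpt_edge hx1); apply: (@fpt_majority _ _ (dir v r1)) => //; [by case: hx1| |by rewrite hd].
  by rewrite ltNge; apply/negP => /(votes_max V1 hi); lra.
have hy' : fvert i u <= fpt i y1.
  by apply: bad => //; rewrite ltNge; apply/negP => /(votes_max V2 hi); lra.
by case: (hc1 i hi); lra.
Qed.

End Step.

Lemma suffice_sym E1 E2 : suffice E1 E2 -> suffice E2 E1.
Proof.
move=> h E lam x y hE hx hy hc; have [x' [y' [h1 h2 h3]]] := h E lam x y hE hx hy hc.
by exists y', x'; split=> // i hi; case: (h3 i hi); [right|left].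
Qed.

(* A side of the search that is down to the edge c with near end r. *)
Definition far_end c r := if r == c then par I c else c.
Definition along c r (s : R) : nat * R := if r == c then (c, 1 - s) else (c, s).
Definition line (A B : nat -> R) i (s : R) := A i + (B i - A i) * s.

(* The smallest parameter where the lines descending from the near end are at
   most [lam]; it exceeds 1 when no point of the edge qualifies. *)
Definition cutoff (A B : nat -> R) lam s : Prop := [/\ 0 <= s,
  forall k, (k < n)%N -> B k < A k -> line A B k s <= lam &
  s = 0 \/ exists k, [/\ (k < n)%N, B k < A k & line A B k s = lam]].

(** * One region reduced to a single edge *)

Section OneEdge.
Variables (rho : nat) (c r : nat) (E2 : seq nat).
Hypotheses (rg : region rho [:: c]) (F : faces rho [:: c] r E2).
Let A i := fvert i r.
Let B i := fvert i (far_end c r).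

Lemma region1_pos : (0 < c < N)%N.
Proof. by apply: (region_edges rg); rewrite mem_head. Qed.

Lemma region1_root : rho = par I c.
Proof.
have /andP[hc _] := region1_pos; have := region_par rg (mem_head _ _).
rewrite !inE => /orP[/eqP -> //|/eqP e]; by have := proj2 parP _ hc; rewrite e ltnn.
Qed.

Lemma anchor1 : r = c \/ r = par I c /\ r != c.
Proof.
have := faces_mem F; rewrite !inE region1_root => /orP[|] /eqP ->; [right|by left].
by split=> //; rewrite neq_ltn (proj2 parP) //; case/andP: region1_pos.
Qed.

Lemma fpt_along i s : fpt i (along c r s) = line A B i s.
Proof.
rewrite /fpt /along /line /A /B /far_end; case: anchor1 => [->|[-> /negbTE ->]];
  rewrite ?eqxx /=; ring.
Qed.

Lemma on_along s : 0 <= s <= 1 -> on [:: c] (along c r s).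
Proof. by move=> /andP[h0 h1]; rewrite /along; case: ifP; split; rewrite /= ?mem_head //; lra. Qed.

Lemma along_ex x : on [:: c] x -> exists2 s, 0 <= s <= 1 & x = along c r s.
Proof.
case: x => c' s [] /=; rewrite inE => /eqP -> /andP[h0 h1]; rewrite /along.
case: (r == c); last by exists s; rewrite ?h0.
by exists (1 - s); [lra|congr pair; ring].
Qed.

(** A line descending away from r means, by [fpt_minority], that more than half of the mass of the
    point is seen from r through c; no center seen in another direction can then beat r. *)
Lemma descending_far i y : (i < n)%N -> B i < A i -> on E2 y -> (0 < y.1)%N -> y.1 != c ->
  A i <= fpt i y.
Proof.
move=> hi hlt [hy hs] hy0 hne; have /andP[hc _] := region1_pos.
have hd : dir r y.1 != dir r c by apply: (faces_sep F); rewrite ?inE ?mem_head.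
case: (lerP (2 * mass r (dir r c) i) (total_mass i)) => hm; last first.
  by case: y hy hs hy0 hne hd => a s /= *; apply: fpt_majority hm _.
suff : A i <= B i by rewrite leNgt hlt.
have h01 : 0 <= (0 : R) <= 1 by rewrite lexx ler01.
have h11 : 0 <= (1 : R) <= 1 by rewrite lexx ler01.
have := fpt_minority hi hc h01 hm; have := fpt_minority hi hc h11 hm.
rewrite /fpt /A /B /far_end /=; case: ifP => _; lra.
Qed.

Section OneEdgeStep.
Variables (rho2 r2 : nat).
Hypotheses (rg2 : region rho2 E2) (F2 : faces rho2 E2 r2 [:: c]).
Variables (lamu : R) (u d : nat).
Hypotheses (hu : u \in rho2 :: E2) (iu : interior u E2).
Hypothesis V2 : votes E2 (dir u r2) u lamu d.
Hypothesis suff12 : suffice [:: c] E2.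

Lemma up_edge : exists2 e, e \in E2 & dir u e = dir u r2.
Proof.
have hur := interior_anchor F2 iu; have e0 := faces_dir F2 hu hur (mem_head c [::]).
have := faces_mem F2; rewrite inE => /orP[/eqP er|hr]; last by exists r2.
have hu' := interior_mem rg2 iu hu.
by exists u => //; rewrite dir_self er (dir_root parP rg2).
Qed.

(** Let lam < [lamu] and let the second center be beyond u. By [descending_far] every descending
    line is at most lam at the first center, whose parameter t is therefore at least s. This
    excludes s > 1. A point above [lamu] at s does not descend, so it is above [lamu] at t, and it
    is above [lamu] beyond u too. *)
Lemma suffice_up1 s : cutoff A B lamu s ->
  (1 < s \/ exists i, [/\ (i < n)%N, lamu < line A B i s & lamu < fvert i u]) ->
  suffice [:: c] (cut u (dir u r2) E2).
Proof.
move=> [hs hcut hs0] hbad E lam x y hE hx hy hc; have h0 := covers_ge0 hx hy hc.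
have [x1 [y1 [hx1 hy1 hc1]]] := suff12 hE hx hy hc.
case: (eqVneq (dir u y1.1) (dir u r2)) => hdir.
  by exists x1, y1; split=> //; split; [rewrite mem_filter hdir eqxx (proj1 hy1)|case: hy1].
have yp := on_pos rg2 hy1.
have far k : (k < n)%N -> total_mass k < 2 * mass u (dir u r2) k -> fvert k u <= fpt k y1.
  by move=> hk hm; rewrite (fpt_edge hy1); apply: fpt_majority hm hdir => //; case: hy1.
case: (lerP lamu lam) => hlt.
  have rg' := region_cut parP rg2 hu up_edge.
  have [y' hy' ey'] := vertex_on rg' (cut_self parP rg2 hu up_edge).
  exists x1, y'; split=> // k hk; rewrite ey'; case: (hc1 k hk) => h; first by left.
  right; case: (lerP (2 * mass u (dir u r2) k) (total_mass k)) => hm.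
    exact: le_trans (votes_max V2 hk hm) hlt.
  exact: le_trans (far _ hk hm) h.
have yc : y1.1 != c.
  apply: contraNneq hdir => ->; apply/eqP.
  exact: (faces_dir F2 hu (interior_anchor F2 iu) (mem_head c [::])).
have [t /andP[t0 t1] ex] := along_ex hx1.
have hD k : (k < n)%N -> B k < A k -> line A B k t <= lam.
  move=> hk hBA; case: (hc1 k hk); first by rewrite ex fpt_along.
  have := descending_far hk hBA hy1 yp yc; rewrite /line; nra.
have hst : s <= t.
  case: hs0 => [-> //|[k [hk hBA hl]]]; have := hD k hk hBA; move: hl; rewrite /line; nra.
case: hbad => [|[i [hi hl hfu]]]; first by lra.
have hBA : A i <= B i by case: (lerP (A i) (B i)) => // /(hcut i hi); lra.
have hfar : fvert i u <= fpt i y1.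
  by apply: far => //; rewrite ltNge; apply/negP => /(votes_max V2 hi); lra.
case: (hc1 i hi); last by lra.
by rewrite ex fpt_along; move: hl; rewrite /line; nra.
Qed.

End OneEdgeStep.
End OneEdge.

(** * The optimum on two single edges *)

Section TwoEdges.
Variables (rho1 c1 r1 rho2 c2 r2 : nat).
Hypotheses (rg1 : region rho1 [:: c1]) (rg2 : region rho2 [:: c2]).
Hypotheses (F1 : faces rho1 [:: c1] r1 [:: c2]) (F2 : faces rho2 [:: c2] r2 [:: c1]).
Hypothesis r12 : c1 = c2 -> r1 != r2.
Let A1 i := fvert i r1.
Let B1 i := fvert i (far_end c1 r1).
Let A2 i := fvert i r2.
Let B2 i := fvert i (far_end c2 r2).

(* q is the cost at which a line that does not descend meets the upper envelope
   of the descending ones. *)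
Definition crossing (A B : nat -> R) (q : R) i : Prop := forall lam,
  0 <= lam -> (forall k, (k < n)%N -> B k < A k -> B k <= lam) ->
  (q <= lam <-> exists s, [/\ 0 <= s <= 1,
     forall k, (k < n)%N -> B k < A k -> line A B k s <= lam & line A B i s <= lam]).

Variables (q1 q2 : nat -> R) (lam s1 s2 : R).
Hypothesis lam_ge0 : 0 <= lam.
Hypothesis lam_B1 : forall i, (i < n)%N -> B1 i < A1 i -> B1 i <= lam.
Hypothesis lam_B2 : forall i, (i < n)%N -> B2 i < A2 i -> B2 i <= lam.
Hypothesis lam_q : forall i, (i < n)%N -> A1 i <= B1 i -> A2 i <= B2 i -> Num.min (q1 i) (q2 i) <= lam.
Hypothesis lam_arg : lam = 0 \/ exists2 i, (i < n)%N &
  [\/ B1 i < A1 i /\ lam = B1 i, B2 i < A2 i /\ lam = B2 i |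
      [/\ A1 i <= B1 i, A2 i <= B2 i & lam = Num.min (q1 i) (q2 i)]].
Hypothesis q1P : forall i, (i < n)%N -> A1 i <= B1 i -> crossing A1 B1 (q1 i) i.
Hypothesis q2P : forall i, (i < n)%N -> A2 i <= B2 i -> crossing A2 B2 (q2 i) i.
Hypothesis s1P : cutoff A1 B1 lam s1.
Hypothesis s2P : cutoff A2 B2 lam s2.

(** A descending line that is at most l at its far end reaches l at parameter 1 at the latest. *)
Lemma cutoff_le1 A B l s : (forall i, (i < n)%N -> B i < A i -> B i <= l) ->
  cutoff A B l s -> 0 <= s <= 1.
Proof.
move=> hB [h0 _ h]; rewrite h0 /=; case: h => [->|[k [hk hBA hl]]]; first exact: ler01.
by have := hB k hk hBA; move: hl; rewrite /line; nra.
Qed.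

(** Any admissible parameter t is at least the cutoff s, and a line that does not descend is no
    higher at s than at t. *)
Lemma crossing_cutoff A B l s q i : 0 <= l ->
  (forall k, (k < n)%N -> B k < A k -> B k <= l) ->
  A i <= B i -> cutoff A B l s -> crossing A B q i -> q <= l -> line A B i s <= l.
Proof.
move=> hl hB hAB [h0 _ hs] hq /(hq l hl hB) [t [/andP[t0 t1] hk hi]].
suff : s <= t by move: hi; rewrite /line; nra.
case: hs => [-> //|[k [hkn hBA e]]]; have := hk k hkn hBA; move: e; rewrite /line; nra.
Qed.

Lemma final_covers : covers lam (along c1 r1 s1) (along c2 r2 s2).
Proof.
move=> i hi; rewrite (fpt_along rg1 F1) (fpt_along rg2 F2) -/A1 -/B1 -/A2 -/B2.
case: (ltrP (B1 i) (A1 i)) => h1; first by left; case: s1P => _ h _; apply: h.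
case: (ltrP (B2 i) (A2 i)) => h2; first by right; case: s2P => _ h _; apply: h.
have := lam_q hi h1 h2; rewrite ge_min => /orP[h|h]; [left|right].
  exact: crossing_cutoff lam_B1 h1 s1P (q1P hi h1) h.
exact: crossing_cutoff lam_B2 h2 s2P (q2P hi h2) h.
Qed.

(** On different edges, a descending point served on the other edge costs at least its near end
    there, so its own line is at most l anyway. If both sides have ended on the same edge, it is run
    through from opposite ends; exchanging the centers if necessary puts each, seen from its own
    near end, beyond the other, so that every descending point is served by the center it descends
    to. *)
Lemma ordered_pair l x y : on [:: c1] x -> on [:: c2] y -> covers l x y ->
  exists t1 t2, [/\ 0 <= t1 <= 1, 0 <= t2 <= 1, covers l (along c1 r1 t1) (along c2 r2 t2),
    forall i, (i < n)%N -> B1 i < A1 i -> line A1 B1 i t1 <= l &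
    forall i, (i < n)%N -> B2 i < A2 i -> line A2 B2 i t2 <= l].
Proof.
move=> hx hy hc; have [a1 ha1 ex] := along_ex r1 hx; have [a2 ha2 ey] := along_ex r2 hy.
have cov i (hi : (i < n)%N) : line A1 B1 i a1 <= l \/ line A2 B2 i a2 <= l.
  by have := hc i hi; rewrite ex ey (fpt_along rg1 F1) (fpt_along rg2 F2).
have mk t1 t2 : (forall i, (i < n)%N -> line A1 B1 i t1 <= l \/ line A2 B2 i t2 <= l) ->
    covers l (along c1 r1 t1) (along c2 r2 t2).
  by move=> h i /h; rewrite (fpt_along rg1 F1) (fpt_along rg2 F2).
have /andP[p1 _] := region1_pos rg1; have /andP[p2 _] := region1_pos rg2.
case: (eqVneq c1 c2) => [e|hne]; last first.
  exists a1, a2; split=> //; first exact: mk.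
    move=> i hi hBA; case: (cov i hi) => // h.
    have := descending_far rg1 F1 hi hBA hy (on_pos rg2 hy).
    rewrite ey (fpt_along rg2 F2) -/(A1 i) /along.
    by case: ifP => _ /= /(_ ltac:(by rewrite eq_sym)) ?; move: hBA ha1; rewrite /line -/(A1 i) -/(B1 i); nra.
  move=> i hi hBA; case: (cov i hi) => // h.
  have := descending_far rg2 F2 hi hBA hx (on_pos rg1 hx).
  rewrite ex (fpt_along rg1 F1) -/(A2 i) /along.
  by case: ifP => _ /= /(_ hne) ?; move: hBA ha2; rewrite /line -/(A2 i) -/(B2 i); nra.
have hn := r12 e.
have eA i : A2 i = B1 i /\ B2 i = A1 i.
  rewrite /A2 /B2 /A1 /B1 /far_end -e; move: hn (anchor1 rg1 F1) (anchor1 rg2 F2).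
  rewrite -e => hn [e1|[e1 n1]] [e2|[e2 n2]].
  - by rewrite e1 e2 eqxx in hn.
  - by rewrite e1 (negbTE n2) eqxx e2.
  - by rewrite e2 (negbTE n1) eqxx e1.
  - by rewrite e1 e2 eqxx in hn.
have eL i t : line A2 B2 i t = line A1 B1 i (1 - t).
  by have [h1 h2] := eA i; rewrite /line h1 h2; ring.
wlog hle : a1 a2 ha1 ha2 cov {ex ey} / 1 - a2 <= a1.
  move=> hw; case: (lerP (1 - a2) a1) => h; first exact: hw h.
  (* The two centers exchanged, with parameters measured from the other end. *)
  apply: (hw (1 - a2) (1 - a1)); [lra|lra| |lra].
  move=> i hi; rewrite eL; have -> : 1 - (1 - a1) = a1 by ring.
  by case: (cov i hi); rewrite ?eL; [right|left].
exists a1, a2; split=> //; first exact: mk.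
  move=> i hi hBA; case: (cov i hi) => //; rewrite eL /line; nra.
move=> i hi; have [-> ->] := eA i => hBA; rewrite eL.
by case: (cov i hi); rewrite ?eL // /line; nra.
Qed.

Lemma final_min l x y : on [:: c1] x -> on [:: c2] y -> covers l x y -> lam <= l.
Proof.
move=> hx hy hc; have l0 := covers_ge0 hx hy hc.
have [t1 [t2 [h1 h2 hcov hD1 hD2]]] := ordered_pair hx hy hc.
have hB1 i : (i < n)%N -> B1 i < A1 i -> B1 i <= l.
  by move=> hi hBA; have := hD1 i hi hBA; rewrite /line; nra.
have hB2 i : (i < n)%N -> B2 i < A2 i -> B2 i <= l.
  by move=> hi hBA; have := hD2 i hi hBA; rewrite /line; nra.
case: lam_arg => [-> //|[i hi [[h ->]|[h ->]|[h h' ->]]]]; [exact: hB1|exact: hB2|].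
rewrite ge_min; case: (hcov i hi); rewrite ?(fpt_along rg1 F1) ?(fpt_along rg2 F2) => hl.
  by apply/orP; left; apply/(q1P hi h l0 hB1); exists t1.
by apply/orP; right; apply/(q2P hi h' l0 hB2); exists t2.
Qed.

End TwoEdges.
End Search.

(** * Splitting the tree at a separating edge *)

Section Separation.
Variables (R : realFieldType) (I : instance R).
Hypothesis I_ok : instance_ok I.
Local Notation N := (size_t I).
Local Notation n := (npt I).
Local Notation anc := (anc (par I)).
Local Notation dir := (dir (par I)).
Local Notation region := (region N (par I)).
Local Notation cut := (cut (par I)).
Local Notation cut_root := (cut_root (par I)).
Local Open Scope ring_scope.
Let parP := par_ok I_ok.
Let par_lt x : (0 < x -> par I x < x)%N. Proof. exact: (proj2 parP). Qed.

Definition edges : seq nat := iota 1 N.-1.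

Lemma mem_edges c : (c \in edges) = (0 < c < N)%N.
Proof. by rewrite mem_iota; have := size_gt1 I_ok; lia. Qed.

Lemma region_edges_all : region 0 edges.
Proof.
have hN := size_gt1 I_ok; split.
- by move=> c; rewrite mem_edges.
- exact: iota_ltn_sorted.
- move=> c; rewrite inE !mem_edges => /andP[h1 h2]; have := par_lt h1.
  by case: eqP => //= /eqP; lia.
- exists 1%N => c; rewrite mem_edges => /andP[h1 h2].
  have [e [k1 k2 k3]] := child_ex parP (anc0 parP c) (lt0n_neq0 h1).
  rewrite (dir_down parP k1 k2 k3); have := anc_le parP k3.
  case: (ltnP 1 e) => he hle; last by lia.
  by have := root_leaf I_ok (x := e); rewrite k2 he => /(_ ltac:(lia)).
- by apply/eqP => e; have := mem_edges 1; rewrite e hN.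
Qed.

(* At every boundary vertex b of the region, one of the two centers lies on the
   side of the region, unless a vertex of the region serves all points. *)
Definition confined (rho : nat) (E : seq nat) : Prop :=
  forall lam (x y : nat * R), on edges x -> on edges y -> covers I lam x y ->
  (exists2 z, z \in rho :: E & forall i, (i < n)%N -> fvert I i z <= lam) \/
  forall f, f \in edges -> f \notin E -> exists b d,
    [/\ forall e, e \in E -> dir b e = d, dir b f != d & dir b x.1 = d \/ dir b y.1 = d].

Lemma confined_all : confined 0 edges.
Proof. by move=> lam x y _ _ _; right=> f ->. Qed.

Lemma edges_pos (x : nat * R) : on edges x -> (0 < x.1)%N.
Proof. by move=> []; rewrite mem_edges => /andP[]. Qed.

(** From [lamv] on, v serves all points. Below it, the point attaining [lamv] is served only in the
    direction d in which it is drawn from v, so at the new boundary vertex v some center lies on the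
    side of the piece. *)
Lemma confined_cut rho E v lamv up d : region rho E -> v \in rho :: E ->
  votes I E up v lamv d -> (forall i, (i < n)%N -> 2 * mass I v up i <= total_mass I i) ->
  confined rho E -> confined (cut_root v d rho) (cut v d E).
Proof.
move=> rg hv V hup hE lam x y hx hy hc; have h0 := covers_ge0 I_ok hx hy hc.
have hself := cut_self parP rg hv (votes_dir V).
case: (lerP lamv lam) => hlt.
  by left; exists v => // i hi; apply: le_trans hlt; apply: (votes_max V) => //; apply: hup.
have [e|[i [hi hf _ hd]]] := votes_arg V; first by lra.
have serve z : on edges z -> fpt I i z <= lam -> dir v z.1 = d.
  move=> hz hle; apply/eqP/negPn/negP => hne.
  suff : fvert I i v <= fpt I i z by lra.
  rewrite (fpt_edge hz); apply: fpt_minority (hd _ hne) => //; first exact: edges_pos.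
  by case: hz.
case: (hE lam x y hx hy hc) => [[z hz hzi]|hsep].
  left; exists z => //; have hfz : fvert I i z < fvert I i v by have := hzi i hi; lra.
  apply: (cut_vertex parP rg hv (votes_dir V) hz).
  apply/eqP/negPn/negP => hne; suff : fvert I i v <= fvert I i z by lra.
  by apply: fvert_minority => //; rewrite (hd _ hne) orbT.
right=> f hf'; rewrite mem_filter negb_and; case: (boolP (f \in E)) => hfE; last first.
  move=> _; have [b [d' [h1 h2 h3]]] := hsep f hf' hfE.
  by exists b, d'; split=> // e; rewrite mem_filter => /andP[_ /h1].
rewrite orbF => hne; exists v, d; split=> //.
  by move=> e; rewrite mem_filter => /andP[/eqP].
by case: (hc i hi) => h; [left|right]; apply: serve.
Qed.

Section Split.
Variables (rho c : nat).
Hypotheses (rg : region rho [:: c]).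
Let hc : (0 < c < N)%N. Proof. exact: (region1_pos rg). Qed.
Let p := par I c.
Let E1 := cut c p edges.
Let E2 := cut p c edges.
Let c_pos : (0 < c)%N. Proof. by case/andP: hc. Qed.
Let pc : (p < c)%N. Proof. exact: par_lt. Qed.
Let dcc : dir c c = p. Proof. exact: dir_self. Qed.
Let dpc : dir p c = c. Proof. exact: dir_child. Qed.

Lemma below_dir f : dir p f = c -> anc c f.
Proof.
case: (dirP parP p f) => [e _ _ h _ _ <- //|_ e].
by have := par_le parP p; have := pc; lia.
Qed.

Lemma not_above_dir f : dir c f != p -> [/\ anc c f, f != c & dir p f = c].
Proof.
case: (dirP parP c f) => [e h1 h2 h3 h4 h5 _|_]; last by rewrite eqxx.
by split=> //; apply: dir_down.
Qed.

(** E1 and E2 together contain all edges. Confinement at the two ends of c puts a center in E1 and a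
    center in E2; if it is the same center for both, the other one takes the side it happens to be
    on. *)
Lemma confined_suffice : confined rho [:: c] -> suffice I E1 E2.
Proof.
move=> hconf E lam x y hE hx0 hy0 hcov.
have hEe (z : nat * R) : on E z -> on edges z by move=> [/hE h1 h2]; split=> //; rewrite mem_edges.
have hx := hEe _ hx0; have hy := hEe _ hy0.
have in1 z (s : R) : z \in edges -> 0 <= s <= 1 -> dir c z = p -> on E1 (z, s).
  by move=> h1 h2 h3; split=> //=; rewrite mem_filter h3 eqxx.
have in2 z (s : R) : z \in edges -> 0 <= s <= 1 -> dir p z = c -> on E2 (z, s).
  by move=> h1 h2 h3; split=> //=; rewrite mem_filter h3 eqxx.
have hce : c \in edges by rewrite mem_edges.
case: (hconf lam x y hx hy hcov) => [[z hz hzi]|hsep].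
  have [s hs hzs] : exists2 s, (0 : R) <= s <= 1 & forall i, fpt I i (c, s) = fvert I i z.
    move: hz; rewrite !inE (region1_root I_ok rg) => /orP[|] /eqP ->.
      by exists 0; [rewrite lexx ler01|move=> i; rewrite /fpt /=; ring].
    by exists 1; [rewrite ler01 lexx|move=> i; rewrite /fpt /=; ring].
  exists (c, s), (c, s); split; [exact: in1|exact: in2|].
  by move=> i hi; left; rewrite hzs hzi.
have one1 : dir c x.1 = p \/ dir c y.1 = p.
  case: (eqVneq (dir c x.1) p) => [|hne]; first by left.
  have [h1 h2 _] := not_above_dir hne.
  have [f [f0 fp hf]] := child_ex parP h1 h2.
  have fc : f != c by have := par_lt f0; rewrite fp => /ltn_eqF; rewrite eq_sym => ->.
  have fe : f \in edges.
    by rewrite mem_edges f0 /=; have := anc_le parP hf; case: hx => +_; rewrite mem_edges; lia.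
  have [b [d [k1 k2 k3]]] := hsep f fe ltac:(by rewrite inE).
  (* As f hangs from c, the edges c and f are seen in the same direction from every vertex but c. *)
  have bc : b = c.
    apply/eqP/negPn/negP => hbc; move: k2; rewrite -dir_par_edge // fp 1?eq_sym //.
    by rewrite k1 ?mem_head ?eqxx.
  by move: k1 k3 => /(_ c (mem_head _ _)); rewrite bc dcc => <-.
have one2 : dir p x.1 = c \/ dir p y.1 = c.
  case: (eqVneq (dir p x.1) c) => [|hne]; first by left.
  have [f [fe fc hf]] : exists f, [/\ f \in edges, f != c & f = p \/ par I f = p].
    case: (dirP parP p x.1) hne => [f h1 h2 h3 h4 h5 h6|h _].
      exists f; split=> //; last by right.
      by rewrite mem_edges h1 /=; have := anc_le parP h3; case: hx => +_; rewrite mem_edges; lia.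
    exists p; split; [rewrite mem_edges|by rewrite ltn_eqF|by left].
    have := pc; case/andP: hc => _ hcN hpc; rewrite (ltn_trans hpc hcN) andbT.
    case: (posnP p) => // p0; move: h; rewrite p0 anc0 //= => /eqP x0.
    by have := edges_pos hx; rewrite x0.
  have [b [d [k1 k2 k3]]] := hsep f fe ltac:(by rewrite inE).
  have hcd := k1 c (mem_head _ _).
  have bp : b = p.
    apply/eqP/negPn/negP => hbp; have e1 : dir b p = d.
      by rewrite -hcd dir_par_edge // eq_sym.
    case: hf => [ef|ef]; first by rewrite ef e1 eqxx in k2.
    move: k2; rewrite -dir_par_edge // ?ef ?e1 ?eqxx // 1?eq_sym //.
    by move: fe; rewrite mem_edges => /andP[].
  by move: hcd k3; rewrite bp dpc => <-.
have cases z : z \in edges -> dir c z = p \/ dir p z = c.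
  by move=> _; case: (eqVneq (dir c z) p) => [|/not_above_dir[]]; [left|right].
have [hx1 hxs] := hx; have [hy1 hys] := hy.
have hcov' : covers I lam y x by move=> i /hcov[]; [right|left].
have fin1 : dir c x.1 = p -> dir p y.1 = c ->
  exists x' y', [/\ on E1 x', on E2 y' & covers I lam x' y'].
  move=> k1 k2; exists x, y; split=> //; [rewrite (fpt_edge hx)|rewrite (fpt_edge hy)];
    [exact: in1|exact: in2].
have fin2 : dir c y.1 = p -> dir p x.1 = c ->
  exists x' y', [/\ on E1 x', on E2 y' & covers I lam x' y'].
  move=> k1 k2; exists y, x; split=> //; [rewrite (fpt_edge hy)|rewrite (fpt_edge hx)];
    [exact: in1|exact: in2].
case: one1 => k1; case: one2 => k2; [|exact: fin1|exact: fin2|].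
  by case: (cases _ hy1) => k3; [exact: fin2|exact: fin1].
by case: (cases _ hx1) => k3; [exact: fin1|exact: fin2].
Qed.

Lemma split_dir1 : exists2 e, e \in edges & dir c e = p.
Proof. by exists c; rewrite ?mem_edges. Qed.

Lemma split_dir2 : exists2 e, e \in edges & dir p e = c.
Proof. by exists c; rewrite ?mem_edges. Qed.

Lemma split_mem1 : c \in 0%N :: edges.
Proof. by rewrite inE mem_edges hc orbT. Qed.

Lemma split_mem2 : p \in 0%N :: edges.
Proof. by rewrite inE mem_edges; case: eqP => //= /eqP; case/andP: hc; have := pc; lia. Qed.

(** The edge c belongs to both sides, so the upper side reaches down to the vertex c and the lower
    one up to p; the two anchors are the opposite ends of c. *)
Lemma split_faces1 : faces I (cut_root c p 0) E1 c E2.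
Proof.
split.
- exact: cut_self region_edges_all split_mem1 split_dir1.
- by exists p => e; rewrite mem_filter => /andP[/eqP].
- move=> v e hv hvc; rewrite mem_filter => /andP[/eqP /below_dir he _].
  have hdv := cut_vertex_dir parP region_edges_all split_mem1 split_dir1 hv hvc.
  case: (eqVneq e c) => [-> //|hec]; apply: dir_through => //; rewrite hdv.
  have [f [f0 fp hf]] := child_ex parP he hec.
  rewrite (dir_down parP f0 fp hf) ltn_eqF //; apply: leq_trans pc _.
  by have := par_lt f0; rewrite fp => /ltnW.
- move=> e' e; rewrite !mem_filter => /andP[_ ->]; rewrite andbT => hne /andP[/eqP -> _].
  exact: hne.
Qed.

Lemma split_faces2 : faces I (cut_root p c 0) E2 p E1.
Proof.
split.
- exact: cut_self region_edges_all split_mem2 split_dir2.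
- by exists c => e; rewrite mem_filter => /andP[/eqP].
- move=> v e hv hvp; rewrite mem_filter => /andP[/eqP he _].
  have hdv := cut_vertex_dir parP region_edges_all split_mem2 split_dir2 hv hvp.
  case: (eqVneq (dir p e) c) => hpe; last by apply: dir_through => //; rewrite hdv eq_sym.
  suff -> : e = c by rewrite -dir_par_edge // eq_sym.
  apply/eqP/negPn/negP => hec; have [f [f0 fp hf]] := child_ex parP (below_dir hpe) hec.
  move: he; rewrite (dir_down parP f0 fp hf) => e1.
  by have := par_lt f0; rewrite fp e1; have := pc; lia.
- move=> e' e; rewrite !mem_filter => /andP[_ ->]; rewrite andbT => hne /andP[/eqP -> _].
  exact: hne.
Qed.

End Split.
End Separation.

(** * Upper envelopes of descending lines *)

Section Hull.
Variables (R : realFieldType) (A B : nat -> R).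
Local Open Scope ring_scope.
Local Notation line := (line A B).
Local Notation slope k := (B k - A k).

(* The upper envelope on [0, oo) of the lines h 0, ..., h (L - 1), where
   h t is on top from st t on. *)
Record hull (L : nat) (h : nat -> nat) (st : nat -> R) : Prop := Hull {
  hull_st0 : (0 < L)%N -> st 0%N = 0;
  hull_desc : forall t, (t < L)%N -> slope (h t) < 0;
  hull_step : forall t, (t.+1 < L)%N -> [/\ slope (h t) < slope (h t.+1), st t < st t.+1 &
    line (h t) (st t.+1) = line (h t.+1) (st t.+1)] }.

Definition dominated L (h : nat -> nat) k := forall s, 0 <= s -> exists2 t, (t < L)%N & line k s <= line (h t) s.

Lemma line_le k k' s0 s : slope k <= slope k' -> line k s0 <= line k' s0 -> s0 <= s ->
  line k s <= line k' s.
Proof. by rewrite /line; nra. Qed.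

Lemma line_ge k k' s0 s : slope k <= slope k' -> line k' s0 <= line k s0 -> s <= s0 ->
  line k' s <= line k s.
Proof. by rewrite /line; nra. Qed.

Variables (L : nat) (h : nat -> nat) (st : nat -> R).
Hypothesis H : hull L h st.

Lemma hull_st_le t u : (t <= u < L)%N -> st t <= st u.
Proof.
elim: u => [|u IH]; first by rewrite leqn0 => /andP[/eqP ->].
rewrite leq_eqVlt => /andP[/orP[/eqP ->//|htu] hu].
have [_ h2 _] := hull_step H hu; apply: le_trans (ltW h2); apply: IH; lia.
Qed.

Lemma hull_above t u s : (t <= u < L)%N -> st u <= s -> line (h t) s <= line (h u) s.
Proof.
elim: u => [|u IH]; first by rewrite leqn0 => /andP[/eqP ->].
rewrite leq_eqVlt => /andP[/orP[/eqP ->//|htu] hu] hs.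
have [h1 h2 h3] := hull_step H hu; apply: (@le_trans _ _ (line (h u) s)).
  by apply: IH; [lia|apply: le_trans (ltW h2) hs].
by apply: (line_le (ltW h1) _ hs); rewrite h3.
Qed.

Lemma hull_below t u s : (t <= u < L)%N -> ((t.+1 < L)%N -> s <= st t.+1) -> line (h u) s <= line (h t) s.
Proof.
elim: u => [|u IH]; first by rewrite leqn0 => /andP[/eqP ->].
rewrite leq_eqVlt => /andP[/orP[/eqP ->//|htu] hu] hs.
have [h1 h2 h3] := hull_step H hu; apply: (@le_trans _ _ (line (h u) s)); last by apply: IH hs; lia.
apply: (line_ge (ltW h1) _ (s0 := st u.+1)); rewrite ?h3 //.
apply: le_trans (hs _) _; first by lia.
by apply: hull_st_le; lia.
Qed.

Lemma hull_max t s k : (t < L)%N -> 0 <= s -> st t <= s -> ((t.+1 < L)%N -> s <= st t.+1) ->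
  dominated L h k -> line k s <= line (h t) s.
Proof.
move=> ht h0 hs hs' /(_ _ h0) [u hu hk]; apply: le_trans hk _.
case: (leqP u t) => hut; first by apply: hull_above hs; lia.
by apply: hull_below hs'; lia.
Qed.

Lemma hull_ge0 t : (t < L)%N -> 0 <= st t.
Proof. by move=> ht; rewrite -(hull_st0 H ltac:(lia)); apply: hull_st_le. Qed.

End Hull.

Section Push.
Variables (R : realFieldType) (A B : nat -> R).
Local Open Scope ring_scope.
Local Notation line := (line A B).
Local Notation slope k := (B k - A k).

Lemma hull_pop L h st : hull A B L.+1 h st -> hull A B L h st.
Proof.
move=> H; split.
- by move=> h0; apply: (hull_st0 H).
- by move=> t ht; apply: (hull_desc H); lia.
- by move=> t ht; apply: (hull_step H); lia.
Qed.

(** The line [h L] is on top only from [st L] on; there x is at least as high and descends no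
    faster. Before [st L] the previous line is above [h L]. *)
Lemma dominated_pop L h st x k : hull A B L.+1 h st ->
  slope (h L) <= slope x -> line (h L) (st L) <= line x (st L) ->
  (forall s, 0 <= s -> (exists2 t, (t < L.+1)%N & line k s <= line (h t) s) \/ line k s <= line x s) ->
  forall s, 0 <= s -> (exists2 t, (t < L)%N & line k s <= line (h t) s) \/ line k s <= line x s.
Proof.
move=> H hs hl hk s h0; case: (hk s h0) => [[t ht h1]|]; last by right.
case: (ltnP t L) => htL; first by left; exists t.
have et : t = L by lia.
subst t; case: (lerP (st L) s) => hsL.
  by right; apply: le_trans h1 _; apply: (line_le hs hl hsL).
case: L H {ht htL} hs hl h1 hsL hk => [|L] H hs hl h1 hsL hk.
  by move: hsL; rewrite (hull_st0 H) //; lra.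
left; exists L => //; apply: le_trans h1 _.
by apply: (hull_below H); [lia|move=> _; apply: ltW].
Qed.

Lemma hull_push L h st x s' : hull A B L h st -> slope x < 0 ->
  (if L == 0%N then s' = 0 else [/\ slope (h L.-1) < slope x, st L.-1 < s' & line (h L.-1) s' = line x s']) ->
  hull A B L.+1 (fun t => if t == L then x else h t) (fun t => if t == L then s' else st t).
Proof.
move=> H hx hc; split.
- by rewrite eq_sym; case: eqP hc => [->//|/eqP e _ _]; apply: (hull_st0 H); lia.
- by move=> t ht; case: eqP => [_//|hne]; apply: (hull_desc H); lia.
- move=> t ht; rewrite (_ : (t == L) = false); last by lia.
  case: eqP => [e|hne]; last by apply: (hull_step H); lia.
  by move: hc; rewrite -e.
Qed.

Lemma dominated_push L h x k :
  (forall s, 0 <= s -> (exists2 t, (t < L)%N & line k s <= line (h t) s) \/ line k s <= line x s) ->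
  dominated A B L.+1 (fun t => if t == L then x else h t) k.
Proof.
move=> hk s /hk [[t ht h1]|h1]; last by exists L; rewrite ?eqxx.
by exists t; [lia|rewrite (_ : (t == L) = false) //; lia].
Qed.

(* A new line of the slope of the last one that is below it at st (L - 1) is
   below it everywhere. *)
Lemma dominated_skip L h st x k : slope x <= slope (h L) -> slope (h L) <= slope x ->
  line x (st L) <= line (h L) (st L) ->
  (forall s, 0 <= s -> (exists2 t, (t < L.+1)%N & line k s <= line (h t) s) \/ line k s <= line x s) ->
  dominated A B L.+1 h k.
Proof.
move=> h1 h2 hx hk s /hk [//|h3]; exists L => //; apply: le_trans h3 _.
have e : slope x = slope (h L) by lra.
by move: hx; rewrite /line e; lra.
Qed.

End Push.

(** * Crossings of a line with the envelope *)

Section Crossing.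
Variables (R : realFieldType) (I : instance R) (A B : nat -> R).
Local Open Scope ring_scope.
Local Notation n := (npt I).
Local Notation line := (line A B).

(** Before s' the descending line k is at least q, after it the line i is. So s' is the best
    parameter, or 1 if s' is off the edge: descending lines are then at most lam because their far
    ends are, which is why the envelope may be taken on all of [0, oo). *)
Lemma crossing_at q i k s' : A i <= B i -> (k < n)%N -> B k < A k -> 0 <= s' ->
  line k s' = q -> line i s' = q ->
  (forall k', (k' < n)%N -> B k' < A k' -> line k' s' <= q) -> crossing I A B q i.
Proof.
move=> hi hk hBA h0 hkq hiq hmax lam hlam hB; split=> [hq|[s [/andP[s0 s1] hd hl]]].
  case: (lerP s' 1) => h1.
    exists s'; rewrite h0 h1 hiq; split=> // k' hk' h; exact: le_trans (hmax k' hk' h) hq.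
  exists 1; rewrite ler01 lexx; split=> // [k' hk' h|].
    by have := hB k' hk' h; rewrite /line; lra.
  by have := hq; rewrite -hiq /line; nra.
have := hd k hk hBA; case: (lerP s s') => h; first by rewrite -hkq /line; nra.
by move=> _; rewrite -hiq; apply: le_trans hl; rewrite /line; nra.
Qed.

Lemma crossing_near i : A i <= B i ->
  (forall k, (k < n)%N -> B k < A k -> A k <= A i) -> crossing I A B (A i) i.
Proof.
move=> hi hmax lam hlam hB; split=> [hq|[s [/andP[s0 s1] hd]]].
  exists 0; rewrite lexx ler01; split=> // [k hk h|].
    by rewrite /line; have := hmax k hk h; lra.
  by rewrite /line; lra.
by rewrite /line; nra.
Qed.

(** The two inequalities place the crossing of the line i with [h t] in the interval on which [h t]
    is the envelope. *)
Lemma crossing_far L h st i t : hull A B L h st -> (forall t, (t < L)%N -> (h t < n)%N) ->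
  (forall k, (k < n)%N -> B k < A k -> dominated A B L h k) ->
  A i <= B i -> (t < L)%N -> line i (st t) <= line (h t) (st t) ->
  ((t.+1 < L)%N -> line (h t.+1) (st t.+1) < line i (st t.+1)) ->
  crossing I A B (line i ((A (h t) - A i) / ((B i - A i) - (B (h t) - A (h t))))) i.
Proof.
move=> H hn hdom hi ht h1 h2; set s' := _ / _; have hd := hull_desc H ht.
have hpos : 0 < (B i - A i) - (B (h t) - A (h t)) by lra.
have hcr : line (h t) s' = line i s'.
  by rewrite /line /s'; field; exact: lt0r_neq0.
have hst : st t <= s'.
  by rewrite /s' ler_pdivlMr //; move: h1; rewrite /line; nra.
have hst' : (t.+1 < L)%N -> s' <= st t.+1.
  move=> hL; have [_ _ e] := hull_step H hL; have := h2 hL; rewrite -e.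
  by rewrite /s' ler_pdivrMr // /line; nra.
have s0 : 0 <= s' by apply: le_trans (hull_ge0 H ht) hst.
apply: (@crossing_at _ _ (h t) s') => //; [exact: hn|lra|].
move=> k hk hBA; rewrite -hcr; apply: (hull_max H) => //; exact: hdom.
Qed.

End Crossing.

(** * Distances on the given tree *)

(* A rooting numbers the vertices by positions in such a way that the parent
   array [parp] on positions is ordered; [ech k] is the lower end of edge k. *)
Record rooting (R : realType) (T : wgraph R) (pos : 'I_(nv T) -> nat)
    (ech : 'I_(ne T) -> nat) (parp : nat -> nat) : Prop := Rooting {
  rt_par : parent_array parp;
  rt_lt : forall v, pos v < nv T;
  rt_surj : forall r, r < nv T -> exists v, pos v = r;
  rt_einj : injective ech;
  rt_elt : forall k, 0 < ech k < nv T;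
  rt_esurj : forall r, 0 < r < nv T -> exists k, ech k = r;
  rt_edge : forall k, pos (src k) = parp (ech k) /\ pos (dst k) = ech k \/
    pos (dst k) = parp (ech k) /\ pos (src k) = ech k }.

Section CutMetric.
Variables (R : realType) (T : wgraph R).
Variables (pos : 'I_(nv T) -> nat) (ech : 'I_(ne T) -> nat) (parp : nat -> nat).
Local Notation anc := (anc parp).
Local Open Scope ring_scope.

(** In a rooting [ech] is injective, so at most one term occurs: the sum is the length of the edge
    above r, and 0 for the root, without choosing an inverse of [ech]. *)
Definition elen r : R := \sum_(k | ech k == r) len (w := T) k.

(* A point is given by a position r and an offset from the parent of r. *)
Definition coord (p : tpoint T) : nat * R :=
  match p with
  | Vertex v => (pos v, elen (pos v))
  | OnEdge k t => (ech k, if pos (src k) == parp (ech k) then t else len k - t)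
  end.

(* The projection of a point on the edge above q. *)
Definition proj q (x : nat * R) : R := if q == x.1 then x.2 else elen q * (anc q x.1)%:R.
(** The isometric embedding of a tree in l1: an edge contributes the part of it between the
    projections of the two points. *)
Definition cdist x y : R := \sum_(q < nv T) `|proj q x - proj q y|.

Hypothesis rt : rooting pos ech parp.
Hypothesis T_tree : is_tree T.
Hypothesis len_gt0 : forall k : 'I_(ne T), 0 < len k.
Let parP := rt_par rt.

Lemma elen_ech k : elen (ech k) = len k.
Proof. by rewrite /elen (big_pred1 k) // => j; rewrite inj_eq //; apply: rt_einj rt. Qed.

Lemma elen_ge0 q : 0 <= elen q.
Proof. by apply: sumr_ge0 => k _; apply: ltW. Qed.

Lemma elen0 : elen 0%N = 0.
Proof. by apply: big1 => k /eqP e; have := rt_elt rt k; rewrite e. Qed.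

Lemma ech_par_neq k : parp (ech k) != ech k.
Proof. by rewrite neq_ltn (proj2 parP) //; case/andP: (rt_elt rt k). Qed.

Lemma joins_pos k u v : joins k u v ->
  pos u = parp (ech k) /\ pos v = ech k \/ pos v = parp (ech k) /\ pos u = ech k.
Proof.
by case/orP => /andP[/eqP <- /eqP <-]; case: (rt_edge rt k) => -[-> ->]; [left|right|right|left].
Qed.

Lemma joins_ends k a b x y : joins (T := T) k a b -> joins k x y -> (a == x) || (a == y).
Proof.
by case/orP => /andP[/eqP h1 /eqP h2] /orP[] /andP[/eqP h3 /eqP h4]; subst; rewrite eqxx ?orbT.
Qed.

Lemma anc_cross k u v q : joins k u v -> anc q (pos u) (+) anc q (pos v) = (q == ech k).
Proof.
have main : anc q (parp (ech k)) (+) anc q (ech k) = (q == ech k).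
  case: (eqVneq q (ech k)) => [->|h]; last by rewrite -anc_par ?addbb.
  by rewrite ancxx // anc_parF //; case/andP: (rt_elt rt k).
by case/joins_pos => -[-> ->]; rewrite // addbC.
Qed.

Lemma avoid_anc k u s : path (adj (T := T)) u s ->
  all (fun uv => ~~ joins k uv.1 uv.2) (steps u s) ->
  anc (ech k) (pos u) = anc (ech k) (pos (last u s)).
Proof.
elim: s u => //= y s IH u /andP[/existsP[k' hk'] hp] /andP[hj ha].
rewrite -(IH _ hp ha); apply/eqP/negPn; rewrite negb_eqb (anc_cross _ hk').
by apply: contra hj => /eqP /(rt_einj rt) ->.
Qed.

Lemma notin_avoid k u0 y0 u s : joins (T := T) k u0 y0 -> u0 \notin u :: s ->
  all (fun uv => ~~ joins k uv.1 uv.2) (steps u s).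
Proof.
move=> hj; elim: s u => //= y s IH u hn.
have /and3P[h1 h2 h3] : [&& u0 != u, u0 != y & u0 \notin s] by move: hn; rewrite !inE !negb_or.
rewrite IH ?andbT; last by rewrite inE negb_or h2.
apply/negP => /(joins_ends hj).
by rewrite (negbTE h1) (negbTE h2).
Qed.

(** Once a simple path has crossed k it has left one end of k for good, so it cannot cross k back
    and would end on the other side. *)
Lemma same_side_avoids k u s : path (adj (T := T)) u s -> uniq (u :: s) ->
  anc (ech k) (pos u) = anc (ech k) (pos (last u s)) ->
  all (fun uv => ~~ joins k uv.1 uv.2) (steps u s).
Proof.
elim: s u => //= y s IH u /andP[/existsP[k' hk'] hp] /andP[hu huniq] e.
case: (boolP (joins k u y)) => hj /=.
  have := avoid_anc hp (notin_avoid hj hu); rewrite -e => h.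
  by have := anc_cross (ech k) hj; rewrite h addbb eqxx.
apply: IH => //; rewrite -e; apply/eqP/negPn; rewrite negb_eqb addbC (anc_cross _ hk').
by apply: contra hj => /eqP /(rt_einj rt) ->.
Qed.

Lemma walk_lenE u s : path (adj (T := T)) u s -> uniq (u :: s) ->
  walk_len u s = \sum_(q < nv T) elen q * (anc q (pos u) (+) anc q (pos (last u s)))%:R.
Proof.
elim: s u => /= [|y s IH] u.
  by rewrite /walk_len /= big_nil => _ _; rewrite big1 // => q _; rewrite addbb mulr0.
move=> /andP[/existsP[k hk] hp] /andP[hu huniq].
have [_ [_ hsimple] _ _] := T_tree.
rewrite /walk_len big_cons -/(walk_len y s) IH //=.
rewrite (big_pred1 k) => [|j]; last by apply/idP/eqP => [hj|-> //]; apply: hsimple hj hk.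
have /andP[_ hkn] := rt_elt rt k.
rewrite (bigD1 (Ordinal hkn)) //= [in RHS](bigD1 (Ordinal hkn)) //=.
have e1 := avoid_anc hp (notin_avoid hk hu); have e2 := anc_cross (ech k) hk.
rewrite -e1 addbb mulr0 add0r e2 eqxx mulr1 elen_ech; congr (_ + _).
apply: eq_bigr => q hq; congr (_ * _%:R); congr (nat_of_bool (_ (+) _)).
apply/eqP/negPn; rewrite negb_eqb addbC (anc_cross _ hk).
by apply: contra hq => /eqP e; apply/eqP/val_inj.
Qed.

(* The contribution of the edge holding p to a path leaving p at the exit a
   towards a vertex on the same side of that edge. *)
Lemma exit_proj p (a : 'I_(nv T)) (x : R) q (b : bool) : on_tree p -> (a, x) \in exits p ->
  (if p is OnEdge k _ then anc (ech k) (pos a) == b else true) ->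
  proj q (coord p) = if (if p is OnEdge k _ then q == ech k else false)
    then (if b then elen q - x else x) else elen q * (anc q (pos a))%:R.
Proof.
case: p => [v _|k t]; rewrite /exits.
  rewrite inE => /eqP[-> _] _; rewrite /proj /=; case: eqP => // ->.
  by rewrite ancxx ?mulr1.
rewrite /= => /andP[ht0 ht1]; rewrite !inE /proj /= => ha hb.
have hka : ech k == parp (ech k) = false by rewrite eq_sym; apply/negbTE/ech_par_neq.
have hc : (0 < ech k)%N by case/andP: (rt_elt rt k).
case: (eqVneq q (ech k)) => [->|hq]; last first.
  congr (_ * (nat_of_bool _)%:R).
  have hr : joins k (src k) (dst k) by rewrite /joins !eqxx.
  have hs : anc q (pos (src k)) = anc q (ech k) /\ anc q (pos (dst k)) = anc q (ech k).
    have := anc_par parP hq; case: (rt_edge rt k) => -[-> ->] ->; by split.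
  by case/orP: ha => /eqP[-> _]; case: hs.
rewrite elen_ech; case/orP: ha => /eqP[ea ->]; move: hb; rewrite ea.
  case: (rt_edge rt k) => -[e1 e2]; first by rewrite e1 eqxx anc_parF // => /eqP <-.
  by rewrite e2 ancxx // hka => /eqP <-.
case: (rt_edge rt k) => -[e1 e2]; first by rewrite e2 ancxx // e1 eqxx => /eqP <-; ring.
by rewrite e1 anc_parF // e2 hka => /eqP <-.
Qed.

Lemma exit_bounds p a x : on_tree p -> (a, x) \in exits p ->
  0 <= x /\ (if p is OnEdge k _ then x <= len (w := T) k else x = 0).
Proof.
case: p => [v _|k t /andP[h0 h1]]; rewrite !inE.
  by move=> /eqP[_ ->].
by case/orP => /eqP[_ ->]; split; lra.
Qed.

(** Spreads the length travelled to an exit over all edges, so that [simple_path_cdist] can be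
    verified one edge at a time. *)
Lemma sum_edge_of p a x : on_tree p -> (a, x) \in exits p ->
  \sum_(q < nv T) (if p is OnEdge k _ then ((q : nat) == ech k)%:R * x else 0) = x.
Proof.
case: p => [v|k t] ho hx.
  by rewrite big1 //; have [_ ->] := exit_bounds ho hx.
have /andP[_ hk] := rt_elt rt k; rewrite (bigD1 (Ordinal hk)) //= eqxx mul1r big1 ?addr0 //.
move=> q hq; suff -> : (q : nat) == ech k = false by rewrite mul0r.
by apply: contraNF hq => /eqP e; apply/eqP/val_inj.
Qed.

Lemma simple_path_cdist p q l : on_tree p -> on_tree q ->
  simple_path_length p q l -> l = cdist (coord p) (coord q).
Proof.
move=> hp hq; rewrite /simple_path_length; case: ifP => hs.
  case: p q hp hq hs => [//|k t] [//|k' t'] _ _ /= /eqP <- ->.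
  have /andP[_ hk] := rt_elt rt k; rewrite /cdist (bigD1 (Ordinal hk)) //= big1 ?addr0.
    rewrite /proj /= eqxx; case: ifP => _ //.
    by rewrite -[LHS]normrN; congr `|_|; ring.
  move=> i hi; rewrite /proj /=; suff -> : (i : nat) == ech k = false by rewrite subrr normr0.
  by apply: contraNF hi => /eqP e; apply/eqP/val_inj.
move=> [[a x] [[b y] [s [[ha hb] [hpath hlast] huniq /andP[hap haq] ->]]]] /=.
rewrite /= in hpath hlast huniq hap haq.
rewrite walk_lenE // hlast.
rewrite -[in LHS](sum_edge_of hp ha) -[in LHS](sum_edge_of hq hb) -!big_split /=.
apply: eq_bigr => i _.
have [x0 xl] := exit_bounds hp ha; have [y0 yl] := exit_bounds hq hb.
have sp : if p is OnEdge k _ then anc (ech k) (pos a) = anc (ech k) (pos b) else True.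
  by case: p hap {hp hs ha xl} => // k t /= h; rewrite -hlast; apply: avoid_anc.
have sq : if q is OnEdge k _ then anc (ech k) (pos a) = anc (ech k) (pos b) else True.
  by case: q haq {hq hs hb yl} => // k t /= h; rewrite -hlast; apply: avoid_anc.
set A := anc i (pos a); set B := anc i (pos b).
have L0 := elen_ge0 i.
case: p hp hs ha xl sp {hap} => [v|k t] hp hs ha xl sp;
  case: q hq hs hb yl sq {haq} => [w|k' t'] hq hs hb yl sq.
- rewrite (exit_proj (b := true) i hp ha) // (exit_proj (b := true) i hq hb) //.
  by rewrite -/A -/B; case: A; case: B; rewrite /= ?mulr0 ?mulr1 ?subrr ?normr0 ?subr0 ?sub0r ?normrN ?ger0_norm //; ring.
- rewrite (exit_proj (b := true) i hp ha) //.
  case: (eqVneq (i : nat) (ech k')) => e.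
    rewrite (exit_proj (b := B) i hq hb); last by rewrite /B e.
    rewrite e eqxx -e -/A; have -> : A = B by rewrite /A /B e.
    move: yl; rewrite -elen_ech -e.
    by case: B => /=; rewrite ?mulr0 ?mulr1 ?add0r ?mul1r => h; [rewrite ger0_norm; lra|rewrite ler0_norm; lra].
  rewrite (exit_proj (b := anc (ech k') (pos b)) i hq hb) // (negbTE e).
  by rewrite -/A -/B; case: A; case: B; rewrite /= ?mulr0 ?mulr1 ?mul0r ?subrr ?normr0 ?subr0 ?sub0r ?normrN ?ger0_norm //; ring.
- rewrite (exit_proj (b := true) i hq hb) //.
  case: (eqVneq (i : nat) (ech k)) => e.
    rewrite (exit_proj (b := A) i hp ha); last by rewrite /A e.
    rewrite e eqxx -e -/B; have <- : A = B by rewrite /A /B e.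
    move: xl; rewrite -elen_ech -e.
    by case: A => /=; rewrite ?mulr0 ?mulr1 ?add0r ?mul1r => h; [rewrite ler0_norm; lra|rewrite ger0_norm; lra].
  rewrite (exit_proj (b := anc (ech k) (pos a)) i hp ha) // (negbTE e).
  by rewrite -/A -/B; case: A; case: B; rewrite /= ?mulr0 ?mulr1 ?mul0r ?subrr ?normr0 ?subr0 ?sub0r ?normrN ?ger0_norm //; ring.
case: (eqVneq (i : nat) (ech k)) => e.
  have nk' : (i : nat) == ech k' = false.
    by rewrite e; apply/negbTE; apply: contraFneq hs => /(rt_einj rt) ->; apply: eqxx.
  rewrite (exit_proj (b := A) i hp ha); last by rewrite /A e.
  rewrite (exit_proj (b := anc (ech k') (pos b)) i hq hb) // nk' e eqxx -e -/B.
  have <- : A = B by rewrite /A /B e.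
  move: xl; rewrite -elen_ech -e.
  by case: A => /=; rewrite ?mulr0 ?mulr1 ?add0r ?mul1r ?mul0r ?addr0 => h; [rewrite ler0_norm; lra|rewrite ger0_norm; lra].
rewrite (exit_proj (b := anc (ech k) (pos a)) i hp ha) // (negbTE e) -/A.
case: (eqVneq (i : nat) (ech k')) => e'.
  rewrite (exit_proj (b := B) i hq hb); last by rewrite /B e'.
  rewrite e' eqxx -e'; have -> : A = B by rewrite /A /B e'.
  move: yl; rewrite -elen_ech -e'.
  by case: B => /=; rewrite ?mulr0 ?mulr1 ?add0r ?mul1r ?mul0r => h; [rewrite ger0_norm; lra|rewrite ler0_norm; lra].
rewrite (exit_proj (b := anc (ech k') (pos b)) i hq hb) // (negbTE e') -/B.
by case: A; case: B; rewrite /= ?mulr0 ?mulr1 ?mul0r ?subrr ?normr0 ?subr0 ?sub0r ?normrN ?ger0_norm //; ring.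
Qed.

Lemma exit_choice p (c : bool) : exists a x, (a, x) \in exits (T := T) p /\
  (if p is OnEdge k _ then anc (ech k) (pos a) = c else True).
Proof.
case: p => [v|k t]; first by exists v, 0; rewrite mem_head.
have hc : (0 < ech k)%N by case/andP: (rt_elt rt k).
have h1 : (src k, t) \in exits (OnEdge k t) by rewrite mem_head.
have h2 : (dst k, len k - t) \in exits (OnEdge k t) by rewrite !inE eqxx orbT.
by case: c; case: (rt_edge rt k) => -[e1 e2];
  [exists (dst k), (len k - t)|exists (src k), t|exists (src k), t|exists (dst k), (len k - t)];
  split; rewrite ?e1 ?e2 ?ancxx ?anc_parF.
Qed.

Lemma exit_anc q (b : 'I_(nv T)) (y : R) e : (b, y) \in exits q ->
  (if q is OnEdge k _ then ech k != e else true) -> anc e (pos b) = anc e (coord q).1.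
Proof.
case: q => [v|k t]; first by rewrite inE => /eqP[-> _].
rewrite !inE => hb; rewrite eq_sym => he; rewrite [RHS](anc_par parP he).
by case/orP: hb => /eqP[-> _]; case: (rt_edge rt k) => -[e1 e2]; rewrite ?e1 ?e2 // anc_par.
Qed.

(** Each point is left at the end of its edge that lies on the side of the other point. A simple
    path between these ends starts and finishes on one side of both edges, so it avoids them. *)
Lemma simple_path_ex p q : exists l, simple_path_length (T := T) p q l.
Proof.
rewrite /simple_path_length; case hs : (same_edge p q).
  by case: p q hs => [//|k t] [//|k' t'] _; exists `|t - t'|.
have [a [x [ha hpa]]] := exit_choice p (if p is OnEdge k _ then anc (ech k) (coord q).1 else true).
have [b [y [hb hqb]]] := exit_choice q (if q is OnEdge k _ then anc (ech k) (coord p).1 else true).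
have [_ _ hconn _] := T_tree.
case/connectP: (hconn a b) => s0 hs0 elast; case/shortenP: hs0 elast => s hpath huniq _ hlast.
exists (x + walk_len a s + y), (a, x), (b, y), s; split=> //=.
apply/andP; split.
  case: p hpa hqb ha hs => // k t hpa hqb ha hs; apply: same_side_avoids => //.
  rewrite hpa -hlast; apply/esym; apply: exit_anc hb _; case: q hs {hqb hpa} => //= k' t'.
  by move=> h; rewrite inj_eq ?[k' == k]eq_sym ?h //; apply: rt_einj rt.
case: q hpa hqb hb hs => // k t hpa hqb hb hs; apply: same_side_avoids => //.
rewrite -hlast hqb; apply: exit_anc ha _; case: p hs {hqb hpa} => //= k' t'.
by move=> h; rewrite inj_eq ?h //; apply: rt_einj rt.
Qed.

Lemma dist_cdist p q : on_tree p -> on_tree q -> dist p q = cdist (coord p) (coord q).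
Proof.
move=> hp hq; have [l hl] := simple_path_ex p q.
have := @xgetI _ 0 [set l | simple_path_length p q l]%classic l hl.
exact: simple_path_cdist.
Qed.

Lemma coord_lt p : ((coord p).1 < nv T)%N.
Proof. by case: p => [v|k t] /=; [apply: rt_lt rt _|case/andP: (rt_elt rt k)]. Qed.

Lemma coord_bounds p : on_tree p -> 0 <= (coord p).2 <= elen (coord p).1.
Proof.
case: p => [v|k t] /=; first by rewrite elen_ge0 lexx.
by rewrite elen_ech; case: ifP => _ /andP[h0 h1]; lra.
Qed.

End CutMetric.

(** * The subdivided tree *)

(* Nodes 1, ..., N - 1 come in chains, one for each position r: the nodes x with
   [rr x = r] lie on the edge above r at increasing offsets [oo x] and end with
   the node [nid r] of the vertex itself. Node 0 is an extra root. *)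
Record chains (R : numDomainType) (nvT : nat) (parp : nat -> nat) (elen : nat -> R)
    (N : nat) (par : nat -> nat) (rr : nat -> nat) (oo : nat -> R) (nid : nat -> nat) : Prop := Chains {
  ch_N : 1 < N;
  ch_par0 : par 0 = 0 /\ forall x, N <= x -> par x = 0;
  ch_root : rr 0 = 0 /\ oo 0 = 0%R;
  ch_rr : forall x, 0 < x < N -> rr x < nvT /\ x <= nid (rr x);
  ch_mono : forall x y, 0 < x <= y -> y < N -> rr x <= rr y;
  ch_in : forall x, 1 < x < N -> rr x.-1 = rr x -> par x = x.-1 /\ (oo x.-1 <= oo x)%R;
  ch_first : forall x, 0 < x < N -> (1 < x -> rr x.-1 <> rr x) ->
    par x = if rr x == 0 then 0 else nid (parp (rr x));
  ch_oo : forall x, 0 < x < N -> (0 <= oo x <= elen (rr x))%R;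
  ch_nid : forall r, r < nvT -> [/\ 0 < nid r < N, rr (nid r) = r & oo (nid r) = elen r] }.

Section Subdivision.
Variables (R : realType) (T : wgraph R).
Variables (pos : 'I_(nv T) -> nat) (ech : 'I_(ne T) -> nat) (parp : nat -> nat).
Hypothesis rt : rooting pos ech parp.
Hypothesis T_tree : is_tree T.
Hypothesis len_gt0 : forall k : 'I_(ne T), (0 < len k)%R.
Variables (N : nat) (par : nat -> nat) (rr : nat -> nat) (oo : nat -> R) (nid : nat -> nat).
Local Notation elen := (elen ech).
Hypothesis ch : chains (nv T) parp elen N par rr oo nid.
Local Open Scope ring_scope.
Local Notation proj := (proj ech parp).
Local Notation cdist := (cdist ech parp).
Let parpP := rt_par rt.

(* The offset at which the edge above x starts. *)
Definition below x : R := if (1 < x)%N && (rr x.-1 == rr x) then oo x.-1 else 0.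
Definition seglen x : R := if x == 0%N then 0 else oo x - below x.
Definition spot x : nat * R := (rr x, oo x).
Definition spot_on c s : nat * R := (rr c, oo c - (1 - s) * seglen c).

Let nid_gt0 r : (r < nv T)%N -> (0 < nid r < N)%N. Proof. by case/(ch_nid ch). Qed.
Let rr_nid r : (r < nv T)%N -> rr (nid r) = r. Proof. by case/(ch_nid ch). Qed.
Let nv_gt0 : (0 < nv T)%N. Proof. by case: T_tree. Qed.

Lemma chain_first_ne x : (0 < x < N)%N -> ~~ ((1 < x)%N && (rr x.-1 == rr x)) ->
  par x = if rr x == 0%N then 0%N else nid (parp (rr x)).
Proof.
by move=> hx hn; apply: (ch_first ch) => // h1 /eqP h2; move: hn; rewrite h1 h2.
Qed.

Lemma nid_lt r x : (0 < x < N)%N -> (r < rr x)%N -> (nid r < x)%N.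
Proof.
move=> hx hr; have [h1 _] := ch_rr ch hx; have hrn : (r < nv T)%N by apply: ltn_trans hr h1.
rewrite ltnNge; apply/negP => hle; have /andP[_ hn] := nid_gt0 hrn.
by have := ch_mono ch (x := x) (y := nid r); rewrite hle rr_nid //; lia.
Qed.

Lemma chain_parent : parent_array par.
Proof.
have [p0 pN] := ch_par0 ch; split=> // x hx; case: (ltnP x N) => hN; last by rewrite pN.
have hx' : (0 < x < N)%N by rewrite hx.
case: (boolP ((1 < x)%N && (rr x.-1 == rr x))) => [/andP[h1 /eqP h2]|hn].
  by have [-> _] := ch_in ch (x := x) ltac:(lia) h2; lia.
rewrite chain_first_ne //; case: (posnP (rr x)) => [_ //|h].
by apply: nid_lt => //; apply: (proj2 parpP).
Qed.

Lemma chain_root_leaf x : (1 < x < N)%N -> (0 < par x)%N.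
Proof.
move=> hx; have hx' : (0 < x < N)%N by lia.
case: (boolP ((1 < x)%N && (rr x.-1 == rr x))) => [/andP[h1 /eqP h2]|hn].
  by have [-> _] := ch_in ch hx h2; lia.
rewrite chain_first_ne //; have [hr _] := ch_rr ch hx'; case: (posnP (rr x)) => [e|h].
  by have := ch_mono ch (x := x.-1) (y := x); lia.
have := par_le parpP (rr x) => hp.
by case/andP: (@nid_gt0 (parp (rr x)) ltac:(lia)).
Qed.

Lemma seglen_ge0 x : (x < N)%N -> 0 <= seglen x.
Proof.
move=> hx; rewrite /seglen /below; case: eqP => // /eqP; rewrite -lt0n => h0.
case: ifP => [/andP[h1 /eqP h2]|_].
  by have [_ h] := ch_in ch (x := x) ltac:(lia) h2; rewrite subr_ge0.
by rewrite subr0; case/andP: (ch_oo ch (x := x) ltac:(lia)).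
Qed.

Lemma below_bounds x : (0 < x < N)%N -> 0 <= below x <= oo x.
Proof.
move=> hx; rewrite /below; case: ifP => [/andP[h1 /eqP h2]|_].
  have [_ h] := ch_in ch (x := x) ltac:(lia) h2; rewrite h andbT.
  by case/andP: (ch_oo ch (x := x.-1) ltac:(lia)).
by rewrite lexx; case/andP: (ch_oo ch hx).
Qed.

(** Along a chain parents are consecutive numbers, and a chain hangs from the last node of the chain
    of its parent position, which is below all nodes of that chain. *)
Lemma chain_anc c a : (0 < c < N)%N -> (a < N)%N ->
  anc par c a = if rr a == rr c then (c <= a)%N else anc parp (rr c) (rr a).
Proof.
move=> hc; have [r0 o0] := ch_root ch.
have hcr := proj1 (ch_rr ch hc).
elim/ltn_ind: a => a IH ha; rewrite (ancE chain_parent).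
case: (posnP a) => [->|ha0].
  rewrite r0; case: (ltngtP c 0); case: (eqVneq 0%N (rr c)) => //= h h'; try lia.
  by rewrite (ancE parpP) /=; move: h; rewrite eq_sym => /negbTE ->.
have ha' : (0 < a < N)%N by rewrite ha0.
have har := proj1 (ch_rr ch ha').
have hlt := proj2 chain_parent _ ha0.
rewrite /= IH //; last by apply: ltn_trans hlt ha.
case: (boolP ((1 < a)%N && (rr a.-1 == rr a))) => [/andP[h1 /eqP h2]|hn].
  have [-> _] := ch_in ch (x := a) ltac:(lia) h2; rewrite h2.
  case: (eqVneq (rr a) (rr c)) => [_|h]; first by lia.
  by case: eqP => // e; rewrite e eqxx in h.
have hlo x : (0 < x < a)%N -> rr x <> rr a.
  move=> hx e; have := ch_mono ch (x := x) (y := a.-1); have := ch_mono ch (x := a.-1) (y := a).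
  by move: hn; case: eqP => //; lia.
rewrite chain_first_ne //; case: (eqVneq (rr a) 0%N) => [e|hne].
  rewrite e r0; case: (eqVneq 0%N (rr c)) => [e'|ne'].
    case: (eqVneq c a) => [->|hca]; first by rewrite leqnn.
    have : ~ (c < a)%N by move=> h; apply: (hlo c); rewrite -?e' //; lia.
    by lia.
  by case: (eqVneq c a) => // hca; rewrite hca e eqxx in ne'.
set p := parp (rr a); have hp : (p < rr a)%N by apply: (proj2 parpP); rewrite lt0n.
rewrite rr_nid; last by lia.
case: (eqVneq (rr a) (rr c)) => [e|hn'].
  rewrite -e (ltn_eqF hp) anc_parF ?orbF ?lt0n //.
  case: (eqVneq c a) => [->|hca]; first by rewrite leqnn.
  have : ~ (c < a)%N by move=> h; apply: (hlo c); rewrite -?e //; lia.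
  by lia.
have -> : (c == a) = false by apply: contraNF hn' => /eqP ->.
rewrite (anc_par parpP (c := rr c) (x := rr a)) 1?eq_sym // -/p.
case: (eqVneq p (rr c)) => [->|//]; rewrite ancxx //.
by have [_ ->] := ch_rr ch hc.
Qed.

Lemma proj_spot c y : (0 < c < N)%N -> (y < N)%N ->
  if anc par c y then oo c <= proj (rr c) (spot y) else proj (rr c) (spot y) <= below c.
Proof.
move=> hc hy; rewrite chain_anc // /proj /spot /=; have [r0 o0] := ch_root ch.
have /andP[oc0 oc1] := ch_oo ch hc; have /andP[bc0 bc1] := below_bounds hc.
rewrite [rr c == rr y]eq_sym; case: (eqVneq (rr y) (rr c)) => e; last first.
  by case: (anc parp _ _); rewrite ?mulr1 ?mulr0.
have hmono x z : (0 < x)%N -> (x <= z < N)%N -> rr x = rr z -> oo x <= oo z.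
  move=> hx; elim: z => [|z IH]; first by lia.
  case: (eqVneq x z.+1) => [-> //|hne hz exz].
  have ez : rr z = rr z.+1.
    by have := ch_mono ch (x := x) (y := z); have := ch_mono ch (x := z) (y := z.+1); lia.
  have [_ h] := ch_in ch (x := z.+1) ltac:(lia) ez.
  by apply: le_trans h; apply: IH; rewrite ?ez //; lia.
case: leqP => hcy; first by apply: hmono => //; lia.
case: (posnP y) => [->|y0]; first by rewrite o0.
have hm : rr c.-1 = rr c.
  by have := ch_mono ch (x := y) (y := c.-1); have := ch_mono ch (x := c.-1) (y := c); lia.
by rewrite /below hm eqxx andbT ifT; [apply: hmono; rewrite ?hm //; lia|lia].
Qed.

Lemma proj_par c q : (0 < c < N)%N -> proj q (spot (par c)) = proj q (rr c, below c).
Proof.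
move=> hc; rewrite /spot /below; have [r0 o0] := ch_root ch.
case: (boolP ((1 < c)%N && (rr c.-1 == rr c))) => [/andP[h1 /eqP h2]|hn].
  by have [-> _] := ch_in ch (x := c) ltac:(lia) h2; rewrite h2.
rewrite chain_first_ne //; case: (eqVneq (rr c) 0%N) => [e|hne]; first by rewrite r0 o0 e.
have hr := proj1 (ch_rr ch hc); set p := parp (rr c).
have hp : (p < rr c)%N by apply: (proj2 parpP); rewrite lt0n.
have [_ -> ->] := ch_nid ch (r := p) ltac:(lia).
rewrite /proj /=; case: (eqVneq q (rr c)) => [->|hq].
  by rewrite (gtn_eqF hp) anc_parF ?mulr0 ?lt0n.
rewrite (anc_par parpP hq) -/p; case: eqP => // ->.
by rewrite ancxx ?mulr1.
Qed.

(** By [proj_spot] no node projects strictly inside the segment above c, so the absolute value for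
    that edge keeps its sign along the segment; for the other edges nothing changes. *)
Lemma cdist_spot_on y c s : (0 < c < N)%N -> (y < N)%N -> 0 <= s <= 1 ->
  cdist (spot y) (spot_on c s) =
  (1 - s) * cdist (spot y) (spot (par c)) + s * cdist (spot y) (spot c).
Proof.
move=> hc hy /andP[s0 s1]; rewrite /cdist !mulr_sumr -big_split; apply: eq_bigr => q _ /=.
have ec : (c == 0%N) = false by apply/negbTE; rewrite -lt0n; case/andP: hc.
rewrite (proj_par _ hc); case: (eqVneq (q : nat) (rr c)) => [->|hq]; last first.
  have e x : proj q (rr c, x) = proj q (rr c, 0) by rewrite /proj /= (negbTE hq).
  by rewrite /spot_on /spot !(e (below c), e (oo c)) (e (_ - _)); ring.
have /andP[b0 b1] := below_bounds hc.
have eo x : proj (rr c) (rr c, x) = x by rewrite /proj /= eqxx.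
rewrite /spot_on [spot c]/spot !eo /seglen ec.
have := proj_spot hc hy; set z := proj _ _; case: ifP => _ h.
  by rewrite !ger0_norm ?subr_ge0 //; [ring|lra|nra].
by rewrite !ler0_norm ?subr_le0 //; [ring|lra|nra].
Qed.

Lemma cdist_edge y c : (0 < c < N)%N -> (y < N)%N ->
  cdist (spot y) (spot c) - cdist (spot y) (spot (par c)) =
  seglen c * (1 - 2 * (anc par c y)%:R).
Proof.
move=> hc hy; have hcr := proj1 (ch_rr ch hc).
rewrite /cdist -sumrB (bigD1 (Ordinal hcr)) //= big1 ?addr0.
  rewrite (proj_par _ hc); have eo x : proj (rr c) (rr c, x) = x by rewrite /proj /= eqxx.
  rewrite [spot c]/spot !eo /seglen; have /andP[b0 b1] := below_bounds hc.
  have -> : (c == 0%N) = false by apply/negbTE; rewrite -lt0n; case/andP: hc.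
  have := proj_spot hc hy; set z := proj _ _; case: ifP => _ h /=.
    by rewrite !ger0_norm ?subr_ge0 //; [ring|lra].
  by rewrite !ler0_norm ?subr_le0 //; [ring|lra].
move=> q hq; rewrite (proj_par _ hc).
have hq' : (q : nat) != rr c by apply: contraNneq hq => e; apply/eqP/val_inj.
have e x : proj q (rr c, x) = proj q (rr c, 0) by rewrite /proj /= (negbTE hq').
by rewrite [spot c]/spot (e (oo c)) (e (below c)) subrr.
Qed.

Lemma cdist_xx x : cdist x x = 0.
Proof. by apply: big1 => q _; rewrite subrr normr0. Qed.

(** Both distances from x change by the same amount across every edge, by [cdist_edge], and both
    vanish at x itself. *)
Lemma tdist_spot x y : (x < N)%N -> (y < N)%N ->
  tdist N par seglen x y = cdist (spot x) (spot y).
Proof.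
move=> hx hy; set f := fun z => tdist N par seglen x z - cdist (spot x) (spot z).
have hf z : (z < N)%N -> f z = f 0%N.
  elim/ltn_ind: z => z IH hz; case: (posnP z) => [-> //|z0].
  have hlt := proj2 chain_parent _ z0; rewrite -(IH (par z)) //; last by lia.
  have hz' : (0 < z < N)%N by rewrite z0.
  have := cdist_edge hz' hx; rewrite /f => e.
  suff : tdist N par seglen x z - tdist N par seglen x (par z) =
    seglen z * (1 - 2 * (anc par z x)%:R) by lra.
  rewrite /tdist -sumrB (bigD1 (Ordinal hz)) //= big1 ?addr0.
    by rewrite (ancxx chain_parent) (anc_parF chain_parent z0) addbT addbF; case: (anc _ _ _) => /=; ring.
  move=> c hc; have hc' : (c : nat) != z by apply: contraNneq hc => ec; apply/eqP/val_inj.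
  by rewrite (anc_par chain_parent hc') subrr.
have := hf y hy; rewrite -(hf x hx) /f tdistxx cdist_xx subrr => /eqP.
by rewrite subr_eq0 => /eqP.
Qed.

Variables (n m : nat) (P : uncertain T n m) (lv : nat -> nat).
Hypothesis weight_ge0 : forall i, 0 <= weight P i.
Hypothesis loc_on : forall i j, on_tree (loc P i j).
Hypothesis prob_ge0 : forall i j, 0 <= prob P i j.
Hypothesis n_gt0 : (0 < n)%N.
Hypothesis lvP : forall (i : 'I_n) (j : 'I_m),
  (lv (i * m + j) < N)%N /\ spot (lv (i * m + j)) = coord pos ech parp (loc P i j).
Variables (prb : nat -> R) (wgt : nat -> R).
Hypothesis prbP : forall (i : 'I_n) (j : 'I_m), prb (i * m + j)%N = prob P i j.
Hypothesis wgtP : forall i : 'I_n, wgt i = weight P i.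

Definition inst : instance R := Instance N par seglen n m lv prb wgt.

Let idx_split k : (k < n * m)%N -> exists (i : 'I_n) (j : 'I_m), k = (i * m + j)%N.
Proof.
move=> hk; have m0 : (0 < m)%N by lia.
have hi : (k %/ m < n)%N by rewrite ltn_divLR.
exists (Ordinal hi), (Ordinal (ltn_pmod k m0)) => /=; exact: divn_eq.
Qed.

Lemma inst_ok : instance_ok inst.
Proof.
split=> //=.
- exact: chain_parent.
- exact: seglen_ge0.
- by move=> k /idx_split[i [j ->]]; case: (lvP i j).
- by move=> k /idx_split[i [j ->]]; rewrite prbP.
- by move=> i hi; rewrite (wgtP (Ordinal hi)).
- exact: ch_N ch.
- exact: chain_root_leaf.
Qed.

Lemma fvert_cdist (i : 'I_n) v : (v < N)%N ->
  fvert inst i v = weight P i * \sum_j prob P i j * cdist (coord pos ech parp (loc P i j)) (spot v).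
Proof.
move=> hv; rewrite /fvert /= wgtP; congr (_ * _); apply: eq_bigr => j _.
by have [h1 <-] := lvP i j; rewrite prbP tdist_spot.
Qed.

(** Only projections are compared, since a point has several coordinates: offset 0 on an edge is the
    full offset on the edge above it. *)
Lemma fpt_Edist (i : 'I_n) c s p : (0 < c < N)%N -> 0 <= s <= 1 -> on_tree p ->
  (forall q, (q < nv T)%N -> proj q (coord pos ech parp p) = proj q (spot_on c s)) ->
  fpt inst i (c, s) = weight P i * Edist P i p.
Proof.
move=> hc hs hp hq; have hcN : (c < N)%N by case/andP: hc.
have hpc : (par c < N)%N by have := proj2 chain_parent c; lia.
rewrite /fpt /= !fvert_cdist // ![_ * (weight P i * _)]mulrCA -mulrDr; congr (_ * _).
rewrite /Edist !mulr_sumr -big_split; apply: eq_bigr => j _ /=.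
rewrite (dist_cdist rt) //; have [h1 e1] := lvP i j.
rewrite ![_ * (prob P i j * _)]mulrCA -mulrDr; congr (_ * _).
rewrite -e1 -cdist_spot_on //; apply: eq_bigr => q _.
by rewrite hq.
Qed.

Lemma spot_cover p : on_tree p -> exists c s, [/\ (0 < c < N)%N, 0 <= s <= 1 &
  coord pos ech parp p = spot_on c s].
Proof.
move=> hp; have := coord_bounds rt len_gt0 hp; have := coord_lt rt p.
case: (coord _ _ _ p) => r o /= hr /andP[o0 o1].
have [/andP[n0 nN] n1 n2] := ch_nid ch hr.
have ex : exists c, [&& (0 < c)%N, rr c == r & o <= oo c].
  by exists (nid r); rewrite n0 n1 n2 eqxx.
case: (ex_minnP ex) => c /and3P[c0 /eqP ec co] cmin.
have hc : (0 < c < N)%N.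
  by rewrite c0 (leq_ltn_trans (cmin (nid r) _) nN) // n0 n1 n2 eqxx.
have /andP[b0 b1] := below_bounds hc.
have bo : below c <= o.
  rewrite /below; case: ifP => // /andP[h1 /eqP h2]; case: (lerP o (oo c.-1)) => [h|/ltW //].
  by have := cmin c.-1; rewrite h2 ec eqxx h; lia.
have esl : seglen c = oo c - below c by rewrite /seglen gtn_eqF.
(* Segments may have length 0, for instance above a location at offset 0; the general fraction would
   then divide by 0. *)
case: (eqVneq (below c) (oo c)) => [e|hne].
  exists c, 1; split; rewrite ?ler01 ?lexx // /spot_on ec; congr pair.
  by rewrite subrr mul0r subr0; apply: le_anti; rewrite co -e bo.
have hpos : 0 < oo c - below c by rewrite subr_gt0 lt_neqAle hne.
exists c, (1 - (oo c - o) / (oo c - below c)); split=> //.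
  rewrite lerBrDr add0r lerBlDr lerDl ler_pdivrMr // mul1r lerB //=.
  by rewrite divr_ge0 // ?subr_ge0 // ltW.
rewrite /spot_on ec esl; congr pair; field; exact: lt0r_neq0.
Qed.

Lemma two_centers_inst q1 q2 x1 x2 lam : on_tree q1 -> on_tree q2 ->
  on (edges inst) x1 -> on (edges inst) x2 ->
  (forall q, (q < nv T)%N -> proj q (coord pos ech parp q1) = proj q (spot_on x1.1 x1.2)) ->
  (forall q, (q < nv T)%N -> proj q (coord pos ech parp q2) = proj q (spot_on x2.1 x2.2)) ->
  covers inst lam x1 x2 ->
  (forall l y1 y2, on (edges inst) y1 -> on (edges inst) y2 -> covers inst l y1 y2 -> lam <= l) ->
  two_centers P q1 q2.
Proof.
have hE c : c \in edges inst -> (0 < c < N)%N by rewrite (mem_edges inst_ok).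
have hmin i (a b : R) : 0 <= i -> i * Num.min a b = Num.min (i * a) (i * b).
  by move=> hi; rewrite minr_pMr.
move=> hq1 hq2 ho1 ho2 e1 e2 hcov hopt; split=> // p1 p2 hp1 hp2.
have l0 := covers_ge0 inst_ok ho1 ho2 hcov.
have [/hE c1 s1] := ho1; have [/hE c2 s2] := ho2.
apply: (@le_trans _ _ lam).
  rewrite /phi; elim/big_ind: _ => // [a b ha hb|i _]; first by rewrite ge_max ha.
  rewrite hmin // ge_min -(fpt_Edist i c1 s1 hq1 e1) -(fpt_Edist i c2 s2 hq2 e2).
  by rewrite -!surjective_pairing; case: (hcov i (ltn_ord i)) => ->; rewrite ?orbT.
have [d1 [t1 [hd1 ht1 f1]]] := spot_cover hp1; have [d2 [t2 [hd2 ht2 f2]]] := spot_cover hp2.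
apply: (hopt _ (d1, t1) (d2, t2)); try by split; rewrite //= (mem_edges inst_ok).
move=> i hi; have := le_bigmax_cond 0
  (fun i => weight P i * Num.min (Edist P i p1) (Edist P i p2)) (isT : predT (Ordinal hi)).
rewrite -/(phi P p1 p2) hmin // ge_min.
rewrite -(@fpt_Edist (Ordinal hi) d1 t1) //; last by move=> q _; rewrite f1.
rewrite -(@fpt_Edist (Ordinal hi) d2 t2) //; last by move=> q _; rewrite f2.
by case/orP; [left|right].
Qed.

End Subdivision.

(** * Peeling leaves *)

Section Peeling.
Variables (R : realType) (T : wgraph R).
Hypothesis T_tree : is_tree T.
Local Notation V := 'I_(nv T).
Local Notation K := 'I_(ne T).
Let entry : Type := ((V * K) * V)%type.
Implicit Types (L : seq (V * K * V)) (u v x y root : V) (k : K).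
Local Notation joins := (joins (T := T)).
Local Notation adj := (adj (T := T)).

Definition verts L : seq V := [seq e.1.1 | e <- L].
Definition gone L : seq K := [seq e.1.2 | e <- L].
Definition incident k v := (src k == v) || (dst k == v).

(* The entry (v, k, u) says that the leaf v was removed along the edge k to u;
   the last removal comes first. *)
Fixpoint peeled root L : Prop :=
  if L is (v, k, u) :: L' then
    [/\ peeled root L', v != root, v \notin verts L' /\ u \notin verts L', joins k v u &
     k \notin gone L' /\ forall k', incident k' v -> k' != k -> k' \in gone L']
  else True.

Lemma joins_sym k u v : joins k u v -> joins k v u.
Proof. by rewrite /Defs.joins orbC. Qed.

Lemma joins_incident k u v : joins k u v -> incident k u.
Proof. by case/orP => /andP[h1 h2]; rewrite /incident ?h1 ?h2 ?orbT. Qed.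

Lemma incident_joins k u : incident k u -> exists v, joins k u v.
Proof.
by case/orP => h; [exists (dst k)|exists (src k)]; rewrite /Defs.joins h eqxx ?orbT.
Qed.

Lemma joins_neq k u v : joins k u v -> u != v.
Proof.
case: T_tree => _ [hs _] _ _; case/orP => /andP[/eqP <- /eqP <-]; first exact: hs.
by rewrite eq_sym; apply: hs.
Qed.

Lemma joins_inj k u v w : joins k u v -> joins k u w -> v = w.
Proof.
move=> h1 h2; have := joins_ends (joins_sym h1) h2.
by rewrite eq_sym (negbTE (joins_neq h1)) /= => /eqP.
Qed.

Section Root.
Variable root : V.
Local Notation peeled := (peeled root).

Lemma peeled_joins L v k u : peeled L -> (v, k, u) \in L -> joins k v u.
Proof.
elim: L => //= -[[v' k'] u'] L IH [h1 h2 h3 h4 h5]; rewrite inE => /orP[/eqP[-> -> ->] //|].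
exact: IH.
Qed.

Lemma peeled_root L : peeled L -> root \notin verts L.
Proof.
elim: L => //= -[[v' k'] u'] L IH [h1 h2 h3 h4 h5] /=.
by rewrite inE eq_sym (negbTE h2) /= IH.
Qed.

Lemma peeled_uniq L : peeled L -> uniq (verts L).
Proof. by elim: L => //= -[[v' k'] u'] L IH [h1 h2 [h3 _] h4 h5] /=; rewrite h3 IH. Qed.

Lemma peeled_uniq_gone L : peeled L -> uniq (gone L).
Proof. by elim: L => //= -[[v' k'] u'] L IH [h1 h2 h3 h4 [h5 _]] /=; rewrite h5 IH. Qed.

Lemma mem_verts L v k u : (v, k, u) \in L -> v \in verts L.
Proof. by move=> h; apply/mapP; exists (v, k, u). Qed.

Lemma goneP L k : k \in gone L -> exists v u, (v, k, u) \in L.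
Proof. by case/mapP => -[[v k'] u] h -> /=; exists v, u. Qed.

Lemma peeled_fun L v k u k' u' : peeled L -> (v, k, u) \in L -> (v, k', u') \in L -> k = k' /\ u = u'.
Proof.
elim: L => //= -[[a b] c] L IH [h1 h2 [h3 h3'] h4 h5]; rewrite !inE.
move=> /orP[/eqP[ev ek eu]|h6] /orP[/eqP[ev' ek' eu']|h7]; last exact: IH.
- by rewrite ek eu ek' eu'.
- by move: h3; rewrite -ev (mem_verts h7).
- by move: h3; rewrite -ev' (mem_verts h6).
Qed.

Lemma peeled_gone L v k' : peeled L -> v \in verts L -> incident k' v -> k' \in gone L.
Proof.
elim: L => //= -[[a b] c] L IH [h1 h2 h3 h4 [h5 h6]] /=; rewrite !inE => /orP[/eqP ->|hv] hk.
  by case: (eqVneq k' b) => //= hne; rewrite h6.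
by rewrite IH ?orbT.
Qed.

(** Every edge at a removed vertex x is gone, and all but the edge to u were removed from their
    other end. So a simple path from x that misses u moves on to a vertex removed towards x, and so
    forth. *)
Lemma peeled_walk L p x k u : peeled L -> (x, k, u) \in L -> path adj x p -> u \notin p ->
  uniq (x :: p) -> last x p \in verts L.
Proof.
move=> hL; elim: p x k u => [|y p IH] x k u hx /=; first by rewrite (mem_verts hx).
case/andP => /existsP[k2 hk2] hp; rewrite inE negb_or => /andP[huy hup] /and3P[hxp hyp hu].
have hg : k2 \in gone L.
  by apply: (peeled_gone hL (mem_verts hx)); apply: joins_incident hk2.
have [x' [u' hx']] := goneP hg; have hj := peeled_joins hL hx'.
have hkk : k2 != k.
  apply: contraNneq huy => e; rewrite e in hk2.
  by rewrite (joins_inj (peeled_joins hL hx) hk2).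
have ex : x' != x.
  by apply: contra hkk => /eqP e; rewrite e in hx'; have [-> _] := peeled_fun hL hx hx'.
have [e1 e2] : x' = y /\ u' = x.
  have := joins_ends hj hk2; rewrite (negbTE ex) /= => /eqP e1; split=> //.
  by rewrite e1 in hj; apply: (joins_inj hj (joins_sym hk2)).
subst x' u'; apply: IH hx' hp _ _; last by rewrite /= hyp.
by move: hxp; rewrite inE negb_or => /andP[].
Qed.

(** If all edges at v were gone, the first step of a path from v to the root would lead to a vertex
    removed towards v, and by [peeled_walk] the path would end among removed vertices. *)
Lemma alive_edge L v : peeled L -> v != root -> v \notin verts L ->
  exists2 k, k \notin gone L & incident k v.
Proof.
move=> hL hv hvL; case: (boolP [exists k, (k \notin gone L) && incident k v]) => [/existsP[k /andP[]]|].
  by exists k.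
rewrite negb_exists => /forallP hn; exfalso.
case: T_tree => _ _ hc _; case/connectP: (hc v root) => p0 hp0.
case: (shortenP hp0) => p hp hu _ {p0 hp0} hl.
case: p hp hu hl => [|y p] /=; first by move=> _ _ e; rewrite e eqxx in hv.
case/andP => /existsP[k hk] hp /and3P[hvp hyp hu] hl.
have hg : k \in gone L.
  by have := hn k; rewrite negb_and negbK (joins_incident hk) orbF.
have [x [u hx]] := goneP hg; have hj := peeled_joins hL hx.
have ex : x != v by apply: contra hvL => /eqP <-; apply: mem_verts hx.
have e1 : x = y by have := joins_ends hj hk; rewrite (negbTE ex) /= => /eqP.
have e2 : u = v by rewrite e1 in hj; apply: (joins_inj hj (joins_sym hk)).
subst x u; have := peeled_walk hL hx hp; rewrite -hl (negbTE (peeled_root hL)).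
by move: hvp; rewrite inE negb_or => /andP[_ ->] /(_ isT); rewrite /= hyp hu => /(_ isT).
Qed.

Definition aadj L : rel V := fun u v => [exists k, joins k u v && (k \notin gone L)].

(* Extending a path of alive edges as long as possible ends in a leaf. *)
Lemma leaf_ex L k : peeled L -> k \notin gone L ->
  exists v k', [/\ v != root, k' \notin gone L, incident k' v &
    forall k2, incident k2 v -> k2 \notin gone L -> k2 = k'].
Proof.
move=> hL hk; have aadjC a b : aadj L a b -> aadj L b a.
  by case/existsP => k0 /andP[h1 h2]; apply/existsP; exists k0; rewrite joins_sym.
have aadjW a b : aadj L a b -> adj a b.
  by case/existsP => k0 /andP[h1 h2]; apply/existsP; exists k0.
(* The path grows at its head l. Its last vertex is the root, or no alive edge meets the root;
   either way the leaf found is not the root. *)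
have main d : forall l p s, nv T - size s <= d -> path (aadj L) l (p :: s) -> uniq (l :: p :: s) ->
    last p s = root \/ (forall k', incident k' root -> k' \in gone L) ->
  exists v k', [/\ v != root, k' \notin gone L, incident k' v &
    forall k2, incident k2 v -> k2 \notin gone L -> k2 = k'].
  elim: d => [|d IH] l p s hd hp hu hroot.
    have : size (l :: p :: s) <= nv T by rewrite -(card_uniqP hu) -[X in _ <= X]card_ord max_card.
    by rewrite /=; lia.
  have /andP[/existsP[k1 /andP[hk1 hg1]] hps] := hp.
  have lroot : l != root.
    case: hroot => [e|hr].
      by move: hu => /= /andP[+ _]; rewrite -e; apply: contra => /eqP ->; exact: mem_last.
    by apply: contraNneq hg1 => e; apply: hr; rewrite -e; apply: joins_incident hk1.
  case: (boolP [exists k2, [&& incident k2 l, k2 \notin gone L & k2 != k1]]); last first.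
    rewrite negb_exists => /forallP hn; exists l, k1; split=> //; first exact: joins_incident hk1.
    by move=> k2 h1 h2; have := hn k2; rewrite h1 h2 /= negbK => /eqP.
  case/existsP => k2 /and3P[h1 h2 h3]; have [w hw] := incident_joins h1.
  have hwp : w != p.
    apply: contra h3 => /eqP e; rewrite e in hw; case: T_tree => _ [_ hs] _ _.
    by apply/eqP; apply: hs hw hk1.
  have hwl : w != l by rewrite eq_sym; apply: joins_neq hw.
  have hal : aadj L w l by apply: aadjC; apply/existsP; exists k2; rewrite hw h2.
  have hws : w \notin l :: p :: s.
    (* If w were on the path already, the part up to w and the edge back to l would form a cycle of
       at least three vertices. *)
    rewrite !inE (negbTE hwl) (negbTE hwp) /=; apply/negP => hin.
    case: T_tree => _ _ _ hac.
    case/splitPr: hin hu hp => s1 s2 hu hp.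
    have hc := hac (l :: p :: rcons s1 w).
    move: hu; rewrite -cat_rcons -!cat_cons cat_uniq => /andP[hu1 _].
    have hpa : path adj l (rcons (p :: rcons s1 w) l).
      move: hp; rewrite -cat_rcons -cat_cons cat_path => /andP[hp1 _].
      rewrite rcons_path /= last_rcons (aadjW _ _ hal) andbT.
      by apply: sub_path hp1 => a b; apply: aadjW.
    by have := hc hpa hu1; rewrite /= size_rcons.
  have hd' : nv T - size (p :: s) <= d by move: hd {hu hp hps hws} => /=; lia.
  have hp' : path (aadj L) w (l :: p :: s) by rewrite [path _ _ _]/= hal.
  have hu' : uniq (w :: l :: p :: s) by rewrite cons_uniq hws.
  exact: (IH w l (p :: s) hd' hp' hu' hroot).
have start a b : aadj L a b -> (b = root \/ (forall k', incident k' root -> k' \in gone L)) -> 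
  exists v k', [/\ v != root, k' \notin gone L, incident k' v &
    forall k2, incident k2 v -> k2 \notin gone L -> k2 = k'].
  move=> hab hr; apply: (main (nv T) a b [::]) => //=; rewrite ?subn0 ?hab //.
  case/existsP: hab => k0 /andP[/joins_neq h _]; by rewrite inE h.
case: (boolP [exists k', incident k' root && (k' \notin gone L)]) => [/existsP[k' /andP[h1 h2]]|].
  have [w hw] := incident_joins h1.
  apply: (start w root); last by left.
  by apply: aadjC; apply/existsP; exists k'; rewrite hw h2.
rewrite negb_exists => /forallP hn.
apply: (start (src k) (dst k)).
  by apply/existsP; exists k; rewrite hk /Defs.joins !eqxx.
by right=> k' hk'; have := hn k'; rewrite hk' /= negbK.
Qed.

Lemma peeled_all L v : peeled L -> (forall k, k \in gone L) -> v != root -> v \in verts L.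
Proof.
move=> hL hg hv; apply/negPn/negP => hn; have [k + _] := alive_edge hL hv hn.
by rewrite hg.
Qed.

Section Full.
Variable L : seq (V * K * V).
Hypotheses (hL : peeled L) (hg : forall k, k \in gone L).
Let VS := root :: verts L.
(** A vertex hangs from the root or from one that is removed later, and L lists the last removal
    first; so this order puts parents before children. *)
Definition peel_pos v := index v VS.
Definition peel_par r := if 0 < r < nv T then peel_pos (nth root [seq e.2 | e <- L] r.-1) else 0.
Definition peel_ech k := (index k (gone L)).+1.

Let VS_all v : v \in VS.
Proof. by rewrite inE; case: eqVneq => //= h; apply: peeled_all. Qed.
Let VS_uniq : uniq VS. Proof. by rewrite /= peeled_root ?peeled_uniq. Qed.

Lemma peel_size : (size L).+1 = nv T.
Proof.
have -> : (size L).+1 = size VS by rewrite /= size_map.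
rewrite -(card_uniqP VS_uniq) -[RHS]card_ord; apply: eq_card => v; by rewrite VS_all.
Qed.

Lemma peel_nth d i : i < size L -> let e := nth d L i in
  [/\ peel_pos e.1.1 = i.+1, peel_ech e.1.2 = i.+1 & peel_par i.+1 = peel_pos e.2].
Proof.
move=> hi /=; set e := nth d L i; have [[d1 d2] d3] := d.
have hv : nth root VS i.+1 = e.1.1 by rewrite /= (nth_map d).
split.
- by rewrite /peel_pos -hv index_uniq //= size_map.
- have -> : e.1.2 = nth e.1.2 (gone L) i by rewrite (nth_map d).
  by rewrite /peel_ech index_uniq ?size_map ?peeled_uniq_gone.
- have hlt : i.+1 < nv T by rewrite -peel_size.
  by rewrite /peel_par hlt /= (nth_map d).
Qed.

Lemma peel_later M i d : peeled M -> i < size M -> (nth d M i).2 \notin verts (drop i M).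
Proof.
elim: M i => //= -[[v k] u] M IH [|i] [h1 h2 [h3 h4] h5 h6] hi /=; last exact: IH.
by rewrite inE negb_or h4 eq_sym (joins_neq h5).
Qed.

Lemma peel_par_lt i d : i < size L -> peel_pos (nth d L i).2 <= i.
Proof.
move=> hi; have hu := peel_later d hL hi; set u := (nth d L i).2 in hu *.
have := VS_all u; rewrite /peel_pos inE /=; case: eqVneq => //= hne hin.
rewrite ltnNge; apply: contra hu => hle; rewrite /verts map_drop -/(verts L).
have hlt : index u (verts L) < size (verts L) by rewrite index_mem.
have h : nth root (drop i (verts L)) (index u (verts L) - i) = u.
  by rewrite nth_drop subnKC // nth_index.
by rewrite -h mem_nth // size_drop ltn_sub2r // (leq_ltn_trans hle).
Qed.

Lemma peel_rooting : rooting peel_pos peel_ech peel_par.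
Proof.
have hs := peel_size; case: T_tree => hnv _ _ _.
have gl k : index k (gone L) < size L by rewrite -[size L](size_map (fun e => e.1.2)) index_mem hg.
split.
- split=> [|x hx] //; rewrite /peel_par; case: ifP => // /andP[_ hlt].
  have hi : x.-1 < size L by lia.
  have [d _] : exists d, d \in L by case: (L) hi => //= d ?; exists d; rewrite mem_head.
  by rewrite (nth_map d) // (leq_ltn_trans (peel_par_lt d hi)) //; lia.
- by move=> v; rewrite -hs /peel_pos -[size L](size_map (fun e => e.1.1)) -/(size VS) index_mem.
- move=> r hr; exists (nth root VS r); rewrite /peel_pos index_uniq //=.
  by rewrite size_map hs.
- by move=> k k' [] /(congr1 (nth k (gone L))); rewrite !nth_index.
- by move=> k; rewrite /peel_ech /= -hs ltnS; apply: gl.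
- move=> r /andP[r0 hr]; have hi : r.-1 < size L by lia.
  have [d _] : exists d, d \in L by case: (L) hi => //= d ?; exists d; rewrite mem_head.
  by have [_ e _] := peel_nth d hi; exists (nth d L r.-1).1.2; rewrite e prednK.
- move=> k; have hi := gl k.
  have [d _] : exists d, d \in L by case: (L) hi => //= d ?; exists d; rewrite mem_head.
  have [e1 e2 e3] := peel_nth d hi; set e := nth d L _ in e1 e2 e3.
  have ek : e.1.2 = k by rewrite -[RHS](nth_index k (hg k)) (nth_map d).
  have hj : joins k e.1.1 e.2.
    by apply: (peeled_joins hL); rewrite -ek -!surjective_pairing mem_nth.
  rewrite /peel_ech e3; case/orP: hj => /andP[/eqP -> /eqP ->]; [right|left]; by rewrite e1.
Qed.

End Full.
End Root.
End Peeling.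

Arguments upd {A} f a i x b j /.

(** * Hoare-style reasoning about the machine *)

Section Hoare.
Variables (R : realType) (W : nat).
Implicit Types (s : state R) (c : cmd).

(* Total versions of the evaluators; [isafe], [rsafe], [bsafe] say that no
   intermediate integer exceeds W. *)
Fixpoint iev s e : nat :=
  match e with
  | IConst k => k
  | ILoad a e => ints s a (iev s e)
  | IAdd e1 e2 => iev s e1 + iev s e2
  | ISub e1 e2 => iev s e1 - iev s e2
  | IMul e1 e2 => iev s e1 * iev s e2
  | IDiv e1 e2 => iev s e1 %/ iev s e2
  end.

Fixpoint isafe s e : Prop :=
  match e with
  | IConst k => k <= W
  | ILoad a e => isafe s e
  | IAdd e1 e2 => [/\ isafe s e1, isafe s e2 & iev s e1 + iev s e2 <= W]
  | ISub e1 e2 => [/\ isafe s e1, isafe s e2 & iev s e1 - iev s e2 <= W]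
  | IMul e1 e2 => [/\ isafe s e1, isafe s e2 & iev s e1 * iev s e2 <= W]
  | IDiv e1 e2 => [/\ isafe s e1, isafe s e2 & iev s e1 %/ iev s e2 <= W]
  end.

Fixpoint rev s e : R :=
  match e with
  | RConst z => z%:~R%R
  | RLoad a e => reals s a (iev s e)
  | RAdd e1 e2 => (rev s e1 + rev s e2)%R
  | RSub e1 e2 => (rev s e1 - rev s e2)%R
  | RMul e1 e2 => (rev s e1 * rev s e2)%R
  | RDiv e1 e2 => (rev s e1 / rev s e2)%R
  end.

Fixpoint rsafe s e : Prop :=
  match e with
  | RConst _ => True
  | RLoad a e => isafe s e
  | RAdd e1 e2 | RSub e1 e2 | RMul e1 e2 | RDiv e1 e2 => rsafe s e1 /\ rsafe s e2
  end.

Fixpoint bev s b : bool :=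
  match b with
  | ILe e1 e2 => iev s e1 <= iev s e2
  | RLe e1 e2 => (rev s e1 <= rev s e2)%R
  | BNot b => ~~ bev s b
  | BAnd b1 b2 => bev s b1 && bev s b2
  end.

Fixpoint bsafe s b : Prop :=
  match b with
  | ILe e1 e2 => isafe s e1 /\ isafe s e2
  | RLe e1 e2 => rsafe s e1 /\ rsafe s e2
  | BNot b => bsafe s b
  | BAnd b1 b2 => bsafe s b1 /\ bsafe s b2
  end.

Lemma ieval_safe s e : isafe s e -> ieval W s e = Some (iev s e).
Proof.
elim: e => //= [k|a e IH|e1 IH1 e2 IH2|e1 IH1 e2 IH2|e1 IH1 e2 IH2|e1 IH1 e2 IH2];
  rewrite /word.
- by move=> ->.
- by move=> /IH ->.
all: by case=> /IH1 -> /IH2 -> /= ->.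
Qed.

Lemma reval_safe s e : rsafe s e -> reval W s e = Some (rev s e).
Proof.
elim: e => //= [a e|e1 IH1 e2 IH2|e1 IH1 e2 IH2|e1 IH1 e2 IH2|e1 IH1 e2 IH2].
  by move=> /ieval_safe ->.
all: by case=> /IH1 -> /IH2 ->.
Qed.

Lemma beval_safe s b : bsafe s b -> beval W s b = Some (bev s b).
Proof.
elim: b => //= [e1 e2|e1 e2|b IH|b1 IH1 b2 IH2].
- by case=> /ieval_safe -> /ieval_safe ->.
- by case=> /reval_safe -> /reval_safe ->.
- by move=> /IH ->.
- by case=> /IH1 -> /IH2 ->.
Qed.

Fixpoint imods c : seq nat :=
  match c with
  | Skip => [::]
  | IStore a _ _ => [:: a]
  | RStore _ _ _ => [::]
  | Seq c1 c2 | If _ c1 c2 => imods c1 ++ imods c2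
  | While _ c => imods c
  end.

Fixpoint rmods c : seq nat :=
  match c with
  | Skip => [::]
  | IStore _ _ _ => [::]
  | RStore a _ _ => [:: a]
  | Seq c1 c2 | If _ c1 c2 => rmods c1 ++ rmods c2
  | While _ c => rmods c
  end.

Definition frame (ia ra : seq nat) s s' : Prop :=
  (forall a i, a \notin ia -> ints s' a i = ints s a i) /\
  (forall a i, a \notin ra -> reals s' a i = reals s a i).

Lemma frame_refl ia ra s : frame ia ra s s.
Proof. by []. Qed.

Lemma frame_trans ia ra s1 s2 s3 :
  frame ia ra s1 s2 -> frame ia ra s2 s3 -> frame ia ra s1 s3.
Proof.
move=> [h1 h2] [h3 h4]; split=> a i ha; first by rewrite h3 ?h1.
by rewrite h4 ?h2.
Qed.

Lemma frame_sub ia ra ia' ra' s1 s2 : {subset ia <= ia'} -> {subset ra <= ra'} ->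
  frame ia ra s1 s2 -> frame ia' ra' s1 s2.
Proof.
move=> h1 h2 [h3 h4]; split=> a i ha.
  by rewrite h3 //; apply: contra ha; apply: h1.
by rewrite h4 //; apply: contra ha; apply: h2.
Qed.

Lemma exec_frame c s t s' : exec W c s t s' -> frame (imods c) (rmods c) s s'.
Proof.
elim=> //= {c s t s'}.
- move=> s a e1 e2 i x _ _; split=> //= b j; rewrite inE => hb.
  by rewrite (negbTE hb).
- move=> s a e1 e2 i x _ _; split=> //= b j; rewrite inE => hb.
  by rewrite (negbTE hb).
- move=> c1 c2 s1 s2 s3 t1 t2 _ h1 _ h2; apply: (@frame_trans _ _ _ s2).
    by apply: frame_sub h1 => a; rewrite mem_cat => ->.
  by apply: frame_sub h2 => a; rewrite mem_cat => ->; rewrite orbT.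
- move=> b c1 c2 s s' t _ _ h1.
  by apply: frame_sub h1 => a; rewrite mem_cat => ->.
- move=> b c1 c2 s s' t _ _ h1.
  by apply: frame_sub h1 => a; rewrite mem_cat => ->; rewrite orbT.
- by move=> b c s1 s2 s3 t1 t2 _ _ h1 _ h2; apply: frame_trans h1 h2.
Qed.

(** A bound that does not depend on the run: a test pays for both branches and a loop for a single
    round, the number of rounds being the other factor in [run]. *)
Fixpoint unit_cost c : nat :=
  match c with
  | Skip => 1
  | IStore _ e1 e2 => (icost e1 + icost e2).+1
  | RStore _ e1 e2 => (icost e1 + rcost e2).+1
  | Seq c1 c2 => unit_cost c1 + unit_cost c2
  | If b c1 c2 => (bcost b + (unit_cost c1 + unit_cost c2)).+1
  | While b c => (bcost b + unit_cost c).+1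
  end.

(* Running time is counted in loop iterations: k iterations cost at most a
   program-dependent constant times k + 1. *)
Definition run c s k (Q : state R -> Prop) : Prop :=
  exists t s', [/\ exec W c s t s', t <= unit_cost c * k.+1 & Q s'].

Lemma run_weak c s k k' (Q Q' : state R -> Prop) : k <= k' -> (forall s', Q s' -> Q' s') ->
  run c s k Q -> run c s k' Q'.
Proof.
move=> hk hQ [t [s' [h1 h2 h3]]]; exists t, s'; split=> //; last exact: hQ.
by apply: leq_trans h2 _; rewrite leq_mul2l ltnS hk orbT.
Qed.

Lemma run_framed c s k (Q : state R -> Prop) : run c s k Q ->
  run c s k (fun s' => Q s' /\ frame (imods c) (rmods c) s s').
Proof.
by move=> [t [s' [h1 h2 h3]]]; exists t, s'; split=> //; split=> //; apply: exec_frame h1.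
Qed.

Lemma run_seq c1 c2 s k1 k2 (Q1 Q : state R -> Prop) :
  run c1 s k1 Q1 ->
  (forall s', frame (imods c1) (rmods c1) s s' -> Q1 s' -> run c2 s' k2 Q) ->
  run (Seq c1 c2) s (k1 + k2) Q.
Proof.
move=> /run_framed [t1 [s1 [h1 h2 [h3 f1]]]] /(_ _ f1 h3) [t2 [s2 [h4 h5 h6]]].
by exists (t1 + t2), s2; split=> //; [exact: ESeq h1 h4|rewrite /=; nia].
Qed.

Lemma run_if b c1 c2 s k (Q : state R -> Prop) :
  bsafe s b -> (bev s b -> run c1 s k Q) -> (~~ bev s b -> run c2 s k Q) ->
  run (If b c1 c2) s k Q.
Proof.
move=> /beval_safe hb h1 h2; case E: (bev s b) hb h1 h2 => hb h1 h2.
  have [t [s' [h3 h4 h5]]] := h1 isT.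
  by exists (bcost b + t).+1, s'; split=> //; [exact: EIfTrue|rewrite /=; nia].
have [t [s' [h3 h4 h5]]] := h2 isT.
by exists (bcost b + t).+1, s'; split=> //; [exact: EIfFalse|rewrite /=; nia].
Qed.

Fixpoint wp c (Q : state R -> Prop) s : Prop :=
  match c with
  | Skip => Q s
  | IStore a e1 e2 => [/\ isafe s e1, isafe s e2 &
      Q (State (upd (ints s) a (iev s e1) (iev s e2)) (reals s))]
  | RStore a e1 e2 => [/\ isafe s e1, rsafe s e2 &
      Q (State (ints s) (upd (reals s) a (iev s e1) (rev s e2)))]
  | Seq c1 c2 => wp c1 (wp c2 Q) s
  | If b c1 c2 => bsafe s b /\ if bev s b then wp c1 Q s else wp c2 Q s
  | While _ _ => False
  end.

Lemma wp_run c Q s : wp c Q s -> run c s 0 Q.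
Proof.
elim: c Q s => //= [|a e1 e2|a e1 e2|c1 IH1 c2 IH2|b c1 IH1 c2 IH2] Q s.
- by move=> h; exists 1, s; split=> //; apply: ESkip.
- case=> /ieval_safe h1 /ieval_safe h2 hQ.
  by eexists _, _; split; [exact: EIStore h1 h2|rewrite /= muln1|exact: hQ].
- case=> /ieval_safe h1 /reval_safe h2 hQ.
  by eexists _, _; split; [exact: ERStore h1 h2|rewrite /= muln1|exact: hQ].
- move=> /IH1 h1; rewrite -[0]addn0; apply: run_seq h1 _ => s' _ /IH2 //.
- move=> [hb h]; apply: run_if hb _ _ => hv; move: h; rewrite ?hv ?(negbTE hv).
  by move/IH1.
by move/IH2.
Qed.

(** The index k is the budget left. A round that uses kb inner iterations must bring the budget
    below k - kb; the unit lost pays for the round and ensures termination. *)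
Lemma run_while (I : nat -> state R -> Prop) b c Q k s0 :
  (forall k s, frame (imods c) (rmods c) s0 s -> I k s -> bsafe s b /\
     if bev s b then exists2 kb, kb < k & run c s kb (fun s' => exists2 k', kb + k' < k & I k' s')
     else Q s) ->
  I k s0 -> run (While b c) s0 k Q.
Proof.
move=> hI; suff H k' s : frame (imods c) (rmods c) s0 s -> I k' s -> run (While b c) s k' Q.
  exact/H/frame_refl.
elim/ltn_ind: k' s => {}k IH s fs hk.
have [/beval_safe hb] := hI _ _ fs hk; case E: (bev s b) hb => hb.
  move=> [kb _ /run_framed [t1 [s1 [h1 h2 [[k' hk' hI'] f1]]]]].
  have [t2 [s2 [h3 h4 h5]]] := IH k' ltac:(lia) s1 (frame_trans fs f1) hI'.
  exists (bcost b + t1 + t2).+1, s2; split=> //; first exact: EWhileTrue h1 h3.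
  move: h2 h4 => /=; nia.
move=> hQ; exists (bcost b).+1, s; split=> //; [exact: EWhileFalse|rewrite /=; nia].
Qed.

End Hoare.

Notation "''v' x" := (ILoad x (IConst 0)) (at level 8, x at level 2, format "''v' x").
Notation "''r' x" := (RLoad x (IConst 0)) (at level 8, x at level 2, format "''r' x").
Notation "x <~ e" := (IStore x (IConst 0) e) (at level 70).
Notation "x <~~ e" := (RStore x (IConst 0) e) (at level 70).
Notation "c1 ;; c2" := (Seq c1 c2) (at level 75, right associativity).

Definition For (x y : nat) (body : cmd) : cmd :=
  x <~ IConst 0 ;;
  While (BNot (ILe ('v y) ('v x))) (body ;; x <~ IAdd ('v x) (IConst 1)).

Definition set_int (R : realType) (s : state R) x k :=
  State (upd (ints s) x 0 k) (reals s).

Lemma run_for (R : realType) W (I : nat -> state R -> Prop) x y body s0 n kb Q :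
  x \notin imods body -> y \notin x :: imods body -> ints s0 y 0 = n -> n < W ->
  I 0 (set_int s0 x 0) ->
  (forall j s, j < n -> frame (x :: imods body) (rmods body) s0 s -> ints s x 0 = j ->
     I j s -> run W body s kb (fun s' => I j.+1 (set_int s' x j.+1))) ->
  (forall s, frame (x :: imods body) (rmods body) s0 s -> I n s -> Q s) ->
  run W (For x y body) s0 (n * kb.+1) Q.
Proof.
move=> hx hy hn hW hI0 hbody hQ.
have yx : y == x = false by move: hy; rewrite inE negb_or => /andP[/negbTE].
rewrite -[n * _]add0n; apply: (@run_seq _ _ _ _ _ 0 _ (fun s => s = set_int s0 x 0)).
  by apply: wp_run.
move=> s _ ->.
pose J k s := exists j, [/\ j <= n, k = (n - j) * kb.+1,
  frame (x :: imods body) (rmods body) s0 s, ints s x 0 = j & I j s].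
apply: (@run_while _ _ J); last first.
  exists 0; split=> //; rewrite ?subn0 //=.
    by split=> //= a i; rewrite inE negb_or => /andP[/negbTE ->].
  by rewrite !eqxx.
move=> k {}s _ [j [hj -> hf hsj hI]]; split=> //=.
have hyn : ints s y 0 = n by rewrite hf.1.
rewrite hyn hsj -ltnNge; case: ltnP => hlt; last first.
  by apply: hQ => //; have <- : j = n by lia.
exists kb; first nia.
rewrite -[X in run _ _ _ X _]addn0.
apply: run_seq (hbody j s hlt hf hsj hI) _ => s' hf' hI'.
have hx' : ints s' x 0 = j by rewrite hf'.1.
apply: wp_run => /=; split=> //; first by rewrite hx'; split=> //; lia.
exists ((n - j.+1) * kb.+1); first by nia.
rewrite hx' addn1; exists j.+1; split=> //=; last by rewrite !eqxx.
apply: (@frame_trans _ _ _ _ s); first exact: hf.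
split=> [a i|a i] ha /=; last by rewrite hf'.2.
move: ha; rewrite inE negb_or => /andP[/negbTE -> ha] /=.
by rewrite hf'.1.
Qed.

Lemma run_le (R : realType) W c (s : state R) k k' Q :
  run W c s k Q -> k <= k' -> run W c s k' Q.
Proof. by move=> h hk; apply: run_weak h. Qed.

Lemma run_pre (R : realType) W c1 c2 (s : state R) k Q :
  wp W c1 (fun s' => run W c2 s' k Q) s -> run W (c1 ;; c2) s k Q.
Proof.
move=> h; rewrite -[k]add0n.
by apply: run_seq (wp_run h) _ => s' _.
Qed.

(* The translation done by [lia] is slow on large contexts, and most goals only
   need the facts about naturals. *)
Ltac nat_lia :=
  repeat match goal with
  | H : ?P |- _ => lazymatch P with
    | @eq nat _ _ => fail
    | is_true (leq _ _) => fail
    | is_true (andb (leq _ _) (leq _ _)) => fail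
    | _ => lazymatch type of P with Prop => clear H | _ => fail end
    end
  end; lia.
Ltac qlia := first [nat_lia | lia].
(* Discharges the bounds on intermediate integers. *)
Ltac bnd := solve [do ?split => //=; rewrite ?eqxx /= ?andbT ?andbF; qlia].
(* Splits the obligations of a store, or of a test, from its continuation. *)
Ltac sto := split; [bnd|bnd|].
Ltac tst := split; [bnd|].
Ltac step := apply: run_pre; rewrite /= ?eqxx /=.
Ltac safe := try bnd.

(** * Tournament sort *)

Notation sL := 50. Notation sO := 51. Notation sT := 52. Notation sP := 53. Notation sL1 := 54.
Notation aTR := 55. Notation aSO := 56. Notation aSK := 50.

(* The better of two entries of the tournament; an entry is a key index plus
   one, or 0 when no competitor is left. *)
Definition winner (R : numDomainType) (sk : nat -> R) a b :=
  if a == 0 then b else if (0 < b) && ~~ (sk a.-1 <= sk b.-1)%R then b else a.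

Definition Play : cmd :=
  If (ILe (ILoad aTR (IMul (IConst 2) ('v sP))) (IConst 0))
    (IStore aTR ('v sP) (ILoad aTR (IAdd (IMul (IConst 2) ('v sP)) (IConst 1))))
    (If (BAnd (ILe (IConst 1) (ILoad aTR (IAdd (IMul (IConst 2) ('v sP)) (IConst 1))))
          (BNot (RLe (RLoad aSK (ISub (ILoad aTR (IMul (IConst 2) ('v sP))) (IConst 1)))
            (RLoad aSK (ISub (ILoad aTR (IAdd (IMul (IConst 2) ('v sP)) (IConst 1))) (IConst 1))))))
      (IStore aTR ('v sP) (ILoad aTR (IAdd (IMul (IConst 2) ('v sP)) (IConst 1))))
      (IStore aTR ('v sP) (ILoad aTR (IMul (IConst 2) ('v sP))))).

(** The winner is output, its leaf [sL + sT] is emptied, and only the matches on the path from this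
    leaf to the root are replayed; this gives a logarithmic step without recursion. *)
Definition SortStep : cmd :=
  sT <~ ISub (ILoad aTR (IConst 1)) (IConst 1) ;;
  IStore aSO ('v sO) ('v sT) ;;
  sP <~ IAdd ('v sT) ('v sL) ;;
  IStore aTR ('v sP) (IConst 0) ;;
  sP <~ IDiv ('v sP) (IConst 2) ;;
  While (ILe (IConst 1) ('v sP)) (Play ;; sP <~ IDiv ('v sP) (IConst 2)).

Definition Sort : cmd :=
  For sO sL (IStore aTR (IAdd ('v sL) ('v sO)) (IAdd ('v sO) (IConst 1))) ;;
  sL1 <~ ISub ('v sL) (IConst 1) ;;
  For sO sL1 (sP <~ ISub ('v sL1) ('v sO) ;; Play) ;;
  For sO sL SortStep.

Section Sort.
Variables (R : realType) (W L : nat) (sk : nat -> R).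

Lemma winner_cases a b : winner sk a b = a \/ winner sk a b = b.
Proof. by rewrite /winner; case: ifP => _; [right|case: ifP; [right|left]]. Qed.

Lemma winner0 a b : (winner sk a b == 0) = (a == 0) && (b == 0).
Proof.
rewrite /winner; case: (eqVneq a 0) => //= ha; case: ifP => [/andP[hb _]|_].
  by rewrite eqn0Ngt hb.
exact: negbTE.
Qed.

Lemma winner_le a b x : x != 0 -> x = a \/ x = b -> (sk (winner sk a b).-1 <= sk x.-1)%R.
Proof.
rewrite /winner => hx hab; case: eqP => [a0|_].
  by case: hab => e; rewrite ?e //; rewrite e a0 in hx.
case: ifP => [/andP[hb h]|hf].
  by case: hab => ->; rewrite ?lexx // ltW // ltNge.
case: hab => e; rewrite e ?lexx //; move: hf.
by rewrite lt0n -e hx /= => /negbFE.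
Qed.

(* Every inner node t < L of the tree with children 2t and 2t+1 holds the winner. *)
Definition played (tr : nat -> nat) t := tr t = winner sk (tr (2 * t)) (tr (2 * t + 1)).

Lemma root_min tr u : (forall t, 0 < t < L -> played tr t) -> 0 < u < 2 * L -> tr u != 0 ->
  tr 1 != 0 /\ (sk (tr 1).-1 <= sk (tr u).-1)%R.
Proof.
move=> hp; elim/ltn_ind: u => u IH hu hu0.
case: (eqVneq u 1) => [e|hne]; first by rewrite e lexx -{1}e.
have hh : 0 < u./2 < L by qlia.
have e : tr u = tr (2 * u./2) \/ tr u = tr (2 * u./2 + 1).
  have := odd_double_half u; rewrite -mul2n; case: (odd u) => /= <-; [right|left]; congr tr; qlia.
have h0 : tr u./2 != 0.
  rewrite (hp _ hh) winner0; apply/negP => /andP[/eqP h1 /eqP h2].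
  by case: e => e; rewrite e ?h1 ?h2 in hu0.
have [h1 h2] := IH u./2 ltac:(qlia) ltac:(qlia) h0; split=> //.
by apply: le_trans h2 _; rewrite (hp _ hh); apply: winner_le.
Qed.

Lemma node_leaf tr u : (forall t, 0 < t < L -> played tr t) -> 0 < u < 2 * L -> tr u != 0 ->
  exists2 t, t < L & tr u = tr (L + t).
Proof.
move=> hp; have [k] := ubnP (2 * L - u); elim: k u => // k IH u hk hu hu0.
case: (leqP L u) => hLu; first by exists (u - L); [qlia|congr tr; qlia].
have := winner_cases (tr (2 * u)) (tr (2 * u + 1)); rewrite -(hp u) //; last by qlia.
by case=> e; rewrite e in hu0 *; apply: IH hu0; qlia.
Qed.

Definition sort_tree (outs : seq nat) (tr : nat -> nat) : Prop :=
  forall t, t < L -> tr (L + t) = if t \in outs then 0 else t.+1.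

Lemma Play_spec s p (Q : state R -> Prop) :
  ints s sP 0 = p -> (forall j, j < L -> reals s aSK j = sk j) -> 2 * L + 2 <= W -> p < L ->
  ints s aTR (2 * p) <= L -> ints s aTR (2 * p + 1) <= L -> 0 < p ->
  Q (State (upd (ints s) aTR p (winner sk (ints s aTR (2 * p)) (ints s aTR (2 * p + 1)))) (reals s)) ->
  wp W Play Q s.
Proof.
move=> hp hsk hW hpL h1 h2 p0 hQ.
move: hQ; rewrite /= hp /winner leqn0; case: eqP => e hQ.
  by do ?split => //; qlia.
split; first by do ?split => //; qlia.
set a := ints s aTR (2 * p) in h1 e hQ *; set b := ints s aTR (2 * p + 1) in h2 hQ *.
split; first by do ?split => //; qlia.
rewrite !subn1 hsk; last by qlia.
case: (posnP b) hQ => [b0|b0] /= hQ; first by do ?split => //; qlia.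
rewrite hsk; last by qlia.
by move: hQ; case: ifP => _ hQ; do ?split => //; qlia.
Qed.

Lemma free_leaf (outs : seq nat) : size outs < L -> exists2 t, t < L & t \notin outs.
Proof.
move=> hsz; suff /hasP[t] : has (fun t => t \notin outs) (iota 0 L).
  by rewrite mem_iota => ht ho; exists t.
rewrite has_predC; apply/negP => /allP h.
by have := uniq_leq_size (iota_uniq 0 L) h; rewrite size_iota leqNgt hsz.
Qed.

Lemma tree_le (outs : seq nat) tr t : (forall t, 0 < t < L -> played tr t) ->
  sort_tree outs tr -> 0 < t < 2 * L -> tr t <= L.
Proof.
move=> hp ht h; case: (posnP (tr t)) => [-> //|h0].
have [u hu ->] := node_leaf hp h (lt0n_neq0 h0).
by rewrite ht //; case: ifP.
Qed.

Lemma SortStep_spec s outs : size outs < L -> (forall t, t \in outs -> t < L) ->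
  2 * L + 2 <= W -> ints s sL 0 = L -> ints s sO 0 = size outs ->
  (forall j, j < L -> reals s aSK j = sk j) ->
  (forall t, 0 < t < L -> played (ints s aTR) t) -> sort_tree outs (ints s aTR) ->
  run W SortStep s (trunc_log 2 (2 * L)).+1 (fun s' => exists t, [/\ t < L, t \notin outs,
    forall t', t' < L -> t' \notin outs -> (sk t <= sk t')%R,
    forall i, ints s' aSO i = if i == size outs then t else ints s aSO i &
    (forall t, 0 < t < L -> played (ints s' aTR) t) /\ sort_tree (rcons outs t) (ints s' aTR)]).
Proof.
move=> hsz hlt hW hL hO hsk hpl htree.
have [t0 ht0 hn0] := free_leaf hsz.
have r0 t' : t' < L -> t' \notin outs -> ints s aTR 1 != 0 /\ (sk (ints s aTR 1).-1 <= sk t')%R.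
  move=> h1 h2; have := root_min hpl (u := L + t') ltac:(qlia).
  by rewrite htree // (negbTE h2) => /(_ isT).
have [root0 _] := r0 _ ht0 hn0.
have [t htL htr] := node_leaf hpl (u := 1) ltac:(qlia) root0.
have hto : t \notin outs.
  by apply: contraNN root0 => h; rewrite htr htree // h.
have et : ints s aTR 1 = t.+1 by rewrite htr htree // (negbTE hto).
rewrite /SortStep.
do 5! (step; rewrite ?et ?hL ?hO; sto).
set s1 := State _ _.
have tri := tree_le hpl htree.
(* Only the nodes p / 2 ^ e, on the path from p to the root, may hold an outdated winner. *)
pose J k (s : state R) := exists p, [/\ ints s sP 0 = p, k = (if p == 0 then 0 else (trunc_log 2 p).+1),
  p < L, forall t', 0 < t' < L -> played (ints s aTR) t' \/ exists e, t' = p %/ 2 ^ e &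
  sort_tree (rcons outs t) (ints s aTR) /\ forall t', 0 < t' < 2 * L -> ints s aTR t' <= L].
have ep : t.+1 - 1 + L = L + t by qlia.
apply: (@run_weak R W _ s1 (if (L + t) %/ 2 == 0 then 0 else (trunc_log 2 ((L + t) %/ 2)).+1) _
  (fun s' => J 0 s' /\ frame [:: aTR; sP] [::] s1 s')).
- case: eqP => // _; rewrite ltnS; apply: leq_trunc_log; qlia.
- move=> s' [[p [_ + _ hp [ht hle]]] fr]; case: eqP => // p0 _; exists t; split=> //.
  + by move=> t' h1 h2; have [_] := r0 t' h1 h2; rewrite et.
  + by move=> i; rewrite fr.1 //= subn1.
  + split=> // t' ht'; case: (hp t' ht') => // [[e]]; rewrite p0 div0n => e0.
    by rewrite e0 in ht'.
apply: (@run_while _ _ J); last first.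
  exists ((L + t) %/ 2); rewrite /= ep; split=> //; first by qlia.
    move=> t' ht'; case: (eqVneq t' ((L + t) %/ 2)) => [->|hne].
      by right; exists 0; rewrite expn0 divn1.
    left; have := hpl t' ht'; rewrite /played /=.
    have n1 : (t' == L + t) = false by qlia.
    have n2 : (2 * t' == L + t) = false by apply/negbTE; apply: contra hne => /eqP <-; rewrite mulKn.
    have n3 : (2 * t' + 1 == L + t) = false.
      by apply/negbTE; apply: contra hne => /eqP <-; rewrite mulnC divnMDl // addn0.
    by rewrite n1 n2 n3.
  split; last by move=> t' ht' /=; case: ifP => // _; apply: tri.
  move=> t' ht' /=; rewrite eqn_add2l mem_rcons inE htree //.
  by case: (eqVneq t' t) => [->|hne].
move=> k s' fr [p [hp hk hpL hpl' [ht' hle]]]; split; first by do ?split => //=; qlia.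
have hL' : ints s' sL 0 = L by rewrite fr.1 //= hL.
rewrite /= hp; case: ltnP => p0; last first.
  split; last by apply: frame_sub fr => a //; rewrite /= !inE; case/or3P => ->; rewrite ?orbT.
  exists p; split=> //; by rewrite ?hk; have -> : p = 0 by qlia.
exists 0; first by rewrite hk gtn_eqF.
apply: run_pre; apply: (Play_spec hp) => //; try (by apply: hle; qlia).
  by move=> j hj; rewrite fr.2 //= hsk.
apply: wp_run; rewrite /= ?eqxx /= hp; do ?split => //; safe.
exists (if p %/ 2 == 0 then 0 else (trunc_log 2 (p %/ 2)).+1).
  have -> : k = (trunc_log 2 p).+1 by rewrite hk; case: (p) p0.
  case: (eqVneq (p %/ 2) 0) => //= h.
  have hp1 : 1 < p by qlia.
  by rewrite (trunc_log2S hp1) -divn2 ltnS.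
exists (p %/ 2); rewrite /= ?eqxx; split=> //; first by qlia.
  move=> t' ht2; rewrite /played /=.
  case: (eqVneq t' p) => [etp|hne].
    left; rewrite etp; have -> : (2 * p == p) = false by qlia.
    by have -> : (2 * p + 1 == p) = false by qlia.
  case: (eqVneq (t' * 2) p) => [e2|hne2].
    by right; exists 0; rewrite expn0 divn1 -e2 mulnK.
  case: (eqVneq (t' * 2 + 1) p) => [e2|hne3].
    by right; exists 0; rewrite expn0 divn1 -e2 divnMDl // addn0.
  case: (hpl' t' ht2) => [h|[e he]].
    by left; rewrite ![2 * _]mulnC (negbTE hne2) (negbTE hne3) [_ * 2]mulnC.
  case: e he => [|e] he; first by rewrite he expn0 divn1 eqxx in hne.
  by right; exists e; rewrite -divnMA -expnS.
split.
  move=> t' htl /=; have -> : (L + t' == p) = false by qlia.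
  exact: ht'.
move=> t' ht2 /=; case: eqP => _; last exact: hle.
by case: (winner_cases (ints s' aTR (2 * p)) (ints s' aTR (2 * p + 1))) => ->; apply: hle; qlia.
Qed.

Lemma Sort_spec s : 2 * L + 2 <= W -> ints s sL 0 = L ->
  (forall j, j < L -> reals s aSK j = sk j) ->
  run W Sort s (L * (trunc_log 2 (2 * L) + 4) + 1) (fun s' => exists o : seq nat,
    [/\ perm_eq o (iota 0 L), forall j, j < L -> ints s' aSO j = nth 0 o j &
     forall j j', j <= j' < L -> (sk (nth 0 o j) <= sk (nth 0 o j'))%R]).
Proof.
move=> hW hL hsk.
apply: (@run_le _ _ _ _ (L * 1 + (L.-1 * 1 + L * (trunc_log 2 (2 * L)).+2))); last by qlia.
apply: (@run_seq _ _ _ _ _ _ _ (fun s => forall t, t < L -> ints s aTR (L + t) = t.+1)).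
  apply: (run_for (n := L) (I := fun j s => forall t, t < j -> ints s aTR (L + t) = t.+1)) => //.
  - by qlia.
  - move=> j s' hj fr hO hI; apply: wp_run; rewrite /= ?eqxx /= hO fr.1 //= hL.
    do ?split => //; safe.
    move=> t ht /=; rewrite eqn_add2l addn1; case: eqP => [->//|/eqP h].
    by apply: hI; qlia.
move=> s1 f1 h1.
have hL1 : ints s1 sL 0 = L by rewrite f1.1.
step; rewrite hL1; sto.
apply: (@run_seq _ _ _ _ _ _ _ (fun s => (forall t, 0 < t < L -> played (ints s aTR) t) /\
    sort_tree [::] (ints s aTR))).
  apply: (run_for (n := L.-1) (I := fun j (s : state R) => [/\ forall t, L.-1 - j < t < L -> played (ints s aTR) t,
    sort_tree [::] (ints s aTR) & forall t, L - j <= t < 2 * L -> ints s aTR t <= L])) => //=.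
  - by rewrite subn1.
  - by qlia.
  - split; first by qlia.
      by move=> t ht; rewrite /= h1.
    move=> t ht /=; have e : t = L + (t - L) by qlia. rewrite e h1. qlia. qlia.
  - move=> j s' hj fr hO [hI1 hI2 hI3].
    have hl' : ints s' sL1 0 = L.-1 by rewrite fr.1 //= subn1.
    apply: run_pre; rewrite /= hl' hO; split; safe.
    apply: wp_run; apply: (@Play_spec _ (L.-1 - j)) => //=; try qlia.
    + by move=> i hi; rewrite fr.2 //= f1.2 // hsk.
    + by rewrite hI3 //; qlia.
    + by rewrite hI3 //; qlia.
    have e2 : (2 * (L.-1 - j) == L.-1 - j) = false by qlia.
    have e3 : (2 * (L.-1 - j) + 1 == L.-1 - j) = false by qlia.
    split.
    + move=> t ht; rewrite /played /=; case: (eqVneq t (L.-1 - j)) => [->|hne].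
        by rewrite e2 e3.
      have -> : (2 * t == L.-1 - j) = false by qlia.
      have -> : (2 * t + 1 == L.-1 - j) = false by qlia.
      by apply: hI1; qlia.
    + move=> t ht /=; have -> : (L + t == L.-1 - j) = false by qlia.
      exact: hI2.
    + move=> t ht /=; case: eqP => [_|]; last by move=> ?; apply: hI3; qlia.
      by case: (winner_cases (ints s' aTR (2 * (L.-1 - j))) (ints s' aTR (2 * (L.-1 - j) + 1))) => ->;
        apply: hI3; qlia.
  - by move=> s' _ [h2 h3 _]; split=> // t ht; apply: h2; qlia.
move=> s2 f2 [h2 h3].
have hL2 : ints s2 sL 0 = L by rewrite f2.1 //= hL1.
pose J j (s : state R) := exists o : seq nat, [/\ size o = j, uniq o, forall t, t \in o -> t < L,
  forall i, i < j -> ints s aSO i = nth 0 o i & [/\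
  forall i t, i < j -> t < L -> t \notin take i o -> (sk (nth 0 o i) <= sk t)%R,
  forall t, 0 < t < L -> played (ints s aTR) t & sort_tree o (ints s aTR)]].
apply: (run_for (n := L) (I := J)) => //=; first by qlia.
- by exists [::]; split=> //; split.
- move=> j s3 hj fr hO [o [hs hu ho hi [hm hp ht]]].
  apply: run_weak (SortStep_spec (outs := o) _ ho hW _ _ _ hp ht); rewrite ?hs // ?fr.1 //; last first.
    by move=> i hij; rewrite fr.2 // f2.2 //= f1.2 // hsk.
  move=> s4 [t [htL hto htm hSO [hp4 ht4]]]; exists (rcons o t); split=> //=.
  + by rewrite size_rcons hs.
  + by rewrite rcons_uniq hto.
  + by move=> t'; rewrite mem_rcons inE => /orP[/eqP -> //|/ho].
  + move=> i hij; rewrite hSO nth_rcons ?hs; case: (ltngtP i j) => h; try qlia; by rewrite ?hi.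
  + split=> // i t' hij ht'; rewrite nth_rcons hs -cats1 take_cat hs.
    case: (ltngtP i j) => h; try qlia; first by apply: hm.
    by rewrite h subnn take0 cats0 => hn; apply: htm; rewrite ?h.
- move=> s3 _ [o [hs hu ho hi [hm _ _]]]; exists o; split=> //.
    apply: uniq_perm => //; first exact: iota_uniq.
    have hsub : {subset o <= iota 0 L} by move=> t /ho; rewrite mem_iota.
    have hsize : size (iota 0 L) <= size o by rewrite size_iota hs.
    by have [_ h] := uniq_min_size hu hsub hsize.
  move=> j j' /andP[hj hj']; apply: hm; first by apply: leq_ltn_trans hj hj'.
    by apply: ho; rewrite mem_nth // hs.
  rewrite -(cat_take_drop j o) cat_uniq in hu; case/and3P: hu => _ /hasPn h _.
  have : nth 0 o j' \in drop j o.
    by rewrite -{1}(subnKC hj) -nth_drop mem_nth // size_drop hs; qlia.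
  by move=> /h.
Qed.
End Sort.

(** * Region operations *)

(* Shared storage. Integers: sizes n, m, n * m and N, parents, nodes of the
   locations. Reals: weights, probabilities, depths. *)
Notation vn := 12. Notation vm := 13. Notation vM := 14. Notation vN := 15.
Notation aPAR := 20. Notation aLV := 21.
Notation aWGT := 2. Notation aPRB := 3. Notation aDEP := 20.
(* Storage of one side of the search. *)
Notation aREG := 80. Notation vK := 81. Notation aENT := 82. Notation vV := 83.
Notation vUP := 84. Notation vDD := 85. Notation vANC := 86. Notation aDIR := 87.
Notation aOFF := 80. Notation aFV := 81. Notation vLAM := 82. Notation aDST := 83.
Notation aON := 30. Notation aCNT := 31. Notation vr := 32. Notation vx := 33. Notation vy := 34.
Notation vr2 := 35. Notation vk1 := 36. Notation vi := 37. Notation vj := 38. Notation vidx := 39.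
Notation vi0 := 40. Notation ve := 41.
Notation aLD := 30. Notation racc := 31. Notation rtot := 32. Notation rum := 33. Notation rbal := 34.

Definition IEq e1 e2 := BAnd (ILe e1 e2) (ILe e2 e1).

Definition InitAll : cmd :=
  For vr vN (IStore aREG ('v vr) ('v vr)) ;;
  vK <~ ISub ('v vN) (IConst 1) ;;
  IStore aDIR ('v vN) ('v vN) ;;
  For vidx vM (IStore aENT ('v vidx) (ILoad aLV ('v vidx)) ;; RStore aOFF ('v vidx) (RConst 0)).

Definition Centroid : cmd :=
  vk1 <~ IAdd ('v vK) (IConst 1) ;;
  For vr vk1 (IStore aCNT (ILoad aREG ('v vr)) (IConst 1)) ;;
  For vr vK (
    vx <~ ILoad aREG (ISub ('v vK) ('v vr)) ;;
    vy <~ ILoad aPAR ('v vx) ;;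
    IStore aCNT ('v vy) (IAdd (ILoad aCNT ('v vy)) (ILoad aCNT ('v vx)))) ;;
  For vr vk1 (
    vx <~ ILoad aREG ('v vr) ;;
    If (ILe ('v vk1) (IMul (IConst 2) (ILoad aCNT ('v vx)))) (vV <~ 'v vx) Skip).

(** Vertices above v are marked in [aON], from the end of the list up. Then, parents first, [aLD]
    receives the depth of the lowest common ancestor with v, which gives the distance as in
    [tdistE]. *)
Definition EvalDist : cmd :=
  vk1 <~ IAdd ('v vK) (IConst 1) ;;
  For vr vk1 (IStore aON (ILoad aREG ('v vr)) (IConst 0)) ;;
  IStore aON ('v vV) (IConst 1) ;;
  For vr vK (
    vx <~ ILoad aREG (ISub ('v vK) ('v vr)) ;;
    If (ILe (IConst 1) (ILoad aON ('v vx))) (IStore aON (ILoad aPAR ('v vx)) (IConst 1)) Skip) ;;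
  For vr vk1 (
    vx <~ ILoad aREG ('v vr) ;;
    vy <~ ILoad aPAR ('v vx) ;;
    If (ILe (IConst 1) (ILoad aON ('v vx)))
      (RStore aLD ('v vx) (RLoad aDEP ('v vx)) ;;
       IStore aDIR ('v vx) (ILoad aPAR ('v vV)))
      (RStore aLD ('v vx) (RLoad aLD ('v vy)) ;;
       If (IEq ('v vy) ('v vV))
         (IStore aDIR ('v vx) ('v vx))
         (IStore aDIR ('v vx) (ILoad aDIR ('v vy)))) ;;
    RStore aDST ('v vx) (RSub (RAdd (RLoad aDEP ('v vV)) (RLoad aDEP ('v vx)))
      (RMul (RConst 2) (RLoad aLD ('v vx))))) ;;
  vUP <~ ILoad aDIR ('v vANC).

Definition EvalCost : cmd :=
  vLAM <~~ RConst 0 ;;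
  vi0 <~ IConst 0 ;;
  vidx <~ IConst 0 ;;
  For vi vn (
    racc <~~ RConst 0 ;;
    rtot <~~ RConst 0 ;;
    rum <~~ RConst 0 ;;
    For vj vm (
      ve <~ ILoad aENT ('v vidx) ;;
      racc <~~ RAdd ('r racc) (RMul (RLoad aPRB ('v vidx)) (RAdd (RLoad aOFF ('v vidx)) (RLoad aDST ('v ve)))) ;;
      rtot <~~ RAdd ('r rtot) (RLoad aPRB ('v vidx)) ;;
      If (IEq (ILoad aDIR ('v ve)) ('v vUP)) (rum <~~ RAdd ('r rum) (RLoad aPRB ('v vidx))) Skip ;;
      vidx <~ IAdd ('v vidx) (IConst 1)) ;;
    RStore aFV ('v vi) (RMul (RLoad aWGT ('v vi)) ('r racc)) ;;
    If (BAnd (RLe (RMul (RConst 2) ('r rum)) ('r rtot)) (RLe ('r vLAM) (RLoad aFV ('v vi))))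
      (vLAM <~~ RLoad aFV ('v vi) ;; vi0 <~ 'v vi)
      Skip).

(* The Boyer-Moore majority vote, by probability, over the directions of the
   locations of point i0. *)
Definition Vote : cmd :=
  vDD <~ ILoad aPAR ('v vV) ;;
  rbal <~~ RConst 0 ;;
  vidx <~ IMul ('v vi0) ('v vm) ;;
  For vj vm (
    ve <~ ILoad aDIR (ILoad aENT ('v vidx)) ;;
    If (IEq ('v ve) ('v vDD))
      (rbal <~~ RAdd ('r rbal) (RLoad aPRB ('v vidx)))
      (If (RLe (RLoad aPRB ('v vidx)) ('r rbal))
        (rbal <~~ RSub ('r rbal) (RLoad aPRB ('v vidx)))
        (vDD <~ 'v ve ;;
         rbal <~~ RSub (RLoad aPRB ('v vidx)) ('r rbal))) ;;
    vidx <~ IAdd ('v vidx) (IConst 1)).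

(** The list of edges is filtered in place: the write position [vr2] never passes the read
    position. *)
Definition Shrink : cmd :=
  For vidx vM (
    ve <~ ILoad aENT ('v vidx) ;;
    If (IEq (ILoad aDIR ('v ve)) ('v vDD)) Skip
      (RStore aOFF ('v vidx) (RAdd (RLoad aOFF ('v vidx)) (RLoad aDST ('v ve))) ;;
       IStore aENT ('v vidx) ('v vV))) ;;
  If (IEq ('v vDD) (ILoad aPAR ('v vV))) Skip (IStore aREG (IConst 0) ('v vV)) ;;
  vr2 <~ IConst 0 ;;
  For vr vK (
    vx <~ ILoad aREG (IAdd ('v vr) (IConst 1)) ;;
    If (IEq (ILoad aDIR ('v vx)) ('v vDD))
      (vr2 <~ IAdd ('v vr2) (IConst 1) ;; IStore aREG ('v vr2) ('v vx))
      Skip) ;;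
  vK <~ 'v vr2.

Section RegionOps.
Variables (R : realType) (I : instance R).
Hypothesis I_ok : instance_ok I.
Local Notation N := (size_t I).
Local Notation n := (npt I).
Local Notation m := (nloc I).
Local Notation dir := (dir (par I)).
Local Notation anc := (anc (par I)).
Local Notation tdist := (tdist N (par I) (pl I)).
Local Notation region := (region N (par I)).
Let parP := par_ok I_ok.

Record stored (s : state R) : Prop := Stored {
  st_n : ints s vn 0 = n;
  st_m : ints s vm 0 = m;
  st_M : ints s vM 0 = n * m;
  st_N : ints s vN 0 = N;
  st_par : forall x, x < N -> ints s aPAR x = par I x;
  st_lv : forall k, k < n * m -> ints s aLV k = node I k;
  st_wgt : forall i, i < n -> reals s aWGT i = wgt I i;
  st_prb : forall k, k < n * m -> reals s aPRB k = prb I k;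
  st_dep : forall x, x < N -> reals s aDEP x = depth N (par I) (pl I) x }.

Lemma stored_frame ia ra s s' : frame ia ra s s' ->
  all (fun a => a \notin ia) [:: vn; vm; vM; vN; aPAR; aLV] ->
  all (fun a => a \notin ra) [:: aWGT; aPRB; aDEP] -> stored s -> stored s'.
Proof.
move=> [fi fa] /= /and5P[h1 h2 h3 h4 /and3P[h5 h6 _]] /and4P[h7 h8 h9 _] [*].
by split=> *; rewrite ?fi ?fa //; auto.
Qed.

Definition reg_at rho E (s : state R) : Prop :=
  ints s vK 0 = size E /\ forall r, r <= size E -> ints s aREG r = nth 0 (rho :: E) r.

Definition ent_at rho E (s : state R) : Prop := forall k, k < n * m ->
  [/\ ints s aENT k \in rho :: E, enters (par I) E (node I k) (ints s aENT k) &
      reals s aOFF k = tdist (node I k) (ints s aENT k)].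

Definition dist_at rho E v (s : state R) : Prop := forall x, x \in rho :: E ->
  ints s aDIR x = dir v x /\ reals s aDST x = tdist v x.

Lemma region_lt rho E x : region rho E -> x \in rho :: E -> x < N.
Proof.
move=> rg; rewrite inE => /orP[/eqP ->|/(region_gt rg)]; last by qlia.
have := region_ne rg; case eE : E => [//|c E'] _.
by have := region_gt rg (c := c); rewrite eE mem_head => /(_ isT); qlia.
Qed.

(* Counting subtree sizes from the leaves up: a child is listed after its parent. *)
Definition below_count rho E x := count (anc x) (rho :: E).

(** A vertex of the region strictly below x is below exactly one child of x, and this child belongs
    to the region because regions are connected. *)
Lemma below_count_rec rho E x : region rho E -> x \in rho :: E ->
  below_count rho E x = 1 + \sum_(y <- E | par I y == x) below_count rho E y.
Proof.
move=> rg hx; have huniq : uniq (rho :: E).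
  rewrite cons_uniq (sorted_uniq ltn_trans ltnn (region_sorted rg)) andbT.
  by apply/negP => /(region_gt rg); rewrite ltnn.
have cnt x' : below_count rho E x' = \sum_(e <- rho :: E) (anc x' e : nat).
  by rewrite /below_count -sum1_count big_mkcond; apply: eq_bigr => e _; case: (anc _ _).
have huniqE : uniq E by move: huniq; rewrite cons_uniq => /andP[].
have key e : e \in rho :: E ->
    (anc x e : nat) = (e == x) + \sum_(y <- E) (if par I y == x then (anc y e : nat) else 0).
  move=> he; have zero : (anc x e -> e = x) -> \sum_(y <- E) (if par I y == x then (anc y e : nat) else 0) = 0.
    move=> hz; rewrite big1_seq // => y /andP[_ hyE]; case: eqP => // hy.
    have y0 : 0 < y by have := region_gt rg hyE; qlia.
    case: (boolP (anc y e)) => // hye.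
    have hxe : anc x e by apply: anc_trans hye => //; apply: anc_up; rewrite // hy ancxx.
    by have := anc_le parP hye; rewrite (hz hxe) -hy; have := proj2 parP _ y0; qlia.
  case: (eqVneq e x) => [ex|hne]; first by rewrite (zero (fun _ => ex)) ex ancxx.
  case: (boolP (anc x e)) => hxe; last by rewrite zero //; rewrite (negbTE hxe).
  have [y [y0 hy hye]] := child_ex parP hxe hne.
  have hyr : ~~ anc y rho.
    apply/negP => h; have := anc_le parP h; have := proj2 parP _ y0; rewrite hy.
    by have := anc_le parP (region_anc parP rg hx); qlia.
  have heE : e \in E.
    by move: he; rewrite inE => /orP[/eqP e1|//]; rewrite -e1 hye in hyr.
  have hyE := region_anc_mem parP rg heE hye hyr.
  rewrite (bigD1_seq y) //= hy eqxx hye big1_seq // => z /andP[hzy hzE].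
  case: eqP => // hz; case: (boolP (anc z e)) => // hze.
  have z0 : 0 < z by have := region_gt rg hzE; qlia.
  by rewrite (child_uniq parP z0 y0 _ hze hye) ?eqxx // ?hz ?hy in hzy.
have split y : (if par I y == x then below_count rho E y else 0) =
    \sum_(e <- rho :: E) (if par I y == x then (anc y e : nat) else 0).
  by case: ifP => _; rewrite ?cnt // big1.
rewrite cnt [X in _ = 1 + X]big_mkcond /= (eq_bigr _ (fun y _ => split y)) exchange_big /=.
rewrite big_seq (eq_bigr _ (fun e => key e)) -big_seq big_split /=; congr (_ + _).
rewrite -(big_mkcond (fun e => e == x)) /= sum1_count.
by rewrite (count_uniq_mem x huniq) hx.
Qed.

Lemma below_count_root rho E : region rho E -> below_count rho E rho = (size E).+1.
Proof.
move=> rg; rewrite /below_count -[RHS]/(size (rho :: E)); apply/eqP.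
by rewrite -all_count; apply/allP => x hx; apply: region_anc rg hx.
Qed.

Lemma region_uniq rho E : region rho E -> uniq E.
Proof. by move=> rg; apply: sorted_uniq (region_sorted rg) => //; [exact: ltn_trans|exact: ltnn]. Qed.

Lemma child_later rho E j y x : region rho E -> j < size E -> x = nth 0 (rho :: E) j ->
  y \in E -> par I y = x -> y \in drop j E.
Proof.
move=> rg hj -> hy hp; have hy0 : 0 < y by have := region_gt rg hy; qlia.
have hlt := proj2 parP _ hy0; rewrite hp in hlt.
have := hy; rewrite -{1}(cat_take_drop j E) mem_cat => /orP[h|//]; exfalso.
have hi := h; rewrite -index_mem size_takel in hi; last exact: ltnW.
have hs := region_sorted rg.
have ey : y = nth 0 E (index y (take j E)) by rewrite -(nth_take 0 hi) nth_index.
case: j hj hi hlt {h hp} ey => [|j] // hj hi hlt ey; move: hlt; rewrite {1}[y]ey /=.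
set a := index _ _ in hi ey *; case: (ltngtP a j) => h; last 1 first.
- by rewrite h ltnn.
- have hl : nth 0 E a < nth 0 E j by apply: (sorted_ltn_nth ltn_trans 0 hs); rewrite ?inE //; qlia.
  by qlia.
- by qlia.
Qed.

(** Cutting K edges at v leaves at most (K + 1) / 2 of them, which is less than K as long as K >
    1. *)
Definition balanced v E := forall d, 2 * count (fun c => dir v c == d) E <= (size E).+1.

Lemma balanced_interior v E : 1 < size E -> balanced v E -> interior (par I) v E.
Proof.
move=> hs hb d; have := hb d; case: (boolP (has (fun c => dir v c != d) E)) => [/hasP[c]|].
  by exists c.
by rewrite has_predC negbK all_count => /eqP ->; qlia.
Qed.

(** Children are listed after their parent, so the last heavy vertex has no heavy child: each
    downward direction is light. As at least half of the vertices are at or below v, at most half of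
    K + 1 edges are seen upwards. *)
Lemma last_heavy_balanced rho E v : region rho E -> v \in rho :: E ->
  (size E).+1 <= 2 * below_count rho E v ->
  (forall y, y \in E -> par I y = v -> 2 * below_count rho E y < (size E).+1) -> balanced v E.
Proof.
move=> rg hv hge hlt d.
have down y : y \in E -> par I y = v -> count (fun c => dir v c == y) E <= below_count rho E y.
  move=> hy hp; rewrite /below_count /=; apply: leq_trans (leq_addl _ _).
  apply: sub_count => c /= /eqP; case: (dirP parP v c) => [b h1 h2 h3 _ _ <- //|_ e].
  by have := par_le parP v; have := proj2 parP y; have := region_gt rg hy; qlia.
case: (boolP (has (fun c => dir v c == d) E)) => [/hasP[c hc /eqP hd]|]; last first.
  by rewrite has_count -leqNgt leqn0 => /eqP ->.
move: hd; case: (dirP parP v c) => [y h1 h2 h3 h4 h5|h] hd.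
  have hyE : y \in E.
    apply: (region_anc_mem parP rg hc h3); apply/negP => hyr; have := anc_le parP hyr.
    by have := proj2 parP _ h1; have := anc_le parP (region_anc parP rg hv); qlia.
  by have := down _ hyE h2; have := hlt _ hyE h2; rewrite hd; qlia.
have hve : v \in E.
  move: hv; rewrite inE => /orP[/eqP e|//]; move: h; rewrite e (region_anc parP rg) /=.
    by move/eqP => e2; have := region_gt rg hc; rewrite e2 ltnn.
  by rewrite inE hc orbT.
have hs : below_count rho E v = 1 + count (fun x => anc v x && (x != v)) E.
  rewrite /below_count /= (_ : anc v rho = false) ?add0n; last first.
    by apply/negP => /(anc_le parP); have := region_gt rg hve; qlia.
  set q := fun x : nat => anc v x && (x != v).
  have e1 : count (anc v) E = count (predU (pred1 v) q) E.
    by apply: eq_count => x; rewrite /q /=; case: eqP => [->|_]; rewrite ?ancxx ?andbT.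
  have e2 : count (predI (pred1 v) q) E = 0.
    rewrite -(count_pred0 E); apply: eq_count => x; rewrite /q /=.
    by case: eqP => //= _; rewrite andbF.
  rewrite e1 -[LHS]addn0 -e2 count_predUI (count_uniq_mem v (region_uniq rg)).
  by rewrite hve e2.
have hc2 : count (fun c => dir v c == d) E + count (fun x => anc v x && (x != v)) E <= size E.
  rewrite -(count_predC (fun x => anc v x && (x != v)) E) addnC leq_add2l.
  apply: sub_count => x /=; rewrite -hd; case: (dirP parP v x) => [b k1 k2 k3 k4 k5 /eqP e|].
    by have := proj2 parP _ k1; have := par_le parP v; rewrite k2; qlia.
  by rewrite negb_and negbK.
qlia.
Qed.

Variable W : nat.
Hypothesis W_ok : 4 * N + n * m + n + m + 10 <= W.

Lemma InitAll_spec s : stored s -> run W InitAll s (N + n * m) (fun s' =>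
  [/\ reg_at 0 (edges I) s', ent_at 0 (edges I) s', ints s' aDIR N = N &
      forall k, k < n * m -> ints s' aENT k = node I k]).
Proof.
move=> st; have [e1 e2] := (st_N st, st_M st); have hN := size_gt1 I_ok.
rewrite -[N + _]/(N + (n * m)) -[X in run _ _ _ (X + _)]muln1 -[X in run _ _ _ (_ + X)]muln1.
apply: (@run_seq _ _ _ _ _ _ _ (fun s' => forall r, r < N -> ints s' aREG r = r)).
  apply: (run_for (I := fun j (s : state R) => forall r, r < j -> ints s aREG r = r) (n := N)) => //.
  - by qlia.
  move=> j s' hj fr hr hI; apply: wp_run; rewrite /= hr; sto.
  by move=> r hr' /=; case: eqP => [->|?] //=; apply: hI; qlia.
move=> s1 f1 h1; have e1' : ints s1 vN 0 = N by rewrite f1.1.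
step; rewrite e1'; sto.
step; rewrite e1'; sto.
apply: (run_for (I := fun j (s : state R) => forall k, k < j ->
  ints s aENT k = node I k /\ reals s aOFF k = 0%R) (n := n * m)) => //=.
- by rewrite f1.1.
- by qlia.
- move=> j s' hj fr hr hI; apply: wp_run; rewrite /= ?eqxx /= hr; do 2 sto.
  move=> k hk /=; case: eqP => [->|?] /=; last by apply: hI; qlia.
  by rewrite fr.1 //= f1.1 // (st_lv st).
- move=> s' fr hI; split.
  + rewrite /reg_at fr.1 //= /edges size_iota; split; first by qlia.
    move=> r hr; rewrite fr.1 //= h1; last by qlia.
    have -> : (0 :: iota 1 N.-1) = iota 0 N by case: (N) hN.
    by rewrite nth_iota; qlia.
  + move=> k hk; have [-> ->] := hI k hk; have := node_ok I_ok hk => hn.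
    split; rewrite ?tdistxx //; last by left.
    by rewrite inE (mem_edges I_ok) hn andbT; case: (node I k).
  + by rewrite fr.1 //= eqxx.
  + by move=> k /hI[].
Qed.

End RegionOps.

Section RegionSpecs.
Variables (R : realType) (I : instance R).
Hypothesis I_ok : instance_ok I.
Local Notation N := (size_t I).
Local Notation n := (npt I).
Local Notation m := (nloc I).
Local Notation region := (region N (par I)).
Local Notation below_count := (below_count I).
Let parP := par_ok I_ok.

Lemma region_size rho E : region rho E -> size E < N.
Proof.
move=> rg; have hs : {subset rho :: E <= iota 0 N}.
  by move=> x hx; rewrite mem_iota /=; apply: region_lt hx.
have hu : uniq (rho :: E).
  rewrite cons_uniq (region_uniq rg) andbT.
  by apply/negP => /(region_gt rg); rewrite ltnn.
by have := uniq_leq_size hu hs; rewrite size_iota.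
Qed.

Lemma reg_at_frame ia ra rho E (s s' : state R) : frame ia ra s s' ->
  all (fun a => a \notin ia) [:: aREG; vK] -> reg_at rho E s -> reg_at rho E s'.
Proof.
move=> [fi _] /= /and3P[h1 h2 _] [h3 h4]; split; first by rewrite fi.
by move=> r hr; rewrite fi // h4.
Qed.

Lemma nth_region_mem (rho : nat) E r : r <= size E -> nth 0 (rho :: E) r \in rho :: E.
Proof. by move=> h; apply: mem_nth. Qed.

Lemma nth_region_inj rho E r r' : region rho E -> r <= size E -> r' <= size E ->
  (nth 0 (rho :: E) r == nth 0 (rho :: E) r') = (r == r').
Proof.
move=> rg hr hr'; apply: nth_uniq => //.
rewrite cons_uniq (region_uniq rg) andbT.
by apply/negP => /(region_gt rg); rewrite ltnn.
Qed.

Lemma drop_nth_sum (F : nat -> nat) (P : pred nat) E j : 0 < j <= size E ->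
  \sum_(y <- drop j.-1 E | P y) F y =
  (if P (nth 0 E j.-1) then F (nth 0 E j.-1) else 0) + \sum_(y <- drop j E | P y) F y.
Proof.
move=> hj; rewrite (drop_nth 0); last by qlia.
by rewrite prednK ?big_cons; [case: ifP|qlia].
Qed.

Variable W : nat.
Hypothesis W_ok : 4 * N + n * m + n + m + 10 <= W.

Lemma Centroid_spec rho E s : stored I s -> region rho E -> reg_at rho E s -> 1 < size E ->
  run W Centroid s (3 * (size E).+1) (fun s' =>
    [/\ ints s' vV 0 \in E, interior (par I) (ints s' vV 0) E & balanced I (ints s' vV 0) E]).
Proof.
move=> st rg [hK hreg] hE; set K := size E in hK hreg hE *.
have hKN := region_size rg; rewrite -/K in hKN.
apply: (@run_le _ _ _ _ (K.+1 * 1 + (K * 1 + K.+1 * 1))); last by qlia.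
step; rewrite hK; sto; rewrite addn1; set s0 := State _ _.
apply: (@run_seq _ _ _ _ _ _ _ (fun s => forall x, x \in rho :: E -> ints s aCNT x = 1)).
  apply: (run_for (n := K.+1)
    (I := fun j (s : state R) => forall r, r < j -> ints s aCNT (nth 0 (rho :: E) r) = 1)) => //=.
  - by qlia.
  - move=> j s1 hj fr hr hI; apply: wp_run; rewrite /= hr fr.1 //= hreg //; sto.
    move=> r hr' /=; case: eqP => // hne; apply: hI; case: (ltngtP r j) => // h; last by rewrite h in hne.
    by qlia.
  - by move=> s1 _ hI x /(nthP 0)[r hr <-]; apply: hI.
move=> s1 f1 h1.
have regs1 : reg_at rho E s1 by apply: reg_at_frame f1 _ _.
have st0 : stored I s0 by case: st => *; split.
have st1 := stored_frame f1 isT isT st0.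
have hK1 := proj1 regs1; rewrite -/K in hK1.
apply: (@run_seq _ _ _ _ _ _ _ (fun s => forall x, x \in rho :: E -> ints s aCNT x = below_count rho E x)).
  apply: (run_for (n := K) (I := fun j (s : state R) => forall x, x \in rho :: E ->
    ints s aCNT x = 1 + \sum_(y <- drop (K - j) E | par I y == x) below_count rho E y)) => //=.
  - by qlia.
  - by move=> x hx; rewrite subn0 drop_size big_nil h1.
  - move=> j s2 hj fr hr hI; have [hK2 hreg2] := reg_at_frame fr isT regs1.
    have st2 := stored_frame fr isT isT st1; rewrite -/K in hK2 hreg2.
    set x := nth 0 E (K - j).-1.
    have hpos : 0 < K - j by qlia.
    have ex : nth 0 (rho :: E) (K - j) = x by rewrite /x -{1}(prednK hpos).
    have hxE : x \in E by apply: mem_nth; rewrite -/K; qlia.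
    have hxN : x < N by have := region_gt rg hxE; qlia.
    have hx : x \in rho :: E by rewrite inE hxE orbT.
    have hpx := region_par rg hxE.
    have cx : ints s2 aCNT x = below_count rho E x.
      rewrite hI // (below_count_rec I_ok rg hx); congr (1 + _).
      set F := below_count rho E; rewrite -{2}(cat_take_drop (K - j) E) big_cat /= [X in _ = X + _]big1_seq ?add0n // => y /andP[/eqP hp hy].
      have hyE := mem_take hy.
      have := child_later I_ok rg (j := K - j) _ (esym ex) hyE hp.
      have := region_uniq rg; rewrite -{1}(cat_take_drop (K - j) E) cat_uniq => /and3P[_ /hasPn h _] h2.
      have hy2 : y \in drop (K - j) E.
        case: (ltnP (K - j) K) => hlt; first exact: h2.
        have e0 : K - j = K by qlia.
        have : x < y by have := proj2 parP y; have := region_gt rg hyE; rewrite hp; qlia.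
        have := region_sorted rg => hs.
        have hi : index y E < K by rewrite index_mem.
        have hle : y <= x.
          rewrite /x e0 -{1}(nth_index 0 hyE); case: (ltngtP (index y E) K.-1) => h'; last by rewrite h'.
            by apply/ltnW/(sorted_ltn_nth ltn_trans 0 hs); rewrite ?inE //; qlia.
          by qlia.
        by qlia.
      by have := h _ hy2; rewrite hy.
    have hcle z : z \in rho :: E -> below_count rho E z <= K.+1.
      by move=> _; rewrite /(below_count _ _); apply: (leq_trans (count_size _ _)).
    have cp : ints s2 aCNT (par I x) <= N.
      rewrite hI //; apply: leq_trans (_ : below_count rho E (par I x) <= N).
        rewrite (below_count_rec I_ok rg hpx) leq_add2l; set F := below_count rho E.
        rewrite -{2}(cat_take_drop (K - j) E) big_cat /=.
        exact: leq_addl.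
      exact: leq_trans (hcle _ hpx) hKN.
    have cx' := hcle _ hx.
    apply: wp_run; rewrite /= ?eqxx /= hK2 hr hreg2; last by qlia.
    rewrite ex (st_par st2) //; do 2 sto; split; [bnd| |].
      by do ?split => //; rewrite cx; qlia.
    move=> z hz /=; have -> : K - j.+1 = (K - j).-1 by qlia.
    rewrite drop_nth_sum; last by rewrite -/K; qlia.
    rewrite -/x eq_sym; case: eqP => [->|_]; last by rewrite add0n hI // eq_sym.
    by rewrite (hI _ hz) cx; qlia.
  - move=> s2 _ hI x hx; rewrite hI // subnn drop0.
    by rewrite (below_count_rec I_ok rg hx).
move=> s2 f2 h2.
have regs2 : reg_at rho E s2 by apply: reg_at_frame f2 _ _.
have hk2 : ints s2 vk1 0 = K.+1 by rewrite f2.1 // f1.1.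
(* The root of the region is heavy and comes first, so [vV] is set in the first round; from then on
   it holds the last heavy vertex seen. *)
apply: (run_for (n := K.+1) (I := fun j (s : state R) => j = 0 \/
   exists r, [/\ r <= K, ints s vV 0 = nth 0 (rho :: E) r, K.+1 <= 2 * below_count rho E (nth 0 (rho :: E) r) &
     forall r', r < r' < j -> 2 * below_count rho E (nth 0 (rho :: E) r') < K.+1])) => //=.
- by qlia.
- by left.
- move=> j s3 hj fr hr hI; have [hK3 hreg3] := reg_at_frame fr isT regs2.
  set x := nth 0 (rho :: E) j.
  have hx : x \in rho :: E by apply: nth_region_mem.
  have hc : ints s3 aCNT x = below_count rho E x by rewrite fr.1 // h2.
  have hcle : below_count rho E x <= K.+1 by apply: (leq_trans (count_size _ _)).
  have hk3 : ints s3 vk1 0 = K.+1 by rewrite fr.1.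
  apply: wp_run; rewrite /= ?eqxx /= hr hreg3 // -/x; sto; split; first by rewrite hc; bnd.
  rewrite /= hc hk3; case: ifP => hle.
    by sto; right; exists j; split=> //; rewrite ?eqxx // => r'; qlia.
  case: hI => [j0|[r [h3 h4 h5 h6]]].
    by move: hle; rewrite /x j0 /= (below_count_root I_ok rg) -/K; qlia.
  right; exists r; split=> // r' hr'; case: (eqVneq r' j) => [->|hne]; first by move: hle; rewrite /x; qlia.
  by apply: h6; qlia.
- move=> s3 _ [//|[r [h3 h4 h5 h6]]].
  have hv : ints s3 vV 0 \in rho :: E by rewrite h4; apply: nth_region_mem.
  have hb : balanced I (ints s3 vV 0) E.
    apply: (last_heavy_balanced I_ok rg) => //; first by rewrite h4.
    move=> y hyE hp; have hy : y \in rho :: E by rewrite inE hyE orbT.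
    have := hy; case/(nthP 0) => r' hr' er'.
    rewrite -er'; apply: h6; move: (hr') => /= ->; rewrite andbT.
    rewrite ltnNge; apply/negP => hle.
    have hlt : nth 0 (rho :: E) r < nth 0 (rho :: E) r'.
      by rewrite er' -h4 -hp; apply: (proj2 parP); have := region_gt rg hyE; qlia.
    have hs : sorted ltn (rho :: E).
      rewrite /= path_min_sorted ?(region_sorted rg) //.
      by apply/allP => z hz /=; have := region_gt rg hz; qlia.
    case: (ltngtP r' r) hle => // h _; last by rewrite h ltnn in hlt.
    have hs2 : nth 0 (rho :: E) r' < nth 0 (rho :: E) r.
      by apply: (sorted_ltn_nth ltn_trans 0 hs); rewrite ?inE.
    by qlia.
  have hi := balanced_interior hE hb; split=> //.
  exact: interior_mem rg hi hv.
Qed.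

End RegionSpecs.

Section RegionSpecs.
Variables (R : realType) (I : instance R).
Hypothesis I_ok : instance_ok I.
Local Notation N := (size_t I).
Local Notation n := (npt I).
Local Notation m := (nloc I).
Local Notation dir := (dir (par I)).
Local Notation anc := (anc (par I)).
Local Notation tdist := (tdist N (par I) (pl I)).
Local Notation depth := (depth N (par I) (pl I)).
Local Notation meet_depth := (meet_depth N (par I) (pl I)).
Local Notation region := (region N (par I)).
Let parP := par_ok I_ok.
Variable W : nat.
Hypothesis W_ok : 4 * N + n * m + n + m + 10 <= W.

Lemma EvalDist_spec rho E v s : stored I s -> region rho E -> reg_at rho E s ->
  v \in rho :: E -> ints s vV 0 = v ->
  run W EvalDist s (3 * (size E).+1) (fun s' => [/\ dist_at I rho E v s',
    ints s' vUP 0 = ints s' aDIR (ints s vANC 0) &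
    forall x, x \notin rho :: E -> ints s' aDIR x = ints s aDIR x]).
Proof.
move=> st rg [hK hreg] hv hV; set K := size E in hK hreg *.
have hKN := region_size rg; rewrite -/K in hKN.
apply: (@run_le _ _ _ _ (K.+1 * 1 + (K * 1 + K.+1 * 1))); last by qlia.
step; rewrite hK; sto; rewrite addn1; set s0 := State _ _.
have st0 : stored I s0 by case: st => *; split.
have reg0 : reg_at rho E s0 by split.
apply: (@run_seq _ _ _ _ _ _ _ (fun s => forall x, x \in rho :: E -> ints s aON x = 0)).
  apply: (run_for (n := K.+1)
    (I := fun j (s : state R) => forall r, r < j -> ints s aON (nth 0 (rho :: E) r) = 0)) => //=.
  - by qlia.
  - move=> j s1 hj fr hr hI; apply: wp_run; rewrite /= hr fr.1 //= hreg //; sto.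
    move=> r hr' /=; case: eqP => // hne; apply: hI; case: (ltngtP r j) => // h; last by rewrite h in hne.
    by qlia.
  - by move=> s1 _ hI x /(nthP 0)[r hr <-]; apply: hI.
move=> s1 f1 h1; have hV1 : ints s1 vV 0 = v by rewrite f1.1.
have reg1 := reg_at_frame f1 isT reg0; have st1 := stored_frame f1 isT isT st0.
step; rewrite hV1; sto; set s1' := State _ _.
have reg1' : reg_at rho E s1' by split; [case: reg1|case: reg1 => _].
have st1' : stored I s1' by case: st1 => *; split.
apply: (@run_seq _ _ _ _ _ _ _ (fun s => forall x, x \in rho :: E -> ints s aON x = anc x v)).
  apply: (run_for (n := K) (I := fun j (s : state R) => forall x, x \in rho :: E ->
    ints s aON x = (x == v) || has (fun y => (par I y == x) && anc y v) (drop (K - j) E))) => //=.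
  - by case: reg1'.
  - by qlia.
  - by move=> x hx; rewrite subn0 drop_size /= orbF; case: eqP => // _; rewrite h1.
  - move=> j s2 hj fr hr hI; have [hK2 hreg2] := reg_at_frame fr isT reg1'.
    have st2 := stored_frame fr isT isT st1'; rewrite -/K in hK2 hreg2.
    have hpos : 0 < K - j by qlia.
    set x := nth 0 E (K - j).-1.
    have ex : nth 0 (rho :: E) (K - j) = x by rewrite /x -{1}(prednK hpos).
    have hxE : x \in E by apply: mem_nth; rewrite -/K; qlia.
    have hxN : x < N by have := region_gt rg hxE; qlia.
    have hx : x \in rho :: E by rewrite inE hxE orbT.
    have onx : ints s2 aON x = anc x v.
      rewrite hI //; congr nat_of_bool; apply/idP/idP.
        case/orP => [/eqP ->|/hasP[y _ /andP[/eqP <- h]]]; first by rewrite ancxx.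
        by apply: anc_trans h => //; apply: anc_up; rewrite // ancxx.
      move=> hxv; case: (eqVneq x v) => //= hne.
      have [y [y0 hy hyv]] := child_ex parP hxv ltac:(by rewrite eq_sym).
      have hrx : rho < x by have := region_gt rg hxE; qlia.
      have hyr : ~~ anc y rho.
        by apply/negP => /(anc_le parP); have := proj2 parP _ y0; rewrite hy; qlia.
      have hvE : v \in E.
        move: hv; rewrite inE => /orP[/eqP e|//]; by rewrite -e hyv in hyr.
      have hyE := region_anc_mem parP rg hvE hyv hyr.
      apply/hasP; exists y; rewrite ?hy ?eqxx //.
      case: (ltnP (K - j) K) => hlt; first exact: (child_later I_ok rg hlt (esym ex)).
      have e0 : (K - j).-1 = K.-1 by qlia.
      have hi : index y E < K by rewrite index_mem.
      have hle : y <= x.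
        rewrite /x e0 -{1}(nth_index 0 hyE); case: (ltngtP (index y E) K.-1) => h'; last by rewrite h'.
          by apply/ltnW/(sorted_ltn_nth ltn_trans 0 (region_sorted rg)); rewrite ?inE //; qlia.
        by qlia.
      by have := proj2 parP _ y0; rewrite hy; qlia.
    have dropE : drop (K - j.+1) E = x :: drop (K - j) E.
      have -> : K - j.+1 = (K - j).-1 by qlia.
      by rewrite (drop_nth 0) ?prednK // -/K; qlia.
    apply: wp_run; rewrite /= ?eqxx /= hK2 hr hreg2; last by qlia.
    rewrite ex; sto; tst; rewrite /= onx; case: ifP => hon.
      rewrite ?eqxx /= (st_par st2) //; sto => z hz /=.
      rewrite dropE /= eq_sym; case: (eqVneq (par I x) z) => /= hne; last by rewrite hI.
      by case: (anc x v) hon; rewrite ?orbT.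
    move=> z hz /=; rewrite dropE /= hI //.
    by case: (anc x v) hon; rewrite ?andbF.
  - move=> s2 _ hI x hx; rewrite hI // subnn drop0; congr nat_of_bool; apply/idP/idP.
      case/orP => [/eqP ->|/hasP[y _ /andP[/eqP <- h]]]; first by rewrite ancxx.
      by apply: anc_trans h => //; apply: anc_up; rewrite // ancxx.
    move=> hxv; case: (eqVneq x v) => //= hne.
    have [y [y0 hy hyv]] := child_ex parP hxv ltac:(by rewrite eq_sym).
    have hrx : rho <= x by apply: anc_le (region_anc parP rg hx).
    have hyr : ~~ anc y rho.
      by apply/negP => /(anc_le parP); have := proj2 parP _ y0; rewrite hy; qlia.
    have hvE : v \in E.
      move: hv; rewrite inE => /orP[/eqP e|//]; by rewrite -e hyv in hyr.
    have hyE := region_anc_mem parP rg hvE hyv hyr.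
    by apply/hasP; exists y; rewrite ?hy ?eqxx.
move=> s2 f2 h2; have reg2 := reg_at_frame f2 isT reg1'; have st2 := stored_frame f2 isT isT st1'.
have hV2 : ints s2 vV 0 = v by rewrite f2.1.
have hvN := region_lt rg hv.
rewrite -[K.+1 * 1]addn0.
apply: (@run_seq _ _ _ _ _ _ _ (fun s' => dist_at I rho E v s' /\
   forall x, x \notin rho :: E -> ints s' aDIR x = ints s2 aDIR x)).
  apply: (run_for (n := K.+1) (I := fun j (s : state R) => (forall r, r < j ->
    let x := nth 0 (rho :: E) r in
    [/\ ints s aDIR x = dir v x, reals s aLD x = meet_depth v x & reals s aDST x = tdist v x]) /\
    forall x, x \notin rho :: E -> ints s aDIR x = ints s2 aDIR x)) => //=.
  - by rewrite f2.1 //= f1.1.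
  - by qlia.
  - move=> j s3 hj fr hr [hI hout]; have [hK3 hreg3] := reg_at_frame fr isT reg2.
    have st3 := stored_frame fr isT isT st2; rewrite -/K in hK3 hreg3.
    set x := nth 0 (rho :: E) j.
    have hx : x \in rho :: E by apply: nth_region_mem.
    have hxN := region_lt rg hx.
    have hon : ints s3 aON x = anc x v by rewrite fr.1 // h2.
    have hV3 : ints s3 vV 0 = v by rewrite fr.1.
    have hI' r : r < j -> nth 0 (rho :: E) r == x = false.
      by move=> h; rewrite (nth_region_inj rg) ?ltn_eqF //; rewrite -/K; qlia.
    have hpx : ~~ anc x v -> exists2 r, r < j & par I x = nth 0 (rho :: E) r.
      move=> hxv; have hxE : x \in E.
        move: hx; rewrite inE => /orP[/eqP e|//]; by rewrite e (region_anc parP rg hv) in hxv.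
      have hp := region_par rg hxE; case/(nthP 0): (hp) => r hr1 er; exists r => //.
      have hlt : par I x < x by apply: (proj2 parP); have := region_gt rg hxE; qlia.
      rewrite ltnNge; apply/negP; rewrite leq_eqVlt => /orP[/eqP e|h].
        by move: hlt; rewrite -er -e ltnn.
      have hs : sorted ltn (rho :: E).
        rewrite /= path_min_sorted ?(region_sorted rg) //.
        by apply/allP => z hz /=; have := region_gt rg hz; qlia.
      have : x < par I x by rewrite -er; apply: (sorted_ltn_nth ltn_trans 0 hs); rewrite ?inE.
      by qlia.
    have done' (a : nat) (b d : R) : a = dir v x -> b = meet_depth v x -> d = tdist v x ->
      forall r, r < j.+1 -> let y := nth 0 (rho :: E) r in
      [/\ (if y == x then a else ints s3 aDIR y) = dir v y,
          (if y == x then b else reals s3 aLD y) = meet_depth v y &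
          (if y == x then d else reals s3 aDST y) = tdist v y].
      move=> ea eb ed r hr1 /=; case: (ltnP r j) => h; first by rewrite hI' //; apply: hI.
      have -> : r = j by qlia.
      by rewrite -/x eqxx.
    have out' (a : nat) : forall y, y \notin rho :: E ->
        (if y == x then a else ints s3 aDIR y) = ints s2 aDIR y.
      by move=> y hy; case: eqP => [e|_]; [rewrite e hx in hy|apply: hout].
    apply: wp_run; rewrite /= ?eqxx /= hr hreg3 // -/x (st_par st3 hxN); do 2 sto; tst.
    rewrite /= hon; case: (boolP (anc x v)) => hxv /=.
      rewrite ?eqxx /= hV3 (st_par st3) //; do 3 sto.
      have em : depth x = meet_depth v x by rewrite meet_depth_rec // hxv.
      have ed : dir v x = par I v by rewrite dir_rec // hxv.
      have et : (depth v + depth x - 2 * depth x)%R = tdist v x by rewrite tdistE em.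
      by rewrite !(st_dep st3) //; split; [apply: done'|exact: out'].
    have [r hrj er] := hpx hxv; have [i1 i2 i3] := hI r hrj; rewrite /= -er in i1 i2 i3.
    have hpN : par I x < N by have := par_le parP x; qlia.
    have em : meet_depth v (par I x) = meet_depth v x.
      by rewrite [RHS]meet_depth_rec // (negbTE hxv).
    have et : (depth v + depth x - 2 * meet_depth v (par I x))%R = tdist v x by rewrite tdistE em.
    sto; tst; rewrite ?eqxx /= hV3 -eqn_leq; case: (eqVneq (par I x) v) => hpv.
      have ed : x = dir v x by rewrite dir_rec // (negbTE hxv) hpv eqxx.
      do 2 sto; rewrite !(st_dep st3) // i2.
      by split; [apply: done'|exact: out'].
    have ed : dir v (par I x) = dir v x by rewrite [RHS]dir_rec // (negbTE hxv) (negbTE hpv).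
    do 2 sto; rewrite !(st_dep st3) // i2 i1.
    by split; [apply: done'|exact: out'].
  - move=> s3 _ [hI hout]; split=> // x /(nthP 0)[r hr <-]; by have [] := hI r hr.
move=> s3 f3 [h3 h3']; apply: wp_run; rewrite /= ?eqxx; sto.
split=> //=.
  by congr (ints s3 aDIR _); rewrite f3.1 // f2.1 //= f1.1.
by move=> x hx; rewrite h3' // f2.1 //= f1.1.
Qed.

(** The root carries no edge of its own, but from v it is seen through the edge above v. *)
Lemma valid_dir rho E v e : region rho E -> v \in E -> e \in rho :: E ->
  exists2 c, c \in E & dir v c = dir v e.
Proof.
move=> rg hv; rewrite inE => /orP[/eqP ->|he]; last by exists e.
by exists v => //; rewrite (dir_root parP rg hv) dir_self.
Qed.

Lemma ent_at_frame ia ra rho E (s s' : state R) : frame ia ra s s' ->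
  aENT \notin ia -> aOFF \notin ra -> ent_at I rho E s -> ent_at I rho E s'.
Proof. by move=> [fi fa] h1 h2 h k /h; rewrite fi // fa. Qed.

Lemma dist_at_frame ia ra rho E v (s s' : state R) : frame ia ra s s' ->
  aDIR \notin ia -> aDST \notin ra -> dist_at I rho E v s -> dist_at I rho E v s'.
Proof. by move=> [fi fa] h1 h2 h x /h; rewrite fi // fa. Qed.

Let idx_lt i j : i < n -> j < m -> i * m + j < n * m. Proof. nia. Qed.

(* Masses as the machine sees them, by the direction of the entry vertices. *)
Definition entry_mass (s : state R) e i : R :=
  (\sum_(0 <= j < m) prb I (i * m + j) * (ints s aDIR (ints s aENT (i * m + j)) == e)%:R)%R.

Lemma entry_massE rho E v e i s : region rho E -> ent_at I rho E s -> dist_at I rho E v s ->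
  v \in E -> interior (par I) v E -> i < n -> entry_mass s e i = mass I v e i.
Proof.
move=> rg hent hd hv hi hin; rewrite /entry_mass big_mkord; apply: eq_bigr => j _.
have [h1 h2 _] := hent _ (idx_lt hin (ltn_ord j)); have [-> _] := hd _ h1.
by rewrite (enters_dirE parP rg h2).
Qed.

(** If all points are drawn towards the anchor, [vLAM] keeps its initial value 0 and [vi0] the
    default 0; the disjunct [vLAM = 0] covers this. *)
Lemma EvalCost_spec rho E v s : stored I s -> region rho E -> ent_at I rho E s ->
  dist_at I rho E v s -> v \in rho :: E ->
  run W EvalCost s (n * m.+1) (fun s' => [/\
    forall i, i < n -> reals s' aFV i = fvert I i v,
    forall i, i < n -> (2 * entry_mass s (ints s vUP 0) i <= total_mass I i)%R ->
      (fvert I i v <= reals s' vLAM 0)%R,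
    (0 <= reals s' vLAM 0)%R, ints s' vi0 0 < n &
    reals s' vLAM 0 = 0%R \/ fvert I (ints s' vi0 0) v = reals s' vLAM 0 /\
      (2 * entry_mass s (ints s vUP 0) (ints s' vi0 0) <= total_mass I (ints s' vi0 0))%R]).
Proof.
move=> st rg hent hd hv; have [hn hm] := (st_n st, st_m st); have n0 := npt_gt0 I_ok.
step; sto; step; sto; step; sto; set s0 := State _ _.
have st0 : stored I s0 by case: st => *; split.
have -> : n * m.+1 = n * (m * 1).+1 by qlia.
set um := entry_mass s (ints s vUP 0).
apply: (run_for (n := n) (I := fun i (s' : state R) => [/\ ints s' vidx 0 = i * m,
    forall i', i' < i -> reals s' aFV i' = fvert I i' v,
    forall i', i' < i -> (2 * um i' <= total_mass I i')%R -> (fvert I i' v <= reals s' vLAM 0)%R,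
    (0 <= reals s' vLAM 0)%R /\ ints s' vi0 0 < n &
    reals s' vLAM 0 = 0%R \/ fvert I (ints s' vi0 0) v = reals s' vLAM 0 /\
      (2 * um (ints s' vi0 0) <= total_mass I (ints s' vi0 0))%R])) => //=.
- by qlia.
- by split=> //; left.
- move=> i s1 hi fr hr [h1 h2 h3 [h4 h4'] h5].
  have st1 := stored_frame fr isT isT st0.
  step; sto; step; sto; step; sto; set s2 := State _ _.
  have st2 : stored I s2 by case: st1 => *; split.
  have ent1 : ent_at I rho E s1 by apply: (ent_at_frame fr).
  have dist1 : dist_at I rho E v s1 by apply: (dist_at_frame fr).
  rewrite -[m * 1]addn0.
  apply: (@run_seq _ _ _ _ _ _ _ (fun s' => [/\ ints s' vidx 0 = i * m + m,
    reals s' racc 0 = (\sum_(0 <= j < m) prb I (i * m + j) * tdist (node I (i * m + j)) v)%R,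
    reals s' rtot 0 = (\sum_(0 <= j < m) prb I (i * m + j))%R & reals s' rum 0 = um i])).
    apply: (run_for (n := m) (I := fun j (s' : state R) => [/\ ints s' vidx 0 = i * m + j,
      reals s' racc 0 = (\sum_(0 <= j < j) prb I (i * m + j) * tdist (node I (i * m + j)) v)%R,
      reals s' rtot 0 = (\sum_(0 <= j < j) prb I (i * m + j))%R & reals s' rum 0 =
     (\sum_(0 <= j < j) prb I (i * m + j) *
       (ints s aDIR (ints s aENT (i * m + j)) == ints s vUP 0)%:R)%R])) => //=.
    + exact: st_m st1.
    + by qlia.
    + by rewrite h1 addn0 !big_geq.
    + move=> j s3 hj fr3 hr3 [g1 g2 g3 g4]; have hk := idx_lt hi hj.
      have [e1 e2 e3] := hent _ hk; have [d1 d2] := hd _ e1.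
      have ee : ints s3 aENT (i * m + j) = ints s aENT (i * m + j) by rewrite fr3.1 //= fr.1.
      have edir x : ints s3 aDIR x = ints s aDIR x by rewrite fr3.1 //= fr.1.
      have edst x : reals s3 aDST x = reals s aDST x by rewrite fr3.2 //= fr.2.
      have eoff x : reals s3 aOFF x = reals s aOFF x by rewrite fr3.2 //= fr.2.
      have eup : ints s3 vUP 0 = ints s vUP 0 by rewrite fr3.1 //= fr.1.
      have st3 := stored_frame fr3 isT isT st2.
      have hI (x : R) : x = (if ints s aDIR (ints s aENT (i * m + j)) == ints s vUP 0
          then reals s3 rum 0 + prb I (i * m + j) else reals s3 rum 0)%R ->
        [/\ i * m + j + 1 = i * m + j.+1,
         (reals s3 racc 0 + prb I (i * m + j) * (reals s3 aOFF (i * m + j) + reals s3 aDST (ints s3 aENT (i * m + j))))%R =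
           (\sum_(0 <= j < j.+1) prb I (i * m + j) * tdist (node I (i * m + j)) v)%R,
         (reals s3 rtot 0 + prb I (i * m + j))%R = (\sum_(0 <= j < j.+1) prb I (i * m + j))%R &
         x = (\sum_(0 <= j < j.+1) prb I (i * m + j) *
           (ints s aDIR (ints s aENT (i * m + j)) == ints s vUP 0)%:R)%R].
        move=> ->; rewrite !big_nat_recr //= g2 g3 g4 ee eoff edst e3 d2; split=> //; first by qlia.
          by rewrite (enters_tdist parP (pl I) rg e2 e1 hv) (tdistC _ _ _ v).
        by case: ifP => _; rewrite ?mulr1 ?mulr0 ?addr0.
      apply: wp_run; rewrite /= ?eqxx /= g1 !(st_prb st3) //; do 3 sto; tst; rewrite /= ?eqxx /=.
      rewrite ee edir eup -eqn_leq ?g1 ?(st_prb st3) //; case: ifP => hdir.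
        do 2 sto; rewrite -ee; apply: hI; by rewrite hdir.
      sto; rewrite -ee; apply: hI; by rewrite hdir.
  move=> s3 fr3 [g1 g2 g3 g4]; have st3 := stored_frame fr3 isT isT st2.
  have hi3 : ints s3 vi 0 = i by rewrite fr3.1.
  have hlam : reals s3 vLAM 0 = reals s1 vLAM 0 by rewrite fr3.2.
  have hfv : (wgt I i * reals s3 racc 0)%R = fvert I i v by rewrite g2 big_mkord.
  have htot : reals s3 rtot 0 = total_mass I i by rewrite g3 big_mkord.
  have hFV i' : i' < i.+1 -> (if i' == i then fvert I i v else reals s3 aFV i') = fvert I i' v.
    by move=> hi'; case: eqP => [->//|hne]; rewrite fr3.2 //= h2 //; qlia.
  have hi0 : ints s3 vi0 0 = ints s1 vi0 0 by rewrite fr3.1.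
  apply: wp_run; rewrite /= ?eqxx /= hi3 (st_wgt st3) // hfv; sto; tst; rewrite /= ?eqxx /=.
  rewrite ?hi3 ?eqxx /= hlam htot g4; case: ifP => [/andP[c1 c2]|hc].
    do 2 sto; split=> //.
    + by rewrite g1; qlia.
    + move=> i' hi' hu; case: (eqVneq i' i) => [->//|hne].
      by apply: le_trans c2; apply: h3 => //; qlia.
    + by split=> //; apply: le_trans c2.
    + by right.
  split=> //.
  + by rewrite g1; qlia.
  + move=> i' hi' hu; case: (eqVneq i' i) => [e|hne]; last by rewrite ?hlam; apply: h3 => //; qlia.
    by move: hc; rewrite ?hlam -e hu /= => /negbT; rewrite -ltNge => /ltW.
  + by rewrite ?hlam hi0.
  + by rewrite ?hlam hi0.
- by move=> s1 fr [h1 h2 h3 [h4 h4'] h5]; split.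
Qed.

Lemma Vote_spec rho E v s : stored I s -> region rho E -> v \in E -> ints s vV 0 = v ->
  dist_at I rho E v s -> ent_at I rho E s -> ints s vi0 0 < n ->
  run W Vote s m (fun s' => (exists2 c, c \in E & dir v c = ints s' vDD 0) /\
    forall e, e != ints s' vDD 0 -> (2 * entry_mass s e (ints s vi0 0) <= total_mass I (ints s vi0 0))%R).
Proof.
move=> st rg hv hV hd hent hi; set i := ints s vi0 0 in hi *.
have hvN := region_lt rg (mem_behead (s := rho :: E) hv).
have hiM : i * m <= n * m by nia.
step; rewrite hV (st_par st hvN); sto; step; sto; step; rewrite -/i (st_m st); sto; set s0 := State _ _.
have st0 : stored I s0 by case: st => *; split.
rewrite -[m]muln1.
pose pm e j := (\sum_(0 <= j < j) prb I (i * m + j) *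
  (ints s aDIR (ints s aENT (i * m + j)) == e)%:R)%R.
pose pt j := (\sum_(0 <= j < j) prb I (i * m + j))%R.
(* The mass [rbal] is unmatched and belongs to the candidate; the remaining mass is matched between
   different directions, so no direction has more than half of it. The initial candidate [par v] is
   the direction of the edge above v, hence a valid one. *)
apply: (run_for (n := m) (I := fun j (s' : state R) => [/\ ints s' vidx 0 = i * m + j,
  exists2 c, c \in E & dir v c = ints s' vDD 0, (0 <= reals s' rbal 0)%R,
  forall e, e != ints s' vDD 0 -> (2 * pm e j <= pt j - reals s' rbal 0)%R &
  (2 * pm (ints s' vDD 0) j <= pt j + reals s' rbal 0)%R])) => //=.
- exact: st_m st0.
- by qlia.
- rewrite addn0 /pm /pt big_geq //; split=> //; first by exists v => //; rewrite dir_self.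
    by move=> e _; rewrite !big_geq //; rewrite mulr0 subr0.
  by rewrite !big_geq // mulr0 addr0.
- move=> j s1 hj fr hr [g1 g2 g3 g4 g5]; have hk := idx_lt hi hj.
  have st1 := stored_frame fr isT isT st0.
  have [e1 e2 e3] := hent _ hk; have [d1 d2] := hd _ e1.
  have edir x : ints s1 aDIR x = ints s aDIR x by rewrite fr.1.
  have eent x : ints s1 aENT x = ints s aENT x by rewrite fr.1.
  set e0 := ints s aDIR (ints s aENT (i * m + j)).
  have hp : (0 <= prb I (i * m + j))%R by apply: (prb_ok I_ok).
  have pmS e : pm e j.+1 = (pm e j + prb I (i * m + j) * (e0 == e)%:R)%R by rewrite /pm big_nat_recr.
  have ptS : pt j.+1 = (pt j + prb I (i * m + j))%R by rewrite /pt big_nat_recr.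
  set p := prb I (i * m + j) in hp pmS ptS *.
  have hidx : i * m + j + 1 = i * m + j.+1 by qlia.
  apply: wp_run; rewrite /= ?eqxx /= g1 eent edir -/e0; sto; tst.
  rewrite /= ?eqxx /= -eqn_leq ?g1 ?(st_prb st1) // -/p; case: eqP => he.
    do 2 sto; rewrite hidx; split=> //; first by rewrite addr_ge0.
    + move=> e hne; rewrite pmS ptS he eq_sym (negbTE hne) /=; have := g4 e hne; lra.
    + by rewrite pmS ptS he eqxx /=; lra.
  tst; rewrite /= ?eqxx /= ?g1 ?(st_prb st1) // -/p; case: ifP => hle.
    do 2 sto; rewrite hidx; split=> //; first by rewrite subr_ge0.
    + move=> e hne; rewrite pmS ptS; have := g4 e hne; case: eqP => _ /=; lra.
    + by rewrite pmS ptS (introF eqP he) /=; lra.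
  do 3 sto; rewrite hidx; split=> //.
  + by rewrite -/e0 /e0 d1; apply: valid_dir e1.
  + by move/negbT: hle; rewrite -ltNge subr_ge0 => /ltW.
  + move/negbT: hle; rewrite -ltNge => hle.
    move=> e hne; rewrite pmS ptS eq_sym (negbTE hne) /=; case: (eqVneq e (ints s1 vDD 0)) => [->|h].
      by lra.
    by have := g4 e h; lra.
  + move/negbT: hle; rewrite -ltNge => hle.
    by rewrite pmS ptS eqxx /=; have := g4 e0 ltac:(by apply/eqP); lra.
- move=> s1 fr [g1 g2 g3 g4 g5]; split=> // e /g4.
  have -> : total_mass I i = pt m by rewrite /total_mass /pt big_mkord.
  by have -> : entry_mass s e i = pm e m by []; lra.
Qed.

Lemma Shrink_spec rho E v d s : stored I s -> region rho E -> v \in rho :: E -> ints s vV 0 = v ->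
  ints s vDD 0 = d -> (exists2 c, c \in E & dir v c = d) ->
  dist_at I rho E v s -> reg_at rho E s -> ent_at I rho E s ->
  (forall k, k < n * m -> ints s aENT k = node I k) \/ interior (par I) v E ->
  run W Shrink s (n * m + size E) (fun s' =>
    reg_at (cut_root (par I) v d rho) (cut (par I) v d E) s' /\
    ent_at I (cut_root (par I) v d rho) (cut (par I) v d E) s').
Proof.
move=> st rg hv hV hD hd hdist hreg hent hint.
have hvN := region_lt rg hv; have hKN := region_size rg.
rewrite -[n * m]muln1 -[size E]muln1.
apply: (@run_seq _ _ _ _ _ _ _ (ent_at I (cut_root (par I) v d rho) (cut (par I) v d E))).
  apply: (run_for (n := n * m) (I := fun j (s' : state R) =>
    (forall k, k < j -> [/\ ints s' aENT k \in cut_root (par I) v d rho :: cut (par I) v d E,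
      enters (par I) (cut (par I) v d E) (node I k) (ints s' aENT k) &
      reals s' aOFF k = tdist (node I k) (ints s' aENT k)]) /\
    forall k, j <= k -> ints s' aENT k = ints s aENT k /\ reals s' aOFF k = reals s aOFF k)) => //=.
  - exact: st_M st.
  - by qlia.
  - move=> j s1 hj fr hr [hI1 hI2]; have [k1 k2] := hI2 j (leqnn j).
    have [e1 e2 e3] := hent j hj; have [d1 d2] := hdist _ e1.
    have edir x : ints s1 aDIR x = ints s aDIR x by rewrite fr.1.
    have hV1 : ints s1 vV 0 = v by rewrite fr.1.
    have hD1 : ints s1 vDD 0 = d by rewrite fr.1.
    have hint' : ints s aENT j = node I j \/ interior (par I) v E.
      by case: hint => [h|]; [left; apply: h|right].
    have := enters_cut parP rg e2 e1 hv hint' hd; rewrite /= => -[c1 c2].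
    apply: wp_run; rewrite /= ?eqxx /= hr k1; sto; tst.
    rewrite /= ?eqxx /= edir d1 hD1 -eqn_leq; case: ifP => hc; rewrite hc in c1 c2.
      split=> k hk; last by apply: hI2; qlia.
      case: (eqVneq k j) => [->|hne]; last by apply: hI1; qlia.
      by rewrite k1 k2.
    rewrite ?hr hV1; do 2 sto; split=> k hk /=; last first.
      have -> : k == j = false by qlia.
      by apply: hI2; qlia.
    case: (eqVneq k j) => [->|hne]; last by apply: hI1; qlia.
    split=> //; rewrite k2 e3 fr.2 // d2 (tdistC _ _ _ v).
    by rewrite (enters_tdist parP (pl I) rg e2 e1 hv).
  - by move=> s1 fr [hI1 hI2].
move=> s1 f1 hent1; have reg1 := reg_at_frame f1 isT hreg; have st1 := stored_frame f1 isT isT st.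
have hV1 : ints s1 vV 0 = v by rewrite f1.1.
have hD1 : ints s1 vDD 0 = d by rewrite f1.1.
have edir1 x : x \in rho :: E -> ints s1 aDIR x = dir v x.
  by move=> hx; rewrite f1.1 //; case: (hdist x hx).
have [hK1 hr1] := reg1.
rewrite -[size E * 1]add0n.
apply: (@run_seq _ _ _ _ _ _ _ (fun s' => [/\ ints s' aREG 0 = cut_root (par I) v d rho,
   forall r, 0 < r <= size E -> ints s' aREG r = nth 0 (rho :: E) r &
   ent_at I (cut_root (par I) v d rho) (cut (par I) v d E) s'])).
  apply: wp_run; rewrite /=; tst; rewrite /= hD1 hV1 (st_par st1) // -eqn_leq /cut_root; case: ifP => hdp.
    split=> //; first by rewrite hr1 //= hdp.
    by move=> r /andP[_ hr]; apply: hr1.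
  sto; split=> //; rewrite ?hdp //.
  by move=> r /andP[h0 hr] /=; rewrite gtn_eqF //; apply: hr1.
move=> s2 f2 [h0 hr2 hent2].
have hV2 : ints s2 vV 0 = v by rewrite f2.1.
have hD2 : ints s2 vDD 0 = d by rewrite f2.1.
have hK2 : ints s2 vK 0 = size E by rewrite f2.1.
step; sto; set s3 := State _ _.
rewrite -[size E * 1]addn0.
apply: (@run_seq _ _ _ _ _ _ _ (fun s' => ints s' vr2 0 = size (cut (par I) v d E) /\
   forall r, r <= size (cut (par I) v d E) ->
     ints s' aREG r = nth 0 (cut_root (par I) v d rho :: cut (par I) v d E) r)).
  apply: (run_for (n := size E) (I := fun j (s' : state R) =>
    [/\ ints s' vr2 0 = size (cut (par I) v d (take j E)),
     forall r, r <= size (cut (par I) v d (take j E)) -> ints s' aREG r =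
       nth 0 (cut_root (par I) v d rho :: cut (par I) v d (take j E)) r &
     forall r, j < r <= size E -> ints s' aREG r = nth 0 (rho :: E) r])) => //=.
  - by qlia.
  - by rewrite take0 /=; split=> // r; rewrite leqn0 => /eqP ->.
  - move=> j s4 hj fr hr [g1 g2 g3].
    set x := nth 0 E j; have hxE : x \in E by apply: mem_nth.
    have hx : ints s4 aREG j.+1 = x by rewrite g3 // ltnSn.
    have hdx : ints s4 aDIR x = dir v x by rewrite fr.1 //= f2.1 // edir1 // inE hxE orbT.
    have hD4 : ints s4 vDD 0 = d by rewrite fr.1.
    have hsz : size (cut (par I) v d (take j E)) <= j.
      by rewrite size_filter (leq_trans (count_size _ _)) // size_take_min geq_minl.
    have ecut : cut (par I) v d (take j.+1 E) =
        if dir v x == d then rcons (cut (par I) v d (take j E)) x else cut (par I) v d (take j E).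
      by rewrite /cut (take_nth 0) // filter_rcons.
    apply: wp_run; rewrite /= ?eqxx /= hr addn1 hx; sto; tst.
    rewrite /= ?eqxx /= hdx hD4 -eqn_leq; case: ifP => hc; rewrite hc in ecut; rewrite ecut.
      rewrite g1 ?eqxx /=; do 2 sto; rewrite size_rcons; split=> //; first by rewrite addn1.
      + move=> r hr'; rewrite addn1 /=; case: eqP => [->|hne] /=.
          by rewrite nth_rcons ltnn eqxx.
        rewrite g2; last by qlia.
        case: r hr' hne => //= r hr' hne; rewrite nth_rcons; case: ltngtP => //; qlia.
      + move=> r hr' /=; have -> : r == size (cut (par I) v d (take j E)) + 1 = false by qlia.
        by apply: g3; qlia.
    by split=> // r hr'; apply: g3; qlia.
  - by move=> s4 _ [g1 g2 _]; rewrite take_size in g1 g2.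
move=> s4 f4 [g1 g2]; apply: wp_run; rewrite /= ?g1; sto; split; first by split.
by move=> k /hent2; rewrite /= f4.1 //= f4.2.
Qed.

End RegionSpecs.

(** * The two sides of the search *)

(* The arrays 80, ..., 99 belong to one side and 100, ..., 119 to the other;
   programs for the other side are obtained by renaming. *)
Definition swp a := if 79 < a < 100 then a + 20 else if 99 < a < 120 then a - 20 else a.

Fixpoint ren_i e := match e with
  | IConst k => IConst k
  | ILoad a e => ILoad (swp a) (ren_i e)
  | IAdd e1 e2 => IAdd (ren_i e1) (ren_i e2)
  | ISub e1 e2 => ISub (ren_i e1) (ren_i e2)
  | IMul e1 e2 => IMul (ren_i e1) (ren_i e2)
  | IDiv e1 e2 => IDiv (ren_i e1) (ren_i e2)
  end.
Fixpoint ren_r e := match e with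
  | RConst z => RConst z
  | RLoad a e => RLoad (swp a) (ren_i e)
  | RAdd e1 e2 => RAdd (ren_r e1) (ren_r e2)
  | RSub e1 e2 => RSub (ren_r e1) (ren_r e2)
  | RMul e1 e2 => RMul (ren_r e1) (ren_r e2)
  | RDiv e1 e2 => RDiv (ren_r e1) (ren_r e2)
  end.
Fixpoint ren_b b := match b with
  | ILe e1 e2 => ILe (ren_i e1) (ren_i e2)
  | RLe e1 e2 => RLe (ren_r e1) (ren_r e2)
  | BNot b => BNot (ren_b b)
  | BAnd b1 b2 => BAnd (ren_b b1) (ren_b b2)
  end.
Fixpoint ren_c c := match c with
  | Skip => Skip
  | IStore a e1 e2 => IStore (swp a) (ren_i e1) (ren_i e2)
  | RStore a e1 e2 => RStore (swp a) (ren_i e1) (ren_r e2)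
  | Seq c1 c2 => Seq (ren_c c1) (ren_c c2)
  | If b c1 c2 => If (ren_b b) (ren_c c1) (ren_c c2)
  | While b c => While (ren_b b) (ren_c c)
  end.

Section Renaming.
Variables (R : realType) (W : nat).

Definition ren_s (s : state R) := State (fun a => ints s (swp a)) (fun a => reals s (swp a)).

Lemma swpK : involutive swp.
Proof. by move=> a; rewrite /swp; do ![case: ifP]; qlia. Qed.

Lemma ren_sK : involutive ren_s.
Proof. by case=> f g; rewrite /ren_s /=; congr State; apply: funext => a; rewrite swpK. Qed.

Lemma icost_ren e : icost (ren_i e) = icost e.
Proof. by elim: e => //= [a e ->|e1 -> e2 ->|e1 -> e2 ->|e1 -> e2 ->|e1 -> e2 ->]. Qed.
Lemma rcost_ren e : rcost (ren_r e) = rcost e.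
Proof. by elim: e => //= [a e|e1 -> e2 ->|e1 -> e2 ->|e1 -> e2 ->|e1 -> e2 ->]; rewrite ?icost_ren. Qed.
Lemma bcost_ren b : bcost (ren_b b) = bcost b.
Proof. by elim: b => //= [e1 e2|e1 e2|b ->|b1 -> b2 ->]; rewrite ?icost_ren ?rcost_ren. Qed.
Lemma unit_cost_ren c : unit_cost (ren_c c) = unit_cost c.
Proof.
by elim: c => //= [a e1 e2|a e1 e2|c1 -> c2 ->|b c1 -> c2 ->|b c ->];
  rewrite ?icost_ren ?rcost_ren ?bcost_ren.
Qed.

Lemma ieval_ren s e : ieval W (ren_s s) (ren_i e) = ieval W s e.
Proof.
elim: e => //= [a e ->|e1 -> e2 ->|e1 -> e2 ->|e1 -> e2 ->|e1 -> e2 ->] //.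
by case: (ieval W s e) => //= i; rewrite swpK.
Qed.
Lemma reval_ren s e : reval W (ren_s s) (ren_r e) = reval W s e.
Proof.
elim: e => //= [a e|e1 -> e2 ->|e1 -> e2 ->|e1 -> e2 ->|e1 -> e2 ->] //.
by rewrite ieval_ren; case: (ieval W s e) => //= i; rewrite swpK.
Qed.
Lemma beval_ren s b : beval W (ren_s s) (ren_b b) = beval W s b.
Proof. by elim: b => //= [e1 e2|e1 e2|b ->|b1 -> b2 ->]; rewrite ?ieval_ren ?reval_ren. Qed.

Lemma upd_ren A (f : nat -> nat -> A) a i x :
  (fun b => upd f a i x (swp b)) = upd (fun b => f (swp b)) (swp a) i x.
Proof.
apply: funext => b; apply: funext => j /=.
by rewrite (can2_eq swpK swpK).
Qed.

Lemma exec_ren c s t s' : exec W c s t s' -> exec W (ren_c c) (ren_s s) t (ren_s s').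
Proof.
elim=> {c s t s'} /=.
- by move=> s; apply: ESkip.
- move=> s a e1 e2 i x h1 h2; rewrite -(icost_ren e1) -(icost_ren e2) /ren_s /= upd_ren.
  by apply: EIStore; rewrite -/(ren_s s) ieval_ren.
- move=> s a e1 e2 i x h1 h2; rewrite -(icost_ren e1) -(rcost_ren e2) /ren_s /= upd_ren.
  by apply: ERStore; rewrite -/(ren_s s) ?ieval_ren ?reval_ren.
- by move=> c1 c2 s1 s2 s3 t1 t2 _ h1 _ h2; apply: ESeq h1 h2.
- by move=> b c1 c2 s s' t hb _ h; rewrite -(bcost_ren b); apply: EIfTrue; rewrite ?beval_ren.
- by move=> b c1 c2 s s' t hb _ h; rewrite -(bcost_ren b); apply: EIfFalse; rewrite ?beval_ren.
- move=> b c s1 s2 s3 t1 t2 hb _ h1 _ h2; rewrite -(bcost_ren b).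
  by apply: EWhileTrue h1 h2; rewrite beval_ren.
- by move=> b c s hb; rewrite -(bcost_ren b); apply: EWhileFalse; rewrite beval_ren.
Qed.

Definition scmd (b : bool) c := if b then ren_c c else c.
Definition side (b : bool) (s : state R) := if b then ren_s s else s.

Lemma run_side b c s k (Q : state R -> Prop) :
  run W c (side b s) k Q -> run W (scmd b c) s k (fun s' => Q (side b s')).
Proof.
case: b => //= -[t [s' [h1 h2 h3]]]; exists t, (ren_s s'); split=> //.
- by have := exec_ren h1; rewrite ren_sK.
- by rewrite unit_cost_ren.
- by rewrite /= ren_sK.
Qed.

Lemma frame_ren ia ra s s' : frame ia ra s s' -> frame (map swp ia) (map swp ra) (ren_s s) (ren_s s').
Proof.
move=> [h1 h2]; split=> a i ha /=; [apply: h1|apply: h2];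
  by apply: contra ha => h; apply/mapP; exists (swp a); rewrite ?swpK.
Qed.

End Renaming.

Notation aFA := 84. Notation aFB := 85. Notation vS := 86. Notation rlam := 35.

Definition EvalEnd : cmd := EvalDist ;; EvalCost.
Definition Finish : cmd :=
  vx <~ ILoad aREG (IConst 1) ;;
  vV <~ 'v vANC ;;
  EvalEnd ;;
  For vi vn (RStore aFA ('v vi) (RLoad aFV ('v vi))) ;;
  vx <~ ILoad aREG (IConst 1) ;;
  If (IEq ('v vANC) ('v vx)) (vV <~ ILoad aPAR ('v vx)) (vV <~ 'v vx) ;;
  EvalEnd ;;
  For vi vn (RStore aFB ('v vi) (RLoad aFV ('v vi))).

Definition Prep : cmd :=
  If (ILe (IConst 2) ('v vK)) (Centroid ;; EvalDist ;; EvalCost ;; Vote) Finish.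

(* [vr2] = 0 moves down, in the voted direction, and [vr2] = 1 moves up. *)
Notation vupf := 42.
Definition Advance : cmd :=
  If (ILe (IConst 1) ('v vupf)) (vDD <~ 'v vUP) Skip ;;
  Shrink ;;
  If (IEq ('v vDD) ('v vUP)) Skip (vANC <~ 'v vV) ;;
  Prep.

(** [vS] becomes the largest parameter at which a descending line meets [rlam], with 0 as seed. The
    costs at that point go to [aFV], where they play the part that the costs at the centroid play
    for a larger region. *)
Definition Cut : cmd :=
  vS <~~ RConst 0 ;;
  For vi vn (
    If (RLe (RLoad aFA ('v vi)) (RLoad aFB ('v vi))) Skip
      (racc <~~ RDiv (RSub (RLoad aFA ('v vi)) ('r rlam)) (RSub (RLoad aFA ('v vi)) (RLoad aFB ('v vi))) ;;
       If (RLe ('r vS) ('r racc)) (vS <~~ 'r racc) Skip)) ;;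
  For vi vn (RStore aFV ('v vi) (RAdd (RLoad aFA ('v vi))
    (RMul (RSub (RLoad aFB ('v vi)) (RLoad aFA ('v vi))) ('r vS)))).

Section Sides.
Variables (R : realType) (I : instance R).
Hypothesis I_ok : instance_ok I.
Local Notation N := (size_t I).
Local Notation n := (npt I).
Local Notation m := (nloc I).
Local Notation dir := (dir (par I)).
Local Notation cut := (cut (par I)).
Local Notation cut_root := (cut_root (par I)).
Local Notation interior := (interior (par I)).
Local Notation region := (region N (par I)).
Let parP := par_ok I_ok.
Variable W : nat.
Hypothesis W_ok : 4 * N + n * m + n + m + 10 <= W.
Hypothesis m_gt0 : 0 < m.
Let n_gt0 := npt_gt0 I_ok.

Record probed (E : seq nat) r (s : state R) : Prop := Probed {
  pb_mem : ints s vV 0 \in E;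
  pb_int : interior (ints s vV 0) E;
  pb_bal : balanced I (ints s vV 0) E;
  pb_up : ints s vUP 0 = dir (ints s vV 0) r;
  pb_fv : forall i, i < n -> reals s aFV i = fvert I i (ints s vV 0);
  pb_votes : votes I E (dir (ints s vV 0) r) (ints s vV 0) (reals s vLAM 0) (ints s vDD 0) }.

(** A large region comes with a centroid and its votes, a single edge with the costs at its ends;
    this is what a comparison with the other region needs. *)
Record ready rho E r (s : state R) : Prop := Ready {
  rd_region : region rho E;
  rd_reg : reg_at rho E s;
  rd_ent : ent_at I rho E s;
  rd_anc : ints s vANC 0 = r;
  rd_probed : 1 < size E -> probed E r s /\ dist_at I rho E (ints s vV 0) s;
  rd_ends : forall c i, E = [:: c] -> i < n ->
    reals s aFA i = fvert I i r /\ reals s aFB i = fvert I i (far_end I c r) }.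

Definition Probe : cmd := Centroid ;; EvalDist ;; EvalCost ;; Vote.

(** The second alternative for r is the sentinel of the halving phase; its cell of [aDIR] lies
    outside every region, so it keeps the value N. *)
Lemma Probe_spec rho E r s : stored I s -> region rho E -> reg_at rho E s -> ent_at I rho E s ->
  ints s vANC 0 = r -> r \in rho :: E \/ r = N /\ ints s aDIR N = N -> 1 < size E ->
  run W Probe s (6 * (size E).+1 + n * m.+1 + m) (fun s' =>
    [/\ stored I s', reg_at rho E s', ent_at I rho E s', ints s' vANC 0 = r &
    [/\ forall x, x \notin rho :: E -> ints s' aDIR x = ints s aDIR x,
     dist_at I rho E (ints s' vV 0) s', interior (ints s' vV 0) E,
     ints s' vV 0 \in E /\ balanced I (ints s' vV 0) E & [/\
     ints s' vUP 0 = (if r == N then N else dir (ints s' vV 0) r),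
     forall i, i < n -> reals s' aFV i = fvert I i (ints s' vV 0) &
     votes I E (if r == N then N else dir (ints s' vV 0) r)
       (ints s' vV 0) (reals s' vLAM 0) (ints s' vDD 0)]]]).
Proof.
move=> st rg hreg hent hanc hr hE.
apply: (@run_le _ _ _ _ (3 * (size E).+1 + (3 * (size E).+1 + (n * m.+1 + m)))); last by qlia.
apply: (run_seq (Centroid_spec I_ok W_ok st rg hreg hE)) => s1 f1 [hv hi hb].
set v := ints s1 vV 0 in hv hi hb.
have st1 := stored_frame f1 isT isT st; have reg1 := reg_at_frame f1 isT hreg.
have ent1 : ent_at I rho E s1 by apply: (ent_at_frame f1).
have hvv : v \in rho :: E by rewrite inE hv orbT.
have hvN := region_lt rg hvv.
apply: (run_seq (EvalDist_spec I_ok W_ok st1 rg reg1 hvv (erefl _))) => s2 f2 [d2 u2 o2].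
have st2 := stored_frame f2 isT isT st1; have reg2 := reg_at_frame f2 isT reg1.
have ent2 : ent_at I rho E s2 by apply: (ent_at_frame f2).
apply: (run_seq (EvalCost_spec I_ok W_ok st2 rg ent2 d2 hvv)) => s3 f3 [c1 c2 c3 c4 c5].
have st3 := stored_frame f3 isT isT st2; have reg3 := reg_at_frame f3 isT reg2.
have ent3 : ent_at I rho E s3 by apply: (ent_at_frame f3).
have d3 : dist_at I rho E v s3 by apply: (dist_at_frame f3).
have hv3 : ints s3 vV 0 = v by rewrite f3.1 // f2.1.
have := Vote_spec I_ok W_ok st3 rg hv hv3 d3 ent3 c4.
move/run_framed; apply: run_weak => // s4 [[g1 g2] f4].
have st4 := stored_frame f4 isT isT st3; have reg4 := reg_at_frame f4 isT reg3.
have hv4 : ints s4 vV 0 = v by rewrite f4.1.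
have hup : ints s2 vUP 0 = if r == N then N else dir v r.
  rewrite u2 f1.1 // hanc; case: hr => [hr|[-> hN]].
    by have [-> _] := d2 r hr; have := region_lt rg hr; case: eqP => // ->; rewrite ltnn.
  rewrite eqxx o2 ?f1.1 //; apply/negP => /(region_lt rg); by rewrite ltnn.
have em e i : i < n -> entry_mass I s2 e i = mass I v e i.
  by move=> hin; apply: entry_massE rg ent2 d2 hv hi hin.
have em3 e i : i < n -> entry_mass I s3 e i = mass I v e i.
  by move=> hin; apply: entry_massE rg ent3 d3 hv hi hin.
split=> //.
- by apply: (ent_at_frame f4).
- by rewrite f4.1 // f3.1 // f2.1 // f1.1.
rewrite hv4; split=> //.
- by move=> x hx; rewrite f4.1 // f3.1 // o2 // f1.1.
- by apply: (dist_at_frame f4).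
split; first by rewrite f4.1 // f3.1.
- by move=> i hi'; rewrite f4.2 // c1.
have hlam : reals s4 vLAM 0 = reals s3 vLAM 0 by rewrite f4.2.
split; rewrite ?hlam // -?hup.
- by move=> i hin hm; apply: c2 => //; rewrite em.
- case: c5 => [|[h1 h2]]; [by left|right].
  exists (ints s3 vi0 0); split=> //; first by rewrite -em.
  by move=> e he; rewrite -em3 //; apply: g2.
Qed.

Lemma EvalAt_spec rho E v s : stored I s -> region rho E -> reg_at rho E s -> ent_at I rho E s ->
  v \in rho :: E -> ints s vV 0 = v ->
  run W EvalEnd s (3 * (size E).+1 + n * m.+1) (fun s' =>
    forall i, i < n -> reals s' aFV i = fvert I i v).
Proof.
move=> st rg hreg hent hv hV.
apply: (run_seq (EvalDist_spec I_ok W_ok st rg hreg hv hV)) => s2 f2 [d2 u2 o2].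
have st2 := stored_frame f2 isT isT st.
have ent2 : ent_at I rho E s2 by apply: (ent_at_frame f2).
have := EvalCost_spec I_ok W_ok st2 rg ent2 d2 hv.
by apply: run_weak => // s3 [].
Qed.

Lemma Finish_spec rho c r s : stored I s -> region rho [:: c] -> reg_at rho [:: c] s ->
  ent_at I rho [:: c] s -> ints s vANC 0 = r -> r \in rho :: [:: c] ->
  run W Finish s (2 * (6 + n * m.+1 + n)) (fun s' => forall i, i < n ->
    reals s' aFA i = fvert I i r /\ reals s' aFB i = fvert I i (far_end I c r)).
Proof.
move=> st rg hreg hent hanc hr.
apply: (@run_le _ _ _ _ ((3 * 2 + n * m.+1) + (n * 1 + (0 + ((3 * 2 + n * m.+1) + n * 1))))); last by qlia.
have hcN : c < N by apply: (region_lt rg); rewrite !inE eqxx orbT.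
step; sto; rewrite (proj2 hreg) //=; step; rewrite hanc; sto; set s0 := State _ _.
have st0 : stored I s0 by case: st => *; split.
have reg0 : reg_at rho [:: c] s0 by [].
apply: (run_seq (EvalAt_spec st0 rg reg0 hent hr (erefl _))) => s1 f1 h1.
have st1 := stored_frame f1 isT isT st0; have reg1 := reg_at_frame f1 isT reg0.
have ent1 : ent_at I rho [:: c] s1 by apply: (ent_at_frame f1).
apply: (@run_seq _ _ _ _ _ _ _ (fun s => forall i, i < n -> reals s aFA i = fvert I i r)).
  apply: (run_for (n := n) (I := fun j (s : state R) => forall i, i < j -> reals s aFA i = fvert I i r)) => //.
  - exact: st_n st1.
  - by qlia.
  move=> j s2 hj fr hj' hI; apply: wp_run; rewrite /= hj'; sto=> i hi /=.
  by case: (eqVneq i j) => [->|hne]; [rewrite fr.2 // h1|apply: hI; qlia].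
move=> s2 f2 h2; have st2 := stored_frame f2 isT isT st1; have reg2 := reg_at_frame f2 isT reg1.
have ent2 : ent_at I rho [:: c] s2 by apply: (ent_at_frame f2).
have anc2 : ints s2 vANC 0 = r by rewrite f2.1 // f1.1.
step; rewrite (proj2 reg2) //=; sto.
apply: (@run_seq _ _ _ _ _ 0 _ (fun s => [/\ ints s vV 0 = far_end I c r, stored I s,
  reg_at rho [:: c] s, ent_at I rho [:: c] s & forall i, i < n -> reals s aFA i = fvert I i r])).
  apply: wp_run; rewrite /=; tst; rewrite /= anc2 -eqn_leq /far_end; case: ifP => hc.
    rewrite (st_par st2) //; sto; split=> //; first by rewrite /far_end hc.
    by case: st2 => *; split.
  sto; split=> //; first by rewrite /far_end hc.
  by case: st2 => *; split.
move=> s3 f3 [h3 st3 reg3 ent3 a3].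
have hz : far_end I c r \in rho :: [:: c].
  rewrite /far_end; case: ifP => _; rewrite ?mem_head ?inE ?eqxx ?orbT //.
  by have := region_par rg (mem_head c [::]); rewrite !inE.
apply: (run_seq (EvalAt_spec st3 rg reg3 ent3 hz h3)) => s4 f4 h4.
have st4 := stored_frame f4 isT isT st3.
apply: (run_for (n := n) (I := fun j (s : state R) => forall i, i < j -> reals s aFB i = fvert I i (far_end I c r))) => //.
- exact: st_n st4.
- by qlia.
- move=> j s5 hj fr hj' hI; apply: wp_run; rewrite /= hj'; sto=> i hi /=.
  by case: (eqVneq i j) => [->|hne]; [rewrite fr.2 // h4|apply: hI; qlia].
- move=> s5 fr hI i hi; split; last exact: hI.
  by rewrite fr.2 // f4.2 // a3.
Qed.

Definition prep_ticks K := 6 * K.+1 + 6 * (n * m) + 20.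

Lemma Prep_spec rho E r s : stored I s -> region rho E -> reg_at rho E s -> ent_at I rho E s ->
  ints s vANC 0 = r -> r \in rho :: E ->
  run W Prep s (prep_ticks (size E)) (fun s' => stored I s' /\ ready rho E r s').
Proof.
move=> st rg hreg hent hanc hr; have hrN := region_lt rg hr.
have rN : (r == N) = false by rewrite ltn_eqF.
apply: run_if; first by bnd.
  rewrite /= (proj1 hreg) => hE.
  have := Probe_spec st rg hreg hent hanc (or_introl hr) hE.
  apply: run_weak; first by rewrite /prep_ticks; nia.
  move=> s' [h1 h2 h3 h4 [h5 h6 h7 [h8 h9] [k1 k2 k3]]]; rewrite rN in k1 k3.
  by split=> //; split=> //; move=> c i e; rewrite e in hE.
rewrite /= (proj1 hreg) -leqNgt => hE.
have [c eE] : exists c, E = [:: c].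
  have := region_ne rg; case: (E) hE => [//|c [|//]] _ _; by exists c.
subst E; have := run_framed (Finish_spec st rg hreg hent hanc hr).
apply: run_weak; first by rewrite /prep_ticks; nia.
move=> s' [h f]; split; first exact: stored_frame f isT isT st.
split=> //.
- exact: reg_at_frame f isT hreg.
- exact: (ent_at_frame f).
- by rewrite f.1.
- by move=> c' i [<-]; apply: h.
Qed.

Definition move_dir (up : bool) (s : state R) := if up then ints s vUP 0 else ints s vDD 0.

Lemma Advance_spec rho E r s (up : bool) : stored I s -> ready rho E r s -> r \in rho :: E ->
  1 < size E -> ints s vupf 0 = up ->
  let v := ints s vV 0 in let d := move_dir up s in
  run W Advance s (n * m + size E + prep_ticks (size (cut v d E))) (fun s' => stored I s' /\
    ready (cut_root v d rho) (cut v d E) (if d == dir v r then r else v) s').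
Proof.
move=> st [rg hreg hent hanc hpb _] hr hE hup v d.
have [[hv hi hb hu hfv hvote] hd] := hpb hE; rewrite -/v in hv hi hb hu hfv hvote hd.
rewrite -[n * m + _ + _]add0n -addnA.
have hvv : v \in rho :: E by rewrite inE hv orbT.
have ed : exists2 c, c \in E & dir v c = d.
  rewrite /d /move_dir; case: (up); last exact: votes_dir hvote.
  by rewrite hu; apply: (valid_dir I_ok rg).
have hr' : (if d == dir v r then r else v) \in cut_root v d rho :: cut v d E.
  case: eqP => [e|_]; last exact: (cut_self parP rg hvv ed).
  by apply: (cut_vertex parP rg hvv ed hr).
apply: (@run_seq _ _ _ _ _ 0 _ (fun s1 => [/\ stored I s1, ints s1 vDD 0 = d &
   [/\ reg_at rho E s1, ent_at I rho E s1, dist_at I rho E v s1, ints s1 vANC 0 = r & ints s1 vV 0 = v]] /\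
   ints s1 vUP 0 = dir v r)).
  apply: wp_run; rewrite /=; tst; rewrite /= hup /d /move_dir; case: (up) => /=.
    by sto; split=> //; split=> //; case: st => *; split.
  by split.
move=> s1 f1 [[st1 hd1 [reg1 ent1 dist1 anc1 v1]] up1].
rewrite addnA.
apply: (run_seq (Shrink_spec I_ok W_ok st1 rg hvv v1 hd1 ed dist1 reg1 ent1 (or_intror hi))).
move=> s2 f2 [reg2 ent2]; have st2 := stored_frame f2 isT isT st1.
have rg2 := region_cut parP rg hvv ed.
rewrite -[prep_ticks _]add0n.
apply: (@run_seq _ _ _ _ _ 0 _ (fun s3 => [/\ stored I s3,
   reg_at (cut_root v d rho) (cut v d E) s3, ent_at I (cut_root v d rho) (cut v d E) s3 &
   ints s3 vANC 0 = if d == dir v r then r else v])).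
  have hd2 : ints s2 vDD 0 = d by rewrite f2.1.
  have hu2 : ints s2 vUP 0 = dir v r by rewrite f2.1.
  have hv2 : ints s2 vV 0 = v by rewrite f2.1.
  apply: wp_run; rewrite /=; tst; rewrite /= hd2 hu2 -eqn_leq; case: ifP => hc.
    by split=> //; rewrite f2.1 // hc.
  rewrite hv2; sto; split; [by case: st2 => *; split|by []|by []|by rewrite hc].
move=> s3 f3 [st3 reg3 ent3 anc3]; exact: Prep_spec.
Qed.

Lemma Cut_spec (A B : nat -> R) lam s : stored I s -> reals s rlam 0 = lam ->
  (forall i, i < n -> reals s aFA i = A i /\ reals s aFB i = B i) ->
  run W Cut s (2 * n) (fun s' => cutoff I A B lam (reals s' vS 0) /\
    forall i, i < n -> reals s' aFV i = line A B i (reals s' vS 0)).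
Proof.
move=> st hlam hAB; have -> : 2 * n = n * 1 + n * 1 by qlia.
step; sto; set s0 := State _ _; have st0 : stored I s0 by case: st => *; split.
apply: (@run_seq _ _ _ _ _ _ _ (fun s' => cutoff I A B lam (reals s' vS 0))).
  apply: (run_for (n := n) (I := fun j (s' : state R) => [/\ (0 <= reals s' vS 0)%R,
    forall k, k < j -> (B k < A k)%R -> (line A B k (reals s' vS 0) <= lam)%R &
    reals s' vS 0 = 0%R \/ exists k, [/\ k < n, (B k < A k)%R & line A B k (reals s' vS 0) = lam]])) => //=.
  - exact: st_n st0.
  - by qlia.
  - by split=> //; left.
  move=> j s1 hj fr hj' [h1 h2 h3].
  have [eA eB] : reals s1 aFA j = A j /\ reals s1 aFB j = B j by rewrite !fr.2 //=; apply: hAB.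
  have hl1 : reals s1 rlam 0 = lam by rewrite fr.2.
  apply: wp_run; rewrite /=; tst; rewrite /= hj' eA eB hl1; case: lerP => hBA.
    split=> // k hk hlt; apply: h2 => //; case: (eqVneq k j) => [e|]; last by qlia.
    by move: hlt; rewrite e ltNge hBA.
  sto; tst; rewrite /= ?eqxx /=; set t := ((A j - lam) / (A j - B j))%R.
  have hpos : (0 < A j - B j)%R by rewrite subr_gt0.
  have ht : line A B j t = lam by rewrite /line /t; field; exact: lt0r_neq0.
  have mono k u w : (B k < A k)%R -> (u <= w)%R -> (line A B k w <= line A B k u)%R.
    by rewrite /line => ? ?; nra.
  case: ifP => hst.
    sto; rewrite ?eqxx; split.
    + exact: le_trans h1 hst.
    + move=> k hk hlt; case: (eqVneq k j) => [->|hne]; first by rewrite ht.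
      by apply: le_trans (mono _ _ _ hlt hst) _; apply: h2 => //; qlia.
    + by right; exists j.
  split=> //.
  move=> k hk hlt; case: (eqVneq k j) => [->|hne]; last by apply: h2 => //; qlia.
  by rewrite -ht; apply: mono => //; move/negbT: hst; rewrite -ltNge => /ltW.
move=> s1 f1 h1; have st1 := stored_frame f1 isT isT st0.
apply: (run_for (n := n) (I := fun j (s' : state R) => forall i, i < j ->
  reals s' aFV i = line A B i (reals s1 vS 0))) => //=.
- exact: st_n st1.
- by qlia.
- move=> j s2 hj fr hj' hI; apply: wp_run; rewrite /= hj'; sto=> i hi /=.
  case: (eqVneq i j) => [->|hne]; last by apply: hI; qlia.
  have [eA eB] : reals s2 aFA j = A j /\ reals s2 aFB j = B j by rewrite !fr.2 // !f1.2 //=; apply: hAB.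
  by rewrite eA eB fr.2.
- by move=> s2 fr hI; rewrite fr.2.
Qed.

End Sides.

(** * Cutting the two regions against each other *)

Notation vsel := 43. Notation vflag := 44.
Notation vK' := 101. Notation vLAM' := 102. Notation aFV' := 101. Notation vS' := 106.

Definition CutIf : cmd := If (ILe (IConst 2) ('v vK)) Skip Cut.

(** With two large regions [rlam] is the larger of their costs: flag 1 moves the region of that cost
    down, flag 0 moves the other one up. If one region is a single edge, the other one moves, its
    own cost being [rlam]; it moves up also when [vS > 1], that is, when no point of the edge suits
    all descending lines. *)
Definition Decide : cmd :=
  If (ILe (IConst 2) ('v vK))
    (If (BAnd (ILe (IConst 2) ('v vK')) (RLe ('r vLAM) ('r vLAM')))
       (rlam <~~ 'r vLAM') (rlam <~~ 'r vLAM))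
    (rlam <~~ 'r vLAM') ;;
  CutIf ;;
  ren_c CutIf ;;
  vflag <~ IConst 1 ;;
  For vi vn
    (If (BAnd (BNot (RLe (RLoad aFV ('v vi)) ('r rlam))) (BNot (RLe (RLoad aFV' ('v vi)) ('r rlam))))
       (vflag <~ IConst 0) Skip) ;;
  vupf <~ ISub (IConst 1) ('v vflag) ;;
  If (ILe (IConst 2) ('v vK))
    (If (ILe (IConst 2) ('v vK'))
      (If (RLe ('r vLAM) ('r vLAM')) (vsel <~ 'v vflag) (vsel <~ ISub (IConst 1) ('v vflag)))
      (vsel <~ IConst 0 ;; If (RLe ('r vS') (RConst 1)) Skip (vupf <~ IConst 1)))
    (vsel <~ IConst 1 ;; If (RLe ('r vS) (RConst 1)) Skip (vupf <~ IConst 1)).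

Definition Refine : cmd :=
  While (BNot (BAnd (ILe ('v vK) (IConst 1)) (ILe ('v vK') (IConst 1))))
    (Decide ;; If (ILe (IConst 1) ('v vsel)) (ren_c Advance) Advance).

Section Phases.
Variables (R : realType) (I : instance R).
Hypothesis I_ok : instance_ok I.
Local Notation N := (size_t I).
Local Notation n := (npt I).
Local Notation m := (nloc I).
Local Notation dir := (dir (par I)).
Local Notation cut := (cut (par I)).
Local Notation cut_root := (cut_root (par I)).
Local Notation region := (region N (par I)).
Let parP := par_ok I_ok.

Lemma ready_frame ia ra rho E r s s' : frame ia ra s s' ->
  all (fun a => a \notin ia) [:: aREG; vK; aENT; vV; vUP; vDD; vANC; aDIR] ->
  all (fun a => a \notin ra) [:: aOFF; aFV; vLAM; aDST; aFA; aFB] ->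
  ready I rho E r s -> ready I rho E r s'.
Proof.
move=> [fi fa] /= /and5P[h1 h2 h3 h4 /and5P[h5 h6 h7 h8 _]] /and5P[k1 k2 k3 k4 /and3P[k5 k6 _]].
move=> [g1 [g2 g2'] g3 g4 g5 g6]; split=> //.
- by split=> [|r' hr]; rewrite fi // g2'.
- by move=> k /g3; rewrite !fi // fa.
- by rewrite fi.
- move=> /g5 [[p1 p2 p3 p4 p5 p6] hd]; split; first split; rewrite ?fi ?fa //.
    by move=> i hi; rewrite fa // p5.
  by move=> x; rewrite fi // fa // => /hd.
- by move=> c i hE hi; rewrite !fa //; apply: g6.
Qed.

Definition settled E r lam (s : state R) : Prop := forall c, E = [:: c] ->
  let A i := fvert I i r in let B i := fvert I i (far_end I c r) in
  cutoff I A B lam (reals s vS 0) /\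
  forall i, i < n -> reals s aFV i = line A B i (reals s vS 0).

Lemma settled_frame ia ra E r lam s s' : frame ia ra s s' -> vS \notin ra -> aFV \notin ra ->
  settled E r lam s -> settled E r lam s'.
Proof. by move=> f h1 h2 h c /h; rewrite /= !f.2 // => -[k1 k2]; split=> // i /k2; rewrite f.2. Qed.

Lemma stored_side b s : stored I s -> stored I (side b s).
Proof. by case: b => // -[*]; split. Qed.

Lemma one_edge rho E : region rho E -> ~~ (1 < size E) -> exists c, E = [:: c].
Proof. by move=> rg; have := region_ne rg; case: E {rg} => [//|c [|//]] _ _; exists c. Qed.

Variable W : nat.
Hypothesis W_ok : 4 * N + n * m + n + m + 10 <= W.
Hypothesis m_gt0 : 0 < m.
Let n_gt0 := npt_gt0 I_ok.

Lemma CutIf_spec rho E r lam s : stored I s -> ready I rho E r s -> reals s rlam 0 = lam ->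
  run W CutIf s (2 * n) (fun s' => ready I rho E r s' /\ settled E r lam s').
Proof.
move=> st rd hl; have [hK _] := rd_reg rd; apply: run_if; first by bnd.
  rewrite /= hK => hE; apply: run_le (wp_run _) _ => //=; split=> // c e.
  by rewrite e in hE.
rewrite /= hK => /(one_edge (rd_region rd)) [c eE]; subst E.
have := Cut_spec I_ok W_ok m_gt0 st hl (fun i hi => rd_ends rd (erefl _) hi).
move/run_framed; apply: run_weak => // s' [[h1 h2] f]; split; last by move=> _ [<-].
have [g1 g2 g3 g4 g5 g6] := rd; split=> //.
- exact: reg_at_frame f isT g2.
- exact: (ent_at_frame f).
- by rewrite f.1.
- by move=> c' i hE hi; rewrite !f.2 //; apply: g6.
Qed.

(** Both sides may contain the same edge; [duo_sep] then provides the distinct anchors needed at the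
    end, where this edge is run through from both ends. *)
Record duo (rho : bool -> nat) (E : bool -> seq nat) (r : bool -> nat) (s : state R) : Prop := Duo {
  duo_st : stored I s;
  duo_rd : forall b, ready I (rho b) (E b) (r b) (side b s);
  duo_faces : forall b, faces I (rho b) (E b) (r b) (E (~~ b));
  duo_suff : forall b, suffice I (E b) (E (~~ b));
  duo_sep : forall b c, c \in E b -> c \in E (~~ b) -> r b != r (~~ b) }.

Definition sound_move (E : bool -> seq nat) (r : bool -> nat) b (up : bool) (s : state R) :=
  1 < size (E b) /\ let v := ints (side b s) vV 0 in
  suffice I (cut v (if up then dir v (r b) else ints (side b s) vDD 0) (E b)) (E (~~ b)).

Section Moves.
Variables (rho : bool -> nat) (E : bool -> seq nat) (r : bool -> nat) (s : state R) (b : bool) (lam : R).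
Hypothesis D : duo rho E r s.
Hypothesis big : 1 < size (E b).
Let rg b' : region (rho b') (E b') := rd_region (duo_rd D b').
Let v b' := ints (side b' s) vV 0.
Let L b' := reals (side b' s) vLAM 0.
Let FV b' i := reals (side b' s) aFV i.
Let pb b' : 1 < size (E b') -> probed I (E b') (r b') (side b' s).
Proof. by move=> h; case: (rd_probed (duo_rd D b') h). Qed.

Let mem_v b' : 1 < size (E b') -> v b' \in rho b' :: E b'.
Proof. by move=> /pb h; rewrite inE (pb_mem h) orbT. Qed.

Lemma sound_down2 : 1 < size (E (~~ b)) -> (forall i, i < n -> (FV b i <= L b)%R \/ (FV (~~ b) i <= L b)%R) ->
  sound_move E r b false s.
Proof.
move=> big' hF; split=> //=; have p := pb big; have p' := pb big'.
have [y0 hy0 ey0] := vertex_on I_ok (rg _) (mem_v big').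
apply: (suffice_down I_ok (rg b) (rg _) (duo_faces D b) (mem_v big) (pb_int p) (pb_votes p)
  (duo_suff D b) hy0) => i hi.
by rewrite ey0 -(pb_fv p hi) -(pb_fv p' hi); apply: hF.
Qed.

Lemma sound_up2 i : 1 < size (E (~~ b)) -> (L b <= L (~~ b))%R -> i < n ->
  (L (~~ b) < FV (~~ b) i)%R -> (L (~~ b) < FV b i)%R -> sound_move E r b true s.
Proof.
move=> big' hL hi h1 h2; split=> //=; have p := pb big; have p' := pb big'.
apply: suffice_sym; rewrite /FV (pb_fv p' hi) in h1; rewrite /FV (pb_fv p hi) in h2.
have F := duo_faces D (~~ b); have S := duo_suff D (~~ b); rewrite negbK in F S.
exact: (suffice_up I_ok (rg _) (rg b) F (duo_faces D b) (mem_v big') (mem_v big)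
  (pb_int p') (pb_int p) (pb_votes p') (pb_votes p) S hL hi h1 h2).
Qed.

Lemma sound_down1 : settled (E (~~ b)) (r (~~ b)) (L b) (side (~~ b) s) ->
  ~~ (1 < size (E (~~ b))) -> (reals (side (~~ b) s) vS 0 <= 1)%R ->
  (forall i, i < n -> (FV b i <= L b)%R \/ (FV (~~ b) i <= L b)%R) -> sound_move E r b false s.
Proof.
move=> hs /(one_edge (rg _)) [c ec] h1 hF; split=> //=; have p := pb big.
have [hc hl] := hs _ ec; set S := reals _ vS 0 in h1 hc hl *.
have rg' : region (rho (~~ b)) [:: c] by rewrite -ec.
have F := duo_faces D (~~ b); rewrite negbK ec in F.
have hy0 : on (E (~~ b)) (along c (r (~~ b)) S).
  by rewrite ec; apply: on_along; rewrite h1 andbT; case: hc.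
apply: (suffice_down I_ok (rg b) (rg _) (duo_faces D b) (mem_v big) (pb_int p) (pb_votes p)
  (duo_suff D b) hy0) => i hi.
by rewrite (fpt_along I_ok rg' F) -hl // -(pb_fv p hi); apply: hF.
Qed.

Lemma sound_up1 : settled (E (~~ b)) (r (~~ b)) (L b) (side (~~ b) s) ->
  ~~ (1 < size (E (~~ b))) ->
  (1 < reals (side (~~ b) s) vS 0)%R \/ (exists i, [/\ i < n, (L b < FV b i)%R & (L b < FV (~~ b) i)%R]) ->
  sound_move E r b true s.
Proof.
move=> hs /(one_edge (rg _)) [c ec] hbad; split=> //=; have p := pb big.
have [hc hl] := hs _ ec; set S := reals _ vS 0 in hbad hc hl *.
have rg' : region (rho (~~ b)) [:: c] by rewrite -ec.
have F := duo_faces D (~~ b); have F' := duo_faces D b; have Sf := duo_suff D (~~ b).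
rewrite negbK ec in F Sf; rewrite ec in F'; rewrite ec; apply: suffice_sym.
apply: (suffice_up1 I_ok rg' F (rg b) F' (mem_v big) (pb_int p) (pb_votes p) Sf hc).
case: hbad => [|[i [hi h1 h2]]]; [by left|right; exists i; split=> //].
  by rewrite -hl.
by rewrite -(pb_fv p hi).
Qed.

End Moves.

Lemma duo_frame ia ra rho E r s s' : frame ia ra s s' ->
  all (fun a => ~~ (79 < a < 120) && (a \notin [:: vn; vm; vM; vN; aPAR; aLV])) ia ->
  all (fun a => ~~ (79 < a < 120) && (a \notin [:: aWGT; aPRB; aDEP])) ra ->
  duo rho E r s -> duo rho E r s'.
Proof.
move=> f hi ha [d1 d2 d3 d4 d5].
have ni a : a \in [:: vn; vm; vM; vN; aPAR; aLV] \/ 79 < a < 120 -> a \notin ia.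
  by move=> h; apply/negP => /(allP hi) /andP[/negbTE h1 /negbTE h2]; case: h; rewrite ?h1 ?h2.
have na a : a \in [:: aWGT; aPRB; aDEP] \/ 79 < a < 120 -> a \notin ra.
  by move=> h; apply/negP => /(allP ha) /andP[/negbTE h1 /negbTE h2]; case: h; rewrite ?h1 ?h2.
split=> //.
  by apply: (stored_frame f) d1; apply/allP => a h; [apply: ni|apply: na]; left.
move=> b; have fb : frame (if b then map swp ia else ia) (if b then map swp ra else ra) (side b s) (side b s').
  by case: (b) => //; apply: frame_ren.
have nsw (l : seq nat) : (forall a, 79 < a < 120 -> a \notin l) ->
    forall a, 79 < a < 120 -> a \notin (if b then map swp l else l).
  move=> h a ha'; case: (b); last exact: h.
  by apply/mapP => -[a' ha'' e]; have := h a'; rewrite ha'' => /(_ ltac:(rewrite /swp in e; move: e; do ![case: ifP]; qlia)).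
apply: (ready_frame fb) (d2 b); apply/allP => a ha'; apply: nsw => [a' h|];
  by [apply: ni; right|apply: na; right|move: ha'; rewrite !inE; qlia].
Qed.


Lemma Decide_spec rho E r s : duo rho E r s -> has (fun b => 1 < size (E b)) [:: false; true] ->
  run W Decide s (5 * n) (fun s' => duo rho E r s' /\ exists (b up : bool), [/\ ints s' vsel 0 = b, ints s' vupf 0 = up & sound_move E r b up s']).
Proof.
move=> D hbig; have K0 : ints s vK 0 = size (E false) := proj1 (rd_reg (duo_rd D false)).
have K1 : ints s vK' 0 = size (E true) := proj1 (rd_reg (duo_rd D true)).
have -> : 5 * n = 0 + (2 * n + (2 * n + n * 1)) by qlia.
set L0 := reals s vLAM 0; set L1 := reals s vLAM' 0.
pose lam := if 1 < size (E false) then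
  if (1 < size (E true)) && (L0 <= L1)%R then L1 else L0 else L1.
apply: (@run_seq _ _ _ _ _ _ _ (fun s' => reals s' rlam 0 = lam)).
  apply: wp_run; rewrite /=; tst; rewrite /= K0; case: ifP => h0; last by sto; rewrite /lam h0.
  by tst; rewrite /= K1 -/L0 -/L1; case: ifP => h1; sto; rewrite /lam h0 h1.
move=> s1 f1 hl1; have D1 := duo_frame f1 isT isT D.
apply: (run_seq (CutIf_spec (duo_st D1) (duo_rd D1 false) hl1)) => s2 f2 [rd2 se2].
have st2 := stored_frame f2 isT isT (duo_st D1).
have rd2' : ready I (rho true) (E true) (r true) (side true s2).
  by apply: (ready_frame (frame_ren f2)) (duo_rd D1 true).
have hl2 : reals (side true s2) rlam 0 = lam by rewrite /= f2.2.
have := run_side (b := true) (CutIf_spec (stored_side true st2) rd2' hl2).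
move/run_seq; apply=> s3 f3 [rd3' se3'].
have st3 := stored_frame f3 isT isT st2.
have rd3 : ready I (rho false) (E false) (r false) (side false s3).
  by apply: (ready_frame f3) rd2.
have se3 : settled (E false) (r false) lam (side false s3) by apply: (settled_frame f3) se2.
have hl3 : reals s3 rlam 0 = lam by rewrite f3.2.
have D3 : duo rho E r s3 by case: D1 => *; split=> //; case.
step; sto; set s3' := State _ _; have st3' : stored I s3' by case: st3 => *; split.
rewrite -[n * 1]addn0.
apply: (@run_seq _ _ _ _ _ (n * 1) 0 (fun s' => exists2 flag : bool, ints s' vflag 0 = flag &
  if flag then forall i, i < n -> (reals s' aFV i <= lam)%R \/ (reals s' aFV' i <= lam)%R
  else exists i, [/\ i < n, (lam < reals s' aFV i)%R & (lam < reals s' aFV' i)%R])).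
  apply: (run_for (n := n) (I := fun j (s' : state R) => exists2 flag : bool, ints s' vflag 0 = flag &
    if flag then forall i, i < j -> (reals s' aFV i <= lam)%R \/ (reals s' aFV' i <= lam)%R
    else exists i, [/\ i < n, (lam < reals s' aFV i)%R & (lam < reals s' aFV' i)%R])) => //=.
  - exact: st_n st3'.
  - by qlia.
  - by exists true.
  move=> j s4 hj fr hj' [flag hf hI]; have hl4 : reals s4 rlam 0 = lam by rewrite fr.2.
  apply: wp_run; rewrite /= hj'; tst.
  rewrite hl4 -!ltNge; case: ifP => [/andP[h1 h2]|h].
    by sto; exists false => //=; exists j.
  exists flag => //=; case: (flag) hI => // hI i hi.
  case: (eqVneq i j) => [->|hne]; last by apply: hI; qlia.
  by case: (lerP (reals s4 aFV j) lam) => h1; [left|right; move: h; rewrite h1 /= => /negbT; rewrite -leNgt].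
move=> s4 f4 [flag hf hflag]; have D4 : duo rho E r s4.
  by apply: (duo_frame f4) => //; apply: (duo_frame (s := s3) (ia := [:: vflag]) (ra := [::])) => //; split=> // a i; rewrite inE /= => /negbTE ->.
have K04 : ints s4 vK 0 = size (E false) by have := proj1 (rd_reg (duo_rd D4 false)).
have K14 : ints s4 vK' 0 = size (E true) by have := proj1 (rd_reg (duo_rd D4 true)).
have L04 : reals s4 vLAM 0 = L0 by rewrite f4.2 //= f3.2 // f2.2 // f1.2.
have L14 : reals s4 vLAM' 0 = L1 by rewrite f4.2 //= f3.2 // f2.2 // f1.2.
have se4 : settled (E false) (r false) lam (side false s4) by apply: (settled_frame f4) se3.
have se4' : settled (E true) (r true) lam (side true s4).
  by apply: (settled_frame (frame_ren f4)) se3'.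
have fin s5 (b up : bool) : frame [:: vsel; vupf] [::] s4 s5 -> ints s5 vsel 0 = b -> ints s5 vupf 0 = up ->
   sound_move E r b up s4 -> duo rho E r s5 /\ exists (b up : bool), [/\ ints s5 vsel 0 = b, ints s5 vupf 0 = up & sound_move E r b up s5].
  move=> f5 e1 e2 hm; split; first by apply: (duo_frame f5).
  exists b, up; split=> //; move: hm; rewrite /sound_move; case: (b) => /=; by rewrite !f5.1.
have fr5 x y : frame [:: vsel; vupf] [::] s4 (State (upd (upd (ints s4) vupf 0 y) vsel 0 x) (reals s4)).
  by split=> // a i; rewrite !inE negb_or /= => /andP[/negbTE -> /negbTE ->].
have fr5' x y z : frame [:: vsel; vupf] [::] s4 (State (upd (upd (upd (ints s4) vupf 0 y) vsel 0 x) vupf 0 z) (reals s4)).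
  by split=> // a i; rewrite !inE negb_or /= => /andP[/negbTE -> /negbTE ->].
apply: wp_run; rewrite /= ?eqxx /= hf; sto; tst; rewrite /= K04.
rewrite -[true]/(true) in hbig *; case: ifP => h0.
  tst; rewrite /= K14; case: ifP => h1.
    tst; rewrite /= L04 L14; rewrite /lam h0 h1 /= in hflag; case: ifP => hL; rewrite hL in hflag.
      sto; rewrite /= ?hf; case: (flag) hflag => hflag.
        apply: (fin _ true false) => //; apply: (sound_down2 D4) => // i hi.
        by rewrite /= -/L1 L14; case: (hflag i hi); [right|left].
      apply: (fin _ false true) => //; have [i [h2 h3 h4]] := hflag.
      by apply: (sound_up2 D4 _ _ _ h2) => //=; rewrite ?L14 ?L04.
    sto; rewrite /= ?hf; case: (flag) hflag => hflag.
      by apply: (fin _ false false) => //; apply: (sound_down2 D4) => // i hi; rewrite /= L04; apply: hflag.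
    apply: (fin _ true true) => //; have [i [h2 h3 h4]] := hflag.
    apply: (sound_up2 D4 _ _ _ h2) => //=; rewrite ?L14 ?L04 //.
    by move/negbT: hL; rewrite -ltNge => /ltW.
  have el : lam = reals (side false s4) vLAM 0 by rewrite /lam h0 h1 /= L04.
  rewrite el in hflag se4'.
  sto; tst; rewrite /= mulr1z; case: ifP => hS.
    case: (flag) hflag => hflag; rewrite ?subnn ?subn0.
      by apply: (fin _ false false) => //; apply: (sound_down1 D4) => //=; rewrite h1.
    by apply: (fin _ false true) => //; apply: (sound_up1 D4) => //=; [rewrite h1|right].
  sto; apply: (fin _ false true) => //; apply: (sound_up1 D4) => //=; first by rewrite h1.
  by left; move/negbT: hS; rewrite -ltNge.
have h1 : 1 < size (E true) by move: hbig; rewrite /= h0 /= orbF.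
have el : lam = reals (side true s4) vLAM 0 by rewrite /lam h0 /= L14.
rewrite el in hflag se4.
sto; tst; rewrite /= mulr1z; case: ifP => hS.
  case: (flag) hflag => hflag; rewrite ?subnn ?subn0.
    apply: (fin _ true false) => //; apply: (sound_down1 D4) => //=; first by rewrite h0.
    by move=> i hi; case: (hflag i hi); [right|left].
  apply: (fin _ true true) => //; apply: (sound_up1 D4) => //=; first by rewrite h0.
  by have [i [h2 h3 h4]] := hflag; right; exists i.
sto; apply: (fin _ true true) => //; apply: (sound_up1 D4) => //=; first by rewrite h0.
by left; move/negbT: hS; rewrite -ltNge.
Qed.


Definition modify (A : Type) (b : bool) (x : A) (f : bool -> A) : bool -> A :=
  fun b' => if b' == b then x else f b'.

Lemma Move_spec rho E r s (b up : bool) : duo rho E r s -> ints s vupf 0 = up -> sound_move E r b up s ->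
  run W (scmd b Advance) s (n * m + size (E b) + prep_ticks I ((size (E b)).+1 ./2)) (fun s' =>
    exists rho' E' r', [/\ duo rho' E' r' s', 2 * size (E' b) <= (size (E b)).+1 & E' (~~ b) = E (~~ b)]).
Proof.
move=> D hup [big hs]; have rd := duo_rd D b; have rg := rd_region rd.
cbv zeta in hs; set v := ints (side b s) vV 0 in hs; set d := if up then _ else _ in hs.
have [p hd] := rd_probed rd big; have F := duo_faces D b.
have ed : move_dir up (side b s) = d by rewrite /move_dir /d -(pb_up p).
have hdE : exists2 c, c \in E b & dir v c = d.
  rewrite /d; case: (up); last exact: votes_dir (pb_votes p).
  exact: (valid_dir I_ok rg (pb_mem p) (faces_mem F)).
have hv : v \in rho b :: E b by rewrite inE (pb_mem p) orbT.
have hup' : ints (side b s) vupf 0 = up by case: (b).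
have := Advance_spec I_ok W_ok m_gt0 (stored_side b (duo_st D)) rd (faces_mem F) big hup'.
rewrite ed => /run_side /run_framed; apply: run_weak.
  rewrite leq_add2l /prep_ticks -/v.
  by have := pb_bal p d; rewrite -/v size_filter; qlia.
move=> s' [[st' rd'] f]; have st2 : stored I s'.
  by move: st'; case: (b) => // -[*]; split.
exists (modify b (cut_root v d (rho b)) rho), (modify b (cut v d (E b)) E),
  (modify b (if d == dir v (r b) then r b else v) r).
have nb : (~~ b == b) = false by case: (b).
have vr := interior_anchor F (pb_int p).
have vE c : c \in E (~~ b) -> dir v c = dir v (r b) by apply: (faces_dir F).
split.
- split=> //.
  + move=> b'; rewrite /modify; case: eqP => [->//|/eqP hb].
    have -> : b' = ~~ b by move: hb; case: (b); case: (b').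
    move: f (duo_rd D (~~ b)); case: (b) => f; first exact: ready_frame f _ _.
    by apply: (ready_frame (frame_ren f)).
  + move=> b'; rewrite /modify; case: eqP => [->|/eqP hb].
      by rewrite nb; apply: (faces_cut I_ok rg F hv (pb_int p) hdE).
    have -> : b' = ~~ b by move: hb; case: (b); case: (b').
    rewrite negbK eqxx; have := duo_faces D (~~ b); rewrite negbK.
    exact/faces_sub/cut_subset.
  + move=> b'; rewrite /modify; case: eqP => [->|/eqP hb]; first by rewrite nb.
    have -> : b' = ~~ b by move: hb; case: (b); case: (b').
    by rewrite negbK eqxx; apply: suffice_sym.
  + move=> b' c; rewrite /modify.
    have key : c \in cut v d (E b) -> c \in E (~~ b) ->
        (if d == dir v (r b) then r b else v) != r (~~ b).
      move=> h1 h2; have := h1; rewrite mem_filter (vE _ h2) => /andP[/eqP <- h3].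
      by rewrite eqxx; apply: (duo_sep D h3 h2).
    case: eqP => [->|/eqP hb]; first by rewrite nb.
    have -> : b' = ~~ b by move: hb; case: (b); case: (b').
    by rewrite negbK eqxx => h1 h2; rewrite eq_sym; apply: key.
- rewrite /modify eqxx size_filter; exact: (pb_bal p d).
- by rewrite /modify nb.
Qed.

(** A potential for a region of K <= 2 ^ e edges. A round takes O(K + n m): halving K releases a
    multiple of K from the first term, and lowering e by one releases a multiple of n m from the
    second. *)
Definition refine_ticks e K := 20 * K + e * (20 * (n * m) + 60).

Lemma Refine_spec rho E r s e : duo rho E r s -> (forall b, size (E b) <= 2 ^ e b) ->
  run W Refine s (refine_ticks (e false) (size (E false)) + refine_ticks (e true) (size (E true)))
    (fun s' => exists rho' E' r' c, duo rho' E' r' s' /\ forall b, E' b = [:: c b]).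
Proof.
move=> D he; pose J k s' := exists rho E r e, [/\ duo rho E r s', forall b, size (E b) <= 2 ^ e b &
  k = refine_ticks (e false) (size (E false)) + refine_ticks (e true) (size (E true))].
apply: (run_while (I := J)); last by exists rho, E, r, e.
move=> k s1 _ [rho1 [E1 [r1 [e1 [D1 he1 ->]]]]].
have K0 : ints s1 vK 0 = size (E1 false) := proj1 (rd_reg (duo_rd D1 false)).
have K1 : ints s1 vK' 0 = size (E1 true) := proj1 (rd_reg (duo_rd D1 true)).
split; first by bnd.
rewrite /= K0 K1; case: ifP => hb; last first.
  have rg b := rd_region (duo_rd D1 b).
  have h1 b : ~~ (1 < size (E1 b)).
    by move: hb => /negbT; rewrite negbK -leqNgt => /andP[h1 h2]; case: (b).
  have [c0 ec0] := one_edge (rg _) (h1 false); have [c1 ec1] := one_edge (rg _) (h1 true).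
  by exists rho1, E1, r1, (fun b => if b then c1 else c0); split=> // -[].
have hbig : has (fun b => 1 < size (E1 b)) [:: false; true].
  by move: hb; rewrite negb_and -!ltnNge /= orbF.
pose kb b := 5 * n + (n * m + size (E1 b) + prep_ticks I ((size (E1 b)).+1 ./2)).
pose ps b := refine_ticks (e1 b) (size (E1 b)) - refine_ticks (e1 b).-1 ((size (E1 b)).+1 ./2).
have step2 (b : bool) : 1 < size (E1 b) ->
  [/\ kb b < refine_ticks (e1 b) (size (E1 b)), 
   kb b + refine_ticks (e1 b).-1 ((size (E1 b)).+1 ./2) < refine_ticks (e1 b) (size (E1 b)) &
   (size (E1 b)).+1 ./2 <= 2 ^ (e1 b).-1].
  move=> h; have e0 : 0 < e1 b by case: (e1 b) (he1 b) h => //; qlia.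
  have := he1 b; rewrite -{1 2 3 4}(prednK e0) /kb /prep_ticks /refine_ticks mulSn expnS.
  by move=> h2; split; nia.
have [t [s2 [h1 h2 [D2 [b [up [hsel hupf hm]]]]]]] := Decide_spec D1 hbig.
have [big _] := hm; have [g1 g2 g3] := step2 b big.
exists (kb b); first by case: (b) g1; qlia.
apply: (@run_seq _ _ _ _ _ _ _ (fun s => s = s2)); first by exists t, s2.
move=> _ _ ->; apply: (@run_weak _ _ _ _ _ _ (fun s' =>
    exists rho' E' r', [/\ duo rho' E' r' s', 2 * size (E' b) <= (size (E1 b)).+1 & E' (~~ b) = E1 (~~ b)])).
- exact: leqnn.
- move=> s' [rho2 [E2 [r2 [D2' hs2 hE2]]]].
  have hs2' : size (E2 b) <= (size (E1 b)).+1 ./2 by qlia.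
  pose e2 := modify b (e1 b).-1 e1.
  exists (refine_ticks (e2 false) (size (E2 false)) + refine_ticks (e2 true) (size (E2 true))); last first.
    exists rho2, E2, r2, e2; split=> // b'; rewrite /e2 /modify; case: eqP => [->|/eqP hb'].
      exact: leq_trans hs2' g3.
    have -> : b' = ~~ b by move: hb'; case: (b); case: (b').
    by rewrite hE2; apply: he1.
  have hmono : refine_ticks (e1 b).-1 (size (E2 b)) <= refine_ticks (e1 b).-1 ((size (E1 b)).+1 ./2).
    by rewrite /refine_ticks leq_add2r leq_mul2l hs2' orbT.
  move: g2 hmono hE2; rewrite /e2 /modify; case: (b) => /= g2 hmono ->; qlia.
- have := Move_spec D2 hupf hm => hmove; apply: run_if; first by bnd.
    by rewrite /= hsel; move: hmove; case: (b).
  by rewrite /= hsel; move: hmove; case: (b).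
Qed.


End Phases.

(* The sentinel N is not the direction of any vertex, so that no point counts
   as drawn towards the anchor. *)
Definition Halve : cmd :=
  InitAll ;; vANC <~ 'v vN ;; While (ILe (IConst 2) ('v vK)) (Probe ;; Shrink).

Notation vc := 45. Notation vp := 46.
(** Each half is cut anew from the whole tree, because the halving phase has collapsed all locations
    to a single edge. *)
Definition Half a d : cmd :=
  InitAll ;; vV <~ 'v a ;; vANC <~ 'v a ;; EvalDist ;; vDD <~ 'v d ;; Shrink ;; Prep.
Definition Search : cmd :=
  Halve ;; vc <~ ILoad aREG (IConst 1) ;; vp <~ ILoad aPAR ('v vc) ;;
  Half vc vp ;; ren_c (Half vp vc) ;; Refine.

(** * Halving the tree down to the separating edge *)

Section Halving.
Variables (R : realType) (I : instance R).
Hypothesis I_ok : instance_ok I.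
Local Notation N := (size_t I).
Local Notation n := (npt I).
Local Notation m := (nloc I).
Local Notation dir := (dir (par I)).
Local Notation cut := (cut (par I)).
Local Notation cut_root := (cut_root (par I)).
Local Notation region := (region N (par I)).
Let parP := par_ok I_ok.
Variable W : nat.
Hypothesis W_ok : 4 * N + n * m + n + m + 10 <= W.
Hypothesis m_gt0 : 0 < m.
Let n_gt0 := npt_gt0 I_ok.

Lemma mass_sentinel v i : v < N -> i < n -> mass I v N i = 0%R.
Proof.
move=> hv hi; apply: big1 => j _.
have hk : i * m + j < n * m by case: j => j /= hj; nia.
have hx := node_ok I_ok hk; case: eqP => [e|]; last by rewrite mulr0.
move: e; case: (dirP parP v (node I (i * m + j))) => [b h1 h2 h3 _ _|_] e.
  by have := anc_le parP h3; rewrite e; qlia.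
by have := par_le parP v; rewrite e; qlia.
Qed.

Lemma total_mass_ge0 i : i < n -> (0 <= total_mass I i)%R.
Proof.
move=> hi; apply: sumr_ge0 => j _; apply: (prb_ok I_ok).
by case: j => j /= hj; nia.
Qed.

Lemma Halve_spec s e : stored I s -> N <= 2 ^ e ->
  run W Halve s (N + n * m + refine_ticks I e N) (fun s' => exists rho c,
    [/\ region rho [:: c], reg_at rho [:: c] s' & confined I rho [:: c]]).
Proof.
move=> st he; have hN := size_gt1 I_ok; have hnm : n + m <= n * m + 1 by nia.
apply: (run_seq (InitAll_spec I_ok W_ok st)) => s1 f1 [hreg hent hdir hnode].
have st1 := stored_frame f1 isT isT st.
step; rewrite (st_N st1); sto; set s2 := State _ _.
pose J k (s' : state R) := exists rho E e, [/\ region rho E, reg_at rho E s', ent_at I rho E s',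
  confined I rho E & [/\ ints s' vANC 0 = N, ints s' aDIR N = N, size E <= 2 ^ e & refine_ticks I e (size E) <= k]].
apply: (run_while (I := J)); last first.
  exists 0, (edges I), e; split=> //; [exact: (region_edges_all I_ok)|exact: confined_all|].
  by split=> //; rewrite /edges size_iota ?/refine_ticks; qlia.
move=> k s3 f3 [rho [E [e3 [rg reg3 ent3 cf [anc3 dir3 he3 hk]]]]].
have st3 : stored I s3.
  by apply: (stored_frame f3) => //; case: st1 => *; split.
split; first by bnd.
rewrite /= (proj1 reg3); case: ifP => hE; last first.
  by have [c ec] := one_edge rg (negbT hE); subst E; exists rho, c.
have e0 : 0 < e3 by case: (e3) he3 hE => //; qlia.
have hdec : 7 * size E + 4 * (n * m) + 10 + refine_ticks I e3.-1 ((size E).+1 ./2) <= refine_ticks I e3 (size E).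
  by rewrite -{2}(prednK e0) /refine_ticks mulSn; nia.
exists (6 * (size E).+1 + n * m.+1 + m + (n * m + size E)); first by nia.
have := Probe_spec I_ok W_ok m_gt0 st3 rg reg3 ent3 anc3 (or_intror (conj (erefl N) dir3)) hE.
move/run_seq; apply=> s4 f4 [st4 reg4 ent4 anc4 [d4 dist4 int4 [hv hb] [up4 fv4 vo4]]].
set v := ints s4 vV 0 in dist4 int4 hv hb fv4 vo4 *; set d := ints s4 vDD 0 in vo4.
rewrite eqxx in vo4; have hvv : v \in rho :: E by rewrite inE hv orbT.
have := Shrink_spec I_ok W_ok st4 rg hvv (erefl _) (erefl _) (votes_dir vo4) dist4 reg4 ent4 (or_intror int4).
move/run_framed; apply: run_weak => // s5 [[reg5 ent5] f5].
exists (refine_ticks I e3.-1 (size (cut v d E))).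
  have : size (cut v d E) <= (size E).+1 ./2 by rewrite size_filter; have := hb d; qlia.
  move: hdec hk; rewrite /refine_ticks; nia.
exists (cut_root v d rho), (cut v d E), e3.-1; split=> //.
- exact: (region_cut parP rg hvv (votes_dir vo4)).
- apply: (confined_cut I_ok rg hvv vo4) => // i hi.
  by rewrite mass_sentinel ?mulr0 ?total_mass_ge0 //; apply: region_lt rg hvv.
- rewrite f5.1 //; split=> //.
  + rewrite f5.1 // d4 //; apply/negP => /(region_lt rg); by rewrite ltnn.
  + have := hb d; rewrite size_filter; move: he3; rewrite -{1}(prednK e0) expnS; qlia.
Qed.

Lemma Half_spec a d s : stored I s -> a \in [:: vc; vp] -> d \in [:: vc; vp] ->
  ints s a 0 \in 0 :: edges I ->
  (exists2 c, c \in edges I & dir (ints s a 0) c = ints s d 0) ->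
  run W (Half a d) s (11 * N + 8 * (n * m) + 30) (fun s' => stored I s' /\
    ready I (cut_root (ints s a 0) (ints s d 0) 0) (cut (ints s a 0) (ints s d 0) (edges I)) (ints s a 0) s').
Proof.
move=> st ha hd hv hc; set v := ints s a 0 in hv hc *; set d' := ints s d 0 in hc *.
have hN := size_gt1 I_ok; have rg := region_edges_all I_ok.
have na : a \notin imods (InitAll ;; vV <~ 'v a ;; vANC <~ 'v a ;; EvalDist).
  by move: ha; rewrite !inE => /orP[|] /eqP ->.
have nd : d \notin imods (InitAll ;; vV <~ 'v a ;; vANC <~ 'v a ;; EvalDist).
  by move: hd; rewrite !inE => /orP[|] /eqP ->.
have a_ne : (a == vV) = false by move: ha; rewrite !inE => /orP[|] /eqP ->.
have sz : size (edges I) = N.-1 by rewrite size_iota.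
set E' := cut v d' (edges I); have szE : size E' <= N.-1 by rewrite -sz size_filter count_size.
apply: (@run_le _ _ _ _ (N + n * m + (3 * (size (edges I)).+1 + (n * m + size (edges I) + prep_ticks I (size E'))))); last first.
  by rewrite sz /prep_ticks; qlia.
apply: (run_seq (InitAll_spec I_ok W_ok st)) => s1 f1 [hreg hent hdir hnode].
have st1 := stored_frame f1 isT isT st.
have ea : ints s1 a 0 = v by apply: f1.1; move: ha; rewrite !inE => /orP[|] /eqP ->.
have ed : ints s1 d 0 = d' by apply: f1.1; move: hd; rewrite !inE => /orP[|] /eqP ->.
step; rewrite ea; sto; step; rewrite a_ne /= ea; sto; set s2 := State _ _.
have st2 : stored I s2 by case: st1 => *; split.
have ed2 : ints s2 d 0 = d' by move: hd ed; rewrite /s2 !inE => /orP[|] /eqP ->.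
have reg2 : reg_at 0 (edges I) s2 by [].
apply: (run_seq (EvalDist_spec I_ok W_ok st2 rg reg2 hv (erefl _))) => s3 f3 [d3 u3 o3].
have st3 := stored_frame f3 isT isT st2; have reg3 := reg_at_frame f3 isT reg2.
have ent3 : ent_at I 0 (edges I) s3.
  by apply: (ent_at_frame f3).
have ed3 : ints s3 d 0 = d' by rewrite f3.1 //; move: hd; rewrite !inE => /orP[|] /eqP ->.
have v3 : ints s3 vV 0 = v by rewrite f3.1.
have anc3 : ints s3 vANC 0 = v by rewrite f3.1.
have dist3 : dist_at I 0 (edges I) v s3 by [].
step; rewrite ed3; sto; set s4 := State _ _.
have st4 : stored I s4 by case: st3 => *; split.
have n4 : forall k, k < n * m -> ints s4 aENT k = node I k by move=> k hk; rewrite /s4 /= f3.1 //= hnode.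
apply: (run_seq (Shrink_spec I_ok W_ok st4 rg (v := v) hv v3 (erefl _) hc dist3 reg3 ent3 (or_introl n4))).
move=> s5 f5 [reg5 ent5]; have st5 := stored_frame f5 isT isT st4.
apply: (Prep_spec I_ok W_ok m_gt0 st5 (region_cut parP rg hv hc) reg5 ent5).
  by rewrite f5.1.
exact: (cut_self parP rg hv hc).
Qed.


Lemma duo_start rho c s0 : region rho [:: c] -> confined I rho [:: c] -> let p := par I c in
  stored I s0 -> ready I (cut_root c p 0) (cut c p (edges I)) c s0 ->
  ready I (cut_root p c 0) (cut p c (edges I)) p (side true s0) ->
  duo I (fun b => if b then cut_root p c 0 else cut_root c p 0)
    (fun b => if b then cut p c (edges I) else cut c p (edges I)) (fun b => if b then p else c) s0.
Proof.
move=> rg cf p st h0 h1; have hs := confined_suffice I_ok rg cf.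
have pc : p != c by rewrite ltn_eqF //; apply: (proj2 parP); case/andP: (region1_pos rg).
split=> //.
- by case.
- by case; [exact: (split_faces2 I_ok rg)|exact: (split_faces1 I_ok rg)].
- by case; [exact: suffice_sym hs|exact: hs].
- by case=> c' _ _ //; rewrite eq_sym.
Qed.

Lemma Search_spec s e : stored I s -> N <= 2 ^ e ->
  run W Search s (100 * N + 20 * (n * m) + 100 + 3 * (e * (20 * (n * m) + 60))) (fun s' =>
    exists rho E r c, duo I rho E r s' /\ forall b, E b = [:: c b]).
Proof.
move=> st he; have hN := size_gt1 I_ok.
set H := 11 * N + 8 * (n * m) + 30.
apply: (@run_le _ _ _ _ (N + n * m + refine_ticks I e N + (H + (H + (refine_ticks I e N + refine_ticks I e N)))));
  last by rewrite /refine_ticks /H; qlia.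
apply: (run_seq (Halve_spec st he)) => s1 f1 [rho [c [rg reg1 cf]]].
have st1 := stored_frame f1 isT isT st.
have /andP[c0 cN] := region1_pos rg.
set p := par I c; have pc : p < c := proj2 parP _ c0.
step; rewrite (proj2 reg1) //=; sto; step; rewrite (st_par st1) // -/p; sto; set s2 := State _ _.
have st2 : stored I s2 by case: st1 => *; split.
have m1 := split_mem1 I_ok rg; have m2 := split_mem2 I_ok rg.
have d1 := split_dir1 I_ok rg; have d2 := split_dir2 I_ok rg.
have := @Half_spec vc vp s2 st2 isT isT m1 d1.
move/run_seq; apply=> s3 f3 [st3 rd3].
have e3 : ints s3 vp 0 = p by rewrite f3.1.
have e3' : ints s3 vc 0 = c by rewrite f3.1.
have := @Half_spec vp vc (side true s3) (stored_side true st3) isT isT.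
rewrite /= /swp /= e3 e3' => /(_ m2 d2) h4; have := run_side (b := true) h4.
move/run_seq; apply=> s4 f4 [st4 rd4].
have st4' := stored_frame f4 isT isT st3.
have rd4' := ready_frame f4 isT isT rd3.
have sz : size (edges I) = N.-1 by rewrite size_iota.
have szc v d : size (cut v d (edges I)) <= N.-1 by rewrite -sz size_filter count_size.
have hpow (b : bool) : size (if b then cut p c (edges I) else cut c p (edges I)) <= 2 ^ e.
  by case: b; apply: leq_trans (szc _ _) _; qlia.
have := Refine_spec I_ok W_ok m_gt0 (duo_start rg cf st4' rd4' rd4) (e := fun=> e) hpow.
apply: run_weak => //; rewrite /refine_ticks; have := szc c p; have := szc p c; rewrite /p; qlia.
Qed.

End Halving.

(** * Crossings on the final edges *)

Notation aHL := 47. Notation aDL := 48. Notation vHT := 49. Notation aST := 36. Notation aQ := 88.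
Notation vlo := 57. Notation vhi := 58. Notation vmid := 59.

Definition slopeE k := RSub (RLoad aFB k) (RLoad aFA k).
Definition lineE k s := RAdd (RLoad aFA k) (RMul (slopeE k) s).
Definition topE := ISub ('v vHT) (IConst 1).
Definition hullE t := ILoad aHL t.

Definition Collect : cmd :=
  sL <~ IConst 0 ;;
  For vi vn (
    If (RLe (RLoad aFA ('v vi)) (RLoad aFB ('v vi))) Skip
      (IStore aDL ('v sL) ('v vi) ;; RStore aSK ('v sL) (slopeE ('v vi)) ;;
       sL <~ IAdd ('v sL) (IConst 1))).

(** Lines come in order of slope, so a steeper rise to the right is only met later. The top of the
    stack is popped if it is not above the new line where it starts; otherwise the new line starts
    at their crossing, or is dropped if both have the same slope. *)
Definition BuildHull : cmd :=
  vHT <~ IConst 0 ;;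
  vj <~ IConst 0 ;;
  While (BNot (ILe ('v sL) ('v vj))) (
    vx <~ ILoad aDL (ILoad aSO ('v vj)) ;;
    If (BAnd (ILe (IConst 1) ('v vHT))
         (RLe (lineE (hullE topE) (RLoad aST topE)) (lineE ('v vx) (RLoad aST topE))))
      (vHT <~ topE)
      (If (ILe (IConst 1) ('v vHT))
         (If (RLe (slopeE ('v vx)) (slopeE (hullE topE))) Skip
           (RStore aST ('v vHT) (RDiv (RSub (RLoad aFA (hullE topE)) (RLoad aFA ('v vx)))
              (RSub (slopeE ('v vx)) (slopeE (hullE topE)))) ;;
            IStore aHL ('v vHT) ('v vx) ;; vHT <~ IAdd ('v vHT) (IConst 1)))
         (RStore aST ('v vHT) (RConst 0) ;;
          IStore aHL ('v vHT) ('v vx) ;; vHT <~ IAdd ('v vHT) (IConst 1)) ;;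
       vj <~ IAdd ('v vj) (IConst 1))).

(** The envelope descends and the line does not, so they cross at most once: at its near end the
    line is already above the envelope, or binary search finds the envelope line that it meets. *)
Definition Query : cmd :=
  For vi vn (
    If (BNot (RLe (RLoad aFA ('v vi)) (RLoad aFB ('v vi)))) Skip
      (RStore aQ ('v vi) (RLoad aFA ('v vi)) ;;
       If (ILe ('v vHT) (IConst 0)) Skip
        (If (RLe (RLoad aFA (hullE (IConst 0))) (RLoad aFA ('v vi))) Skip
          (vlo <~ IConst 0 ;; vhi <~ 'v vHT ;;
           While (ILe (IAdd ('v vlo) (IConst 2)) ('v vhi)) (
             vmid <~ IDiv (IAdd ('v vlo) ('v vhi)) (IConst 2) ;;
             If (RLe (lineE ('v vi) (RLoad aST ('v vmid))) (lineE (hullE ('v vmid)) (RLoad aST ('v vmid))))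
               (vlo <~ 'v vmid) (vhi <~ 'v vmid)) ;;
           RStore aQ ('v vi) (lineE ('v vi)
             (RDiv (RSub (RLoad aFA (hullE ('v vlo))) (RLoad aFA ('v vi)))
                (RSub (slopeE ('v vi)) (slopeE (hullE ('v vlo)))))))))).

Definition Crossings : cmd := Collect ;; Sort ;; BuildHull ;; Query.

Section Crossings.
Variables (R : realType) (I : instance R).
Hypothesis I_ok : instance_ok I.
Local Notation N := (size_t I).
Local Notation n := (npt I).
Local Notation m := (nloc I).
Variable A B : nat -> R.
Local Notation slope k := (B k - A k)%R.
Local Notation line := (line A B).

Definition ends_at (s : state R) := forall i, i < n -> reals s aFA i = A i /\ reals s aFB i = B i.

Lemma ends_frame ia ra s s' : frame ia ra s s' -> aFA \notin ra -> aFB \notin ra -> ends_at s -> ends_at s'.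
Proof. by move=> f h1 h2 h i /h; rewrite !f.2. Qed.

Definition descending j := [seq i <- iota 0 j | (B i < A i)%R].

Lemma descendingS j : descending j.+1 =
  if (B j < A j)%R then rcons (descending j) j else descending j.
Proof. by rewrite /descending -[j.+1]addn1 iotaD filter_cat /=; case: ifP; rewrite ?cats1 ?cats0. Qed.

Lemma mem_descending j i : (i \in descending j) = (B i < A i)%R && (i < j).
Proof. by rewrite mem_filter mem_iota. Qed.

Lemma size_descending j : size (descending j) <= j.
Proof. by rewrite size_filter -[X in _ <= X](size_iota 0 j) count_size. Qed.

Local Notation D := (descending n).
Local Notation L := (size D).

Lemma mem_D t : t < L -> nth 0 D t < n /\ (B (nth 0 D t) < A (nth 0 D t))%R.
Proof. by move=> /(mem_nth 0); rewrite mem_descending => /andP[]. Qed.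

Variable W : nat.
Hypothesis W_ok : 4 * N + n * m + n + m + 10 <= W.
Hypothesis m_gt0 : 0 < m.
Let n_gt0 := npt_gt0 I_ok.

Lemma Collect_spec s : stored I s -> ends_at s ->
  run W Collect s n (fun s' => [/\ ints s' sL 0 = L, forall t, t < L -> ints s' aDL t = nth 0 D t &
    forall t, t < L -> reals s' aSK t = slope (nth 0 D t)]).
Proof.
move=> st he; step; sto; rewrite -[X in run _ _ _ X]muln1.
apply: (run_for (n := n) (I := fun j (s' : state R) => [/\ ints s' sL 0 = size (descending j),
  forall t, t < size (descending j) -> ints s' aDL t = nth 0 (descending j) t &
  forall t, t < size (descending j) -> reals s' aSK t = slope (nth 0 (descending j) t)])) => //=.
- exact: st_n st.
- by qlia.
move=> j s1 hj fr hj' [h1 h2 h3]; have [eA eB] : reals s1 aFA j = A j /\ reals s1 aFB j = B j.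
  by rewrite !fr.2 //; apply: he.
have hs := size_descending j.
apply: wp_run; rewrite /= hj'; tst; rewrite eA eB descendingS; case: lerP => hBA; first by [].
rewrite h1; sto; rewrite /= ?h1 ?hj'; sto; rewrite /= ?h1; sto; rewrite ?eqxx /= size_rcons.
split; first by rewrite addn1.
- move=> t ht /=; rewrite nth_rcons; case: (ltngtP t (size (descending j))) => h; [exact: h2|by qlia|by []].
- move=> t ht /=; rewrite nth_rcons; case: (ltngtP t (size (descending j))) => h; [exact: h3|by qlia|by []].
Qed.

Definition hull_at (s : state R) := [/\ ints s vHT 0 <= n, hull A B (ints s vHT 0) (ints s aHL) (reals s aST),
  forall t, t < ints s vHT 0 -> ints s aHL t < n &
  forall k, k < n -> (B k < A k)%R -> dominated A B (ints s vHT 0) (ints s aHL) k].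

Lemma BuildHull_spec s o : stored I s -> ends_at s -> ints s sL 0 = L ->
  (forall t, t < L -> ints s aDL t = nth 0 D t) -> perm_eq o (iota 0 L) ->
  (forall j, j < L -> ints s aSO j = nth 0 o j) ->
  (forall j j', j <= j' < L -> (slope (nth 0 D (nth 0 o j)) <= slope (nth 0 D (nth 0 o j')))%R) ->
  run W BuildHull s (2 * L) hull_at.
Proof.
move=> st he hL hD hperm hO hsort; have hLn := size_descending n.
pose x j := nth 0 D (nth 0 o j).
have ho j : j < L -> nth 0 o j < L.
  move=> hj; have := mem_nth 0 (s := o) (n := j); rewrite (perm_size hperm) size_iota => /(_ hj).
  by rewrite (perm_mem hperm) mem_iota.
have hx j : j < L -> x j < n /\ (B (x j) < A (x j))%R by move=> /ho /mem_D.
step; sto; step; sto; set s0 := State _ _.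
(* Each line is pushed and popped at most once, whence the potential 2 (L - j) plus the height of
   the stack. A popped line may be dominated only with the help of the line [x j] that is still to
   be treated. *)
pose J k (s' : state R) := exists j, [/\ ints s' vj 0 = j, j <= L, ints s' vHT 0 <= j,
  k = 2 * (L - j) + ints s' vHT 0 & [/\ hull A B (ints s' vHT 0) (ints s' aHL) (reals s' aST),
  forall t, t < ints s' vHT 0 -> ints s' aHL t < n,
  forall t j', t < ints s' vHT 0 -> j <= j' < L -> (slope (ints s' aHL t) <= slope (x j'))%R &
  forall j', j' < j -> forall u, (0 <= u)%R ->
   (exists2 t, t < ints s' vHT 0 & (line (x j') u <= line (ints s' aHL t) u)%R) \/
   j < L /\ (line (x j') u <= line (x j) u)%R]].
apply: (run_while (I := J)); last first.
  by exists 0; split=> //=; rewrite ?subn0 ?addn0.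
move=> k s1 f1 [j [hj hjL hHT -> [H hn hs hd]]].
have hL1 : ints s1 sL 0 = L by rewrite f1.1.
split; first by bnd.
rewrite /= hL1 hj -ltnNge; case: ltnP => hlt; last first.
  have ej : j = L by qlia.
  rewrite ej in hHT hd; split=> //; first by qlia.
  move=> k' hk hBA u hu; have hkD : k' \in D by rewrite mem_descending hBA hk.
  have hio : index k' D \in o by rewrite (perm_mem hperm) mem_iota /= index_mem.
  have hidx : index (index k' D) o < L.
    by rewrite -[X in _ < X](size_iota 0 L) -(perm_size hperm) index_mem.
  have := hd _ hidx u hu; rewrite /x (nth_index 0 hio) (nth_index 0 hkD).
  by case=> // -[]; rewrite ltnn.
have [hxn hxd] := hx j hlt.
have eX : ints s1 aDL (ints s1 aSO j) = x j by rewrite !f1.1 //= hO // hD // ho.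
have eE i : i < n -> reals s1 aFA i = A i /\ reals s1 aFB i = B i by move=> hi; rewrite !f1.2 //; apply: he.
have [eAx eBx] := eE _ hxn.
set T := ints s1 vHT 0 in H hn hs hd hHT *.
exists 0; first by qlia.
have htop : 0 < T -> [/\ T.-1 < T, ints s1 aHL T.-1 < n & reals s1 aFA (ints s1 aHL T.-1) = A (ints s1 aHL T.-1) /\
  reals s1 aFB (ints s1 aHL T.-1) = B (ints s1 aHL T.-1)].
  by move=> hT; have h := hn T.-1 ltac:(qlia); have := eE _ h; split=> //; qlia.
have fin s2 T' : ints s2 vj 0 = j.+1 -> ints s2 vHT 0 = T' -> T' <= T.+1 ->
  hull A B T' (ints s2 aHL) (reals s2 aST) -> (forall t, t < T' -> ints s2 aHL t < n) ->
  (forall t, t < T' -> (slope (ints s2 aHL t) <= slope (x j))%R) ->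
  (forall j', j' <= j -> dominated A B T' (ints s2 aHL) (x j')) ->
  exists2 k', 0 + k' < 2 * (L - j) + T & J k' s2.
  move=> e1 e2 hT' H2 hn2 hs2 hd2; exists (2 * (L - j.+1) + T'); first by qlia.
  exists j.+1; rewrite e2; split=> //; first by qlia.
  split=> //.
  - move=> t j' ht hj'; apply: le_trans (hs2 t ht) _.
    by apply: hsort; qlia.
  - by move=> j' hj' u hu; left; apply: hd2.
have self j' : j' <= j -> forall u, (0 <= u)%R ->
    (exists2 t, t < T & (line (x j') u <= line (ints s1 aHL t) u)%R) \/ (line (x j') u <= line (x j) u)%R.
  rewrite leq_eqVlt => /orP[/eqP ->|h] u hu; first by right.
  by case: (hd j' h u hu) => [|[_]]; [left|right].
apply: wp_run; rewrite /= ?eqxx /= hj eX; sto; tst; rewrite /= ?eqxx /= -/T ?hj subn1.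
case: (posnP T) => hT /=.
  have H0 : hull A B 0 (ints s1 aHL) (reals s1 aST) by move: H; rewrite hT.
  tst; sto; sto; sto; sto; apply: (fin _ 1) => //=; rewrite ?addn1 ?hT //=.
  - have := hull_push (x := x j) (s' := 0%R) H0 => /=; apply=> //; lra.
  - by case.
  - by case.
  - move=> j' hj'; apply: (@dominated_push _ A B 0 (ints s1 aHL) (x j)) => u hu.
    by have := self j' hj' u hu; rewrite hT.
have [hT1 hh [eAh eBh]] := htop hT.
rewrite eAh eBh eAx eBx; case: ifP => hpop.
  sto; exists (2 * (L - j) + T.-1); first by qlia.
  exists j; rewrite /= -/T ?subn1; split=> //; first by qlia.
  have ET : T = T.-1.+1 by rewrite prednK.
  rewrite ET in H; split=> //.
  - exact: hull_pop H.
  - by move=> t ht; apply: hn; qlia.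
  - by move=> t j' ht; apply: hs; qlia.
  - move=> j' hj' u hu.
    have := dominated_pop (x := x j) (k := x j') H _ hpop _ hu.
    case.
    + by apply: hs; qlia.
    + by rewrite -ET; apply: self; qlia.
    + by left.
    + by right.
move/negbT: hpop; rewrite -ltNge => hpop.
tst; case: ifP => hsl; tst.
  sto; apply: (fin _ T) => //=; rewrite ?addn1 //.
  - by move=> t ht; apply: hs; qlia.
  - move=> j' hj'; have ET : T = T.-1.+1 by rewrite prednK.
    rewrite ET; apply: (dominated_skip (st := reals s1 aST) hsl _ (ltW hpop)).
      by apply: hs; qlia.
    by rewrite -ET; apply: self.
move/negbT: hsl; rewrite -ltNge => hsl.
do 4 sto.
set s' := (_ / _)%R; set h := ints s1 aHL T.-1 in hsl hpop eAh eBh s' *.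
have hpos : (0 < slope (x j) - slope h)%R by rewrite subr_gt0.
apply: (fin _ T.+1) => //=; rewrite ?addn1 //.
- apply: (hull_push (x := x j) (s' := s') H); first by lra.
  rewrite (gtn_eqF hT); split=> //.
    by rewrite /s' ltr_pdivlMr //; move: hpop; rewrite /line; nra.
  by rewrite /s' /line -/h; field; exact: lt0r_neq0.
- by move=> t ht; case: eqP => // hne; apply: hn; qlia.
- by move=> t ht; case: eqP => // hne; apply: hs; qlia.
- by move=> j' hj'; apply: (@dominated_push _ A B T (ints s1 aHL) (x j)) => u; apply: self.
Qed.

End Crossings.

Section Queries.
Variables (R : realType) (I : instance R).
Hypothesis I_ok : instance_ok I.
Local Notation N := (size_t I).
Local Notation n := (npt I).
Local Notation m := (nloc I).
Variable A B : nat -> R.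
Local Notation line := (line A B).
Local Notation D := (descending A B n).
Local Notation L := (size D).
Local Notation ends_at := (ends_at I A B).
Variable W : nat.
Hypothesis W_ok : 4 * N + n * m + n + m + 10 <= W.
Hypothesis m_gt0 : 0 < m.
Let n_gt0 := npt_gt0 I_ok.

Lemma Query_spec s e : stored I s -> ends_at s -> hull_at I A B s -> n <= 2 ^ e ->
  run W Query s (n * e.+1) (fun s' => forall i, i < n -> (A i <= B i)%R -> crossing I A B (reals s' aQ i) i).
Proof.
move=> st he [hT H hn hd] hne; set T := ints s vHT 0 in hT H hn hd.
set h := ints s aHL in H hn hd; set sg := reals s aST in H.
have nW : n * 2 <= n + n * m by nia.
apply: (run_for (n := n) (I := fun j (s' : state R) => forall i, i < j -> (A i <= B i)%R ->
  crossing I A B (reals s' aQ i) i)) => //=.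
- exact: st_n st.
- by qlia.
move=> i s1 hi fr hi' hI.
have eE k : k < n -> reals s1 aFA k = A k /\ reals s1 aFB k = B k by move=> hk; rewrite !fr.2 //; apply: he.
have [eA eB] := eE i hi.
have T1 : ints s1 vHT 0 = T by rewrite fr.1.
have h1 t : ints s1 aHL t = h t by rewrite fr.1.
have sg1 t : reals s1 aST t = sg t by rewrite fr.2.
have keep (q : R) : ((A i <= B i)%R -> crossing I A B q i) ->
   forall j, j < i.+1 -> (A j <= B j)%R -> crossing I A B (if j == i then q else reals s1 aQ j) j.
  by move=> hq j hj; case: (eqVneq j i) => [->//|hne']; apply: hI; qlia.
apply: run_if; first by bnd.
  rewrite /= hi' eA eB => hlt; apply: run_le (wp_run _) _ => //= j hj hAB.
  case: (eqVneq j i) => [e1|hne']; last by apply: hI => //; qlia.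
  by move: hlt; rewrite -e1 hAB.
rewrite /= hi' eA eB negbK => hAB.
step; rewrite hi' eA; sto; set s2 := State _ _.
have near : (forall k, k < n -> (B k < A k)%R -> (A k <= A i)%R) ->
  forall j, j < i.+1 -> (A j <= B j)%R -> crossing I A B (reals s2 aQ j) j.
  by move=> hk; apply: keep => _; apply: crossing_near.
apply: run_if; first by bnd.
  rewrite /= T1 leqn0 => /eqP hT0; apply: run_le (wp_run _) _ => //=; apply: near => k hk hBA.
  by have [t] := hd k hk hBA 0%R (lexx _); rewrite hT0.
rewrite /= T1 -ltnNge => hT0; have [eA0 eB0] := eE _ (hn 0 hT0).
apply: run_if; first by bnd.
  rewrite /= h1 hi' eA0 eA => h0; apply: run_le (wp_run _) _ => //=; apply: near => k hk hBA.
  have := hull_max H hT0 (lexx 0%R) _ _ (hd k hk hBA); rewrite (hull_st0 H hT0) lexx.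
  rewrite /line !mulr0 !addr0 => hmax; apply: le_trans (hmax isT _) h0.
  by move=> hT1; apply: (hull_ge0 H).
rewrite /= h1 hi' eA0 eA -ltNge => h0.
step; sto; step; rewrite T1; sto; set s3 := State _ _.
rewrite -[e]addn0.
(* At [vlo] the line i is not above the envelope, at [vhi] it is; the value T of [vhi] stands for
   the end of the envelope, where nothing is compared. *)
pose J k (s' : state R) := [/\ ints s' vlo 0 < ints s' vhi 0 <= T,
  (line i (sg (ints s' vlo 0)) <= line (h (ints s' vlo 0)) (sg (ints s' vlo 0)))%R,
  ints s' vhi 0 < T -> (line (h (ints s' vhi 0)) (sg (ints s' vhi 0)) < line i (sg (ints s' vhi 0)))%R &
  ints s' vhi 0 - ints s' vlo 0 <= 2 ^ k].
apply: (@run_seq _ _ _ _ _ _ _ (fun s' => [/\ ints s' vlo 0 < T,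
  (line i (sg (ints s' vlo 0)) <= line (h (ints s' vlo 0)) (sg (ints s' vlo 0)))%R &
  (ints s' vlo 0).+1 < T -> (line (h (ints s' vlo 0).+1) (sg (ints s' vlo 0).+1) < line i (sg (ints s' vlo 0).+1))%R])).
  apply: (run_while (I := J)); last first.
    split=> //=; rewrite ?subn0 ?hT0 ?leqnn //; [|by qlia|exact: leq_trans hne].
    by rewrite (hull_st0 H hT0) /line !mulr0 !addr0 ltW.
  move=> k s4 f4 [/andP[k1 k2] k3 k4 k5]; split; first by bnd.
  rewrite /=; case: ifP => hlt; last first.
    have e1 : ints s4 vhi 0 = (ints s4 vlo 0).+1 by qlia.
    by split=> //; [qlia|rewrite -e1].
  set mid := (ints s4 vlo 0 + ints s4 vhi 0) %/ 2.
  have hm : ints s4 vlo 0 < mid < ints s4 vhi 0 by rewrite /mid; qlia.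
  have k0 : 0 < k by case: (k) k5 => //; qlia.
  exists 0 => //.
  have i4 : ints s4 vi 0 = i by rewrite f4.1 //= hi'.
  have fA k' : reals s4 aFA k' = reals s1 aFA k' by rewrite f4.2.
  have fB k' : reals s4 aFB k' = reals s1 aFB k' by rewrite f4.2.
  have hm4 : ints s4 aHL mid = h mid by rewrite f4.1 //= h1.
  have sm4 : reals s4 aST mid = sg mid by rewrite f4.2 //= sg1.
  have [eAm eBm] := eE _ (hn mid ltac:(qlia)).
  have pk : 2 ^ k = 2 * 2 ^ k.-1 by rewrite -{1}(prednK k0) expnS.
  apply: wp_run; rewrite /= -/mid; sto; tst; rewrite /= ?eqxx /= i4 hm4 sm4 !fA !fB eA eB eAm eBm.
  case: ifP => hc; sto; (exists k.-1; first by qlia); split=> //=.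
  - by qlia.
  - by rewrite /mid; qlia.
  - by qlia.
  - by move=> _; move/negbT: hc; rewrite -ltNge.
  - by rewrite /mid; qlia.
move=> s4 f4 [g1 g2 g3]; have i4 : ints s4 vi 0 = i by rewrite f4.1 //= hi'.
have fA k' : reals s4 aFA k' = reals s1 aFA k' by rewrite f4.2.
have fB k' : reals s4 aFB k' = reals s1 aFB k' by rewrite f4.2.
have Q4 k' : reals s4 aQ k' = reals s2 aQ k' by rewrite f4.2.
have hh4 t : ints s4 aHL t = h t by rewrite f4.1 //= h1.
set lo := ints s4 vlo 0 in g1 g2 g3.
have [eAm eBm] := eE _ (hn lo g1).
apply: wp_run; rewrite /= i4 -/lo hh4 !fA !fB eA eB eAm eBm; sto => j hj hABj /=.
case: (eqVneq j i) => [e1|hne']; last first.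
  by rewrite Q4 /= (negbTE hne'); apply: hI; qlia.
by rewrite e1 -/(line i _); apply: (crossing_far H).
Qed.

Lemma Crossings_spec s e : stored I s -> ends_at s -> n <= 2 ^ e ->
  run W Crossings s (n * (2 * e + 12)) (fun s' => forall i, i < n -> (A i <= B i)%R -> crossing I A B (reals s' aQ i) i).
Proof.
move=> st he hne; have hLn := size_descending A B n; have nW : n * 2 <= n + n * m by nia.
apply: (@run_le _ _ _ _ (n + ((L * (trunc_log 2 (2 * L) + 4) + 1) + (2 * L + n * e.+1)))); last first.
  have : trunc_log 2 (2 * L) <= e.+1.
    have h2 : 2 * L <= 2 ^ e.+1 by rewrite expnS; qlia.
    by have := leq_trunc_log 2 h2; rewrite trunc_expnK.
  move: (trunc_log _ _) => t ht; have : L * (t + 4) <= n * (e + 5) by apply: leq_mul; qlia.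
  by nia.
apply: (run_seq (Collect_spec I_ok W_ok m_gt0 st he)) => s1 f1 [L1 D1 K1].
have st1 := stored_frame f1 isT isT st; have he1 := ends_frame f1 isT isT he.
have hLW : 2 * L + 2 <= W by qlia.
apply: (run_seq (Sort_spec hLW L1 K1)) => s2 f2 [o [ho1 ho2 ho3]].
have st2 := stored_frame f2 isT isT st1; have he2 := ends_frame f2 isT isT he1.
have L2 : ints s2 sL 0 = L by rewrite f2.1.
have D2 t : t < L -> ints s2 aDL t = nth 0 D t by move=> /D1; rewrite f2.1.
apply: (run_seq (BuildHull_spec I_ok W_ok m_gt0 st2 he2 L2 D2 ho1 ho2 ho3)) => s3 f3 h3.
apply: Query_spec => //; first exact: stored_frame f3 isT isT st2.
exact: ends_frame f3 isT isT he2.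
Qed.

End Queries.

(** * The optimum on the two final edges *)

Notation aFA' := 104. Notation aFB' := 105. Notation aQ' := 108.

Definition Raise e : cmd := If (RLe ('r rlam) e) (rlam <~~ e) Skip.

Definition Lam : cmd :=
  rlam <~~ RConst 0 ;;
  For vi vn (
    If (RLe (RLoad aFA ('v vi)) (RLoad aFB ('v vi)))
      (If (RLe (RLoad aFA' ('v vi)) (RLoad aFB' ('v vi)))
        (If (RLe (RLoad aQ ('v vi)) (RLoad aQ' ('v vi)))
          (Raise (RLoad aQ ('v vi))) (Raise (RLoad aQ' ('v vi))))
        (Raise (RLoad aFB' ('v vi))))
      (Raise (RLoad aFB ('v vi)) ;;
       If (RLe (RLoad aFA' ('v vi)) (RLoad aFB' ('v vi))) Skip (Raise (RLoad aFB' ('v vi))))).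

Definition Settle : cmd := Crossings ;; ren_c Crossings ;; Lam ;; Cut ;; ren_c Cut.

Section Settling.
Variables (R : realType) (I : instance R).
Hypothesis I_ok : instance_ok I.
Local Notation N := (size_t I).
Local Notation n := (npt I).
Local Notation m := (nloc I).
Variable W : nat.
Hypothesis W_ok : 4 * N + n * m + n + m + 10 <= W.
Hypothesis m_gt0 : 0 < m.

Section Lam.
Variables A1 B1 Q1 A2 B2 Q2 : nat -> R.

(** What the section [TwoEdges] assumes about lam, restricted to the first j points so as to be a
    loop invariant. *)
Definition lam_from (j : nat) (lam : R) : Prop :=
  [/\ (0 <= lam)%R, forall i, i < j -> (B1 i < A1 i)%R -> (B1 i <= lam)%R,
    forall i, i < j -> (B2 i < A2 i)%R -> (B2 i <= lam)%R,
    forall i, i < j -> (A1 i <= B1 i)%R -> (A2 i <= B2 i)%R -> (Num.min (Q1 i) (Q2 i) <= lam)%R &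
    lam = 0%R \/ exists2 i, i < j & [\/ (B1 i < A1 i)%R /\ lam = B1 i, (B2 i < A2 i)%R /\ lam = B2 i |
      [/\ (A1 i <= B1 i)%R, (A2 i <= B2 i)%R & lam = Num.min (Q1 i) (Q2 i)]]].

(* The new value for point j is the maximum of the old one and of a candidate
   [x] that is one of the costs at j and bounds the others. *)
Lemma lam_fromS j lam x : lam_from j lam ->
  ((B1 j < A1 j)%R -> (B1 j <= x)%R) -> ((B2 j < A2 j)%R -> (B2 j <= x)%R) ->
  ((A1 j <= B1 j)%R -> (A2 j <= B2 j)%R -> (Num.min (Q1 j) (Q2 j) <= x)%R) ->
  [\/ (B1 j < A1 j)%R /\ x = B1 j, (B2 j < A2 j)%R /\ x = B2 j |
      [/\ (A1 j <= B1 j)%R, (A2 j <= B2 j)%R & x = Num.min (Q1 j) (Q2 j)]] ->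
  lam_from j.+1 (if (lam <= x)%R then x else lam).
Proof.
move=> [h0 h1 h2 h3 h4] k1 k2 k3 k4; set y := (if _ then _ else _).
have hl : (lam <= y)%R by rewrite /y; case: ifP.
have hx : (x <= y)%R by rewrite /y; case: ifP => // /negbT; rewrite -ltNge => /ltW.
have ext (P : nat -> Prop) : (forall i, i < j -> P i) -> P j -> forall i, i < j.+1 -> P i.
  by move=> hP hj i hi; case: (eqVneq i j) => [->//|hne]; apply: hP; qlia.
split.
- exact: le_trans hl.
- apply: ext => [i hi hd|hd]; first by apply: le_trans (h1 i hi hd) hl.
  exact: le_trans (k1 hd) hx.
- apply: ext => [i hi hd|hd]; first by apply: le_trans (h2 i hi hd) hl.
  exact: le_trans (k2 hd) hx.
- apply: ext => [i hi a b|a b]; first by apply: le_trans (h3 i hi a b) hl.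
  exact: le_trans (k3 a b) hx.
rewrite /y; case: ifP => _; first by right; exists j.
by case: h4 => [->|[i hi h]]; [left|right; exists i => //; qlia].
Qed.

(** Raising twice is raising once by the larger value, which makes [lam_fromS] applicable. *)
Lemma lam_max2 j lam : lam_from j lam -> (B1 j < A1 j)%R -> (B2 j < A2 j)%R ->
  let lam' := (if (lam <= B1 j)%R then B1 j else lam) in
  lam_from j.+1 (if (lam' <= B2 j)%R then B2 j else lam').
Proof.
move=> h h1 h2 /=; set x := if (B1 j <= B2 j)%R then B2 j else B1 j.
have -> : (if ((if (lam <= B1 j)%R then B1 j else lam) <= B2 j)%R then B2 j
    else if (lam <= B1 j)%R then B1 j else lam) = if (lam <= x)%R then x else lam.
  rewrite /x; case: (lerP lam (B1 j)) => a; case: (lerP (B1 j) (B2 j)) => b //.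
  - by rewrite (le_trans a b).
  - by rewrite a.
  - by case: (lerP lam (B2 j)) => c; [exfalso; lra|rewrite leNgt a].
apply: lam_fromS => //.
- by move=> _; rewrite /x; case: ifP.
- by move=> _; rewrite /x; case: (lerP (B1 j) (B2 j)) => // /ltW.
- by move=> a; move: h1; rewrite ltNge a.
by rewrite /x; case: ifP => _; [apply: Or32|apply: Or31].
Qed.

Lemma Lam_spec s : stored I s ->
  ends_at I A1 B1 s -> ends_at I A2 B2 (ren_s s) ->
  (forall i, i < n -> reals s aQ i = Q1 i /\ reals s aQ' i = Q2 i) ->
  run W Lam s n (fun s' => lam_from n (reals s' rlam 0)).
Proof.
move=> st he1 he2 hQ; step; sto; rewrite -[X in run _ _ _ X]muln1.
apply: (run_for (n := n) (I := fun j (s' : state R) => lam_from j (reals s' rlam 0))) => //=.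
- exact: st_n st.
- by qlia.
- by split=> //; left.
move=> j s1 hj fr hj' hI.
have [eA1 eB1] : reals s1 aFA j = A1 j /\ reals s1 aFB j = B1 j by rewrite !fr.2 //; apply: he1.
have [eA2 eB2] : reals s1 aFA' j = A2 j /\ reals s1 aFB' j = B2 j by rewrite !fr.2 //; apply: (he2 j).
have [eQ1 eQ2] : reals s1 aQ j = Q1 j /\ reals s1 aQ' j = Q2 j by rewrite !fr.2 //; apply: (hQ j).
set lam := reals s1 rlam 0 in hI.
have up x : [\/ (B1 j < A1 j)%R /\ x = B1 j, (B2 j < A2 j)%R /\ x = B2 j |
      [/\ (A1 j <= B1 j)%R, (A2 j <= B2 j)%R & x = Num.min (Q1 j) (Q2 j)]] ->
  ((B1 j < A1 j)%R -> (B1 j <= x)%R) -> ((B2 j < A2 j)%R -> (B2 j <= x)%R) ->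
  lam_from j.+1 (if (lam <= x)%R then x else lam).
  move=> h k1 k2; apply: lam_fromS => // a b; case: h => [[+ _]|[+ _]|[_ _ ->//]].
    by rewrite ltNge a.
  by rewrite ltNge b.
have fin x (s2 : state R) : lam_from j.+1 (if (lam <= x)%R then x else lam) ->
    reals s2 rlam 0 = (if (lam <= x)%R then x else lam) -> lam_from j.+1 (reals s2 rlam 0).
  by move=> h ->.
apply: wp_run; rewrite /= hj'; tst; rewrite eA1 eB1; case: lerP => h1.
  tst; rewrite eA2 eB2; case: lerP => h2.
    have hm x : x = Num.min (Q1 j) (Q2 j) -> lam_from j.+1 (if (lam <= x)%R then x else lam).
      move=> ->; apply: up; first by apply: Or33.
        by rewrite ltNge h1.
      by rewrite ltNge h2.
    tst; rewrite eQ1 eQ2; case: ifP => hq.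
      have := hm (Q1 j); rewrite min_l // => /(_ erefl) hfin.
      by tst; move: hfin; case: ifP => _ hfin; [sto|].
    have := hm (Q2 j); rewrite min_r; last by move/negbT: hq; rewrite -ltNge => /ltW.
    move=> /(_ erefl) hfin.
    by tst; move: hfin; case: ifP => _ hfin; [sto|].
  have hfin : lam_from j.+1 (if (lam <= B2 j)%R then B2 j else lam).
    by apply: up => //; [apply: Or32|rewrite ltNge h1].
  by tst; move: hfin; case: ifP => _ hfin; [sto|].
have hfin1 : (A2 j <= B2 j)%R -> lam_from j.+1 (if (lam <= B1 j)%R then B1 j else lam).
  by move=> h2; apply: up => //; [apply: Or31|rewrite ltNge h2].
have hfin2 := lam_max2 hI h1.
tst; case: ifP => c1; rewrite c1 in hfin1 hfin2.
  sto; tst; rewrite /= ?eA2 ?eB2; case: (lerP (A2 j) (B2 j)) => h2; first exact: hfin1.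
  by tst; move: (hfin2 h2) => /=; case: ifP => hc hf; [sto|].
tst; rewrite /= ?eA2 ?eB2; case: (lerP (A2 j) (B2 j)) => h2; first exact: hfin1.
by tst; move: (hfin2 h2) => /=; case: ifP => hc hf; [sto|].
Qed.

End Lam.

Lemma Settle_spec rho E r c s e : duo I rho E r s -> (forall b, E b = [:: c b]) -> n <= 2 ^ e ->
  run W Settle s (n * (4 * e + 29)) (fun s' =>
   exists lam (sg : bool -> R), [/\ stored I s', forall b, [/\ ints (side b s') aREG 1 = c b,
     ints (side b s') vANC 0 = r b, reals (side b s') vS 0 = sg b & on (edges I) (along (c b) (r b) (sg b))],
     forall b, [/\ 0 < c b < N & r b = c b \/ r b = par I (c b)],
     covers I lam (along (c false) (r false) (sg false)) (along (c true) (r true) (sg true)) &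
     forall l y1 y2, on (edges I) y1 -> on (edges I) y2 -> covers I l y1 y2 -> (lam <= l)%R]).
Proof.
move=> D hE hne; have st := duo_st D.
have rg b : region N (par I) (rho b) [:: c b] by rewrite -hE; apply: rd_region (duo_rd D b).
have F b : faces I (rho b) [:: c b] (r b) [:: c (~~ b)] by rewrite -!hE; apply: duo_faces D b.
pose A b i := fvert I i (r b); pose B b i := fvert I i (far_end I (c b) (r b)).
have ends b : ends_at I (A b) (B b) (side b s) by move=> i hi; apply: (rd_ends (duo_rd D b)).
apply: (@run_le _ _ _ _ (n * (2 * e + 12) + (n * (2 * e + 12) + (n + (2 * n + 2 * n))))); last by qlia.
apply: (run_seq (Crossings_spec I_ok W_ok m_gt0 st (ends false) hne)) => s1 f1 q1.
have st1 := stored_frame f1 isT isT st.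
have ends1 : ends_at I (A true) (B true) (side true s1).
  by apply: (ends_frame (frame_ren f1)) (ends true).
have := run_side (b := true) (Crossings_spec I_ok W_ok m_gt0 (stored_side true st1) ends1 hne).
move/run_seq; apply=> s2 f2 q2; have st2 := stored_frame f2 isT isT st1.
have e1 : ends_at I (A false) (B false) s2.
  by apply: (ends_frame f2) => //; apply: (ends_frame f1) (ends false).
have e2 : ends_at I (A true) (B true) (ren_s s2) by apply: (ends_frame (frame_ren f2)) ends1.
have hQ i : i < n -> reals s2 aQ i = reals s1 aQ i /\ reals s2 aQ' i = reals s2 aQ' i by rewrite f2.2.
apply: (run_seq (Lam_spec st2 e1 e2 hQ)) => s3 f3 [l0 lB1 lB2 lq larg].
have st3 := stored_frame f3 isT isT st2; set lam := reals s3 rlam 0 in l0 lB1 lB2 lq larg.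
have e1' : ends_at I (A false) (B false) s3 by apply: (ends_frame f3) e1.
apply: (run_seq (Cut_spec I_ok W_ok m_gt0 st3 (erefl _) e1')) => s4 f4 [c1 _].
have st4 := stored_frame f4 isT isT st3.
have e2' : ends_at I (A true) (B true) (side true s4).
  by apply: (ends_frame (frame_ren f4)) => //; apply: (ends_frame (frame_ren f3)) e2.
have hl4 : reals (side true s4) rlam 0 = lam by rewrite /= f4.2.
have := run_side (b := true) (Cut_spec I_ok W_ok m_gt0 (stored_side true st4) hl4 e2').
move/run_framed; apply: run_weak => // s5 [[c2 _] f5].
exists lam, (fun b => reals (side b s5) vS 0).
have c1' : cutoff I (A false) (B false) lam (reals s5 vS 0) by rewrite f5.2.
have sep : c false = c true -> r false != r true.
  by move=> ec; apply: (duo_sep D (b := false) (c := c false)); rewrite !hE ?ec mem_head.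
have hon b : on (edges I) (along (c b) (r b) (reals (side b s5) vS 0)).
  have hs : (0 <= reals (side b s5) vS 0 <= 1)%R.
    by case: (b); [exact: cutoff_le1 lB2 c2|exact: cutoff_le1 lB1 c1'].
  have [h1 h2] := on_along (c b) (r b) hs; split=> //.
  rewrite (mem_edges I_ok); move: h1; rewrite inE => /eqP ->.
  exact: (region1_pos (rg b)).
split.
- exact: stored_frame f5 isT isT st4.
- move=> b; split=> //.
  + have := proj2 (rd_reg (duo_rd D b)) 1; rewrite hE /= => /(_ isT) <-.
    by case: (b); rewrite /= f5.1 // f4.1 // f3.1 // f2.1 // f1.1.
  + rewrite -(rd_anc (duo_rd D b)).
    by case: (b); rewrite /= f5.1 // f4.1 // f3.1 // f2.1 // f1.1.
- move=> b; split; first exact: (region1_pos (rg b)).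
  by case: (anchor1 I_ok (rg b) (F b)) => [|[]]; [left|right].
- apply: (final_covers I_ok (rg false) (rg true) (F false) (F true) l0 lB1 lB2 lq q1 q2 c1' c2).
- move=> l y1 y2 h1 h2 hc.
  have hEe a : a \in edges I -> 0 < a < N by rewrite (mem_edges I_ok).
  have [x' [y' [k1 k2 k3]]] := duo_suff D false hEe h1 h2 hc.
  rewrite hE in k1; rewrite /= hE in k2.
  exact: (final_min I_ok (rg false) (rg true) (F false) (F true) sep larg q1 q2 k1 k2 k3).
Qed.

End Settling.

(** * Building the search instance *)

Notation vNV := 16. Notation vNE := 17. Notation aSRC := 1. Notation aHEAD := 2. Notation aLEN := 1.
Notation aDEG := 62. Notation aSUM := 63. Notation aQU := 64. Notation aEK := 65. Notation aPV := 66.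
Notation vqh := 67. Notation vqt := 68. Notation vk := 69. Notation vu := 70. Notation vv := 71.

Definition Bump e k : cmd :=
  vx <~ e ;;
  IStore aDEG ('v vx) (IAdd (ILoad aDEG ('v vx)) (IConst 1)) ;;
  IStore aSUM ('v vx) (IAdd (ILoad aSUM ('v vx)) k).

(* The sum of the edges at a leaf is its only edge. *)
Definition Degrees : cmd :=
  For vi vNV (IStore aDEG ('v vi) (IConst 0) ;; IStore aSUM ('v vi) (IConst 0)) ;;
  For vi vNE (Bump (ILoad aSRC ('v vi)) ('v vi) ;; Bump (ILoad aHEAD ('v vi)) ('v vi)).

(** Vertex 0 is the root and is never removed, hence the first test. *)
Definition Enqueue x : cmd :=
  If (BAnd (ILe (IConst 1) x) (IEq (ILoad aDEG x) (IConst 1)))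
    (IStore aQU ('v vqt) x ;; vqt <~ IAdd ('v vqt) (IConst 1)) Skip.

Definition Queue : cmd :=
  vqt <~ IConst 0 ;; For vi vNV (Enqueue ('v vi)) ;; vqh <~ IConst 0.

(** Sums replace adjacency lists: the only edge left at a leaf is the value kept in [aSUM], and its
    other end is the sum of both ends minus the leaf. *)
Definition PeelStep : cmd :=
    vv <~ ILoad aQU ('v vqh) ;;
    vk <~ ILoad aSUM ('v vv) ;;
    vu <~ ISub (IAdd (ILoad aSRC ('v vk)) (ILoad aHEAD ('v vk))) ('v vv) ;;
    IStore aEK ('v vqh) ('v vk) ;;
    IStore aPV ('v vqh) ('v vu) ;;
    IStore aDEG ('v vu) (ISub (ILoad aDEG ('v vu)) (IConst 1)) ;;
    IStore aSUM ('v vu) (ISub (ILoad aSUM ('v vu)) ('v vk)) ;;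
    vqh <~ IAdd ('v vqh) (IConst 1) ;;
    Enqueue ('v vu).

Definition Peel : cmd :=
  Degrees ;; Queue ;; While (BNot (ILe ('v vqt) ('v vqh))) PeelStep.

Lemma PeelStep_spec (R : realType) W (s : state R) q qt v k a b u d e :
  ints s vqh 0 = q -> ints s vqt 0 = qt -> ints s aQU q = v -> ints s aSUM v = k ->
  ints s aSRC k = a -> ints s aHEAD k = b -> a + b - v = u -> a + b <= W ->
  ints s aDEG u = d -> ints s aSUM u = e -> d <= W -> e <= W -> q < qt -> qt < W ->
  let c := (0 < u) && (d - 1 == 1) in
  run W PeelStep s 0 (fun s' => [/\ ints s' vqh 0 = q.+1, ints s' vqt 0 = qt + c,
    forall i, ints s' aQU i = (if c && (i == qt) then u else ints s aQU i),
    forall i, ints s' aEK i = (if i == q then k else ints s aEK i) /\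
      ints s' aPV i = (if i == q then u else ints s aPV i) &
    forall x, ints s' aDEG x = (if x == u then d - 1 else ints s aDEG x) /\
      ints s' aSUM x = (if x == u then e - k else ints s aSUM x)]).
Proof.
move=> e1 e2 e3 e4 e5 e6 e7 h1 e8 e9 h2 h3 h4 h5 c.
apply: wp_run; rewrite /= ?eqxx /= e1 e3 e4 e5 e6 e7 ?e8 ?e9; do 8 sto; tst.
rewrite -eqn_leq -/c; case: c => /=.
  by rewrite e2; do 2 sto; split=> //; rewrite ?addn1.
by rewrite e2 addn0; split=> //; rewrite ?addn1.
Qed.

Section Peel.
Variables (R : realType) (T : wgraph R).
Hypothesis T_tree : is_tree T.
Local Notation V := 'I_(nv T).
Local Notation K := 'I_(ne T).
Implicit Types (L : seq (V * K * V)) (v u w : V) (k : K) (s : state R).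

Record graph_at s : Prop := GraphAt {
  ga_nv : ints s vNV 0 = nv T;
  ga_ne : ints s vNE 0 = ne T;
  ga_edge : forall k : 'I_(ne T), [/\ ints s aSRC k = src k, ints s aHEAD k = dst k & reals s aLEN k = len k] }.

Lemma graph_frame ia ra s s' : frame ia ra s s' ->
  all (fun a => a \notin ia) [:: vNV; vNE; aSRC; aHEAD] -> aLEN \notin ra ->
  graph_at s -> graph_at s'.
Proof.
move=> f /= /and5P[h1 h2 h3 h4 _] h5 [g1 g2 g3]; split; rewrite ?f.1 // => k.
by have [e1 e2 e3] := g3 k; rewrite !f.1 // f.2.
Qed.

Definition deg L v := \sum_(k < ne T | incident k v && (k \notin gone L)) 1.
Definition sumid L v := \sum_(k < ne T | incident k v && (k \notin gone L)) (k : nat).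

Lemma sumid_le L v : sumid L v <= ne T * ne T.
Proof.
apply: leq_trans (_ : \sum_(k < ne T) ne T <= _); last by rewrite sum_nat_const card_ord.
rewrite /sumid big_mkcond /=; apply: leq_sum => k _; case: ifP => // _; exact: ltnW.
Qed.

Lemma deg_le L v : deg L v <= ne T.
Proof. by rewrite /deg sum1_card -[X in _ <= X]card_ord max_card. Qed.

Lemma deg1P L v : deg L v = 1 -> exists k : K, [/\ incident k v, k \notin gone L, sumid L v = k &
  forall k', incident k' v -> k' \notin gone L -> k' = k].
Proof.
move=> h; have /existsP[k /andP[h1 h2]] : [exists k : K, incident k v && (k \notin gone L)].
  case: (boolP [exists k : K, _]) => //; rewrite negb_exists => /forallP hn.
  by move: h; rewrite /deg big1 // => k; rewrite (negbTE (hn k)).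
have hu k' : incident k' v -> k' \notin gone L -> k' = k.
  move=> h3 h4; apply/eqP/negPn/negP => hne.
  move: h; rewrite /deg (bigD1 k) /= ?h1 // (bigD1 k') /=; last by rewrite h3 h4 hne.
  by [].
exists k; split=> //; rewrite /sumid (big_pred1 k) // => k' /=.
apply/andP/eqP => [[h3 h4]|->//]; exact: hu.
Qed.

Lemma deg_cons L v k u w : joins k v u -> k \notin gone L -> w != v ->
  (deg L w = deg ((v, k, u) :: L) w + (w == u))%N /\
  (sumid L w = sumid ((v, k, u) :: L) w + (w == u) * k)%N.
Proof.
move=> hj hk hw.
have hinc : incident k w = (w == u).
  apply/idP/eqP => [|->]; last exact: joins_incident (joins_sym hj).
  by move: hj hw => /orP[] /andP[/eqP <- /eqP <-] hne /orP[] /eqP // e; rewrite e eqxx in hne.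
have key (F : K -> nat) : \sum_(k < ne T | incident k w && (k \notin gone L)) F k =
    \sum_(k' < ne T | incident k' w && (k' \notin gone ((v, k, u) :: L))) F k' + (w == u) * F k.
  rewrite [LHS]big_mkcond [X in _ = X + _]big_mkcond /= (bigD1 k) //= [in RHS](bigD1 k) //=.
  rewrite hinc hk andbT inE eqxx /= andbF add0n addnC; congr (_ + _); last by case: (w == u); rewrite ?mul1n.
  by apply: eq_bigr => k' hne; rewrite inE (negbTE hne).
by split; rewrite /deg /sumid key ?muln1.
Qed.

Lemma deg_gt0 L v k : incident k v -> k \notin gone L -> 0 < deg L v.
Proof. by move=> h1 h2; rewrite /deg (bigD1 k) /= ?h1. Qed.

Variable W : nat.
Hypothesis W_ok : 2 * nv T + 2 * ne T + ne T * ne T + 10 <= W.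

Lemma Degrees_spec s : graph_at s -> run W Degrees s (nv T + ne T) (fun s' =>
  forall v, ints s' aDEG v = deg [::] v /\ ints s' aSUM v = sumid [::] v).
Proof.
move=> g; apply: (@run_le _ _ _ _ (nv T * 1 + ne T * 1)); last by rewrite !muln1.
apply: (@run_seq _ _ _ _ _ _ _ (fun s' => forall x, x < nv T -> ints s' aDEG x = 0 /\ ints s' aSUM x = 0)).
  apply: (run_for (n := nv T) (I := fun j s' => forall x, x < j -> ints s' aDEG x = 0 /\ ints s' aSUM x = 0)) => //.
  - exact: ga_nv g.
  - by qlia.
  move=> j s' hj fr hr hI; apply: wp_run; rewrite /= hr; sto; sto.
  by move=> x hx /=; case: eqP => //= hne; apply: hI; qlia.
move=> s1 f1 h1; have g1 := graph_frame f1 isT isT g.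
pose inc j (x : nat) := (ints s1 aSRC j == x) || (ints s1 aHEAD j == x).
pose dg j x := \sum_(0 <= k < j) inc k x.
pose sm j x := \sum_(0 <= k < j) inc k x * k.
have dgS j x : dg j.+1 x = dg j x + inc j x by rewrite /dg big_nat_recr.
have smS j x : sm j.+1 x = sm j x + inc j x * j by rewrite /sm big_nat_recr.
have dg_le j x : dg j x <= j.
  by elim: j => [|j IH]; [rewrite /dg big_geq|rewrite dgS; case: (inc j x) => /=; qlia].
have sm_le j x : j <= ne T -> sm j x <= j * ne T.
  by elim: j => [|j IH] hj; [rewrite /sm big_geq|rewrite smS; case: (inc j x) => /=; nia].
have [_ [hsimp _] _ _] := T_tree.
apply: (run_for (n := ne T) (I := fun j s' => forall v, ints s' aDEG v = dg j v /\ ints s' aSUM v = sm j v)) => //.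
- exact: ga_ne g1.
- by qlia.
- by move=> v /=; have [-> ->] := h1 v (ltn_ord v); rewrite /dg /sm !big_geq.
- move=> j s2 hj fr hr hI; have [eS eD _] := ga_edge g1 (Ordinal hj).
  set k := Ordinal hj in eS eD; have hne := hsimp k.
  have e1 : ints s2 aSRC j = src k by rewrite fr.1.
  have e2 : ints s2 aHEAD j = dst k by rewrite fr.1.
  have hinc (x : V) : inc j x = (src k == x) + (dst k == x) :> nat.
    rewrite /inc eS eD !val_eqE; case: (eqVneq (src k) x) => [ex|_] //=.
    by rewrite -ex eq_sym (negbTE hne).
  have [d1 d1'] := hI (src k); have [d2 d2'] := hI (dst k).
  have b1 := dg_le j (src k); have b2 := dg_le j (dst k).
  have b3 := sm_le j (src k) (ltnW hj); have b4 := sm_le j (dst k) (ltnW hj).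
  have b5 : j * ne T + ne T <= ne T * ne T by nia.
  have hds : (dst k == src k :> nat) = false by apply/negbTE; rewrite eq_sym.
  apply: wp_run; rewrite /= ?eqxx /= hr e1 e2; sto; rewrite ?d1 ?d1' ?hds ?d2 ?d2' /=; do 2 sto; sto; do 2 sto.
  move=> v; rewrite /= dgS smS hinc; have [q1 q2] := hI v.
  rewrite -!val_eqE /= ![(_ == (v : nat))]eq_sym.
  case: eqP => [ev|n1]; case: eqP => [e|n2].
  + by exfalso; case/eqP: hne; apply: val_inj; rewrite /= -ev -e.
  + by rewrite /= ev; split; qlia.
  + by rewrite /= e; split; qlia.
  + by rewrite /= q1 q2; split; qlia.
- move=> s2 fr hI v; have [-> ->] := hI v.
  have hinc (k : K) : inc k v = incident k v by have [e1 e2 _] := ga_edge g1 k; rewrite /inc e1 e2.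
  rewrite /dg /sm /deg /sumid !big_mkord !(big_mkcond (fun k : K => incident k v && _)).
  by split; apply: eq_bigr => k _; rewrite hinc /= andbT; case: (incident k v); rewrite ?mul1n.
Qed.


Lemma uniq_size (s : seq V) : uniq s -> size s <= nv T.
Proof. by move=> h; rewrite -(card_uniqP h) -[X in _ <= X]card_ord max_card. Qed.

Lemma root_ex : exists root : V, nat_of_ord root = 0.
Proof. by case: T_tree => h _ _ _; exists (Ordinal h). Qed.

(* The queue holds the removed vertices followed by the leaves [P]. *)
Record peeling root L (P : seq V) s : Prop := Peeling {
  pg_peeled : peeled root L;
  pg_uniq : uniq P;
  pg_mem : forall v, (v \in P) = [&& v != root, v \notin verts L & deg L v == 1];
  pg_deg : forall v, v \notin verts L -> ints s aDEG v = deg L v /\ ints s aSUM v = sumid L v;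
  pg_qh : ints s vqh 0 = size L;
  pg_qt : ints s vqt 0 = size L + size P;
  pg_queue : forall j, j < size P -> ints s aQU (size L + j) = nth root P j;
  pg_done : forall d i, i < size L -> let e := nth d L (size L - i.+1) in
    [/\ ints s aQU i = e.1.1, ints s aEK i = e.1.2 & ints s aPV i = e.2] }.

Lemma peeling_size root L P s : peeling root L P s -> size L + size P < nv T.
Proof.
move=> h; have hu : uniq (root :: P ++ verts L).
  rewrite /= cat_uniq (pg_uniq h) (peeled_uniq (pg_peeled h)) andbT mem_cat negb_or.
  rewrite (peeled_root (pg_peeled h)) (pg_mem h) eqxx /=.
  by apply/hasPn => v hv; rewrite (pg_mem h) hv andbF.
have : size (root :: P ++ verts L) <= nv T.
  by rewrite -(card_uniqP hu) -[X in _ <= X]card_ord max_card.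
by rewrite /= size_cat size_map; qlia.
Qed.

Lemma Queue_spec root s : nat_of_ord root = 0 -> graph_at s ->
  (forall v, ints s aDEG v = deg [::] v /\ ints s aSUM v = sumid [::] v) ->
  run W Queue s (nv T)
    (fun s' => exists P, peeling root [::] P s').
Proof.
move=> hr0 g hd; step; sto; apply: (@run_le _ _ _ _ (nv T * 1 + 0)); last by qlia.
apply: (@run_seq _ _ _ _ _ _ _ (fun s' => exists P : seq V, [/\ uniq P, ints s' vqt 0 = size P,
   forall i, i < size P -> ints s' aQU i = nth root P i &
   forall v, (v \in P) = (v != root) && (deg [::] v == 1)])).
  apply: (run_for (n := nv T) (I := fun j s' => exists P : seq V, [/\ uniq P, ints s' vqt 0 = size P,
   forall i, i < size P -> ints s' aQU i = nth root P i &
   forall v, (v \in P) = [&& v < j, v != root & deg [::] v == 1]])) => //=.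
  - exact: ga_nv g.
  - by qlia.
  - by exists [::].
  - move=> j s1 hj fr hj' [P [h1 h2 h3 h4]]; pose w : V := Ordinal hj.
    have eD : ints s1 aDEG j = deg [::] w by rewrite fr.1 //; apply: (hd w).1.
    have hjw : (0 < j) = (w != root) by rewrite -val_eqE /= hr0 lt0n.
    have hP : size P < nv T.
      by apply: (uniq_size (s := w :: P)); rewrite /= h1 h4 ltnn.
    apply: wp_run; rewrite /= ?eqxx /= hj' eD; tst; rewrite -eqn_leq hjw.
    have hlt (v : V) : (v < j.+1) = (v == w) || (v < j) by rewrite ltnS leq_eqVlt -val_eqE.
    case: ifP => hc.
      rewrite ?hj' h2; do 2 sto; exists (rcons P w); rewrite size_rcons; split=> //=.
      + by rewrite rcons_uniq h1 h4 ltnn.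
      + by rewrite addn1.
      + move=> i hi; rewrite nth_rcons; case: (ltngtP i (size P)) => h; [exact: h3|by qlia|by []].
      + move=> v; rewrite mem_rcons inE h4 hlt; case: (eqVneq v w) => [->|] //=; by rewrite hc.
    exists P; split=> // v; rewrite h4 hlt; case: (eqVneq v w) => [->|] //=; by rewrite hc ltnn.
  - move=> s1 fr [P [h1 h2 h3 h4]]; exists P; split=> // v; by rewrite h4 ltn_ord.
move=> s1 f1 [P [h1 h2 h3 h4]]; apply: wp_run; rewrite /=; sto; exists P; split=> //.
by move=> v _; rewrite /= !f1.1 //=; apply: hd.
Qed.

(** An edge left over would yield a leaf other than the root by [leaf_ex], and this leaf would be in
    the queue. *)
Lemma peeling_stop root L s k : peeling root L [::] s -> k \in gone L.
Proof.
move=> h; apply/negPn/negP => hk; have [v [k' [h1 h2 h3 h4]]] := leaf_ex T_tree (pg_peeled h) hk.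
have := pg_mem h v; rewrite h1 /=; case: (boolP (v \in verts L)) => hv.
  by move: h2; rewrite (peeled_gone (pg_peeled h) hv h3).
suff -> : deg L v = 1 by [].
rewrite /deg (big_pred1 k') // => k2 /=; apply/andP/eqP => [[]|->//]; exact: h4.
Qed.

Lemma Peel_spec s : graph_at s -> run W Peel s (3 * nv T + ne T) (fun s' => exists (root : V) L,
  [/\ nat_of_ord root = 0, peeled root L, forall k, k \in gone L &
  forall d i, i < size L -> let e := nth d L (size L - i.+1) in
    [/\ ints s' aQU i = e.1.1, ints s' aEK i = e.1.2 & ints s' aPV i = e.2]]).
Proof.
move=> g; have [root r0] := root_ex.
apply: (@run_le _ _ _ _ ((nv T + ne T) + (nv T + nv T))); last by qlia.
apply: (run_seq (Degrees_spec g)) => s1 f1 h1; have g1 := graph_frame f1 isT isT g.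
apply: (run_seq (Queue_spec r0 g1 h1)) => s2 f2 [P hP].
have g2 := graph_frame f2 isT isT g1.
pose J (t : nat) (s' : state R) := exists L P, t = nv T - size L /\ peeling root L P s'.
apply: (run_while (I := J)); last by exists [::], P; rewrite subn0.
move=> k {h1} s3 f3 [L [{hP}P [-> hP]]]; have hs := peeling_size hP.
have g3 := graph_frame f3 isT isT g2.
split; first by bnd.
rewrite /= (pg_qh hP) (pg_qt hP); case: ifP => hlt; last first.
  have P0 : P = [::] by case: (P) hlt => //= *; qlia.
  rewrite P0 in hP; exists root, L; split=> //; [exact: pg_peeled hP| |exact: pg_done hP].
  by move=> k0; apply: peeling_stop hP.
exists 0; first by qlia.
case: P hP hs hlt => [|v P] hP hs hlt; first by move: hlt; rewrite /= addn0 leqnn.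
have pL := pg_peeled hP.
have := pg_mem hP v; rewrite mem_head => /esym/and3P[hv hvL /eqP dv].
have [kk [k1 k2 k3 k4]] := deg1P dv.
have [u hj] := incident_joins k1.
have uv : u != v by rewrite eq_sym; apply: joins_neq hj.
have uL : u \notin verts L.
  by apply: contra k2 => h; apply: (peeled_gone pL h); apply: joins_incident (joins_sym hj).
have pL' : peeled root ((v, kk, u) :: L).
  by split=> //; split=> // k' h1 h2; apply: contraNT h2 => h2; apply/eqP; apply: k4.
have [eV eE] : ints s3 aQU (size L) = v /\ ints s3 aSUM v = kk.
  by split; [have := pg_queue hP (j := 0); rewrite addn0 /=; apply|have [_ ->] := pg_deg hP hvL].
have [e1 e2 _] := ga_edge g3 kk.
have eU : ints s3 aSRC kk + ints s3 aHEAD kk - v = u.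
  by rewrite e1 e2; case/orP: hj => /andP[/eqP <- /eqP <-]; rewrite ?addnK ?addKn.
have [hd1 hd2] := deg_cons hj k2 uv; rewrite eqxx mul1n in hd1 hd2.
have [dU sU] := pg_deg hP uL.
have bS := sumid_le L u; have bD := deg_le L u; have kN := ltn_ord kk.
have bE : ints s3 aSRC kk + ints s3 aHEAD kk <= 2 * nv T.
  by rewrite e1 e2; have := ltn_ord (src kk); have := ltn_ord (dst kk); clear; qlia.
have hun (w : V) : w \notin verts L -> w != v -> w != u ->
    deg ((v, kk, u) :: L) w = deg L w /\ sumid ((v, kk, u) :: L) w = sumid L w.
  by move=> hw h1 h2; have [-> ->] := deg_cons hj k2 h1; rewrite (negbTE h2) !addn0.
(* As u is still linked to the root, it keeps an edge; so its degree was at least 2 before this step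
   and it was not in the queue. *)
have udeg : u != root -> 0 < deg ((v, kk, u) :: L) u.
  move=> hu; have hu' : u \notin verts ((v, kk, u) :: L) by rewrite inE negb_or uv.
  by have [k' h1 h2] := alive_edge T_tree pL' hu hu'; apply: deg_gt0 h2 h1.
have uP : u \notin P.
  apply/negP => hu; have := pg_mem hP u; rewrite inE hu orbT => /esym/and3P[h1 _ /eqP h2].
  by have := udeg h1; clear -hd1 h2; qlia.
have vP : v \notin P by have := pg_uniq hP; rewrite /= => /andP[].
have hu0 : (0 < u) = (u != root) by rewrite -val_eqE /= r0 lt0n.
have hdec : nv T - (size L).+1 < nv T - size L by clear -hs; move: hs => /=; qlia.
have fin s4 P' : ints s4 vqh 0 = (size L).+1 -> ints s4 vqt 0 = (size L).+1 + size P' ->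
   (forall i, i < size L -> [/\ ints s4 aQU i = ints s3 aQU i, ints s4 aEK i = ints s3 aEK i & ints s4 aPV i = ints s3 aPV i]) ->
   [/\ ints s4 aQU (size L) = v, ints s4 aEK (size L) = kk & ints s4 aPV (size L) = u] ->
   (forall w, w \notin verts L -> w != v -> w != u -> ints s4 aDEG w = ints s3 aDEG w /\ ints s4 aSUM w = ints s3 aSUM w) ->
   ints s4 aDEG u = ints s3 aDEG u - 1 -> ints s4 aSUM u = ints s3 aSUM u - kk ->
   P' = (if (u != root) && (deg ((v, kk, u) :: L) u == 1) then rcons P u else P) ->
   (forall j, j < size P' -> ints s4 aQU ((size L).+1 + j) = nth root P' j) ->
   exists2 k', 0 + k' < nv T - size L & J k' s4.
  move=> q1 q2 q3 q4 q5 q6 q7 q8 q9; exists (nv T - (size L).+1); first exact: hdec.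
  exists ((v, kk, u) :: L), P'; split=> //; split=> //.
  - rewrite q8; case: ifP => _; last by have := pg_uniq hP; rewrite /= => /andP[].
    by rewrite rcons_uniq uP; have := pg_uniq hP; rewrite /= => /andP[].
  - move=> w; have hP' : (w \in P') = (w \in P) || [&& w == u, u != root & deg ((v, kk, u) :: L) u == 1].
      by rewrite q8; case: ifP => _; rewrite ?mem_rcons ?inE ?andbT ?andbF ?orbF // orbC.
    rewrite hP' inE; case: (eqVneq w v) => [->|wv] /=.
      by rewrite (negbTE vP) /= andbF; case: eqP => // e; rewrite -e eqxx in uv.
    case: (eqVneq w u) => [->|wu] /=.
      by rewrite (negbTE uP) uL.
    rewrite orbF; have := pg_mem hP w; rewrite inE (negbTE wv) /= => ->.
    case: (boolP (w \in verts L)) => [_|hw]; first by rewrite /= !andbF.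
    by have [-> _] := hun w hw wv wu.
  - move=> w; rewrite inE negb_or => /andP[wv hw].
    case: (eqVneq w u) => [->|wu]; last first.
      by have [-> ->] := q5 w hw wv wu; have [-> ->] := hun w hw wv wu; apply: (pg_deg hP).
    by rewrite q6 q7 dU sU hd1 hd2 addnK addn1 subn1.
  - move=> d i; rewrite /= ltnS leq_eqVlt => /orP[/eqP ->|hi].
      by have [-> -> ->] := q4; rewrite subnn.
    by have [-> -> ->] := q3 i hi; have := pg_done hP d hi; rewrite subSn.
have hs' : size L + (size P).+1 < nv T by [].
have w1 : ints s3 aSRC kk + ints s3 aHEAD kk <= W by clear -W_ok bE; qlia.
have w2 : deg L u <= W by clear -W_ok bD; qlia.
have w3 : sumid L u <= W by clear -W_ok bS; qlia.
have w4 : size L < size L + (size P).+1 by clear; qlia.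
have w5 : size L + (size P).+1 < W by clear -W_ok hs'; qlia.
have := PeelStep_spec (pg_qh hP) (pg_qt hP) eV eE (erefl _) (erefl _) eU w1 dU sU w2 w3 w4 w5.
have -> : deg L u - 1 = deg ((v, kk, u) :: L) u by rewrite hd1 addnK.
have -> : sumid L u - kk = sumid ((v, kk, u) :: L) u by rewrite hd2 addnK.
rewrite hu0; set c := (u != root) && _.
apply: run_weak => // s4 [q1 q2 q3 q4 q5].
have hq := pg_queue hP.
have ne1 i : i < size L -> (i == size L + (size P).+1) = false by clear; qlia.
apply: (fin s4 (if c then rcons P u else P)) => //.
- by rewrite q2; case: (c); rewrite ?size_rcons /= ?addn1 ?addn0 ?addSnnS ?addnS.
- move=> i hi; rewrite q3; have [-> ->] := q4 i.
  by rewrite (ltn_eqF hi) (ne1 i hi) andbF.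
- have [-> ->] := q4 (size L); rewrite eqxx q3; split=> //.
  have -> : (size L == size L + (size P).+1) = false by clear; qlia.
  by rewrite andbF.
- by move=> w hw wv wu; have [-> ->] := q5 w; rewrite val_eqE (negbTE wu).
- by have [-> _] := q5 u; rewrite eqxx dU hd1 addnK.
- by have [_ ->] := q5 u; rewrite eqxx sU hd2 addnK.
- move=> j ltj; rewrite q3 addSnnS eqn_add2l eqSS.
  case: (c) ltj => [|ltj]; last exact: (hq j.+1).
  rewrite size_rcons ltnS leq_eqVlt nth_rcons andTb => /orP[/eqP ->|ltj]; first by rewrite eqxx ltnn.
  by rewrite (ltn_eqF ltj) ltj; apply: (hq j.+1).
Qed.

End Peel.

(** * Positions of the vertices and coordinates of the locations *)

Notation aPOS := 76. Notation aECH := 77. Notation aPARP := 78. Notation aEDG := 79. Notation aRRL := 120.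
Notation aPLEN := 61. Notation aBASE := 62. Notation aOFL := 63. Notation vlt := 75. Notation aLOC := 4.
Notation aKEY := 50.

(** The queue is read backwards: the vertex removed at step i, counted from 0, gets position
    [nv T - 1 - i], so that parents come before children. Parents are entered in a second loop
    because they look up positions assigned later in the first. *)
Definition Position : cmd :=
  vlt <~ ISub ('v vNV) (IConst 1) ;;
  IStore aPOS (IConst 0) (IConst 0) ;;
  RStore aPLEN (IConst 0) (RConst 0) ;;
  For vi vlt (
    vr <~ ISub ('v vlt) ('v vi) ;;
    vk <~ ILoad aEK ('v vi) ;;
    IStore aPOS (ILoad aQU ('v vi)) ('v vr) ;;
    IStore aEDG ('v vr) ('v vk) ;;
    IStore aECH ('v vk) ('v vr) ;;
    RStore aPLEN ('v vr) (RLoad aLEN ('v vk))) ;;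
  For vi vlt (IStore aPARP (ISub ('v vlt) ('v vi)) (ILoad aPOS (ILoad aPV ('v vi)))) ;;
  IStore aPARP (IConst 0) (IConst 0) ;;
  RStore aBASE (IConst 0) (RConst 0) ;;
  For vi vNV (RStore aBASE (IAdd ('v vi) (IConst 1))
    (RAdd (RAdd (RLoad aBASE ('v vi)) (RLoad aPLEN ('v vi))) (RConst 1))).

(* The unit gap between consecutive positions in BASE keeps the end of one edge
   apart from the start of the next. *)
Definition Locate : cmd :=
  For vidx vM (
    vx <~ ILoad aLOC ('v vidx) ;;
    If (ILe (IAdd ('v vx) (IConst 1)) ('v vNV))
      (vr <~ ILoad aPOS ('v vx) ;; RStore aOFL ('v vidx) (RLoad aPLEN ('v vr)))
      (vk <~ ISub ('v vx) ('v vNV) ;;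
       vr <~ ILoad aECH ('v vk) ;;
       If (IEq (ILoad aPOS (ILoad aSRC ('v vk))) (ILoad aPARP ('v vr)))
         (RStore aOFL ('v vidx) (RLoad aLOC ('v vidx)))
         (RStore aOFL ('v vidx) (RSub (RLoad aLEN ('v vk)) (RLoad aLOC ('v vidx))))) ;;
    IStore aRRL ('v vidx) ('v vr) ;;
    RStore aKEY ('v vidx) (RAdd (RLoad aBASE ('v vr)) (RLoad aOFL ('v vidx)))).

Section Positions.
Variables (R : realType) (T : wgraph R).
Variables (pos : 'I_(nv T) -> nat) (ech : 'I_(ne T) -> nat) (parp : nat -> nat).
Hypothesis rt : rooting pos ech parp.
Hypothesis pos_inj : injective pos.
Hypothesis nv_gt0 : 0 < nv T.
Local Notation V := 'I_(nv T).
Local Notation K := 'I_(ne T).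
Local Notation elen := (elen ech).
Implicit Types (s : state R).

Record placed s : Prop := Placed {
  pl_graph : graph_at T s;
  pl_pos : forall v : V, ints s aPOS v = pos v;
  pl_ech : forall k : K, ints s aECH k = ech k;
  pl_edge : forall k : K, ints s aEDG (ech k) = k;
  pl_par : forall r, r < nv T -> ints s aPARP r = parp r;
  pl_len : forall r, r < nv T -> reals s aPLEN r = elen r;
  pl_base : forall r, r < nv T -> (reals s aBASE r.+1 = reals s aBASE r + elen r + 1)%R }.

Lemma placed_frame ia ra s s' : frame ia ra s s' ->
  all (fun a => a \notin ia) [:: vNV; vNE; aSRC; aHEAD; aPOS; aECH; aEDG; aPARP] ->
  all (fun a => a \notin ra) [:: aLEN; aPLEN; aBASE] -> placed s -> placed s'.
Proof.
move=> f /= /and5P[h1 h2 h3 h4 /and5P[h5 h6 h7 h8 _]] /and4P[k1 k2 k3 _] [p1 p2 p3 p4 p5 p6 p7].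
split=> *; rewrite ?f.1 ?f.2 //; auto.
by apply: (graph_frame f) => //=; rewrite h1 h2 h3 h4.
Qed.

Variable W : nat.
Hypothesis W_ok : 2 * nv T + 10 <= W.

Lemma Position_spec s (root : V) : graph_at T s -> nat_of_ord root = 0 -> pos root = 0 ->
  (forall i, i < (nv T).-1 -> exists (v : V) (k : K) (u : V),
    [/\ ints s aQU i = v, ints s aEK i = k & ints s aPV i = u] /\
    [/\ pos v = (nv T).-1 - i, ech k = (nv T).-1 - i & parp ((nv T).-1 - i) = pos u]) ->
  run W Position s (3 * nv T) placed.
Proof.
move=> g r0 p0 hQ; set n1 := (nv T).-1 in hQ.
have n1v : n1.+1 = nv T by rewrite prednK.
step; rewrite (ga_nv g) subn1; sto; step; sto; step; sto; rewrite mulr0z; set s0 := State _ _.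
apply: (@run_le _ _ _ _ (n1 * 1 + (n1 * 1 + nv T * 1))); last by qlia.
have g0 : graph_at T s0 by case: g => g1 g2 g3; split.
apply: (@run_seq _ _ _ _ _ _ _ (fun s' => [/\ forall v : V, ints s' aPOS v = pos v,
  forall k : K, [/\ ints s' aECH k = ech k, ints s' aEDG (ech k) = k & reals s' aPLEN (ech k) = len k] &
  reals s' aPLEN 0 = 0%R])).
  apply: (run_for (n := n1) (I := fun j s' => [/\ forall v : V, pos v = 0 \/ n1 - j < pos v -> ints s' aPOS v = pos v,
    forall k : K, n1 - j < ech k -> [/\ ints s' aECH k = ech k, ints s' aEDG (ech k) = k & reals s' aPLEN (ech k) = len k] &
    reals s' aPLEN 0 = 0%R])) => //=.
  - by qlia.
  - rewrite subn0; split=> //.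
    + move=> v [h|h]; first by have -> : v = root by [apply: pos_inj; rewrite h p0]; rewrite r0 p0.
      by have := rt_lt rt v; qlia.
    + by move=> k; have := rt_elt rt k; qlia.
  - move=> j s1 hj fr hj' [h1 h2 h3]; have [v [k [u [[q1 q2 q3] [q4 q5 q6]]]]] := hQ j hj.
    have [_ _ el] := ga_edge (graph_frame fr isT isT g0) k.
    have e1 : ints s1 vlt 0 = n1 by rewrite fr.1.
    have e2 : ints s1 aEK j = k by rewrite fr.1.
    have e3 : ints s1 aQU j = v by rewrite fr.1.
    apply: wp_run; rewrite /= ?eqxx /= hj' e1 e2 e3 el; do 6 sto.
    have hn : n1 - j != 0 by qlia.
    split.
    + move=> w hw /=; case: eqP => [e|ne].
        by rewrite -q4; congr pos; apply: val_inj.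
      apply: h1; case: hw => [|hw]; [by left|right].
      have : pos w <> pos v by move=> /pos_inj e; apply: ne; rewrite e.
      by qlia.
    + move=> k' hk' /=; case: (eqVneq k' k) => [->|hne]; first by rewrite q5 !eqxx.
      have hnv : (k' == k :> nat) = false by apply/negbTE.
      have hech : (ech k' == n1 - j) = false.
        by apply: contraNF hne => /eqP e; apply/eqP; apply: (rt_einj rt); rewrite e q5.
      rewrite hnv hech; apply: h2; move/eqP: hech; qlia.
    + by rewrite /= eq_sym (negbTE hn).
  - move=> s1 fr [h1 h2 h3]; split=> // [v|k].
      by apply: h1; rewrite subnn; case: (pos v); [left|right].
    by apply: h2; rewrite subnn; case/andP: (rt_elt rt k).
move=> s1 f1 [h1 h2 h3]; have g1 := graph_frame f1 isT isT g0.
have v1 : ints s1 vlt 0 = n1 by rewrite f1.1.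
apply: (@run_seq _ _ _ _ _ _ _ (fun s' => forall r, 0 < r < nv T -> ints s' aPARP r = parp r)).
  apply: (run_for (n := n1) (I := fun j s' => forall r, n1 - j < r < nv T -> ints s' aPARP r = parp r)) => //=.
  - by qlia.
  - by move=> r; qlia.
  - move=> j s2 hj fr hj' hI; have [v [k [u [[q1 q2 q3] [q4 q5 q6]]]]] := hQ j hj.
    have e1 : ints s2 vlt 0 = n1 by rewrite fr.1.
    have e2 : ints s2 aPV j = u by rewrite fr.1 //= f1.1.
    apply: wp_run; rewrite /= ?eqxx /= hj' e1 e2; sto => r hr /=.
    case: eqP => [->|ne]; first by rewrite fr.1 // h1 -q6.
    by apply: hI; qlia.
  - by move=> s2 fr hI r hr; apply: hI; qlia.
move=> s2 f2 h4; have g2 := graph_frame f2 isT isT g1.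
step; sto; step; sto; rewrite mulr0z; set s3 := State _ _.
have g3 : graph_at T s3 by case: g2 => a b c; split.
have hlen r : r < nv T -> reals s2 aPLEN r = elen r.
  move=> hr; rewrite f2.2 //; case: (posnP r) => [->|r0']; first by rewrite h3 (elen0 rt).
  have [k hk] : exists k, ech k = r by apply: (rt_esurj rt); rewrite r0'.
  by have [_ _] := h2 k; rewrite hk => ->; rewrite -hk (elen_ech rt).
apply: (run_for (n := nv T) (I := fun j s' => forall r, r < j -> (reals s' aBASE r.+1 = reals s' aBASE r + elen r + 1)%R)) => //=.
- exact: ga_nv g3.
- by qlia.
- move=> j s4 hj fr hj' hI; apply: wp_run; rewrite /= ?eqxx /= hj'; sto => r hr /=.
  have e1 : reals s4 aPLEN j = elen j by rewrite fr.2 //= hlen.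
  rewrite addn1 eqSS; case: eqP => [->|ne]; first by rewrite e1 mulr1z ltn_eqF.
  have -> : (r == j.+1) = false by qlia.
  by apply: hI; qlia.
- move=> s4 fr hI; have g4 := graph_frame fr isT isT g3; split=> //.
  + by move=> v; rewrite fr.1 //= f2.1 // h1.
  + by move=> k; rewrite fr.1 //= f2.1 //; have [-> _ _] := h2 k.
  + by move=> k; rewrite fr.1 //= f2.1 //; have [_ -> _] := h2 k.
  + move=> r hr; rewrite fr.1 //=; case: eqP => [->|ne]; first by rewrite (proj1 (rt_par rt)).
    by apply: h4; qlia.
  + by move=> r hr; rewrite fr.2 //= hlen.
Qed.

Lemma Locate_spec s M (loc : nat -> tpoint T) : placed s -> ints s vM 0 = M -> M < W ->
  ne T + nv T <= W -> (forall i, i < M -> stores_point s aLOC i (loc i)) ->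
  run W Locate s M (fun s' => forall i, i < M -> let x := coord pos ech parp (loc i) in
    [/\ ints s' aRRL i = x.1, reals s' aOFL i = x.2 & reals s' aKEY i = (reals s aBASE x.1 + x.2)%R]).
Proof.
move=> pl hM hMW hW hloc; apply: (@run_le _ _ _ _ (M * 1)); last by rewrite muln1.
apply: (run_for (n := M) (I := fun j s' => forall i, i < j -> let x := coord pos ech parp (loc i) in
    [/\ ints s' aRRL i = x.1, reals s' aOFL i = x.2 & reals s' aKEY i = (reals s aBASE x.1 + x.2)%R])) => //=.
move=> j s1 hj fr hj' hI.
have pl1 := placed_frame fr isT isT pl; have g1 := pl_graph pl1.
have b1 r : reals s1 aBASE r = reals s aBASE r by rewrite fr.2.
have fin r (x : R) : (r, x) = coord pos ech parp (loc j) ->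
  forall i, i < j.+1 -> [/\ (if i == j then r else ints s1 aRRL i) = (coord pos ech parp (loc i)).1,
    (if i == j then x else reals s1 aOFL i) = (coord pos ech parp (loc i)).2 &
    (if i == j then (reals s aBASE r + x)%R else reals s1 aKEY i) =
      (reals s aBASE (coord pos ech parp (loc i)).1 + (coord pos ech parp (loc i)).2)%R].
  move=> ex i hi; case: eqP => [->|ne]; first by rewrite -ex.
  by apply: hI; qlia.
have := hloc j hj; case: (loc j) fin => [v|k t] fin /= [l1 l2].
  have e1 : ints s1 aLOC j = v by rewrite fr.1.
  have hv := ltn_ord v.
  apply: wp_run; rewrite /= hj' e1; sto; tst; rewrite /= (ga_nv g1) addn1 hv (pl_pos pl1).
  have e2 := pl_len pl1 (rt_lt rt v).
  by do 4 sto; rewrite eqxx e2 b1; apply: fin.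
have e1 : ints s1 aLOC j = nv T + k by rewrite fr.1.
have e3 : reals s1 aLOC j = t by rewrite fr.2.
have hk := ltn_ord k; have [eS eD eL] := ga_edge g1 k.
have hr : ech k < nv T by case/andP: (rt_elt rt k).
apply: wp_run; rewrite /= hj' e1; sto; tst; rewrite /= (ga_nv g1).
rewrite (_ : nv T + k + 1 <= nv T = false); last by qlia.
rewrite addKn; sto; rewrite (pl_ech pl1); sto; tst.
rewrite -eqn_leq eS (pl_pos pl1) (pl_par pl1 hr) e3 eL /=; case: ifP => hc; do 3 sto.
- by rewrite eqxx b1; apply: fin; rewrite /= hc.
- by rewrite eqxx b1; apply: fin; rewrite /= hc.
Qed.

End Positions.

(** * Merging locations and vertices into chains *)

Notation aRRN := 60. Notation aNID := 61. Notation vrp := 72. Notation vjp := 73. Notation vpr := 74.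
Notation aOON := 60. Notation roff := 37.

Definition AddNode o : cmd :=
  IStore aPAR ('v vx) ('v vpr) ;;
  IStore aRRN ('v vx) ('v vrp) ;;
  RStore aOON ('v vx) o ;;
  RStore aDEP ('v vx) (RAdd (RLoad aDEP ('v vpr)) (RSub o ('r roff))).

(* The locations, sorted by key, are merged with the vertices, taken by
   position. *)
Definition Merge : cmd :=
  IStore aPAR (IConst 0) (IConst 0) ;; IStore aRRN (IConst 0) (IConst 0) ;;
  RStore aOON (IConst 0) (RConst 0) ;; RStore aDEP (IConst 0) (RConst 0) ;;
  vrp <~ IConst 0 ;; vjp <~ IConst 0 ;; vpr <~ IConst 0 ;; roff <~~ RConst 0 ;;
  vlt <~ IAdd ('v vNV) ('v vM) ;;
  vN <~ IAdd ('v vlt) (IConst 1) ;;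
  For vi vlt (
    vx <~ IAdd ('v vi) (IConst 1) ;;
    vk <~ ILoad aSO ('v vjp) ;;
    If (BAnd (ILe (IAdd ('v vjp) (IConst 1)) ('v vM)) (IEq (ILoad aRRL ('v vk)) ('v vrp)))
      (AddNode (RLoad aOFL ('v vk)) ;;
       IStore aLV ('v vk) ('v vx) ;;
       vpr <~ 'v vx ;;
       roff <~~ RLoad aOFL ('v vk) ;;
       vjp <~ IAdd ('v vjp) (IConst 1))
      (AddNode (RLoad aPLEN ('v vrp)) ;;
       IStore aNID ('v vrp) ('v vx) ;;
       vrp <~ IAdd ('v vrp) (IConst 1) ;;
       vpr <~ ILoad aNID (ILoad aPARP ('v vrp)) ;;
       roff <~~ RConst 0)).

Section Growing.
Variables (R : realFieldType) (nvT : nat) (parp : nat -> nat) (elen : nat -> R).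
Hypothesis parpP : parent_array parp.

(* The nodes 1, ..., x of the chains at the positions up to r; the next node
   hangs from [prev], which lies at offset [off]. *)
Record grown (x r : nat) (par rr : nat -> nat) (oo : nat -> R) (nid : nat -> nat) (dep : nat -> R)
    (prev : nat) (off : R) : Prop := Grown {
  gr_r : r <= nvT;
  gr_0 : [/\ par 0 = 0, rr 0 = 0, oo 0 = 0%R & dep 0 = 0%R];
  gr_rr : forall y, 0 < y <= x -> [/\ rr y <= r, rr y < nvT & rr y < r -> y <= nid (rr y)];
  gr_oo : forall y, 0 < y <= x -> (0 <= oo y <= elen (rr y))%R;
  gr_mono : forall y z, 0 < y <= z -> z <= x -> rr y <= rr z;
  gr_in : forall y, 1 < y <= x -> rr y.-1 = rr y -> par y = y.-1 /\ (oo y.-1 <= oo y)%R;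
  gr_first : forall y, 0 < y <= x -> (1 < y -> rr y.-1 <> rr y) ->
    par y = if rr y == 0 then 0 else nid (parp (rr y));
  gr_nid : forall q, q < r -> [/\ 0 < nid q <= x, rr (nid q) = q & oo (nid q) = elen q];
  gr_cur : if (0 < x) && (rr x == r) then prev = x /\ off = oo x
    else off = 0%R /\ (r < nvT -> prev = if r == 0 then 0 else nid (parp r));
  gr_dep : forall y, 0 < y <= x -> par y < y /\
    dep y = (dep (par y) + (oo y - (if (1 < y)%N && (rr y.-1 == rr y) then oo y.-1 else 0)))%R }.

(** The flag b tells whether the new node is the vertex that ends the chain r, after which chain r +
    1 begins, or a location on that chain. *)
Lemma grown_step x r par rr oo nid dep prev off (b : bool) o par' rr' oo' nid' dep' prev' off' :
  grown x r par rr oo nid dep prev off -> r < nvT -> (off <= o <= elen r)%R -> (0 <= o)%R ->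
  (b -> o = elen r) ->
  (forall y, par' y = if y == x.+1 then prev else par y) ->
  (forall y, rr' y = if y == x.+1 then r else rr y) ->
  (forall y, oo' y = if y == x.+1 then o else oo y) ->
  (forall y, dep' y = if y == x.+1 then (dep prev + (o - off))%R else dep y) ->
  (forall q, nid' q = if b && (q == r) then x.+1 else nid q) ->
  (if b then off' = 0%R /\ (r.+1 < nvT -> prev' = nid' (parp r.+1)) else prev' = x.+1 /\ off' = o) ->
  grown x.+1 (r + b) par' rr' oo' nid' dep' prev' off'.
Proof.
move=> G hr /andP[o1 o2] o0 hb epar err eoo edep enid ecur.
have [g1 [p0 r0 oo0 d0] g2 g2' g3 g4 g5 g6 g7 g8] := G.
have old y : y <= x -> [/\ par' y = par y, rr' y = rr y, oo' y = oo y & dep' y = dep y].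
  by move=> hy; rewrite epar err eoo edep; have -> : (y == x.+1) = false by qlia.
have new : [/\ par' x.+1 = prev, rr' x.+1 = r, oo' x.+1 = o & dep' x.+1 = (dep prev + (o - off))%R].
  by rewrite epar err eoo edep eqxx.
have [np nr no nd] := new.
have nidold q : q < r -> nid' q = nid q.
  by move=> hq; rewrite enid (ltn_eqF hq) andbF.
have parp_lt q : 0 < q -> parp q < q by apply: (proj2 parpP).
have ext (Q : nat -> Prop) : (forall y, 0 < y <= x -> Q y) -> Q x.+1 -> forall y, 0 < y <= x.+1 -> Q y.
  move=> h1 h2 y; case: (eqVneq y x.+1) => [->//|hne hy]; apply: h1; qlia.
have prev_lt : prev < x.+1.
  move: g7; case: ifP => [_ [-> _] //|hc [_ h]]; rewrite (h hr); case: eqP => // /eqP hr0.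
  by have [] := g6 (parp r) ltac:(by apply: parp_lt; qlia); qlia.
have rr_le y : 0 < y <= x -> rr y <= r by move=> /g2[].
split.
- by case: (b); rewrite ?addn1 ?addn0.
- by have [-> -> -> ->] := old 0 isT.
- apply: ext => [y hy|].
    have [_ -> _ _] := old y ltac:(qlia); have [h1 h2 h3] := g2 y hy; split=> //.
      by rewrite (leq_trans h1) // leq_addr.
    move=> hlt; case: (ltnP (rr y) r) => h; first by rewrite nidold //; apply: h3.
    have e : rr y = r by qlia.
    move: hlt; rewrite e enid eqxx andbT; case: (b); [qlia|by rewrite addn0 ltnn].
  rewrite nr; split=> //; first exact: leq_addr.
  by case: (b) enid => enid; rewrite ?addn0 ?ltnn // enid eqxx.
- apply: ext => [y hy|]; last by rewrite nr no o0.
  by have [_ -> -> _] := old y ltac:(qlia); apply: g2'.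
- move=> y z hyz hz; case: (eqVneq z x.+1) => [e|hne].
    rewrite e nr; case: (eqVneq y x.+1) => [->|hne']; first by rewrite nr.
    by have [_ -> _ _] := old y ltac:(qlia); apply: rr_le; qlia.
  have [_ -> _ _] := old z ltac:(qlia); have [_ -> _ _] := old y ltac:(qlia); apply: g3; qlia.
- move=> y hy; case: (eqVneq y x.+1) => [e|hne].
    rewrite e /= nr np no; have [_ -> -> _] := old x (leqnn x) => hrx.
    have x0 : 0 < x by qlia.
    by move: g7; rewrite x0 hrx eqxx /= => -[-> e2]; rewrite -e2.
  have [-> -> -> _] := old y ltac:(qlia); have [_ -> -> _] := old y.-1 ltac:(qlia).
  by apply: g4; qlia.
- apply: ext => [y hy|].
    have [-> -> _ _] := old y ltac:(qlia); case: (leqP y 1) => hy1.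
      move=> _; rewrite (g5 y hy); last by qlia.
      case: eqP => // /eqP h; rewrite nidold //; apply: leq_trans (rr_le y hy); apply: parp_lt; qlia.
    have [_ -> _ _] := old y.-1 ltac:(qlia); move=> h; rewrite (g5 y hy (fun _ => h isT)).
    case: eqP => // /eqP h'; rewrite nidold //; apply: leq_trans (rr_le y hy); apply: parp_lt; qlia.
  rewrite np nr /= => h; move: g7; case: ifP => [/andP[x0 /eqP e] _|_ [_ h2]].
    by have [_ e2 _ _] := old x (leqnn x); case: (h _); [qlia|rewrite e2].
  rewrite (h2 hr); case: eqP => // /eqP hr0; rewrite nidold //; apply: parp_lt; qlia.
- move=> q hq; case: (ltnP q r) => hqr.
    have [h1 h2 h3] := g6 q hqr; rewrite nidold //.
    by have [_ -> -> _] := old (nid q) ltac:(qlia); split=> //; qlia.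
  have [eb eq] : b = true /\ q = r by move: hq; case: (b); rewrite ?addn1 ?addn0; qlia.
  by rewrite enid eb eq eqxx /= nr no hb // eb; split=> //; qlia.
- rewrite /= nr; case: (b) ecur hb => ecur hb.
    by rewrite addn1 ltn_eqF //; case: ecur => -> h; split=> // /h ->.
  by rewrite addn0 eqxx no.
- apply: ext => [y hy|].
    have [-> -> -> ->] := old y ltac:(qlia); have [h1 h2] := g8 y hy.
    have [_ _ _ ->] := old (par y) ltac:(qlia).
    have [_ -> -> _] := old y.-1 ltac:(qlia); split=> //.
  rewrite np nr no nd; split=> //; have [_ _ _ ->] := old prev prev_lt.
  have [_ -> -> _] := old x (leqnn x); congr (_ + (_ - _))%R.
  by move: g7; rewrite ltnS; case: ifP => [/andP[h1 h2] [_ ->]|_ [-> _]].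
Qed.

Lemma grown_chains M par rr oo nid dep prev off : 0 < nvT ->
  grown (nvT + M) nvT par rr oo nid dep prev off ->
  chains nvT parp elen (nvT + M).+1 (fun x => if x < (nvT + M).+1 then par x else 0) rr oo nid.
Proof.
move=> hn [g1 [p0 r0 oo0 d0] g2 g2' g3 g4 g5 g6 g7 g8]; split.
- by qlia.
- by split=> // x hx; rewrite ltnNge hx.
- by [].
- move=> x hx; have [h1 h2 h3] := g2 x ltac:(qlia); split=> //; exact: h3.
- by move=> x y h1 h2; apply: g3; qlia.
- move=> x hx h; have -> : (x < (nvT + M).+1) by qlia.
  by apply: g4 => //; qlia.
- move=> x hx h; have -> : (x < (nvT + M).+1) by qlia.
  by apply: g5 => //; qlia.
- by move=> x hx; apply: g2'; qlia.
- by move=> q hq; have [h1 h2 h3] := g6 q hq; split=> //; qlia.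
Qed.

End Growing.

Section Merging.
Variables (R : realType) (T : wgraph R).
Variables (pos : 'I_(nv T) -> nat) (ech : 'I_(ne T) -> nat) (parp : nat -> nat).
Hypothesis rt : rooting pos ech parp.
Hypothesis nv_gt0 : 0 < nv T.
Local Notation elen := (elen ech).
Hypothesis elen_ge0 : forall q, (0 <= elen q)%R.
Variables (W M : nat) (Rk : nat -> nat) (Ok : nat -> R) (o : seq nat).
Hypothesis W_ok : 2 * nv T + M + 10 <= W.
Hypothesis RkP : forall i, i < M -> Rk i < nv T /\ (0 <= Ok i <= elen (Rk i))%R.
Hypothesis o_perm : perm_eq o (iota 0 M).
Hypothesis o_sorted : forall j j', j <= j' < M -> Rk (nth 0 o j) <= Rk (nth 0 o j') /\
  (Rk (nth 0 o j) = Rk (nth 0 o j') -> (Ok (nth 0 o j) <= Ok (nth 0 o j'))%R).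

Definition grown_at x r (s : state R) := grown (nv T) parp elen x r (ints s aPAR) (ints s aRRN)
  (reals s aOON) (ints s aNID) (reals s aDEP) (ints s vpr 0) (reals s roff 0).

Lemma Merge_spec s : placed pos ech parp s -> ints s vM 0 = M ->
  (forall j, j < M -> ints s aSO j = nth 0 o j) ->
  (forall i, i < M -> ints s aRRL i = Rk i /\ reals s aOFL i = Ok i) ->
  run W Merge s (nv T + M) (fun s' => [/\ grown_at (nv T + M) (nv T) s', ints s' vN 0 = (nv T + M).+1 &
    forall i, i < M -> [/\ 0 < ints s' aLV i <= nv T + M, ints s' aRRN (ints s' aLV i) = Rk i &
      reals s' aOON (ints s' aLV i) = Ok i]]).
Proof.
move=> pl hM hO hRk; have g := pl_graph pl; set NM := nv T + M.
have oM j : j < M -> nth 0 o j < M.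
  move=> hj; have := mem_nth 0 (s := o) (n := j); rewrite (perm_size o_perm) size_iota => /(_ hj).
  by rewrite (perm_mem o_perm) mem_iota.
have o_uniq : uniq o by rewrite (perm_uniq o_perm) iota_uniq.
have o_size : size o = M by rewrite (perm_size o_perm) size_iota.
have w1 : NM + 2 <= W by clear -W_ok; rewrite /NM; qlia.
do 8 (step; sto); step; rewrite (ga_nv g) hM; split; [bnd|by split; [bnd|bnd|clear -w1; rewrite -/NM; qlia]|].
step; rewrite -/NM; sto; rewrite !mulr0z addn1; set s0 := State _ _.
apply: (@run_le _ _ _ _ (NM * 1)); last by rewrite muln1.
pose I x s' := exists r j, [/\ ints s' vrp 0 = r, ints s' vjp 0 = j, x = r + j & j <= M] /\
  [/\ grown_at x r s',
   forall j', j' < j -> [/\ 0 < ints s' aLV (nth 0 o j') <= x, ints s' aRRN (ints s' aLV (nth 0 o j')) = Rk (nth 0 o j') &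
      reals s' aOON (ints s' aLV (nth 0 o j')) = Ok (nth 0 o j')] &
   forall j', j <= j' < M -> r <= Rk (nth 0 o j') /\
     (Rk (nth 0 o j') = r -> (reals s' roff 0 <= Ok (nth 0 o j'))%R)].
apply: (run_for (n := NM) (I := I)) => //.
- by clear -w1; qlia.
- exists 0, 0; split=> //; split=> //.
  + by split=> //=; qlia.
  + move=> j' hj'; split=> // e /=; have [_ /andP[]] := RkP (oM j' ltac:(clear -hj'; qlia)); by [].
- move=> x s1 hx fr hx' [r [j [[hr hj exj hjM] [G hlv htodo]]]].
  have g1 : r <= nv T by case: G.
  have e1 : ints s1 vM 0 = M by rewrite fr.1.
  have hk : ints s1 aSO j = ints s aSO j by rewrite fr.1.
  have eR i : i < M -> ints s1 aRRL i = Rk i by move=> hi; rewrite fr.1 //=; case: (hRk i hi).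
  have eO i : i < M -> reals s1 aOFL i = Ok i by move=> hi; rewrite fr.2 //=; case: (hRk i hi).
  have ePL q : q < nv T -> reals s1 aPLEN q = elen q by move=> hq; rewrite fr.2 //= (pl_len pl).
  have ePR q : q < nv T -> ints s1 aPARP q = parp q by move=> hq; rewrite fr.1 //= (pl_par pl).
  have offP : (0 <= reals s1 roff 0)%R /\ (r < nv T -> (reals s1 roff 0 <= elen r)%R).
    case: G => _ _ _ hoo _ _ _ _ + _; case: ifP => [/andP[h1 /eqP h2] [_ ->]|_ [-> _]].
      by have := hoo x; rewrite h1 leqnn h2 => /(_ isT)/andP[].
    by split.
  apply: run_pre; rewrite /= hx'; split; [bnd|by split; [bnd|bnd|clear -w1 hx; qlia]|].
  apply: run_pre; rewrite /= hj hk; sto.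
  set s2 := State _ _.
  have body : wp W (If (BAnd (ILe (IAdd ('v vjp) (IConst 1)) ('v vM)) (IEq (ILoad aRRL ('v vk)) ('v vrp)))
      (AddNode (RLoad aOFL ('v vk)) ;; IStore aLV ('v vk) ('v vx) ;; vpr <~ 'v vx ;;
       roff <~~ RLoad aOFL ('v vk) ;; vjp <~ IAdd ('v vjp) (IConst 1))
      (AddNode (RLoad aPLEN ('v vrp)) ;; IStore aNID ('v vrp) ('v vx) ;;
       vrp <~ IAdd ('v vrp) (IConst 1) ;; vpr <~ ILoad aNID (ILoad aPARP ('v vrp)) ;; roff <~~ RConst 0))
      (fun s3 => I x.+1 (set_int s3 vi x.+1)) s2; last exact: wp_run body.
  have wx : x + 1 <= W by clear -w1 hx; qlia.
  have wj : j + 1 <= W by clear -w1 hjM; rewrite /NM in w1; qlia.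
  have wr : r + 1 <= W by clear -w1 g1; rewrite /NM in w1; qlia.
  split; first by rewrite /= hj; do ?split => //; clear -w1; qlia.
  rewrite /= hj e1 hr -eqn_leq addn1; case: ifP => hc.
    have /andP[hjlt] := hc; have hi := oM j hjlt; rewrite (hO j hjlt) (eR _ hi) => /eqP eRr.
    have [kr /andP[ko ko']] := RkP hi.
    have [_ hoff] := htodo j ltac:(by rewrite leqnn).
    rewrite (eO _ hi).
    do 7 (split; [bnd|bnd|]); split; [bnd|by do ?split => //; clear -w1 wj; qlia|].
    exists r, j.+1; split; first by split=> //; rewrite addnS exj.
    have hnew : forall j', j' < j.+1 -> j' = j \/ j' < j by clear; qlia.
    split.
    + have := grown_step (rt_par rt) (b := false) (o := Ok (nth 0 o j)) G; rewrite addn0; apply=> //.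
      * by rewrite -eRr.
      * by rewrite (hoff eRr) -eRr.
      * by move=> y; rewrite /= addn1.
      * by move=> y; rewrite /= addn1.
      * by move=> y; rewrite /= addn1.
      * by move=> y; rewrite /= addn1.
      * by rewrite /= addn1.
    + move=> j' /hnew[->|hlt]; first by rewrite /= addn1 !eqxx eRr leqnn.
      have [k1 k2 k3] := hlv j' hlt.
      rewrite /= nth_uniq ?o_size ?(ltn_eqF hlt) //; last by apply: ltn_trans hlt hjlt.
      have -> : (ints s1 aLV (nth 0 o j') == x + 1) = false by clear -k1; qlia.
      by split=> //; clear -k1; qlia.
    + move=> j' hj'; have [k1 _] := htodo j' ltac:(clear -hj'; qlia); split=> // e /=.
      by have [_ ->] := o_sorted (j := j) (j' := j') ltac:(clear -hj'; qlia); rewrite ?eRr ?e.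
  (* If all vertices were placed, a location would remain, and its position would be at least
     [nv T]. *)
  have rlt : r < nv T.
    rewrite ltn_neqAle g1 andbT; apply/eqP => er.
    have hjlt : j < M by clear -er exj hx; rewrite /NM in hx; qlia.
    have [k1 _] := htodo j ltac:(by rewrite leqnn); have [k2 _] := RkP (oM j hjlt).
    by clear -er k1 k2; qlia.
  rewrite ?ePL //.
  do 5 (split; [bnd|bnd|]); split; [bnd|by do ?split => //; clear -w1 wr; qlia|]; do 2 sto; rewrite mulr0z.
  exists r.+1, j; split; first by split=> //; rewrite ?addn1 // exj addSn.
  split.
  + have := grown_step (rt_par rt) (b := true) (o := elen r) G; rewrite (addn1 r : r + true = r.+1); apply=> //.
    * by rewrite lexx (proj2 offP rlt).
    * by move=> y; rewrite /= addn1.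
    * by move=> y; rewrite /= addn1.
    * by move=> y; rewrite /= addn1.
    * by move=> y; rewrite /= addn1.
    * by move=> q; rewrite /= addn1.
    (* Past the last vertex the program reads an arbitrary cell of [aPARP], and [gr_cur] asks
       nothing about it. *)
    * by split=> // hlt; rewrite /= !addn1 ePR.
  + move=> j' hlt; have [k1 k2 k3] := hlv j' hlt.
    rewrite /=; have -> : (ints s1 aLV (nth 0 o j') == x + 1) = false by clear -k1; qlia.
    by split=> //; clear -k1; qlia.
  + move=> j' hj'; have [k1 _] := htodo j' hj'.
    have hjM' : j' < M by clear -hj'; qlia.
    (* The next location is not on chain r, or it would have been taken instead of the vertex; the
       sorted order extends this to all later ones. *)
    have hne : r <> Rk (nth 0 o j').
      move=> e; have hjlt : j < M by clear -hj'; qlia.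
      have [k2 _] := htodo j ltac:(by rewrite leqnn).
      have [k3 _] := o_sorted hj'.
      move: hc; rewrite hjlt /= (hO j hjlt) (eR _ (oM j hjlt)) => /eqP; clear -k2 k3 e; qlia.
    split=> [|e]; first by clear -k1 hne; qlia.
    by have [_ /andP[]] := RkP (oM j' hjM').
- move=> s1 fr [r [j [[hr hj exj hjM] [G hlv htodo]]]].
  have g1 : r <= nv T by case: G.
  have [er ej] : r = nv T /\ j = M by clear -exj hjM g1; rewrite /NM in exj; qlia.
  split; rewrite ?er in G *; [by []|by rewrite fr.1|].
  move=> i hi; have hio : i \in o by rewrite (perm_mem o_perm) mem_iota.
  have := hlv (index i o); rewrite ej -o_size index_mem hio => /(_ isT).
  by rewrite nth_index.
Qed.

End Merging.

(** * Construction of the instance and output of the centers *)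

Definition Build : cmd := Peel ;; Position ;; Locate ;; sL <~ 'v vM ;; Sort ;; Merge.

(** The parameter [vS] is measured from the anchor, so if the anchor is the lower end it is itself
    the fraction to go up. Position 0 has no edge above it and stands for vertex 0; elsewhere the
    offset is turned round if the source of the edge is its lower end. *)
Definition Out i : cmd :=
  vx <~ ILoad aREG (IConst 1) ;;
  racc <~~ RSub (RLoad aDEP ('v vx)) (RLoad aDEP (ILoad aPAR ('v vx))) ;;
  If (IEq ('v vANC) ('v vx))
    (racc <~~ RSub (RLoad aOON ('v vx)) (RMul ('r vS) ('r racc)))
    (racc <~~ RSub (RLoad aOON ('v vx)) (RMul (RSub (RConst 1) ('r vS)) ('r racc))) ;;
  vr <~ ILoad aRRN ('v vx) ;;
  If (ILe ('v vr) (IConst 0))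
    (IStore 5 (IConst i) (IConst 0) ;; RStore 5 (IConst i) (RConst 0))
    (vk <~ ILoad aEDG ('v vr) ;;
     IStore 5 (IConst i) (IAdd ('v vNV) ('v vk)) ;;
     If (IEq (ILoad aPOS (ILoad aSRC ('v vk))) (ILoad aPARP ('v vr)))
       (RStore 5 (IConst i) ('r racc))
       (RStore 5 (IConst i) (RSub (RLoad aLEN ('v vk)) ('r racc)))).

Section Main.
Variables (R : realType) (T : wgraph R).
Hypothesis T_tree : is_tree T.
Hypothesis len_gt0 : forall k : 'I_(ne T), (0 < len k)%R.
Let nv_gt0 : 0 < nv T. Proof. by case: T_tree. Qed.

(** A crude bound that holds before any rooting is known: the word size is fixed at the start,
    whereas [ne T < nv T] results from the peeling. *)
Lemma edges_bound : ne T <= nv T * nv T.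
Proof.
case: T_tree => _ [_ hs] _ _.
have hinj : injective (fun k : 'I_(ne T) => (src k, dst k)).
  by move=> k k' [e1 e2]; apply: (hs k k' (src k) (dst k)); rewrite /joins ?e1 ?e2 !eqxx.
by have := leq_card _ hinj; rewrite card_prod !card_ord.
Qed.

Lemma rooting_edges pos ech parp : rooting (T := T) pos ech parp -> ne T < nv T.
Proof.
move=> rt; have hlt (k : 'I_(ne T)) : (ech k).-1 < (nv T).-1 by have := rt_elt rt k; qlia.
have hinj : injective (fun k => Ordinal (hlt k)).
  move=> k k' /(congr1 val) /= e; apply: (rt_einj rt).
  by have := rt_elt rt k; have := rt_elt rt k'; qlia.
by have := leq_card _ hinj; rewrite !card_ord; qlia.
Qed.

Variables (M W : nat) (locf : nat -> tpoint T).
Hypothesis W1 : 2 * nv T + 2 * ne T + ne T * ne T + 10 <= W.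
Hypothesis W2 : 2 * nv T + 2 * M + 10 <= W.
Hypothesis loc_on : forall i, i < M -> on_tree (locf i).

Record built pos ech parp (s : state R) : Prop := Built {
  bt_rt : rooting (T := T) pos ech parp;
  bt_pl : placed pos ech parp s;
  bt_gr : grown_at ech parp (nv T + M) (nv T) s;
  bt_root : forall v, nat_of_ord v = 0 -> pos v = 0;
  bt_N : ints s vN 0 = (nv T + M).+1;
  bt_lv : forall i, i < M -> 0 < ints s aLV i <= nv T + M /\
    (ints s aRRN (ints s aLV i), reals s aOON (ints s aLV i)) = coord pos ech parp (locf i) }.

(** The intervals from [base r] to [base r + el r] are a unit apart, so sorting by base plus offset
    sorts by position first and by offset within a position. *)
Lemma base_mono (base el : nat -> R) r r' : (forall q, (0 <= el q)%R) ->
  (forall q, q < nv T -> (base q.+1 = base q + el q + 1)%R) -> r < r' <= nv T ->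
  (base r + el r + 1 <= base r')%R.
Proof.
move=> h0 hb; elim: r' => // r' IH /andP[]; rewrite ltnS leq_eqVlt => /orP[/eqP -> h|h1 h2].
  by rewrite hb.
have := IH ltac:(qlia); rewrite hb //; have := h0 r'; lra.
Qed.

Lemma Build_spec s : graph_at T s -> ints s vM 0 = M ->
  (forall i, i < M -> stores_point s aLOC i (locf i)) ->
  run W Build s (7 * nv T + ne T + 2 * M + (M * (trunc_log 2 (2 * M) + 4) + 1)) (fun s' =>
    exists pos ech parp, built pos ech parp s').
Proof.
move=> g hM hloc; set tl := M * _ + 1.
apply: (@run_le _ _ _ _ ((3 * nv T + ne T) + (3 * nv T + (M + (tl + (nv T + M)))))); last by qlia.
apply: (run_seq (Peel_spec T_tree W1 g)) => s1 f1 [root [L [r0 pL hg hL]]].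
have g1 := graph_frame f1 isT isT g; have hs := peel_size T_tree pL hg.
have rt := peel_rooting T_tree pL hg.
set pos := peel_pos root L in rt; set ech := peel_ech L in rt; set parp := peel_par root L in rt.
have pos_inj : injective pos.
  have hin v : v \in root :: verts L.
    by rewrite inE; case: (eqVneq v root) => //= hv; apply: (peeled_all T_tree pL hg hv).
  move=> v w /(congr1 (nth root (root :: verts L))).
  by rewrite /pos /peel_pos (nth_index _ (hin v)) (nth_index _ (hin w)).
have p0 : pos root = 0 by rewrite /pos /peel_pos /= eqxx.
have hQ i : i < (nv T).-1 -> exists (v : 'I_(nv T)) (k : 'I_(ne T)) (u : 'I_(nv T)),
    [/\ ints s1 aQU i = v, ints s1 aEK i = k & ints s1 aPV i = u] /\
    [/\ pos v = (nv T).-1 - i, ech k = (nv T).-1 - i & parp ((nv T).-1 - i) = pos u].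
  move=> hi; have hiL : i < size L by qlia.
  have hi' : size L - i.+1 < size L by qlia.
  have [d _] : exists d, d \in L by case: (L) hiL => //= d ?; exists d; rewrite mem_head.
  have [a1 a2 a3] := peel_nth T_tree pL hg d hi'; have [b1 b2 b3] := hL d i hiL.
  have e : (size L - i.+1).+1 = (nv T).-1 - i by qlia.
  by rewrite e in a1 a2 a3; exists (nth d L (size L - i.+1)).1.1, (nth d L (size L - i.+1)).1.2, (nth d L (size L - i.+1)).2.
have w1 : 2 * nv T + 10 <= W by qlia.
apply: (run_seq (Position_spec rt pos_inj nv_gt0 w1 g1 r0 p0 hQ)) => s2 f2 pl2.
have hM2 : ints s2 vM 0 = M by rewrite f2.1 // f1.1.
have hloc2 i : i < M -> stores_point s2 aLOC i (locf i).
  by move=> /hloc; case: (locf i) => [v|k t] /=; rewrite f2.1 // f2.2 // f1.1 // f1.2.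
have wM : M < W by qlia.
have wne : ne T + nv T <= W by qlia.
apply: (run_seq (Locate_spec rt nv_gt0 w1 pl2 hM2 wM wne hloc2)) => s3 f3 h3.
have pl3 := placed_frame f3 isT isT pl2; have hM3 : ints s3 vM 0 = M by rewrite f3.1.
step; rewrite hM3; sto; set s3' := State _ _.
pose Rk i := (coord pos ech parp (locf i)).1; pose Ok i := (coord pos ech parp (locf i)).2.
pose key i := (reals s2 aBASE (Rk i) + Ok i)%R.
have pl3' : placed pos ech parp s3' by case: pl3 => -[a b c] *; split.
have wS : 2 * M + 2 <= W by qlia.
have hkey j : j < M -> reals s3' aSK j = key j by move=> /h3[].
apply: (run_seq (Sort_spec wS (erefl _ : ints s3' sL 0 = M) hkey)) => s4 f4 [o [o1 o2 o3]].
have pl4 := placed_frame f4 isT isT pl3'.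
have el0 q : (0 <= elen ech q)%R by apply: elen_ge0.
have RkP i : i < M -> Rk i < nv T /\ (0 <= Ok i <= elen ech (Rk i))%R.
  by move=> hi; split; [apply: (coord_lt rt)|apply: (coord_bounds rt len_gt0); apply: loc_on].
have o_lt j : j < M -> nth 0 o j < M.
  move=> hj; have := mem_nth 0 (s := o) (n := j); rewrite (perm_size o1) size_iota => /(_ hj).
  by rewrite (perm_mem o1) mem_iota.
have o4 j j' : j <= j' < M -> Rk (nth 0 o j) <= Rk (nth 0 o j') /\
    (Rk (nth 0 o j) = Rk (nth 0 o j') -> (Ok (nth 0 o j) <= Ok (nth 0 o j'))%R).
  move=> hj; have [k1 /andP[k2 k3]] := RkP _ (o_lt j ltac:(qlia)).
  have [k4 /andP[k5 k6]] := RkP _ (o_lt j' ltac:(qlia)).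
  have := o3 j j' hj; rewrite /key => hle; split=> [|e]; last by move: hle; rewrite e; lra.
  rewrite leqNgt; apply/negP => hlt.
  have := base_mono el0 (pl_base pl2) (r := Rk (nth 0 o j')) (r' := Rk (nth 0 o j)).
  by rewrite hlt (ltnW k1) => /(_ isT); lra.
have w3 : 2 * nv T + M + 10 <= W by qlia.
have hM4 : ints s4 vM 0 = M by rewrite f4.1.
have hR4 i : i < M -> ints s4 aRRL i = Rk i /\ reals s4 aOFL i = Ok i.
  by move=> /h3 [a b _]; rewrite f4.1 // f4.2.
have := Merge_spec rt nv_gt0 el0 w3 RkP o1 o4 pl4 hM4 o2 hR4.
move/run_framed; apply: run_weak => // s5 [[k1 k2 k3] f5].
exists pos, ech, parp; split=> //.
- exact: placed_frame f5 isT isT pl4.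
- by move=> v hv; have -> : v = root by apply: val_inj; rewrite /= hv r0.
by move=> i /k3[a b c]; split=> //; rewrite b c -surjective_pairing.
Qed.

Section Tree.
Variables (pos : 'I_(nv T) -> nat) (ech : 'I_(ne T) -> nat) (parp : nat -> nat) (s : state R).
Hypothesis B : built pos ech parp s.
Let N := (nv T + M).+1.
(** Cells of [aPAR] from N on have arbitrary contents, while a parent array has to be decreasing
    everywhere. *)
Definition tpar x := if x < N then ints s aPAR x else 0.

Lemma built_chains : chains (nv T) parp (elen ech) N tpar (ints s aRRN) (reals s aOON) (ints s aNID).
Proof. exact: grown_chains nv_gt0 (bt_gr B). Qed.

Lemma built_depth x : x < N -> reals s aDEP x = depth N tpar (seglen (ints s aRRN) (reals s aOON)) x.
Proof.
have pP := chain_parent (bt_rt B) T_tree built_chains.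
elim/ltn_ind: x => x IH hx; case: (posnP x) => [->|x0].
  have [_ h0 _ _ _ _ _ _ _ _] := bt_gr B; have [_ _ _ ->] := h0.
  rewrite /depth big1 // => c _; case: (posnP c) => [->|c0]; first by rewrite /seglen eqxx mul0r.
  case: (boolP (anc tpar c 0)) => [/(anc_le pP)|_]; last by rewrite mulr0.
  by rewrite leqn0 => /eqP e; rewrite e in c0.
rewrite (depth_par _ pP x0 hx) -IH; last 2 first.
- exact: (proj2 pP).
- exact: ltn_trans (proj2 pP _ x0) hx.
have [_ _ _ _ _ _ _ _ _ hd] := bt_gr B; have hxx : 0 < x <= nv T + M by rewrite x0.
have [h1 ->] := hd x hxx; have -> : tpar x = ints s aPAR x by rewrite /tpar hx.
by rewrite /seglen (gtn_eqF x0).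
Qed.

Lemma Out_spec i s0 c r sg : i < 2 -> 0 < c < N -> r = c \/ r = tpar c -> (0 <= sg <= 1)%R ->
  placed pos ech parp s0 -> reals s0 aDEP =1 reals s aDEP -> ints s0 aPAR =1 ints s aPAR ->
  ints s0 aRRN =1 ints s aRRN -> reals s0 aOON =1 reals s aOON ->
  ints s0 aREG 1 = c -> ints s0 vANC 0 = r -> reals s0 vS 0 = sg ->
  run W (Out i) s0 0 (fun s' => (exists q : tpoint T, [/\ on_tree q, stores_point s' 5 i q &
    coord pos ech parp q = spot_on (ints s aRRN) (reals s aOON) (along c r sg).1 (along c r sg).2]) /\
    forall j, j != i -> ints s' 5 j = ints s0 5 j /\ reals s' 5 j = reals s0 5 j).
Proof.
move=> hi hc hr /andP[sg0 sg1] pl eD eP eR eO hreg hanc hsg.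
have ch := built_chains; have rt := bt_rt B; have g := pl_graph pl.
have pP := chain_parent rt T_tree ch.
have /andP[c0 cN] := hc; have pc : tpar c < N by apply: ltn_trans (proj2 pP _ c0) cN.
have ePc : ints s aPAR c = tpar c by rewrite /tpar cN.
set sl := seglen (ints s aRRN) (reals s aOON) c.
have hsl : (reals s aDEP c - reals s aDEP (tpar c) = sl)%R.
  by rewrite !built_depth // (depth_par _ pP c0 cN) addrAC subrr add0r.
have [hrr _] := ch_rr ch hc; have /andP[o0 o1] := ch_oo ch hc.
set rc := ints s aRRN c in hrr o1.
have [hb0 hb1] : (0 <= sl <= reals s aOON c)%R /\ (reals s aOON c <= elen ech rc)%R.
  split=> //; have /andP[b0 b1] := below_bounds T_tree ch hc.
  by rewrite /sl /seglen (gtn_eqF c0); apply/andP; split; lra.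
pose off := (reals s aOON c - (1 - (along c r sg).2) * sl)%R.
have hoff : (0 <= off <= elen ech rc)%R.
  have : (0 <= (along c r sg).2 <= 1)%R by rewrite /along; case: ifP => _ /=; lra.
  by rewrite /off => /andP[a0 a1]; case/andP: hb0 => b0 b1; apply/andP; split; nra.
have hal : (along c r sg).1 = c by rewrite /along; case: ifP.
rewrite /spot_on hal -/rc -/sl -/off.
have wn : i <= W by qlia.
apply: run_pre; rewrite /= hreg; sto.
apply: run_pre; rewrite /= ?eqxx /= !eD eP ePc hsl; sto.
rewrite -[0]addn0; set s1 := State _ _.
apply: (@run_seq _ _ _ _ _ _ _ (fun s' => reals s' racc 0 = off)).
  apply: wp_run; rewrite /=; tst; rewrite /= hanc hsg -eqn_leq eO /off /along.
  by case: ifP => hrc; sto; rewrite ?hrc /= ?mulr1z; [congr (_ - _)%R; ring|].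
move=> s2 f2 h2; have x2 : ints s2 vx 0 = c by rewrite f2.1.
have pl1 : placed pos ech parp s1 by case: pl => -[a b d] *; split.
have pl2 := placed_frame f2 isT isT pl1; have g2 := pl_graph pl2.
have r2 : ints s2 aRRN c = rc by rewrite f2.1 //= eR.
have keep j : ints s2 5 j = ints s0 5 j /\ reals s2 5 j = reals s0 5 j by rewrite f2.1 // f2.2.
have wr (x : nat) (y : R) j : j != i -> (if j == i then x else ints s2 5 j) = ints s0 5 j /\
    (if j == i then y else reals s2 5 j) = reals s0 5 j.
  by move=> hj; rewrite (negbTE hj); apply: keep.
apply: wp_run; rewrite /= x2 r2; sto; tst; rewrite /= leqn0; case: eqP => hrc.
  do 2 sto; split; last by move=> j /wr; apply.
  rewrite mulr0z; exists (Vertex (Ordinal nv_gt0)); rewrite hrc in hoff *.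
  have off0 : off = 0%R by move: hoff; rewrite (elen0 rt); lra.
  split=> //; first by rewrite /= !eqxx.
  by rewrite /= (bt_root B (v := Ordinal nv_gt0)) // (elen0 rt) off0.
have rc0 : 0 < rc by rewrite lt0n; apply/eqP.
have [k hk] : exists k, ech k = rc by apply: (rt_esurj rt); rewrite rc0.
have eG : ints s2 aEDG rc = k by rewrite -hk (pl_edge pl2).
have [eS _ eL] := ga_edge g2 k; have hkn := ltn_ord k; have hne := edges_bound.
have wk : nv T + k <= W by clear -W1 hkn; qlia.
have hlen : elen ech rc = len k by rewrite -hk (elen_ech rt).
rewrite hlen in hoff; sto; rewrite /= (ga_nv g2) eG; split; [bnd|by split|].
tst; rewrite /= eS (pl_pos pl2) (pl_par pl2 hrr) eL h2 -eqn_leq; case: ifP => hc2; sto; (split; last by move=> j /wr; apply).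
- exists (OnEdge k off); split=> //; first by rewrite /= !eqxx.
  by rewrite /= hk hc2.
- exists (OnEdge k (len k - off)%R); split; first by move: hoff => /= /andP[a1 a2]; apply/andP; split; lra.
    by rewrite /= !eqxx.
  by rewrite /= hk hc2; congr pair; ring.
Qed.

End Tree.
End Main.

(** * The whole program *)

Definition Core : cmd := Build ;; Search ;; Settle ;; Out 0 ;; ren_c (Out 1).

Definition Main : cmd :=
  vNV <~ ILoad 0 (IConst 0) ;; vNE <~ ILoad 0 (IConst 1) ;;
  vn <~ ILoad 0 (IConst 2) ;; vm <~ ILoad 0 (IConst 3) ;; vM <~ IMul ('v vn) ('v vm) ;;
  If (ILe ('v vM) (IConst 0))
    (IStore 5 (IConst 0) (IConst 0) ;; RStore 5 (IConst 0) (RConst 0) ;;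
     IStore 5 (IConst 1) (IConst 0) ;; RStore 5 (IConst 1) (RConst 0))
    Core.

Lemma core_arith v a M n e t : a < v -> 0 < M -> n <= M -> 0 < e -> t <= e.+1 ->
  7 * v + a + 2 * M + (M * (t + 4) + 1) +
    (100 * (v + M).+1 + 20 * M + 100 + 3 * (e * (20 * M + 60)) + (n * (4 * e + 29) + 0)) <=
  310 * v + 500 * (M * e).
Proof.
move=> h1 h2 h3 h4 h5; have h6 : M <= M * e by rewrite leq_pmulr.
have h7 : e <= M * e by rewrite leq_pmull.
have h8 : n * (4 * e + 29) <= M * (4 * e + 29) by rewrite leq_mul2r h3 orbT.
have h9 : M * (t + 4) <= M * (e + 5) by rewrite leq_mul2l; apply/orP; right; qlia.
nia.
Qed.

Section Core.
Variables (R : realType) (T : wgraph R) (n m : nat) (P : uncertain T n m).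
Hypothesis T_tree : is_tree T.
Hypothesis len_gt0 : forall k : 'I_(ne T), (0 < len k)%R.
Hypothesis weight_ge0 : forall i, (0 <= weight P i)%R.
Hypothesis loc_on : forall i j, on_tree (loc P i j).
Hypothesis prob_ge0 : forall i j, (0 <= prob P i j)%R.
Local Notation M := (n * m).
Hypothesis M_gt0 : 0 < M.
Let n_gt0 : 0 < n. Proof. by move: M_gt0; rewrite muln_gt0 => /andP[]. Qed.
Let m_gt0 : 0 < m. Proof. by move: M_gt0; rewrite muln_gt0 => /andP[]. Qed.
Let nv_gt0 : 0 < nv T. Proof. by case: T_tree. Qed.

Let locf k := loc P (insubd (Ordinal n_gt0) (k %/ m)) (insubd (Ordinal m_gt0) (k %% m)).

Let locfE (i : 'I_n) (j : 'I_m) : locf (i * m + j) = loc P i j.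
Proof.
by rewrite /locf divnMDl // modnMDl divn_small // addn0 modn_small // !valKd.
Qed.

Variable W : nat.
Hypothesis W1 : 2 * nv T + 2 * ne T + ne T * ne T + 10 <= W.
Hypothesis W2 : 4 * (nv T + M).+1 + M + n + m + 10 <= W.

Definition core_ticks e := 310 * nv T + 500 * (M * e).

Lemma Core_spec s e : graph_at T s -> ints s vn 0 = n -> ints s vm 0 = m -> ints s vM 0 = M ->
  (forall i : 'I_n, reals s aWGT i = weight P i) ->
  (forall (i : 'I_n) (j : 'I_m), reals s aPRB (i * m + j) = prob P i j) ->
  (forall (i : 'I_n) (j : 'I_m), stores_point s aLOC (i * m + j) (loc P i j)) ->
  0 < e -> (nv T + M).+1 <= 2 ^ e ->
  run W Core s (core_ticks e) (fun s' => exists q1 q2, stores_output s' q1 q2 /\ two_centers P q1 q2).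
Proof.
move=> g hn hm hM hwgt hprb hloc e0 he.
have idx k : k < M -> exists (i : 'I_n) (j : 'I_m), k = i * m + j.
  move=> hk; have hi : k %/ m < n by rewrite ltn_divLR.
  by exists (Ordinal hi), (Ordinal (ltn_pmod k m_gt0)); rewrite /= -divn_eq.
have hlocf k : k < M -> stores_point s aLOC k (locf k) by move=> /idx[i [j ->]]; rewrite locfE.
have hon k : k < M -> on_tree (locf k) by move=> /idx[i [j ->]]; rewrite locfE.
have w2 : 2 * nv T + 2 * M + 10 <= W by clear -W2; qlia.
set tl := 7 * nv T + ne T + 2 * M + (M * (trunc_log 2 (2 * M) + 4) + 1).
set ts := 100 * (nv T + M).+1 + 20 * M + 100 + 3 * (e * (20 * M + 60)).
suff : run W Core s (tl + (ts + (n * (4 * e + 29) + 0))) (fun s' =>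
    ne T < nv T /\ exists q1 q2, stores_output s' q1 q2 /\ two_centers P q1 q2).
  move=> [t [s' [h1 h2 [hne h3]]]]; exists t, s'; split=> //.
  apply: leq_trans h2 _; rewrite leq_mul2l; apply/orP; right; rewrite ltnS.
  have htl : trunc_log 2 (2 * M) <= e.+1.
    have h4 : 2 * M <= 2 ^ e.+1 by rewrite expnS; clear -he; qlia.
    by have := leq_trunc_log 2 h4; rewrite trunc_expnK.
  by apply: core_arith => //; rewrite leq_pmulr.
apply: (run_seq (Build_spec T_tree len_gt0 W1 w2 hon g hM hlocf)) => s1 f1 [pos [ech [parp B]]].
have rt := bt_rt B; have ch := built_chains T_tree B; have pl1 := bt_pl B.
set tp := tpar _ _ _ in ch.
set I := inst (nv T + M).+1 tp (ints s1 aRRN) (reals s1 aOON) n m (ints s1 aLV) (reals s1 aPRB) (reals s1 aWGT).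
have lvP (i : 'I_n) (j : 'I_m) : ints s1 aLV (i * m + j) < (nv T + M).+1 /\
    spot (ints s1 aRRN) (reals s1 aOON) (ints s1 aLV (i * m + j)) = coord pos ech parp (loc P i j).
  have hk : i * m + j < M by have := ltn_ord i; have := ltn_ord j; clear; nia.
  have [/andP[_ h1] h2] := bt_lv B hk; rewrite locfE in h2; by split.
have prbP (i : 'I_n) (j : 'I_m) : reals s1 aPRB (i * m + j) = prob P i j by rewrite f1.2.
have wgtP (i : 'I_n) : reals s1 aWGT i = weight P i by rewrite f1.2.
have I_ok : instance_ok I by apply: (inst_ok rt T_tree ch weight_ge0 prob_ge0 n_gt0 lvP prbP wgtP).
have st1 : stored I s1.
  have e1 : ints s1 vn 0 = n by rewrite f1.1.
  have e2 : ints s1 vm 0 = m by rewrite f1.1.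
  have e3 : ints s1 vM 0 = M by rewrite f1.1.
  split=> //=; first exact: bt_N B.
  - by move=> x hx; rewrite /tp /tpar hx.
  - by move=> x hx; apply: (built_depth T_tree B hx).
apply: (run_seq (@Search_spec R I I_ok W W2 m_gt0 s1 e st1 he)) => s2 f2 [rho [E [r [c [D hE]]]]].
have hne : n <= 2 ^ e.
  by apply: leq_trans he; have : n <= M by [rewrite leq_pmulr]; clear; qlia.
apply: (run_seq (@Settle_spec R I I_ok W W2 m_gt0 rho E r c s2 e D hE hne)) => s3 f3 [lam [sg [st3 h1 h2 h3 h4]]].
have pl3 : placed pos ech parp s3.
  by apply: (placed_frame f3) => //; apply: (placed_frame f2) pl1.
have [a1 a2 a3 a4] := h1 false; have [b1 b2 b3 b4] := h1 true.
have [c1 c2] := h2 false; have [d1 d2] := h2 true.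
have sg01 b : (0 <= sg b <= 1)%R.
  have [_ _ _ [_]] := h1 b; rewrite /along; case: ifP => _ /=; lra.
have eD x : reals s3 aDEP x = reals s1 aDEP x by rewrite f3.2 // f2.2.
have eP x : ints s3 aPAR x = ints s1 aPAR x by rewrite f3.1 // f2.1.
have eR x : ints s3 aRRN x = ints s1 aRRN x by rewrite f3.1 // f2.1.
have eO x : reals s3 aOON x = reals s1 aOON x by rewrite f3.2 // f2.2.
have o0 := @Out_spec R T T_tree M W locf W1 w2 pos ech parp s1 B 0 s3 (c false) (r false) (sg false)
  isT c1 c2 (sg01 false) pl3 eD eP eR eO a1 a2 a3.
apply: (@run_le _ _ _ _ (0 + 0)) => //; apply: (run_seq o0) => s4 f4 [[q1 [k1 k2 k3]] _].
have pl4 := placed_frame f4 isT isT pl3.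
have pl4' : placed pos ech parp (side true s4) by case: pl4 => -[x1 x2 x3] *; split.
have eD4 x : reals (side true s4) aDEP x = reals s1 aDEP x by rewrite /= f4.2 // eD.
have eP4 x : ints (side true s4) aPAR x = ints s1 aPAR x by rewrite /= f4.1 // eP.
have eR4 x : ints (side true s4) aRRN x = ints s1 aRRN x by rewrite /= f4.1 // eR.
have eO4 x : reals (side true s4) aOON x = reals s1 aOON x by rewrite /= f4.2 // eO.
have b1' : ints (side true s4) aREG 1 = c true by rewrite -b1 /= f4.1.
have b2' : ints (side true s4) vANC 0 = r true by rewrite -b2 /= f4.1.
have b3' : reals (side true s4) vS 0 = sg true by rewrite -b3 /= f4.2.
have o1 := @Out_spec R T T_tree M W locf W1 w2 pos ech parp s1 B 1 (side true s4) (c true) (r true) (sg true)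
  isT d1 d2 (sg01 true) pl4' eD4 eP4 eR4 eO4 b1' b2' b3'.
have := run_side (b := true) o1; apply: run_weak => // s5 [[q2 [m1 m2 m3]] kp5].
split; first exact: rooting_edges rt.
have [e1 e2] := kp5 0 isT.
have e1' : ints s5 5 0 = ints s4 5 0 := e1; have e2' : reals s5 5 0 = reals s4 5 0 := e2.
exists q1, q2; split.
  split; first by move: k2; case: (q1) => [v|k t] /=; rewrite e1' e2'.
  by move: m2; case: (q2).
apply: (two_centers_inst rt T_tree len_gt0 ch weight_ge0 loc_on prob_ge0 n_gt0 lvP prbP wgtP
  k1 m1 a4 b4 _ _ h3 h4) => q _; by rewrite ?k3 ?m3.
Qed.

End Core.

(* As ln x < x, the logarithm of (v + M) / M contributes O(v + M) only. *)
Lemma log_bound (R : realType) (v M e : nat) : 0 < v -> 0 < M -> 2 ^ e <= 2 * (v + M).+1 ->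
  ((M * e)%N%:R <= (7 + 2 / ln 2) / ln 2 * (v%:R + M%:R * ln M%:R) :> R)%R.
Proof.
move=> v0 M0 he; set L : R := ln 2; have L0 : (0 < L)%R by rewrite /L ln_gt0 // ltr1n.
have M0' : (0 < (M%:R : R))%R by rewrite ltr0n.
have v1 : (1 <= (v%:R : R))%R by rewrite ler1n.
set y := (M%:R * ln M%:R)%R : R.
have y0 : (0 <= y)%R by rewrite mulr_ge0 ?ler0n // ln_ge0 // ler1n.
(* For M > 1 this is ln 2 <= ln M; for M = 1 the logarithm vanishes and v >= 1 takes over. *)
have hM : ((M%:R : R) <= v%:R + y / L)%R.
  case: (ltnP 1 M) => h1; last first.
    have -> : M = 1%N by qlia.
    by apply: le_trans v1 _; rewrite lerDl divr_ge0 // ltW.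
  have hl : (L <= ln (M%:R : R))%R by rewrite ler_ln ?posrE ?ltr0n // ler_nat.
  apply: (@le_trans _ _ (y / L)%R); last by rewrite lerDr ler0n.
  by rewrite ler_pdivlMr // ler_wpM2l // ltW.
set z := ((2 * (v + M).+1)%N%:R / M%:R)%R : R.
have z0 : (0 < z)%R by rewrite divr_gt0 // ltr0n.
have hN : ((2 * (v + M).+1)%N%:R = 2 * (v%:R + M%:R + 1) :> R)%R by rewrite natrM -[(v + M).+1]addn1 natrD natrD.
have hz : (z * M%:R = 2 * (v%:R + M%:R + 1))%R by rewrite /z divfK ?lt0r_neq0.
(* Since 2 ^ e <= M z, the left side is at most ln M + ln z; the bound ln z <= z is good enough,
   because M z is only O(v + M). *)
have heL : (e%:R * L <= ln (M%:R : R) + z)%R.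
  have -> : (e%:R * L)%R = ln ((2 ^ e)%:R : R) by rewrite natrX lnXn ?ltr0n // mulr_natl.
  apply: (@le_trans _ _ (ln (M%:R * z)%R)).
    have hp : (0 < M%:R * z)%R by exact: mulr_gt0.
    have hq : (0 < ((2 ^ e)%:R : R))%R by rewrite ltr0n expn_gt0.
    by rewrite ler_ln ?posrE // [(M%:R * z)%R]mulrC hz -hN ler_nat.
  by rewrite lnM ?posrE // lerD2l; apply/ltW/ln_sublinear.
have hmain : ((M * e)%N%:R * L <= y + 2 * (v%:R + M%:R + 1))%R.
  rewrite natrM -mulrA; apply: (@le_trans _ _ (M%:R * (ln M%:R + z))%R).
    by rewrite ler_wpM2l // ltW.
  by rewrite mulrDr -hz [(z * _)%R]mulrC.
rewrite mulrAC ler_pdivlMr //; apply: le_trans hmain _.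
have hyL : (0 <= y / L)%R by rewrite divr_ge0 // ltW.
have hvL : (0 <= v%:R / L :> R)%R by rewrite divr_ge0 // ?ler0n // ltW.
have -> : ((7 + 2 / L) * (v%:R + y) = 7 * v%:R + 7 * y + 2 * (v%:R / L) + 2 * (y / L))%R by field; exact: lt0r_neq0.
by lra.
Qed.

(** The dominant term is a * a, a bound on sums of edge indices. It is at most v ^ 4, hence X ^ 4
    with X = v + n + m + 2; two more powers of X >= 3 absorb the constants, which gives the exponent
    6. *)
Lemma word_bound v a n m : 0 < v -> a <= v * v ->
  2 * v + 2 * a + a * a + 10 <= max_word 6 (v + n + m) /\
  4 * (v + n * m).+1 + n * m + n + m + 10 <= max_word 6 (v + n + m).
Proof.
move=> v0 ha; rewrite /max_word; set X := v + n + m + 2; set Y := X * X.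
have hX : 3 <= X by rewrite /X; qlia.
have -> : X ^ 6 = Y * Y * Y by rewrite /Y !expnS expn0 muln1 !mulnA.
have hY : 9 <= Y by apply: (leq_mul (m1 := 3) (m2 := 3)).
have hXY : X <= Y by rewrite leq_pmulr //; qlia.
have aY : a <= Y by apply: leq_trans ha _; apply: leq_mul; rewrite /X; qlia.
have MY : n * m <= Y by apply: leq_mul; rewrite /X; qlia.
have aa : a * a <= Y * Y by apply: leq_mul.
have h9 : 9 * Y <= Y * Y by rewrite leq_mul2r hY orbT.
have h81 : 9 * (Y * Y) <= Y * Y * Y by rewrite mulnC leq_mul2l hY orbT.
move: (n * m) (a * a) (Y * Y * Y) (Y * Y) aa MY h9 h81 => p q r u; rewrite /X in hX hXY *; qlia.
Qed.

Local Open Scope ring_scope.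

Theorem theorem1 (R : realType) :
  exists (prog : cmd) (c : nat) (C : R),
  forall (T : wgraph R) (n m : nat) (P : uncertain T n m) (s : state R),
    is_tree T ->
    (forall k : 'I_(ne T), 0 < len k) ->
    (forall i, 0 <= weight P i) ->
    (forall i j, on_tree (loc P i j)) ->
    (forall i j, 0 <= prob P i j) ->
    stores_input P s ->
    exists (t : nat) (s' : state R) (q1 q2 : tpoint T),
      [/\ exec (max_word c (nv T + n + m)) prog s t s',
          stores_output s' q1 q2,
          two_centers P q1 q2
        & t%:R <= C * ((nv T)%:R + (m * n)%:R * ln (m * n)%:R)].
Proof.
pose U := unit_cost Main; pose D : R := (7 + 2 / ln 2) / ln 2.
(* 310 and 500 are the coefficients of [core_ticks], D is the constant of [log_bound], and one more
   unit comes from the factor [k.+1] in [run]. *)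
exists Main, 6%N, (U%:R * (311 + 500 * D)) => T n m P s T_tree len0 w0 lon p0 hin.
have v0 : (0 < nv T)%N by case: T_tree.
have [W1 W2] := word_bound n m v0 (edges_bound T_tree).
set W := max_word _ _ in W1 W2 *.
have L0 : 0 < ln 2 :> R by rewrite ln_gt0 // ltr1n.
have D0 : 0 <= D by rewrite divr_ge0 ?addr_ge0 ?divr_ge0 ?ler0n // ltW.
rewrite [(m * n)%N]mulnC.
have [[i0 i1 i2 i3] hedge hw hp hl] := hin.
have pre k Q : (forall s1 : state R, (forall a i, a \notin [:: vNV; vNE; vn; vm; vM] -> ints s1 a i = ints s a i) ->
    reals s1 = reals s -> graph_at T s1 -> ints s1 vn 0 = n -> ints s1 vm 0 = m -> ints s1 vM 0 = (n * m)%N ->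
    run W (If (ILe ('v vM) (IConst 0))
      (IStore 5 (IConst 0) (IConst 0) ;; RStore 5 (IConst 0) (RConst 0) ;;
       IStore 5 (IConst 1) (IConst 0) ;; RStore 5 (IConst 1) (RConst 0)) Core) s1 k Q) ->
    run W Main s k Q.
  have b1 : (0 <= W /\ 1 <= W /\ 2 <= W /\ 3 <= W)%N by qlia.
  have b2 : (n * m <= W)%N by qlia.
  have [c0 [c1 [c2 c3]]] := b1.
  move=> h; apply: run_pre; split=> //; apply: run_pre; split=> //; apply: run_pre; split=> //.
  apply: run_pre; split=> //; apply: run_pre; rewrite /= i0 i1 i2 i3; split=> //.
  apply: h => //=.
  by move=> a i; rewrite !inE !negb_or => /and5P[/negbTE h1 /negbTE h2 /negbTE h3 /negbTE h4 /negbTE ->]; rewrite h1 h2 h3 h4.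
(* Without locations there are no points or all expected distances are 0; phi then vanishes and any
   pair is optimal. *)
case: (posnP (n * m)%N) => M0.
  have : run W Main s 0 (fun s' => exists q : tpoint T, stores_output s' q q /\ two_centers P q q).
    apply: pre => s1 _ _ _ _ _ hM; apply: wp_run; split=> //; rewrite /= hM M0.
    do !split=> //; try qlia.
    exists (Vertex (Ordinal v0)); split; first by split; split.
    split=> // x1 x2 _ _; rewrite /phi (eq_bigr (fun=> 0)) => [|i _]; last first.
      rewrite /Edist !big1 ?minxx ?mulr0 // => j _;
        by have := ltn_ord i; have := ltn_ord j; move: M0 => /eqP; rewrite muln_eq0 => /orP[]/eqP; qlia.
    apply: (@le_trans _ _ 0); last exact: bigmax_ge_id.
    by rewrite big_const_idem //= maxxx.
  move=> [t [s' [h1 h2 [q [h3 h4]]]]]; exists t, s', q, q; split=> //.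
  rewrite M0 mul0r addr0 -mulrA; apply: (@le_trans _ _ (U%:R * 1)); first by rewrite mulr1 ler_nat -[U]muln1.
  rewrite ler_wpM2l ?ler0n //; have : 1 <= (nv T)%:R :> R by rewrite ler1n.
  by move: D0; nra.
(* The subdivided tree has [nv T + M + 1] nodes, so e bounds the number of rounds of every halving
   process. *)
set M := (n * m)%N in M0 W2 pre *; pose e := up_log 2 (nv T + M).+1.
have [|he1 he2] := andP (up_log_bounds (isT : (1 < 2)%N) (n := (nv T + M).+1) _); first by rewrite ltnS addn_gt0 v0.
rewrite -/e in he1 he2; have e0 : (0 < e)%N by case: (e) he2 => //; rewrite expn0; qlia.
have he3 : (2 ^ e <= 2 * (nv T + M).+1)%N by rewrite -(prednK e0) expnS leq_mul2l ltnW.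
have : run W Main s (core_ticks T n m e) (fun s' => exists q1 q2, stores_output s' q1 q2 /\ two_centers P q1 q2).
  apply: pre => s1 fi fr g hn hm hM; apply: run_if; first by split=> //=; rewrite hM; qlia.
    by rewrite /= hM leqn0 => /eqP e1; rewrite -/M e1 in M0.
  move=> _; apply: Core_spec => //.
  - by move=> i; rewrite fr hw.
  - by move=> i j; rewrite fr hp.
  - by move=> i j; have := hl i j; case: (loc P i j) => [v|k t] /=; rewrite fi // fr.
move=> [t [s' [h1 h2 [q1 [q2 [h3 h4]]]]]]; exists t, s', q1, q2; split=> //.
have hlog := log_bound R v0 M0 he3; rewrite -/D in hlog.
set x : R := (nv T)%:R + _ in hlog *; have x1 : (nv T)%:R <= x.
  by rewrite /x lerDl mulr_ge0 ?ler0n // ln_ge0 // ler1n.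
have x1' : 1 <= x by apply: le_trans x1; rewrite ler1n.
apply: (@le_trans _ _ (U%:R * (core_ticks T n m e).+1%:R)); first by rewrite -natrM ler_nat.
rewrite -mulrA ler_wpM2l ?ler0n // -natr1 /core_ticks -/M natrD (natrM _ 310) (natrM _ 500) (natrM _ M).
by rewrite natrM in hlog; rewrite mulrDl; lra.
Qed.
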